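(* Let $t_0\ge 1$ and $\sigma\le 1$ be fixed real numbers. Then, as $T\to+\infty$, \[ \int_{t_0}^T\log|\mathcal R(\sigma+it)|\,dt=2\pi\sum_{\substack{\beta>\sigma\\0<\gamma\le T}}(\beta-\sigma)+O_\sigma(\log T), \] where the sum runs over the zeros $\rho=\beta+i\gamma$ of $\mathcal R(s)$ with $\beta>\sigma$ and $0<\gamma\le T$, counted with multiplicity, and the implied constant depends only on the fixed parameters ($\sigma$ and $t_0$).
   Context: Riemann's auxiliary function is the entire function \[ \mathcal R(s)=\int_{0\swarrow 1}\frac{x^{-s}e^{\pi i x^2}}{e^{\pi i x}-e^{-\pi i x}}\,dx , \] where $0\swarrow1$ denotes the straight line of slope $1$, traversed from upper right to lower left, crossing the real axis at a point between $0$ and $1$, and $x^{-s}=e^{-s\log x}$ with the principal branch of $\log x$. It satisfies $\zeta(s)=\mathcal R(s)+\chi(s)\overline{\mathcal R(1-\bar s)}$ with $\chi(s)=\pi^{s-1/2}\Gamma(\frac{1-s}{2})/\Gamma(\frac s2)$. Zeros of $\mathcal R$ are written $\rho=\beta+i\gamma$. *)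

(* Defs.v *)
From mathcomp Require Import all_boot all_order all_algebra.
From mathcomp Require Import all_classical all_reals all_analysis.
From mathcomp Require Export complex.
Import Order.TTheory GRing.Theory Num.Theory.
Import numFieldNormedType.Exports.

Set Implicit Arguments.
Unset Strict Implicit.
Unset Printing Implicit Defensive.

Local Open Scope classical_set_scope.
Local Open Scope ring_scope.
Local Open Scope complex_scope.

Section Definitions.
Variable R : realType.
Implicit Types (z w s x rho : R[i]) (c u t T sigma : R).

Definition cmod z : R := Normc.normc z.

Definition cexp z : R[i] :=
  (expR (complex.Re z) * cos (complex.Im z))
    +i* (expR (complex.Re z) * sin (complex.Im z)).

(* For z != 0 this is the principal argument, in ]-pi, pi]; the value at
   z = 0 is irrelevant. *)
Definition carg z : R :=
  if 0 <= complex.Im z then acos (complex.Re z / cmod z)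
  else - acos (complex.Re z / cmod z).

Definition clog z : R[i] := ln (cmod z) +i* carg z.

Definition cpow z w : R[i] := cexp (w * clog z).

Definition cintegral (f : R -> R[i]) : R[i] :=
  (\int[@lebesgue_measure R]_(u in setT) complex.Re (f u))
    +i* (\int[@lebesgue_measure R]_(u in setT) complex.Im (f u)).

Definition aux_integrand s x : R[i] :=
  cpow x (- s) * cexp ('i * pi%:C * x ^+ 2)
    / (cexp ('i * pi%:C * x) - cexp (- ('i * pi%:C * x))).

Definition aux_direction : R[i] := 1 +i* 1.

Definition aux_line c u : R[i] := c%:C + u%:C * aux_direction.

(* Riemann's auxiliary function, the line of slope 1 crossing the real axis
   at c, 0 < c < 1.  As u increases, [aux_line c] goes from lower left to upper
   right, whereas the contour is traversed from upper right to lower left: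
   hence the sign.  By Cauchy's theorem the value does not depend on c. *)
Definition riemann_aux c s : R[i] :=
  - cintegral (fun u => aux_integrand s (aux_line c u) * aux_direction).

(* Order of vanishing of f at rho: the supremum of the n such that the complex
   derivatives of f of order < n all vanish at rho (+oo if they all do).
   R[i]^o is R[i] as a normed module over itself. *)
Definition multiplicity (f : R[i] -> R[i]) rho : \bar R :=
  ereal_sup [set n%:R%:E | n in [set n : nat |
    forall k : nat, (k < n)%N ->
      derive1n k (f : R[i] -> (R[i])^o) rho = 0]].

Definition zeros_right_of (f : R[i] -> R[i]) sigma T : set R[i] :=
  [set rho | [/\ f rho = 0, sigma < complex.Re rho,
                 0 < complex.Im rho & complex.Im rho <= T]].

End Definitions.

(* Main.v *)
(** Littlewood's lemma without arguments: log|F| is subharmonic, so Green's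
    formula against a product weight a(x) b(t) on a rectangle turns
    log|F| * Laplacian(a b) into 2 pi times the sum of a b over the zeros of F.
    With a(x) = y (1 - y/L)^2, y = x - sigma, the boundary term at x = sigma is
    the integral of b log|F(sigma + it)|, the area term a'' b vanishes as L tends
    to infinity, and a tends to the weight (beta - sigma)_+.  For b the windows
    cos^2(pi (t - tau) / 2), |t - tau| <= 1, translates of which add up to 1,
    the area terms a b'' of two consecutive windows cancel on their common strip,
    so that only the two end windows contribute, and those are O(log T).
    The latter, as well as the number of zeros per window, is controlled by the
    same formula with a(x) = y^m (1 - y/L)^2, m large: there Laplacian(a b) is
    positive where log|F| is not small, and log|F| is bounded above by O(log T).

    The growth input is a polynomial bound for R(s) in vertical strips and
    R(s) = 1 + O(exp(- k sigma)), uniformly for t >= -2.  Both follow from moving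
    the line of integration to the right across the poles 1, ..., N, which gives
    R(s) = sum_(n <= N) n^(-s) plus the integral on the line through N + 1/2, where
    N is about sqrt (t / (2 pi)), so that the line passes near the saddle point. *)

Require Import Defs.
From mathcomp Require Import all_boot all_order all_algebra.
From mathcomp Require Import all_classical all_reals all_analysis.
From mathcomp Require Import measurable_realfun ring lra.
Import Order.TTheory GRing.Theory Num.Theory.
Import numFieldNormedType.Exports.

Set Implicit Arguments.
Unset Strict Implicit.
Unset Printing Implicit Defensive.

Local Open Scope classical_set_scope.
Local Open Scope ring_scope.
Local Open Scope complex_scope.

(** * Complex moduli and real derivatives *)

Section ComplexModulus.
Context {R : realType}.
Implicit Types (z w : R[i]) (x y : R).

(** The smooth weights dispose of the edges of the rectangle: they vanish to second order at the
    horizontal sides and at the right side, and at least to first order on the left, so that no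
    value of F on a horizontal side enters and a zero on an edge has weight 0. Zeros are handled
    through finite factorisations F = prod (z - w) * G. The Jensen bound is proved for every such
    factorisation, even when G still vanishes: log |G| is regularised to log (|G|^2 + eps) / 2,
    whose Laplacian is nonnegative. This limits how many zeros can be divided out of a box, and so
    produces, for each T, a cofactor G without zeros in the region. Information on log |F| is
    one-sided, an upper bound; the sum over zeros being nonnegative turns it into L1 bounds, on
    areas and on the line x = sigma. The order of the limits matters: T, the list of zeros and G are
    fixed first, then L tends to infinity. Errors divided by L may therefore depend on T and on the
    zeros, while the constants that survive depend on neither. *)

Lemma cReD z w : complex.Re (z + w) = complex.Re z + complex.Re w.
Proof. by case: z w => [a b] [c d]. Qed.
Lemma cImD z w : complex.Im (z + w) = complex.Im z + complex.Im w.
Proof. by case: z w => [a b] [c d]. Qed.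
Lemma cReN z : complex.Re (- z) = - complex.Re z. Proof. by case: z. Qed.
Lemma cImN z : complex.Im (- z) = - complex.Im z. Proof. by case: z. Qed.
Lemma cReB z w : complex.Re (z - w) = complex.Re z - complex.Re w.
Proof. by rewrite cReD cReN. Qed.
Lemma cImB z w : complex.Im (z - w) = complex.Im z - complex.Im w.
Proof. by rewrite cImD cImN. Qed.
Lemma cReM z w :
  complex.Re (z * w) = complex.Re z * complex.Re w - complex.Im z * complex.Im w.
Proof. by case: z w => [a b] [c d]. Qed.
Lemma cImM z w :
  complex.Im (z * w) = complex.Re z * complex.Im w + complex.Im z * complex.Re w.
Proof. by case: z w => [a b] [c d]. Qed.
Lemma cReV z : complex.Re z^-1 =
  complex.Re z / (complex.Re z ^+ 2 + complex.Im z ^+ 2).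
Proof. by case: z. Qed.
Lemma cImV z : complex.Im z^-1 =
  - (complex.Im z / (complex.Re z ^+ 2 + complex.Im z ^+ 2)).
Proof. by case: z => a b. Qed.

Lemma complex_ext z w : complex.Re z = complex.Re w ->
  complex.Im z = complex.Im w -> z = w.
Proof. by case: z w => [a b] [c d] /= -> ->. Qed.

Lemma cmod_def z : cmod z = Num.sqrt (complex.Re z ^+ 2 + complex.Im z ^+ 2).
Proof. by case: z. Qed.
Lemma sqr_cmod z : cmod z ^+ 2 = complex.Re z ^+ 2 + complex.Im z ^+ 2.
Proof. by rewrite cmod_def sqr_sqrtr// addr_ge0// sqr_ge0. Qed.
Lemma cmod_ge0 z : 0 <= cmod z.
Proof. by rewrite cmod_def sqrtr_ge0. Qed.
Lemma cmodM z w : cmod (z * w) = cmod z * cmod w.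
Proof. exact: Normc.normcM. Qed.
Lemma cmodD z w : cmod (z + w) <= cmod z + cmod w.
Proof. exact: le_normcD. Qed.
Lemma cmodN z : cmod (- z) = cmod z.
Proof. exact: normcN. Qed.
Lemma cmodB z w : cmod (z - w) <= cmod z + cmod w.
Proof. by rewrite -(cmodN w) cmodD. Qed.
Lemma cmodC z w : cmod (z - w) = cmod (w - z).
Proof. by rewrite -cmodN opprB. Qed.
Lemma cmod_real x : cmod x%:C = `|x|.
Proof. by rewrite cmod_def/= expr0n/= addr0 sqrtr_sqr. Qed.
Lemma cmod0 : cmod (0 : R[i]) = 0.
Proof. by have := cmod_real 0; rewrite normr0. Qed.
Lemma cmod1 : cmod (1 : R[i]) = 1.
Proof. by have := cmod_real 1; rewrite normr1. Qed.
Lemma cmodV z : cmod z^-1 = (cmod z)^-1.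
Proof. exact: Normc.normcV. Qed.
Lemma cmodX z n : cmod (z ^+ n) = cmod z ^+ n.
Proof. by elim: n => [|n ih]; rewrite ?expr0 ?cmod1// !exprS cmodM ih. Qed.
Lemma cmod_eq0 z : (cmod z == 0) = (z == 0).
Proof.
by apply/eqP/eqP => [/Normc.eq0_normc//|->]; rewrite cmod0.
Qed.
Lemma cmod_gt0 z : (0 < cmod z) = (z != 0).
Proof. by rewrite lt_neqAle cmod_ge0 andbT eq_sym cmod_eq0. Qed.
Lemma Re_le_cmod z : `|complex.Re z| <= cmod z.
Proof.
rewrite -(@ler_pXn2r _ 2)// ?nnegrE ?cmod_ge0//.
by rewrite sqr_cmod real_normK ?num_real// lerDl sqr_ge0.
Qed.
Lemma Im_le_cmod z : `|complex.Im z| <= cmod z.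
Proof.
rewrite -(@ler_pXn2r _ 2)// ?nnegrE ?cmod_ge0//.
by rewrite sqr_cmod real_normK ?num_real// lerDr sqr_ge0.
Qed.
Lemma cmod_le z : cmod z <= `|complex.Re z| + `|complex.Im z|.
Proof.
rewrite -(@ler_pXn2r _ 2)// ?nnegrE ?cmod_ge0// ?addr_ge0//.
rewrite sqr_cmod sqrrD !real_normK ?num_real//.
by rewrite -addrA lerD2l lerDr mulrn_wge0// mulr_ge0.
Qed.
Lemma cmod_sum (I : Type) (r : seq I) (F : I -> R[i]) :
  cmod (\sum_(i <- r) F i) <= \sum_(i <- r) cmod (F i).
Proof.
elim/big_ind2 : _ => //; first by rewrite cmod0.
by move=> a b c d h1 h2; rewrite (le_trans (cmodD _ _))// lerD.
Qed.
Lemma cmod_triB z w : cmod z - cmod w <= cmod (z - w).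
Proof. by have := cmodD (z - w) w; rewrite subrK lerBlDr. Qed.
Lemma cmod_i : cmod ('i : R[i]) = 1.
Proof. by rewrite cmod_def/= expr0n/= add0r expr1n sqrtr1. Qed.

Lemma cexpD z w : cexp (z + w) = cexp z * cexp w.
Proof.
by apply: complex_ext; rewrite ?cReM ?cImM /= ?cReD ?cImD expRD ?cosD ?sinD; ring.
Qed.
Lemma cexp0 : cexp (0 : R[i]) = 1.
Proof. by rewrite /cexp/= expR0 cos0 sin0 mulr1 mulr0. Qed.
Lemma cmod_cexp z : cmod (cexp z) = expR (complex.Re z).
Proof.
rewrite cmod_def/= !exprMn -mulrDr cos2Dsin2 mulr1 sqrtr_sqr.
by rewrite ger0_norm// expR_ge0.
Qed.
Lemma cexp_neq0 z : cexp z != 0.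
Proof. by rewrite -cmod_gt0 cmod_cexp expR_gt0. Qed.
Lemma cexpN z : cexp (- z) = (cexp z)^-1.
Proof.
apply: (mulfI (cexp_neq0 z)); rewrite -cexpD subrr cexp0 divff//.
exact: cexp_neq0.
Qed.
End ComplexModulus.

Section RealCalculus.
Context {R : realType}.
Implicit Types (f g F : R -> R) (x y a b d : R).

Definition rder f x d := is_derive x 1 f d.

Lemma rder_eq f x d' d : rder f x d' -> d' = d -> rder f x d.
Proof. by move=> h <-. Qed.
Lemma rder_cst x (k : R) : rder (fun _ => k) x 0.
Proof. exact: is_derive_cst. Qed.
Lemma rder_id x : rder (fun y => y) x 1.
Proof. exact: is_derive_id. Qed.
Lemma rderD f g x df dg : rder f x df -> rder g x dg ->
  rder (fun y => f y + g y) x (df + dg).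
Proof. by move=> hf hg; exact: is_deriveD. Qed.
Lemma rderB f g x df dg : rder f x df -> rder g x dg ->
  rder (fun y => f y - g y) x (df - dg).
Proof. by move=> hf hg; exact: is_deriveB. Qed.
Lemma rderN f x df : rder f x df -> rder (fun y => - f y) x (- df).
Proof. by move=> hf; exact: is_deriveN. Qed.
Lemma rderM f g x df dg : rder f x df -> rder g x dg ->
  rder (fun y => f y * g y) x (df * g x + f x * dg).
Proof.
move=> hf hg; apply: (rder_eq (@is_deriveM _ _ f g x 1 df dg hf hg)).
by rewrite addrC /GRing.scale/= [g x * _]mulrC.
Qed.
Lemma rderV f x df : f x != 0 -> rder f x df ->
  rder (fun y => (f y)^-1) x (- df / f x ^+ 2).
Proof.
move=> fx0 hf; apply: (rder_eq (@is_deriveV _ f x df 1 fx0 hf)).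
by rewrite /GRing.scale/= mulrC mulrN mulNr.
Qed.
Lemma rderX f x df n : rder f x df ->
  rder (fun y => f y ^+ n) x (df * f x ^+ n.-1 *+ n).
Proof.
elim: n => [|n ih] hf /=.
  by rewrite mulr0n; exact: rder_cst.
have -> : (fun y => f y ^+ n.+1) = (fun y => f y * f y ^+ n).
  by apply/funext => y; rewrite exprS.
apply: (rder_eq (rderM hf (ih hf))).
case: n ih => [|n] _ /=; first by rewrite !mulr0n mulr0 addr0 mulr1n.
by rewrite [in RHS]mulrS mulrnAr [f x ^+ n.+1]exprS; congr (_ + _ *+ _); ring.
Qed.
Lemma rder_comp f g x df dg : rder f (g x) df -> rder g x dg ->
  rder (fun y => f (g y)) x (df * dg).
Proof. by move=> hf hg; exact: (@is_derive1_comp _ f g x df dg hf hg). Qed.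
Lemma rder_expR f x df : rder f x df ->
  rder (fun y => expR (f y)) x (expR (f x) * df).
Proof. by move=> hf; apply: rder_comp => //; exact: is_derive_expR. Qed.
Lemma rder_sin f x df : rder f x df ->
  rder (fun y => sin (f y)) x (cos (f x) * df).
Proof. by move=> hf; apply: rder_comp => //; exact: is_derive_sin. Qed.
Lemma rder_cos f x df : rder f x df ->
  rder (fun y => cos (f y)) x (- sin (f x) * df).
Proof. by move=> hf; apply: rder_comp => //; exact: is_derive_cos. Qed.
Lemma rder_atan f x df : rder f x df ->
  rder (fun y => atan (f y)) x ((1 + f x ^+ 2)^-1 * df).
Proof. by move=> hf; apply: rder_comp => //; exact: is_derive1_atan. Qed.
Lemma rder_ln f x df : 0 < f x -> rder f x df ->
  rder (fun y => ln (f y)) x ((f x)^-1 * df).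
Proof.
by move=> fx0 hf; apply: rder_comp => //; exact: is_derive1_ln.
Qed.

Lemma rder_continuous f x d : rder f x d -> {for x, continuous f}.
Proof.
by move=> [hf _]; apply: differentiable_continuous; exact/derivable1_diffP.
Qed.

End RealCalculus.

Ltac rder_step := first
  [ exact: rder_cst | exact: rder_id | eassumption
  | apply: rderD | apply: rderB | apply: rderN | apply: rderM | apply: rderX
  | apply: rder_expR | apply: rder_sin | apply: rder_cos | apply: rder_atan
  | apply: rderV | apply: rder_ln ].
Ltac rder_tac := apply: rder_eq; [repeat rder_step|].

Section RealIntegrals.
Context {R : realType}.
Implicit Types (f g F : R -> R) (x y a b d : R).
Local Notation mu := (@lebesgue_measure R).

Lemma MVT_bound f (df : R -> R) a b (K : R) : a <= b ->
  (forall x, a <= x <= b -> rder f x (df x)) ->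
  (forall x, a <= x <= b -> `|df x| <= K) ->
  `|f b - f a| <= K * (b - a).
Proof.
rewrite le_eqVlt => /predU1P[-> _ _|ab hf hK].
  by rewrite !subrr normr0 mulr0.
have [||c cab ->] := @MVT _ f df _ _ ab.
- by move=> c; rewrite in_itv/= => /andP[c1 c2]; apply: hf; rewrite !ltW.
- by apply: continuous_in_subspaceT => c; rewrite inE/= in_itv/= => cab;
    exact: (rder_continuous (hf _ cab)).
rewrite normrM [`|b - a|]gtr0_norm ?subr_gt0//.
apply: ler_wpM2r; first by rewrite subr_ge0 ltW.
by apply: hK; move: cab; rewrite in_itv/= => /andP[c1 c2]; rewrite !ltW.
Qed.

Lemma continuous_on_integrable f a b :
  (forall x, a <= x <= b -> {for x, continuous f}) ->
  mu.-integrable `[a, b] (EFin \o f).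
Proof.
move=> cf; apply: continuous_compact_integrable; first exact: segment_compact.
by apply: continuous_in_subspaceT => x; rewrite inE/= in_itv/=; exact: cf.
Qed.

Lemma FTC f F a b : a <= b ->
  (forall x, a <= x <= b -> rder F x (f x)) ->
  (forall x, a <= x <= b -> {for x, continuous f}) ->
  \int[mu]_(x in `[a, b]) f x = F b - F a.
Proof.
rewrite le_eqVlt => /predU1P[<- _ _|ab hF cf].
  by rewrite set_itv1 Rintegral_set1 subrr.
rewrite /Rintegral (@continuous_FTC2 _ f F)//.
- by apply: continuous_in_subspaceT => x; rewrite inE/= in_itv/=; exact: cf.
- have cF x : a <= x <= b -> {for x, continuous F}.
    by move=> h; exact: (rder_continuous (hF _ h)).
  split.
  + move=> x; rewrite in_itv/= => /andP[h1 h2].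
    have [] : rder F x (f x) by apply: hF; rewrite !ltW.
    by [].
  + by apply/cvg_at_right_filter/cF; rewrite lexx (ltW ab).
  + by apply/cvg_at_left_filter/cF; rewrite lexx (ltW ab).
- move=> x; rewrite in_itv/= => /andP[h1 h2].
  have [_] : rder F x (f x) by apply: hF; rewrite !ltW.
  by rewrite derive1E.
Qed.

End RealIntegrals.

(** * Derivatives of complex functions of a real variable *)

Section ComplexDerivative.
Context {R : realType}.
Implicit Types (p q : R -> R[i]) (x y : R) (c d : R[i]).

Definition cder p x d :=
  rder (fun y => complex.Re (p y)) x (complex.Re d) /\
  rder (fun y => complex.Im (p y)) x (complex.Im d).

Lemma cder_eq p x d' d : cder p x d' -> d' = d -> cder p x d.
Proof. by move=> h <-. Qed.
Lemma cder_cst x c : cder (fun _ => c) x 0.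
Proof. by split; exact: rder_cst. Qed.
Lemma cderD p q x dp dq : cder p x dp -> cder q x dq ->
  cder (fun y => p y + q y) x (dp + dq).
Proof.
move=> [p1 p2] [q1 q2]; split.
  by rewrite cReD; under eq_fun do rewrite cReD; exact: rderD.
by rewrite cImD; under eq_fun do rewrite cImD; exact: rderD.
Qed.
Lemma cderN p x dp : cder p x dp -> cder (fun y => - p y) x (- dp).
Proof.
move=> [p1 p2]; split.
  by rewrite cReN; under eq_fun do rewrite cReN; exact: rderN.
by rewrite cImN; under eq_fun do rewrite cImN; exact: rderN.
Qed.
Lemma cderB p q x dp dq : cder p x dp -> cder q x dq ->
  cder (fun y => p y - q y) x (dp - dq).
Proof. by move=> hp hq; exact: cderD hp (cderN hq). Qed.
Lemma cderM p q x dp dq : cder p x dp -> cder q x dq ->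
  cder (fun y => p y * q y) x (dp * q x + p x * dq).
Proof.
move=> [p1 p2] [q1 q2]; split.
  under eq_fun do rewrite cReM; apply: rder_eq.
    by apply: rderB; apply: rderM; eassumption.
  by rewrite cReD !cReM; ring.
under eq_fun do rewrite cImM; apply: rder_eq.
  by apply: rderD; apply: rderM; eassumption.
by rewrite cImD !cImM; ring.
Qed.
Lemma cder_real (f : R -> R) x df : rder f x df ->
  cder (fun y => (f y)%:C) x df%:C.
Proof. by move=> h; split => //; exact: rder_cst. Qed.
Lemma cder_cexp p x dp : cder p x dp ->
  cder (fun y => cexp (p y)) x (dp * cexp (p x)).
Proof.
move=> [p1 p2]; split => /=.
  by rewrite cReM; rder_tac => /=; ring.
by rewrite cImM; rder_tac => /=; ring.
Qed.
Lemma cderV p x dp : p x != 0 -> cder p x dp ->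
  cder (fun y => (p y)^-1) x (- dp / p x ^+ 2).
Proof.
move=> p0 [p1 p2].
have n0 : complex.Re (p x) ^+ 2 + complex.Im (p x) ^+ 2 != 0.
  by rewrite -sqr_cmod expf_eq0/= cmod_eq0.
have E : - dp / p x ^+ 2 = - dp * (p x)^-1 * (p x)^-1.
  by rewrite expr2 invfM mulrA.
split.
  under eq_fun do rewrite cReV; rewrite E; apply: rder_eq.
    apply: rderM; first eassumption.
    by apply: rderV => //; apply: rderD; apply: rderX; eassumption.
  by rewrite !(cReM, cImM) !(cReV, cImV) cReN cImN /= !expr1; field.
under eq_fun do rewrite cImV; rewrite E; apply: rder_eq.
  apply: rderN; apply: rderM; first eassumption.
  by apply: rderV => //; apply: rderD; apply: rderX; eassumption.
by rewrite !(cReM, cImM) !(cReV, cImV) cReN cImN /= !expr1; field.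
Qed.

(** The mean value theorem is applied to the real and the imaginary part separately, which costs the
    factor 2. *)
Lemma cMVT_bound p (dp : R -> R[i]) a b (K : R) : a <= b ->
  (forall x, a <= x <= b -> cder p x (dp x)) ->
  (forall x, a <= x <= b -> cmod (dp x) <= K) ->
  cmod (p b - p a) <= 2 * K * (b - a).
Proof.
move=> ab hp hK; apply: (le_trans (cmod_le _)).
rewrite cReB cImB -mulrA mulr2n mulrDl mul1r; apply: lerD.
- apply: (MVT_bound ab (fun x h => (hp x h).1)) => x h.
  exact: (le_trans (Re_le_cmod _) (hK _ h)).
- apply: (MVT_bound ab (fun x h => (hp x h).2)) => x h.
  exact: (le_trans (Im_le_cmod _) (hK _ h)).
Qed.

Lemma cder_lin c x : cder (fun y => y%:C * c) x c.
Proof.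
apply: cder_eq; first exact: (cderM (cder_real (rder_id x)) (cder_cst x c)).
by rewrite mulr0 addr0 mul1r.
Qed.

(** The constants 2 here and 4 in the next lemma come from one and two uses of [cMVT_bound] along
    the segment from 0 to [c]. *)
Lemma cexp_sub1 c : cmod (cexp c - 1) <= 2 * cmod c * expR (cmod c).
Proof.
have hp x : 0 <= x <= 1 -> cder (fun y => cexp (y%:C * c)) x (c * cexp (x%:C * c)).
  by move=> _; apply: cder_cexp; exact: cder_lin.
have := @cMVT_bound _ _ _ _ (cmod c * expR (cmod c)) (@ler01 R) hp.
rewrite mul1r mul0r cexp0 subr0 mulr1 mulrA; apply => x /andP[x0 x1].
rewrite cmodM ler_wpM2l ?cmod_ge0// cmod_cexp ler_expR.
rewrite (le_trans (ler_norm _))// (le_trans (Re_le_cmod _))// cmodM.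
by rewrite cmod_real ger0_norm// ler_piMl ?cmod_ge0.
Qed.

Lemma cexp_sub1D c : cmod (cexp c - 1 - c) <= 4 * cmod c ^+ 2 * expR (cmod c).
Proof.
have hp x : 0 <= x <= 1 -> cder (fun y => cexp (y%:C * c) - 1 - y%:C * c) x
    (c * (cexp (x%:C * c) - 1)).
  move=> _; apply: cder_eq.
    apply: cderB; last exact: cder_lin.
    by apply: cderB (cder_cst x 1); apply: cder_cexp; exact: cder_lin.
  by rewrite subr0 mulrBr mulr1.
have := @cMVT_bound _ _ _ _ (2 * cmod c ^+ 2 * expR (cmod c)) (@ler01 R) hp.
rewrite mul1r mul0r cexp0 !subrr !subr0 mulr1 !mulrA (_ : 2 * 2 = 4); last by rewrite -natrM.
apply => x /andP[x0 x1].
have xc : cmod (x%:C * c) <= cmod c.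
  by rewrite cmodM cmod_real ger0_norm// ler_piMl ?cmod_ge0.
rewrite cmodM -!mulrA mulrCA ler_wpM2l ?cmod_ge0//.
rewrite (le_trans (cexp_sub1 _))// mulrA ler_pM ?expR_ge0//.
- by rewrite mulr_ge0// cmod_ge0.
- by rewrite ler_wpM2l.
- by rewrite ler_expR.
Qed.

End ComplexDerivative.

Ltac cder_step := first
  [ exact: cder_cst | eassumption | exact: cder_lin
  | apply: cderD | apply: cderB | apply: cderN | apply: cderM
  | apply: cder_cexp | apply: cder_real | apply: cderV].
Ltac cder_tac := apply: cder_eq; [repeat cder_step|].

(** * Continuity at a point *)

Section Continuity.
Context {R : realType} {T : topologicalType}.
Implicit Types (f g : T -> R) (p q : T -> R[i]) (z : T).

(** The domain is an arbitrary topological space, so that the same rules serve functions on the line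
    and on the plane. *)
Definition rcont f z := f x @[x --> z] --> f z.
Definition ccont p z :=
  rcont (fun x => complex.Re (p x)) z /\ rcont (fun x => complex.Im (p x)) z.

Lemma rcont_cst k z : rcont (fun _ => k) z. Proof. exact: cvg_cst. Qed.
Lemma rcontD f g z : rcont f z -> rcont g z -> rcont (fun x => f x + g x) z.
Proof. exact: cvgD. Qed.
Lemma rcontB f g z : rcont f z -> rcont g z -> rcont (fun x => f x - g x) z.
Proof. exact: cvgB. Qed.
Lemma rcontN f z : rcont f z -> rcont (fun x => - f x) z.
Proof. exact: cvgN. Qed.
Lemma rcontM f g z : rcont f z -> rcont g z -> rcont (fun x => f x * g x) z.
Proof. exact: cvgM. Qed.
Lemma rcontX f n z : rcont f z -> rcont (fun x => f x ^+ n) z.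
Proof.
move=> hf; elim: n => [|n ih]; first exact: cvg_cst.
by rewrite /rcont; under eq_fun do rewrite exprS; rewrite exprS; exact: cvgM.
Qed.
Lemma rcontV f z : f z != 0 -> rcont f z -> rcont (fun x => (f x)^-1) z.
Proof. by move=> h hf; apply: cvgV. Qed.
Lemma rcont_comp (h : R -> R) f z : {for f z, continuous h} -> rcont f z ->
  rcont (fun x => h (f x)) z.
Proof. by move=> hh hf; apply: (@continuous_cvg _ _ _ _ _ f h). Qed.
Lemma rcont_expR f z : rcont f z -> rcont (fun x => expR (f x)) z.
Proof. by apply: rcont_comp; exact: continuous_expR. Qed.
Lemma rcont_sin f z : rcont f z -> rcont (fun x => sin (f x)) z.
Proof. by apply: rcont_comp; exact: continuous_sin. Qed.
Lemma rcont_cos f z : rcont f z -> rcont (fun x => cos (f x)) z.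
Proof. by apply: rcont_comp; exact: continuous_cos. Qed.
Lemma rcont_atan f z : rcont f z -> rcont (fun x => atan (f x)) z.
Proof. by apply: rcont_comp; exact: continuous_atan. Qed.
Lemma rcont_ln f z : 0 < f z -> rcont f z -> rcont (fun x => ln (f x)) z.
Proof. by move=> h; apply: rcont_comp; exact: continuous_ln. Qed.
Lemma rcont_norm f z : rcont f z -> rcont (fun x => `|f x|) z.
Proof. exact: cvg_norm. Qed.

Lemma ccont_cst k z : ccont (fun _ => k) z.
Proof. by split; exact: rcont_cst. Qed.
Lemma ccontD p q z : ccont p z -> ccont q z -> ccont (fun x => p x + q x) z.
Proof.
move=> [p1 p2] [q1 q2]; split; rewrite /rcont.
  by under eq_fun do rewrite cReD; rewrite cReD; exact: rcontD.
by under eq_fun do rewrite cImD; rewrite cImD; exact: rcontD.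
Qed.
Lemma ccontN p z : ccont p z -> ccont (fun x => - p x) z.
Proof.
move=> [p1 p2]; split; rewrite /rcont.
  by under eq_fun do rewrite cReN; rewrite cReN; exact: rcontN.
by under eq_fun do rewrite cImN; rewrite cImN; exact: rcontN.
Qed.
Lemma ccontB p q z : ccont p z -> ccont q z -> ccont (fun x => p x - q x) z.
Proof. by move=> hp hq; exact: ccontD hp (ccontN hq). Qed.
Lemma ccontM p q z : ccont p z -> ccont q z -> ccont (fun x => p x * q x) z.
Proof.
move=> [p1 p2] [q1 q2]; split; rewrite /rcont.
  under eq_fun do rewrite cReM; rewrite cReM.
  by apply: rcontB; apply: rcontM.
under eq_fun do rewrite cImM; rewrite cImM.
by apply: rcontD; apply: rcontM.
Qed.
Lemma ccontV p z : p z != 0 -> ccont p z -> ccont (fun x => (p x)^-1) z.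
Proof.
move=> p0 [p1 p2].
have n0 : complex.Re (p z) ^+ 2 + complex.Im (p z) ^+ 2 != 0.
  by rewrite -sqr_cmod expf_eq0/= cmod_eq0.
have h : rcont (fun x => (complex.Re (p x) ^+ 2 + complex.Im (p x) ^+ 2)^-1) z.
  by apply: rcontV => //; apply: rcontD; apply: rcontX.
split; rewrite /rcont.
  by under eq_fun do rewrite cReV; rewrite cReV; apply: rcontM.
by under eq_fun do rewrite cImV; rewrite cImV; apply: rcontN; apply: rcontM.
Qed.
Lemma ccont_real f z : rcont f z -> ccont (fun x => (f x)%:C) z.
Proof. by move=> h; split => //; exact: rcont_cst. Qed.
Lemma ccont_mk f g z : rcont f z -> rcont g z -> ccont (fun x => f x +i* g x) z.
Proof. by []. Qed.
Lemma ccont_cexp p z : ccont p z -> ccont (fun x => cexp (p x)) z.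
Proof.
move=> [p1 p2]; split => /=; apply: rcontM; [exact: rcont_expR|exact: rcont_cos
  |exact: rcont_expR|exact: rcont_sin].
Qed.
Lemma ccont_cmod p z : ccont p z -> rcont (fun x => cmod (p x)) z.
Proof.
move=> [p1 p2]; rewrite /rcont; under eq_fun do rewrite cmod_def.
rewrite cmod_def; apply: rcont_comp; first exact: sqrt_continuous.
by apply: rcontD; apply: rcontX.
Qed.

End Continuity.

Lemma cder_ccont {R : realType} (p : R -> R[i]) (x : R) d :
  cder p x d -> ccont p x.
Proof. by move=> [h1 h2]; split; [exact: (rder_continuous h1)|exact: (rder_continuous h2)]. Qed.

Ltac cont_step := first
  [ exact: rcont_cst | exact: ccont_cst | eassumption
  | exact: cvg_id | exact: cvg_fst | exact: cvg_snd
  | apply: ccontD | apply: ccontB | apply: ccontN | apply: ccontM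
  | apply: ccont_cexp | apply: ccont_real | apply: ccont_mk | apply: ccontV
  | apply: rcontD | apply: rcontB | apply: rcontN | apply: rcontM
  | apply: rcontX | apply: rcont_expR | apply: rcont_sin | apply: rcont_cos
  | apply: rcont_atan | apply: rcontV | apply: rcont_ln | apply: rcont_norm ].
Ltac cont_tac := repeat cont_step.

(** * Integrals of real and complex functions, holomorphic sequences *)

Section Integrability.
Context d (T : measurableType d) {R : realType}.
Variable mu : {measure set T -> \bar R}.
Implicit Types (D : set T) (f g : T -> R).

Definition rint D f := mu.-integrable D (EFin \o f).

Lemma rint_meas D f : rint D f -> measurable_fun D f.
Proof. by move=> /integrableP[/measurable_EFinP]. Qed.
Lemma rintD D f g : measurable D -> rint D f -> rint D g ->
  rint D (fun x => f x + g x).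
Proof. by move=> mD hf hg; exact: (integrableD mD hf hg). Qed.
Lemma rintB D f g : measurable D -> rint D f -> rint D g ->
  rint D (fun x => f x - g x).
Proof. by move=> mD hf hg; exact: (integrableB mD hf hg). Qed.
Lemma rintZ D f k : measurable D -> rint D f -> rint D (fun x => k * f x).
Proof. by move=> mD hf; exact: (integrableZl mD k hf). Qed.
Lemma rintN D f : measurable D -> rint D f -> rint D (fun x => - f x).
Proof. by move=> mD hf; exact: (integrableN hf). Qed.
Lemma rint_norm D f : rint D f -> rint D (fun x => `|f x|).
Proof. by move=> hf; exact: (integrable_norm hf). Qed.
Lemma rint_dom D f g : measurable D -> measurable_fun D f ->
  (forall x, D x -> `|f x| <= g x) -> rint D g -> rint D f.
Proof.
move=> mD mf fg ig; apply: (le_integrable mD _ _ ig).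
  exact/measurable_EFinP.
by move=> x Dx /=; rewrite lee_fin (le_trans (fg _ Dx))// ler_norm.
Qed.
Lemma rint0 D : measurable D -> rint D (fun=> 0).
Proof. by move=> mD; exact: integrable0. Qed.
Lemma rint_sum (I : Type) (r : seq I) D (F : I -> T -> R) : measurable D ->
  (forall i, rint D (F i)) -> rint D (fun x => \sum_(i <- r) F i x).
Proof.
move=> mD hF; elim: r => [|i r ih].
  by under eq_fun do rewrite big_nil; exact: rint0.
by under eq_fun do rewrite big_cons; exact: rintD.
Qed.
Lemma rint_sub D E f : measurable E -> measurable D -> D `<=` E ->
  rint E f -> rint D f.
Proof. by move=> mE mD DE; apply: integrableS. Qed.
Lemma rint_bnd D f (K : R) : measurable D -> (mu D < +oo)%E ->
  measurable_fun D f -> (forall x, D x -> `|f x| <= K) -> rint D f.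
Proof.
move=> mD fD mf fK; apply: measurable_bounded_integrable => //.
exists K; split; first exact: num_real.
by move=> K' KK' x Dx; apply: (le_trans (fK _ Dx)); exact: ltW.
Qed.

Lemma Rintegral_sum (I : Type) (r : seq I) D (F : I -> T -> R) : measurable D ->
  (forall i, rint D (F i)) ->
  \int[mu]_(x in D) (\sum_(i <- r) F i x) =
  \sum_(i <- r) \int[mu]_(x in D) F i x.
Proof.
move=> mD hF; elim: r => [|i r ih].
  rewrite big_nil; under eq_Rintegral do rewrite big_nil.
  by rewrite Rintegral_cst// mul0r.
rewrite big_cons -ih -RintegralD//; [|exact: hF|exact: rint_sum].
by apply: eq_Rintegral => x _; rewrite big_cons.
Qed.

Lemma RintegralN D f : measurable D -> rint D f ->
  \int[mu]_(x in D) (- f x) = - \int[mu]_(x in D) f x.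
Proof.
move=> mD hf; rewrite -mulN1r -RintegralZl//.
by apply: eq_Rintegral => x _; rewrite mulN1r.
Qed.

Lemma Rintegral_bound D f g : measurable D -> rint D f -> rint D g ->
  (forall x, D x -> `|f x| <= g x) ->
  `|\int[mu]_(x in D) f x| <= \int[mu]_(x in D) g x.
Proof.
move=> mD hf hg fg; rewrite (le_trans (le_normr_Rintegral _ _))//.
by apply: le_Rintegral => //; exact: rint_norm.
Qed.

End Integrability.

Section ComplexIntegral.
Context d (T : measurableType d) {R : realType}.
Variable mu : {measure set T -> \bar R}.
Implicit Types (D : set T) (p q : T -> R[i]).

Definition cmeas D p :=
  measurable_fun D (fun x => complex.Re (p x)) /\
  measurable_fun D (fun x => complex.Im (p x)).
Definition cint D p := (\int[mu]_(x in D) complex.Re (p x))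
  +i* (\int[mu]_(x in D) complex.Im (p x)).
Definition crint D p := rint mu D (fun x => complex.Re (p x)) /\
  rint mu D (fun x => complex.Im (p x)).

Lemma crint_dom D p g : measurable D -> cmeas D p ->
  (forall x, D x -> cmod (p x) <= g x) -> rint mu D g -> crint D p.
Proof.
move=> mD [m1 m2] pg hg; split.
- apply: rint_dom hg => // x Dx.
  exact: (le_trans (Re_le_cmod _) (pg _ Dx)).
- apply: rint_dom hg => // x Dx.
  exact: (le_trans (Im_le_cmod _) (pg _ Dx)).
Qed.

Lemma cintD D p q : measurable D -> crint D p -> crint D q ->
  cint D (fun x => p x + q x) = cint D p + cint D q.
Proof.
move=> mD [p1 p2] [q1 q2]; apply: complex_ext; rewrite ?cReD ?cImD /=.
  by rewrite -RintegralD//; apply: eq_Rintegral => x _; rewrite cReD.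
by rewrite -RintegralD//; apply: eq_Rintegral => x _; rewrite cImD.
Qed.

Lemma crintD D p q : measurable D -> crint D p -> crint D q ->
  crint D (fun x => p x + q x).
Proof.
move=> mD [p1 p2] [q1 q2]; split.
  by under eq_fun do rewrite cReD; exact: rintD.
by under eq_fun do rewrite cImD; exact: rintD.
Qed.

Lemma crintZ D p c : measurable D -> crint D p -> crint D (fun x => c * p x).
Proof.
move=> mD [p1 p2]; split.
  by under eq_fun do rewrite cReM; apply: rintB => //; exact: rintZ.
by under eq_fun do rewrite cImM; apply: rintD => //; exact: rintZ.
Qed.

Lemma cintZ D p c : measurable D -> crint D p ->
  cint D (fun x => c * p x) = c * cint D p.
Proof.
move=> mD [p1 p2]; apply: complex_ext; rewrite ?cReM ?cImM /=.
  rewrite -!RintegralZl// -RintegralB//; try exact: rintZ.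
  by apply: eq_Rintegral => x _; rewrite cReM.
rewrite -!RintegralZl// -RintegralD//; try exact: rintZ.
by apply: eq_Rintegral => x _; rewrite cImM.
Qed.

Lemma cintN D p : measurable D -> crint D p ->
  cint D (fun x => - p x) = - cint D p.
Proof.
move=> mD hp; rewrite -mulN1r -cintZ//; congr cint.
by apply/funext => x; rewrite mulN1r.
Qed.

Lemma cintB D p q : measurable D -> crint D p -> crint D q ->
  cint D (fun x => p x - q x) = cint D p - cint D q.
Proof.
move=> mD hp hq; rewrite cintD// ?cintN//.
have := crintZ (-1) mD hq; congr (crint _ _).
by apply/funext => x; rewrite mulN1r.
Qed.

Lemma cint_bound D p g : measurable D -> crint D p -> rint mu D g ->
  (forall x, D x -> cmod (p x) <= g x) ->
  cmod (cint D p) <= 2 * \int[mu]_(x in D) g x.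
Proof.
move=> mD [p1 p2] hg pg; rewrite (le_trans (cmod_le _))// mulr2n mulrDl mul1r.
apply: lerD; apply: Rintegral_bound => // x Dx.
- exact: (le_trans (Re_le_cmod _) (pg _ Dx)).
- exact: (le_trans (Im_le_cmod _) (pg _ Dx)).
Qed.

Lemma eq_cint D p q : (forall x, D x -> p x = q x) -> cint D p = cint D q.
Proof.
move=> pq; apply: complex_ext => /=; apply: eq_Rintegral => x; rewrite inE => Dx.
  by rewrite pq.
by rewrite pq.
Qed.

End ComplexIntegral.

(** * Holomorphic functions as sequences of derivatives *)

Section Holomorphic.
Context {R : realType}.
Implicit Types (F : nat -> R[i] -> R[i]) (s h : R[i]).

(* [F k] is the k-th derivative of [F 0]; the Taylor remainder is locally
   uniformly quadratic. *)
Definition hol F := forall k (M : R), exists C : R, [/\ 0 <= C,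
  (forall s, cmod s <= M -> cmod (F k s) <= C) &
  forall s h, cmod s <= M -> cmod h <= 1 ->
    cmod (F k (s + h) - F k s - h * F k.+1 s) <= C * cmod h ^+ 2].

Lemma hol_lip F : hol F -> forall k (M : R), exists2 C : R, 0 <= C &
  forall s h, cmod s <= M -> cmod h <= 1 ->
    cmod (F k (s + h) - F k s) <= C * cmod h.
Proof.
move=> hF k M; have [C [C0 _ H]] := hF k M; have [C' [C'0 H' _]] := hF k.+1 M.
exists (C + C'); first exact: addr_ge0.
move=> s h sM h1; rewrite -[F k (s + h) - F k s](subrK (h * F k.+1 s)).
rewrite (le_trans (cmodD _ _))// mulrDl lerD//.
  rewrite (le_trans (H _ _ sM h1))// ler_wpM2l// expr2 ler_piMl// cmod_ge0//.
by rewrite cmodM mulrC ler_wpM2r ?cmod_ge0// H'.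
Qed.

Lemma rder_quad (f : R -> R) (x a C d : R) : 0 < d ->
  (forall h : R, `|h| <= d -> `|f (x + h) - f x - h * a| <= C * h ^+ 2) ->
  rder f x a.
Proof.
move=> d0 H.
have C0 : 0 <= C.
  have := H d; rewrite gtr0_norm// lexx => /(_ isT) /(le_trans (normr_ge0 _)).
  by rewrite pmulr_lge0// exprn_gt0.
have cv : h^-1 *: (f (h + x) - f x) @[h --> (0 : R)^'] --> a.
  apply/cvgrPdist_le => e e0.
  have d'0 : 0 < Num.min d (e / (C + 1)).
    by rewrite lt_min d0 divr_gt0// ltr_wpDl.
  near=> h.
  have hn0 : h != 0 by near: h; exact: nbhs_dnbhs_neq.
  have : `|h| <= Num.min d (e / (C + 1)) by near: h; exact: dnbhs0_le.
  rewrite le_min => /andP[h1 he].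
  have -> : a - h^-1 *: (f (h + x) - f x) = - (h^-1 * (f (x + h) - f x - h * a)).
    by rewrite [h + x]addrC /GRing.scale/=; field.
  rewrite normrN normrM normfV.
  rewrite ler_pdivrMl ?normr_gt0// (le_trans (H _ h1))//.
  rewrite -[h ^+ 2]real_normK ?num_real// expr2 mulrA mulrC ler_wpM2l//.
  rewrite (@le_trans _ _ ((C + 1) * `|h|))//.
    by rewrite ler_wpM2r// lerDl.
  by rewrite mulrC -ler_pdivlMr// ltr_wpDl.
have E : (fun h : R => h^-1 *: ((f \o shift x) (h *: 1) - f x)) =
    (fun h : R => h^-1 *: (f (h + x) - f x)).
  by apply/funext => h; rewrite /= /shift/= [h *: 1]mulr1.
split.
  by rewrite /derivable E; apply/cvg_ex; exists a.
by rewrite /derive E; exact: (@cvg_lim _ (@norm_hausdorff _ _)).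
Unshelve. all: by end_near. Qed.

Lemma hol_cder F k (z w : R[i]) (x : R) : hol F ->
  cder (fun y => F k (z + y%:C * w)) x (w * F k.+1 (z + x%:C * w)).
Proof.
move=> hF; have [C [C0 _ H]] := hF k (cmod (z + x%:C * w)).
have w1 : 0 < 1 + cmod w by rewrite ltr_wpDr// cmod_ge0.
have B (h : R) : `|h| <= (1 + cmod w)^-1 ->
    cmod (F k (z + (x + h)%:C * w) - F k (z + x%:C * w) -
    (h%:C * w) * F k.+1 (z + x%:C * w)) <= (C * cmod w ^+ 2) * h ^+ 2.
  move=> h1; have := H _ (h%:C * w) (lexx _).
  have hw : `|h| * cmod w <= 1.
    rewrite (@le_trans _ _ ((1 + cmod w)^-1 * (1 + cmod w)))//; last first.
      by rewrite mulVf// gt_eqF.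
    by apply: ler_pM => //; rewrite ?cmod_ge0// lerDr.
  rewrite cmodM cmod_real hw => /(_ isT).
  rewrite (_ : z + (x + h)%:C * w = z + x%:C * w + h%:C * w); last first.
    by rewrite rmorphD mulrDl addrA.
  move=> /le_trans; apply.
  by rewrite exprMn real_normK ?num_real// mulrA mulrAC.
have w2 : 0 < (1 + cmod w)^-1 by rewrite invr_gt0.
split; apply: (@rder_quad _ _ _ (C * cmod w ^+ 2) _ w2) => h h1.
  rewrite (le_trans _ (B h h1))//; apply: le_trans (Re_le_cmod _).
  by rewrite !cReB -mulrA [complex.Re (h%:C * _)]cReM mul0r subr0.
rewrite (le_trans _ (B h h1))//; apply: le_trans (Im_le_cmod _).
by rewrite !cImB -mulrA [complex.Im (h%:C * _)]cImM mul0r addr0.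
Qed.

(** Differentiation under the integral sign: a quadratic Taylor remainder whose constant [G u] is
    integrable in [u] integrates to a quadratic remainder. *)
Lemma hol_param d (T : measurableType d) (mu : {measure set T -> \bar R})
    (D : set T) (P : nat -> T -> R[i] -> R[i]) : measurable D ->
  (forall k s, cmeas D (fun u => P k u s)) ->
  (forall k (M : R), exists2 G : T -> R, rint mu D G &
     forall u, D u -> (forall s, cmod s <= M -> cmod (P k u s) <= G u) /\
     (forall s h, cmod s <= M -> cmod h <= 1 ->
       cmod (P k u (s + h) - P k u s - h * P k.+1 u s) <= G u * cmod h ^+ 2)) ->
  hol (fun k s => cint mu D (fun u => P k u s)).
Proof.
move=> mD mP HP k M; have [G iG HG] := HP k M.
have iP j s : crint mu D (fun u => P j u s).
  have [G' iG' HG'] := HP j (cmod s).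
  by apply: crint_dom iG' => // u Du; apply: (HG' u Du).1.
exists (2 * \int[mu]_(x in D) `|G x|); split.
- by rewrite mulr_ge0// Rintegral_ge0.
- move=> s sM; apply: cint_bound => //; first exact: rint_norm.
  by move=> u Du; rewrite (le_trans ((HG u Du).1 s sM))// ler_norm.
- move=> s h sM h1.
  have ih := crintZ h mD (iP k.+1 s).
  have iB : crint mu D (fun u => P k u (s + h) - P k u s).
    apply: crintD => //; have := crintZ (-1) mD (iP k s); congr (crint _ _ _).
    by apply/funext => x; rewrite mulN1r.
  rewrite -cintB// -cintZ// -cintB//.
  rewrite -mulrA -RintegralZr//; last exact: rint_norm.
  apply: cint_bound => //.
  + apply: crintD => //; have := crintZ (-1) mD ih; congr (crint _ _ _).
    by apply/funext => x; rewrite mulN1r.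
  + have := rintZ (cmod h ^+ 2) mD (rint_norm iG); congr (rint _ _ _).
    by apply/funext => x; rewrite mulrC.
  + move=> u Du; rewrite (le_trans ((HG u Du).2 s h sM h1))//.
    by rewrite ler_wpM2r ?sqr_ge0// ler_norm.
Qed.

End Holomorphic.

(** * Division by a zero and multiplicities *)

Section Division.
Context {R : realType}.
Implicit Types (F G Q : nat -> R[i] -> R[i]) (s h rho : R[i]).
Local Notation mu := (@lebesgue_measure R).

Lemma hol_derive1 F k s : hol F -> derive1 (F k : R[i] -> (R[i])^o) s = F k.+1 s.
Proof.
move=> hF; have [C [C0 _ H]] := hF k (cmod s).
rewrite /derive1; apply: (@cvg_lim _ (@norm_hausdorff _ _)) => //.
apply/cvgrPdist_le => e e0.
  (* In the order of [R[i]], positivity forces the imaginary part to vanish, so [e] is real. *)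
  have [e1 E] : 0 < complex.Re e /\ e = (complex.Re e)%:C.
    move: e0; rewrite ltcE/= => /andP[/eqP i0 r0]; split => //.
    by apply: complex_ext.
  set r := complex.Re e in e1 E.
  have d0 : 0 < Num.min 1 (r / (C + 1)).
    by rewrite lt_min ltr01 divr_gt0// ltr_wpDl.
  have d0' : (0 : R[i]) < (Num.min 1 (r / (C + 1)))%:C by rewrite ltcR.
  near=> h.
  have hn0 : h != 0 by near: h; exact: nbhs_dnbhs_neq.
  have : `|h| <= (Num.min 1 (r / (C + 1)))%:C by near: h; exact: dnbhs0_le.
  rewrite normc_def -cmod_def lecR le_min => /andP[h1 he].
  have -> : F k.+1 s - h^-1 *: ((F k : R[i] -> (R[i])^o) (h + s) - F k s)
      = - (h^-1 * (F k (s + h) - F k s - h * F k.+1 s)).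
    by rewrite [h + s]addrC /GRing.scale/=; field.
  rewrite normc_def -cmod_def E lecR cmodN cmodM cmodV.
  rewrite ler_pdivrMl ?cmod_gt0// (le_trans (H _ _ (lexx _) h1))//.
  rewrite expr2 mulrA mulrC ler_wpM2l ?cmod_ge0//.
  rewrite (@le_trans _ _ ((C + 1) * cmod h))//.
    by rewrite ler_wpM2r ?cmod_ge0// lerDl.
  by rewrite mulrC -ler_pdivlMr// ltr_wpDl.
Unshelve. all: by end_near. Qed.

Lemma hol_derive1n F k : hol F -> derive1n k (F 0%N : R[i] -> (R[i])^o) = F k.
Proof.
move=> hF; elim: k => [|k ih]//.
by apply/funext => s; rewrite derive1nS ih hol_derive1.
Qed.

Lemma hol_unique F G k : hol F -> hol G -> F 0%N = G 0%N -> F k = G k.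
Proof. by move=> hF hG E; rewrite -(hol_derive1n k hF) -(hol_derive1n k hG) E. Qed.

(** Leibniz' rule for the derivatives of [(s - rho) * Q 0 s]; at [k = 0] the factor [k%:R] kills the
    spurious term [Q k.-1]. *)
Definition mulXsub rho Q := fun k s => (s - rho) * Q k s + k%:R * Q k.-1 s.

Lemma hol_mulXsub rho Q : hol Q -> hol (mulXsub rho Q).
Proof.
move=> hQ k M; have [C [C0 B H]] := hQ k M; have [D D0 L] := hol_lip hQ k M.
have [C' [C'0 B' H']] := hQ k.-1 M.
pose K := `|M| + cmod rho; have K0 : 0 <= K by rewrite addr_ge0// cmod_ge0.
have sK s : cmod s <= M -> cmod (s - rho) <= K.
  by move=> sM; rewrite (le_trans (cmodB _ _))// lerD2r (le_trans sM)// ler_norm.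
have kn : cmod (k%:R : R[i]) = k%:R.
  have -> : (k%:R : R[i]) = (k%:R : R)%:C by rewrite rmorph_nat.
  by rewrite cmod_real normr_nat.
exists (K * C + D + k%:R * C'); split.
- by rewrite !addr_ge0// mulr_ge0.
- move=> s sM; rewrite /mulXsub (le_trans (cmodD _ _))//.
  apply: lerD; rewrite cmodM ?kn.
    rewrite (@le_trans _ _ (K * C)) ?lerDl//.
    by apply: ler_pM; rewrite ?cmod_ge0// ?sK ?B.
  by rewrite ler_wpM2l// B'.
- move=> s h sM h1.
  have -> : mulXsub rho Q k (s + h) - mulXsub rho Q k s -
      h * mulXsub rho Q k.+1 s =
      (s - rho) * (Q k (s + h) - Q k s - h * Q k.+1 s) +
      h * (Q k (s + h) - Q k s) +
      k%:R * (Q k.-1 (s + h) - Q k.-1 s - h * Q k.-1.+1 s).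
    rewrite /mulXsub; case: k {C C0 B H D D0 L C' C'0 B' H' kn} => [|k] /=; first ring.
    by rewrite [k.+2%:R]mulrS; ring.
  rewrite (le_trans (cmodD _ _))// [X in _ <= X]mulrDl; apply: lerD; last first.
    by rewrite cmodM kn -mulrA ler_wpM2l// H'.
  rewrite (le_trans (cmodD _ _))// [X in _ <= X]mulrDl; apply: lerD; last first.
    by rewrite cmodM expr2 mulrCA ler_wpM2l ?cmod_ge0// L.
  by rewrite cmodM -mulrA; apply: ler_pM; rewrite ?cmod_ge0// ?sK ?H.
Qed.

(** Hadamard's lemma: the quotient is the integral over [0 <= u <= 1] of F' at [rho + u (s - rho)],
    holomorphic by [hol_param]. Each derivative in [s] brings out a factor [u], hence the [u ^+ k]
    in [P]. *)
Lemma hol_factor F rho : hol F -> F 0%N rho = 0 ->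
  exists2 Q, hol Q & forall s, F 0%N s = (s - rho) * Q 0%N s.
Proof.
move=> hF F0.
pose P k (u : R) s := (u ^+ k)%:C * F k.+1 (rho + u%:C * (s - rho)).
have zM (u : R) s M : 0 <= u <= 1 -> cmod s <= M ->
    cmod (rho + u%:C * (s - rho)) <= cmod rho + (M + cmod rho).
  move=> /andP[u0 u1] sM; rewrite (le_trans (cmodD _ _))// lerD2l cmodM cmod_real.
  rewrite ger0_norm//; apply: (@le_trans _ _ (cmod (s - rho))).
    by rewrite ler_piMl ?cmod_ge0.
  by rewrite (le_trans (cmodB _ _))// lerD2r.
have cP k s u : ccont (fun v => P k v s) u.
  apply: cder_ccont; apply: cderM; last exact: hol_cder.
  by apply: cder_real; apply: rderX; exact: rder_id.
have un (u : R) k : 0 <= u <= 1 -> cmod (u ^+ k)%:C <= 1.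
  by move=> /andP[u0 u1]; rewrite cmod_real ger0_norm ?exprn_ge0// exprn_ile1.
have hQ : hol (fun k s => cint mu `[0, 1] (fun u => P k u s)).
  apply: hol_param => //.
    move=> k s; split; apply: measurable_funTS; apply: continuous_measurable_fun.
      by move=> u; have [] := cP k s u.
    by move=> u; have [] := cP k s u.
  move=> k M; have [C [C0 B H]] := hF k.+1 (cmod rho + (M + cmod rho)).
  exists (fun=> C).
    by apply: continuous_on_integrable => x _; exact: cvg_cst.
  move=> u; rewrite /= in_itv/= => u01; split.
    move=> s sM; rewrite cmodM; apply: le_trans (B _ (zM _ _ _ u01 sM)).
    by rewrite ler_piMl ?cmod_ge0// un.
  move=> s h sM h1; have := H _ (u%:C * h) (zM _ _ _ u01 sM).
  have uh : cmod (u%:C * h) <= cmod h.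
    rewrite cmodM ler_piMl ?cmod_ge0//.
    by have := un u 1%N u01; rewrite expr1.
  rewrite (le_trans uh h1) => /(_ isT) H1.
  have -> : P k u (s + h) - P k u s - h * P k.+1 u s = (u ^+ k)%:C *
     (F k.+1 (rho + u%:C * (s - rho) + u%:C * h) - F k.+1 (rho + u%:C * (s - rho))
      - u%:C * h * F k.+2 (rho + u%:C * (s - rho))).
    rewrite /P (_ : rho + u%:C * (s + h - rho) = rho + u%:C * (s - rho) + u%:C * h).
      by rewrite exprS rmorphM; ring.
    by ring.
  rewrite cmodM (@le_trans _ _ (C * cmod (u%:C * h) ^+ 2))//.
    by rewrite (le_trans _ H1)// ler_piMl ?cmod_ge0// un.
  by rewrite ler_wpM2l// lerXn2r// nnegrE cmod_ge0.
exists (fun k s => cint mu `[0, 1] (fun u => P k u s)) => // s.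
have D x : cder (fun u => F 0%N (rho + u%:C * (s - rho))) x ((s - rho) * P 0%N x s).
  apply: cder_eq; first exact: hol_cder.
  by rewrite /P expr0 mul1r.
rewrite -cintZ//; last first.
  by split; apply: continuous_on_integrable => x _; have [] := cP 0%N s x.
have cD x : ccont (fun u => (s - rho) * P 0%N u s) x.
  by apply: ccontM => //; exact: ccont_cst.
have E : F 0%N s = F 0%N (rho + 1%:C * (s - rho)) - F 0%N (rho + 0%:C * (s - rho)).
  by rewrite mul1r mul0r addr0 F0 subr0 addrC subrK.
apply: complex_ext; rewrite {1}E /cint/=.
  rewrite cReB (FTC (F := fun u => complex.Re (F 0%N (rho + u%:C * (s - rho)))))//.
    by move=> x _; have [] := D x.
  by move=> x _; have [] := cD x.
rewrite cImB (FTC (F := fun u => complex.Im (F 0%N (rho + u%:C * (s - rho)))))//.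
  by move=> x _; have [] := D x.
by move=> x _; have [] := cD x.
Qed.

Definition hord F rho m := (forall j, (j < m)%N -> F j rho = 0) /\ F m rho != 0.

Lemma hord_multiplicity F rho m : hol F -> hord F rho m ->
  multiplicity (F 0%N) rho = m%:R%:E.
Proof.
move=> hF [F0 Fm]; rewrite /multiplicity; apply/eqP; rewrite eq_le; apply/andP; split.
  apply: ge_ereal_sup => _ [n /= hn <-]; rewrite lee_fin ler_nat leqNgt.
  apply/negP => /hn; rewrite hol_derive1n// => /eqP; exact/negP.
apply: ereal_sup_ubound; exists m => //= k km.
by rewrite hol_derive1n// F0.
Qed.

Lemma hord_mulXsub_eq rho Q m : hord Q rho m -> hord (mulXsub rho Q) rho m.+1.
Proof.
move=> [Q0 Qm]; split; rewrite /mulXsub.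
  by case=> [|j] jm; rewrite subrr mul0r add0r ?mul0r// Q0// mulr0.
by rewrite subrr mul0r add0r mulf_neq0// pnatr_eq0.
Qed.

Lemma hord_mulXsub_neq rho rho' Q m : rho' != rho -> hord Q rho' m ->
  hord (mulXsub rho Q) rho' m.
Proof.
move=> rr [Q0 Qm]; split; rewrite /mulXsub.
  move=> j jm; rewrite Q0// mulr0 add0r.
  by case: j jm => [|j] jm; rewrite ?mul0r// Q0 ?mulr0// (ltn_trans _ jm).
case: m Q0 Qm => [|m] Q0 Qm; first by rewrite mul0r addr0 mulf_neq0// subr_eq0.
by rewrite /= [Q m rho']Q0// mulr0 addr0 mulf_neq0// subr_eq0.
Qed.

Definition mulXsubs (zs : seq R[i]) Q := foldr mulXsub Q zs.

Lemma hol_mulXsubs zs Q : hol Q -> hol (mulXsubs zs Q).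
Proof. by move=> hQ; elim: zs => //= z zs ih; exact: hol_mulXsub. Qed.

Lemma mulXsubs0 zs Q s :
  mulXsubs zs Q 0%N s = (\prod_(z <- zs) (s - z)) * Q 0%N s.
Proof.
elim: zs => [|z zs ih] /=; first by rewrite big_nil mul1r.
by rewrite /mulXsub mul0r addr0 ih big_cons mulrA.
Qed.

Lemma hord_mulXsubs zs Q rho : Q 0%N rho != 0 ->
  hord (mulXsubs zs Q) rho (count_mem rho zs).
Proof.
move=> Q0; elim: zs => [|z zs ih] /=; first by split.
have [->|zr] := eqVneq z rho; first by rewrite add1n; exact: hord_mulXsub_eq.
by rewrite add0n; apply: hord_mulXsub_neq => //; rewrite eq_sym.
Qed.

(** A derivative sequence is determined by its first term ([hol_unique]), so the order of vanishing
    read off from Leibniz' rule for [mulXsubs] is that of F. *)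
Lemma multiplicity_count F zs Q rho : hol F -> hol Q ->
  (forall s, F 0%N s = (\prod_(z <- zs) (s - z)) * Q 0%N s) ->
  Q 0%N rho != 0 -> multiplicity (F 0%N) rho = (count_mem rho zs)%:R%:E.
Proof.
move=> hF hQ E Q0; apply: hord_multiplicity => //.
have K k : F k = mulXsubs zs Q k.
  apply: hol_unique => //; first exact: hol_mulXsubs.
  by apply/funext => s; rewrite E mulXsubs0.
have [h1 h2] := hord_mulXsubs zs Q0.
by split=> [j jm|]; rewrite K// h1.
Qed.

End Division.

(** * Fubini and Green on rectangles *)

Lemma rint_patch d (T : measurableType d) {R : realType}
    (mu : {measure set T -> \bar R}) (D : set T) (f : T -> R) :
  measurable D -> rint mu D f <-> rint mu setT (f \_ D).
Proof.
move=> mD; rewrite /rint -restrict_EFin.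
have := @integrable_restrict _ _ _ mu D mD setT measurableT (EFin \o f).
by rewrite setTI => ->.
Qed.

Section PlaneIntegral.
Context {R : realType}.
Implicit Types (f : R * R -> R) (A B : set R) (z : R * R).
Local Notation mu := (@lebesgue_measure R).
Definition mu2 : {measure set (measurableTypeR R * measurableTypeR R) -> \bar R} := (mu \x mu)%E.

Lemma ratr_nbhs (x : R) (A : set R) : nbhs x A -> exists q : rat * rat,
  ratr q.1 < x < ratr q.2 /\ `]ratr q.1, ratr q.2[ `<=` A.
Proof.
move=> /nbhs_ballP[e /= e0 xA].
have /rat_in_itvoo[p] : x - e < x by rewrite ltrBlDr ltrDl.
rewrite in_itv/= => /andP[p1 p2].
have /rat_in_itvoo[q] : x < x + e by rewrite ltrDl.
rewrite in_itv/= => /andP[q1 q2].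
exists (p, q); split; first by rewrite p2 q1.
move=> y; rewrite /= in_itv/= => /andP[py yq]; apply: xA.
by rewrite /ball/= ltr_distlC; apply/andP; split; lra.
Qed.

(** The sigma-algebra of the plane is the product one; an open set is the countable union of the
    rational open rectangles that it contains. *)
Lemma open2_measurable (U : set (R * R)) : open U -> measurable U.
Proof.
move=> oU; pose I (q : rat * rat) : set R := `]ratr q.1, ratr q.2[%classic.
pose F (q : (rat * rat) * (rat * rat)) : set (R * R) :=
  if `[< I q.1 `*` I q.2 `<=` U >] then I q.1 `*` I q.2 else set0.
have -> : U = \bigcup_q F q.
  apply/seteqP; split=> [z Uz|z [q _]]; last first.
    by rewrite /F; case: asboolP => // h; apply: h.
  have [[P Q]/= [Pz Qz] PQU] : nbhs z U by apply: open_nbhs_nbhs.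
  have [p [pz pP]] := ratr_nbhs Pz; have [q [qz qQ]] := ratr_nbhs Qz.
  exists (p, q) => //; rewrite /F; case: asboolP => [_|[]].
    by split; rewrite /I/= in_itv/=.
  by move=> w [w1 w2]; apply: PQU; split; [exact: pP|exact: qQ].
apply: countable_bigcupT_measurable; first exact: (@countableP ((rat * rat) * (rat * rat))%type).
move=> q; rewrite /F; case: ifP => // _. by apply: measurableX; exact: measurable_itv.
Qed.

(** Continuity at the points of [D] is meant in the whole plane, so the points of [D] in the
    preimage of an open interval lie in its interior, which is open. *)
Lemma cont2_measurable (D : set (R * R)) f : measurable D ->
  (forall z, D z -> rcont f z) -> measurable_fun D f.
Proof.
move=> mD cf; apply: (measurability _ (RGenOpens.measurableE R)).
move=> _ [_ [a [b ->] <-]].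
have -> : D `&` f @^-1` `]a, b[ = D `&` (f @^-1` `]a, b[)°.
  apply/seteqP; split=> [z [Dz fz]|z [Dz /interior_subset fz]]; split => //.
  by apply: (cf z Dz); apply: open_nbhs_nbhs; split => //; exact: interval_open.
by apply: measurableI => //; apply: open2_measurable; exact: open_interior.
Qed.

Definition rect (a b p q : R) : set (R * R) := `[a, b] `*` `[p, q].

Lemma measurable_rect a b p q : measurable (rect a b p q).
Proof. exact: measurableX. Qed.

Lemma mu2_setX A B : measurable A -> measurable B ->
  mu2 (A `*` B) = (mu A * mu B)%E.
Proof. by move=> mA mB; exact: (@product_measure1E _ _ _ _ R mu mu A B mA mB). Qed.

Lemma mu_itv_fin (a b : R) : (mu `[a, b] < +oo)%E.
Proof. by rewrite lebesgue_measure_itv/=; case: ifP => // _; rewrite -EFinB ltry. Qed.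

Lemma mu2_rect a b p q : (mu2 (rect a b p q) < +oo)%E.
Proof.
rewrite mu2_setX// lte_mul_pinfty// ?mu_itv_fin//.
by rewrite ge0_fin_numE// mu_itv_fin.
Qed.

Lemma rect_bounded a b p q f : (forall z, rect a b p q z -> rcont f z) ->
  exists K, forall z, rect a b p q z -> `|f z| <= K.
Proof.
move=> cf.
have cp : compact (rect a b p q).
  by apply: compact_setX; exact: segment_compact.
have : compact (f @` rect a b p q).
  apply: continuous_compact => //; apply: continuous_in_subspaceT => z.
  by rewrite inE; exact: cf.
move=> /compact_bounded[M [_ HM]]; exists (`|M| + 1) => z rz.
apply: (HM (`|M| + 1)); last by exists z.
by rewrite (le_lt_trans (ler_norm _))// ltrDl.
Qed.

Lemma cont2_rint a b p q f : (forall z, rect a b p q z -> rcont f z) ->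
  rint mu2 (rect a b p q) f.
Proof.
move=> cf; have [K fK] := rect_bounded cf.
apply: (rint_bnd (K := K)) => //; [exact: measurable_rect|exact: mu2_rect|].
by apply: cont2_measurable => //; exact: measurable_rect.
Qed.

Lemma patch_prod A B f x t : (f \_ (A `*` B)) (x, t) =
  ((fun t => ((fun x => f (x, t)) \_ A) x) \_ B) t.
Proof.
rewrite /patch; case: ifPn.
  by rewrite inE => -[/= h1 h2]; rewrite !ifT// inE.
rewrite notin_setE => h; case: ifPn => //; rewrite inE => Bt.
by case: ifPn => //; rewrite inE => Ax; exfalso; apply: h.
Qed.

(** [Rintegral] takes the finite part of an extended integral; integrability of every section makes
    the inner integrals finite, so that nothing is lost in the iterated form. *)
Lemma Rfubini1 A B f : measurable A -> measurable B ->
  rint mu2 (A `*` B) f ->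
  (forall t, B t -> rint mu A (fun x => f (x, t))) ->
  \int[mu2]_(z in A `*` B) f z =
  \int[mu]_(t in B) \int[mu]_(x in A) f (x, t).
Proof.
move=> mA mB hf hA; rewrite Rintegral_mkcond [RHS]Rintegral_mkcond /Rintegral.
congr fine; rewrite -integral21_prod_meas1; last first.
  exact: (rint_patch mu2 f (measurableX mA mB)).1 hf.
apply: eq_integral => t _; rewrite /fubini_G.
under eq_integral do rewrite patch_prod.
rewrite /patch; case: ifPn => [|_]; last by rewrite integral0.
rewrite inE => Bt; rewrite fineK.
  rewrite [in RHS]integral_mkcond; apply: eq_integral => x _.
  by rewrite /patch; case: ifP.
exact: integrable_fin_num (hA _ Bt).
Qed.

Lemma Rfubini2 A B f : measurable A -> measurable B ->
  rint mu2 (A `*` B) f ->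
  (forall x, A x -> rint mu B (fun t => f (x, t))) ->
  \int[mu2]_(z in A `*` B) f z =
  \int[mu]_(x in A) \int[mu]_(t in B) f (x, t).
Proof.
move=> mA mB hf hA; rewrite Rintegral_mkcond [RHS]Rintegral_mkcond /Rintegral.
congr fine; rewrite -integral12_prod_meas1; last first.
  exact: (rint_patch mu2 f (measurableX mA mB)).1 hf.
apply: eq_integral => x _; rewrite /fubini_F.
have E t : (f \_ (A `*` B)) (x, t) =
  ((fun x => ((fun t => f (x, t)) \_ B) t) \_ A) x.
  rewrite patch_prod /patch; by case: ifP => //; case: ifP.
under eq_integral do rewrite E.
rewrite /patch; case: ifPn => [|_]; last by rewrite integral0.
rewrite inE => Ax; rewrite fineK.
  rewrite [in RHS]integral_mkcond; apply: eq_integral => t _.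
  by rewrite /patch; case: ifP.
exact: integrable_fin_num (hA _ Ax).
Qed.

(** Serves for logarithmic majorants that depend on the height alone. *)
Lemma rint_snd a b B (m : R -> R) : measurable B -> rint mu B m ->
  rint mu2 (`[a, b] `*` B) (fun z => m z.2).
Proof.
move=> mB hm; have mX : measurable (`[a, b] `*` B) by exact: measurableX.
have mm := rint_meas hm.
have mf : measurable_fun (`[a, b] `*` B) (fun z : R * R => m z.2).
  have : measurable_fun setT (fun z : R * R => (m \_ B) z.2).
    apply: measurableT_comp => //; apply/measurable_restrict => //.
    by rewrite setTI.
  move=> /(measurable_funS measurableT (@subsetT _ (`[a, b] `*` B))).
  apply: eq_measurable_fun => z; rewrite inE => -[_ /= h].
  by rewrite /patch ifT// inE.
apply: (rint_patch mu2 _ mX).2; apply/integrable21ltyP.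
  apply/measurable_EFinP; apply/measurable_restrict => //.
  by rewrite setTI.
have mab : (mu `[a, b] < +oo)%E := mu_itv_fin a b.
set A := `[a, b]%classic in mX mf mab *.
have -> : (\int[mu]_y \int[mu]_x
    `|(EFin \o ((fun z : R * R => m z.2) \_ (A `*` B))) (x, y)| =
    \int[mu]_(y in B) (mu A * `|(m y)%:E|))%E.
  rewrite [RHS]integral_mkcond; apply: eq_integral => t _.
  under eq_integral do rewrite /= patch_prod.
  rewrite /patch; case: ifPn => tB; last by rewrite normr0 integral0.
  transitivity (\int[mu]_(x in A) (cst (`|(m t)%:E|) x))%E.
    rewrite [RHS]integral_mkcond; apply: eq_integral => x _.
    by rewrite /patch; case: ifP => //=; rewrite normr0.
  by rewrite integral_cst; [exact: muleC|exact: measurable_itv].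
rewrite ge0_integralZl//.
- apply: lte_mul_pinfty => //; first by rewrite ge0_fin_numE.
  by have /integrableP[] := hm.
- by apply/measurable_EFinP; apply: measurableT_comp.
Qed.

End PlaneIntegral.

Section HolContinuity.
Context {R : realType} {T : topologicalType}.

Lemma hol_ccont (F : nat -> R[i] -> R[i]) k (p : T -> R[i]) (z : T) : hol F ->
  ccont p z -> ccont (fun x => F k (p x)) z.
Proof.
move=> hF hp; have [C C0 L] := hol_lip hF k (cmod (p z)).
have cz : rcont (fun x => cmod (p x - p z)) z.
  by apply: ccont_cmod; apply: ccontB => //; exact: ccont_cst.
have H e : 0 < e -> \forall x \near z, cmod (F k (p z) - F k (p x)) <= e.
  move=> e0; have d0 : 0 < Num.min 1 (e / (C + 1)).
    by rewrite lt_min ltr01 divr_gt0// ltr_wpDl.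
  move/cvgrPdist_le : cz => /(_ _ d0); apply: filterS => x.
  rewrite subrr cmod0 sub0r normrN ger0_norm ?cmod_ge0// le_min => /andP[h1 he].
  rewrite cmodC; have := L (p z) (p x - p z) (lexx _) h1.
  rewrite [p z + _]addrC subrK => /le_trans; apply.
  rewrite (@le_trans _ _ ((C + 1) * cmod (p x - p z)))//.
    by rewrite ler_wpM2r ?cmod_ge0// lerDl.
  by rewrite mulrC -ler_pdivlMr// ltr_wpDl.
split; apply/cvgrPdist_le => e e0; apply: filterS (H e e0) => x.
  by apply: le_trans; rewrite -cReB; exact: Re_le_cmod.
by apply: le_trans; rewrite -cImB; exact: Im_le_cmod.
Qed.

End HolContinuity.

(** * Green's formula for a regularised log |F| *)

Section Green.
Context {R : realType}.
Implicit Types (x t : R) (z : R * R).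
Local Notation mu := (@lebesgue_measure R).
Variables (F : nat -> R[i] -> R[i]) (eps : R).
Hypothesis hF : hol F.

Let P k x t := complex.Re (F k (x +i* t)).
Let Q k x t := complex.Im (F k (x +i* t)).

(** [lh] is log |F| regularised by [eps], [lht] its t-derivative and [llap] its Laplacian. For
    [eps = 0] this is log |F|, harmonic off the zeros; for [eps > 0] it is smooth everywhere and
    subharmonic. *)
Definition lw x t := cmod (F 0%N (x +i* t)) ^+ 2 + eps.
Definition lh x t := 2^-1 * ln (lw x t).
Definition lht x t := (Q 0 x t * P 1 x t - P 0 x t * Q 1 x t) / lw x t.
Definition llap x t := 2 * eps * cmod (F 1%N (x +i* t)) ^+ 2 / lw x t ^+ 2.

Let lhx x t := (P 0 x t * P 1 x t + Q 0 x t * Q 1 x t) / lw x t.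
Let lhxx x t := (P 1 x t ^+ 2 + P 0 x t * P 2 x t + Q 1 x t ^+ 2 + Q 0 x t * Q 2 x t)
  / lw x t - 2 * (P 0 x t * P 1 x t + Q 0 x t * Q 1 x t) ^+ 2 / lw x t ^+ 2.
Let lhtt x t := (Q 1 x t ^+ 2 - P 0 x t * P 2 x t + P 1 x t ^+ 2 - Q 0 x t * Q 2 x t)
  / lw x t - 2 * (Q 0 x t * P 1 x t - P 0 x t * Q 1 x t) ^+ 2 / lw x t ^+ 2.

Let lwE x t : lw x t = P 0 x t ^+ 2 + Q 0 x t ^+ 2 + eps.
Proof. by rewrite /lw sqr_cmod. Qed.

(** The terms with F'' cancel between [lhxx] and [lhtt], by the Cauchy-Riemann equations built into
    them; writing [eps] as [lw - P^2 - Q^2] makes the rest a rational identity. *)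
Lemma lap_lh x t : 0 < lw x t -> lhxx x t + lhtt x t = llap x t.
Proof.
move=> w0; have wn0 := lt0r_neq0 w0.
have E : eps = lw x t - P 0 x t ^+ 2 - Q 0 x t ^+ 2 by rewrite lwE; ring.
rewrite /llap /lhxx /lhtt E sqr_cmod -/(P 1 x t) -/(Q 1 x t).
by field.
Qed.

Let derx k x t : cder (fun y => F k (y +i* t)) x (F k.+1 (x +i* t)).
Proof.
have := hol_cder k (0 +i* t) 1 x hF.
have E y : (0 +i* t) + y%:C * 1 = y +i* t.
  by rewrite mulr1; apply: complex_ext; rewrite /= ?add0r ?addr0.
by rewrite mul1r E; under eq_fun do rewrite E.
Qed.

Let dert k x t : cder (fun y => F k (x +i* y)) t ('i * F k.+1 (x +i* t)).
Proof.
have := hol_cder k x%:C 'i t hF.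
have E y : x%:C + y%:C * 'i = x +i* y.
  by apply: complex_ext; rewrite /= ?mulr0 ?mulr1 ?mul0r ?subr0 ?addr0 ?add0r.
by rewrite E; under eq_fun do rewrite E.
Qed.

Let Px k x t : rder (fun y => P k y t) x (P k.+1 x t).
Proof. by have [] := derx k x t. Qed.
Let Qx k x t : rder (fun y => Q k y t) x (Q k.+1 x t).
Proof. by have [] := derx k x t. Qed.
Let Pt k x t : rder (fun y => P k x y) t (- Q k.+1 x t).
Proof.
have [h _] := dert k x t; apply: rder_eq h _.
by rewrite cReM /= mul0r mul1r sub0r.
Qed.
Let Qt k x t : rder (fun y => Q k x y) t (P k.+1 x t).
Proof.
have [_ h] := dert k x t; apply: rder_eq h _.
by rewrite cImM /= mul0r mul1r add0r.
Qed.

Let rder_lwx x t : rder (fun y => lw y t) x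
  (2 * (P 0 x t * P 1 x t + Q 0 x t * Q 1 x t)).
Proof.
have -> : (fun y => lw y t) = (fun y => P 0 y t ^+ 2 + Q 0 y t ^+ 2 + eps).
  by apply/funext => y; rewrite lwE.
apply: rder_eq.
  by apply: rderD; [apply: rderD; apply: rderX; [exact: Px|exact: Qx]|exact: rder_cst].
by rewrite /= !expr1; ring.
Qed.

Let rder_lwt x t : rder (fun y => lw x y) t
  (2 * (Q 0 x t * P 1 x t - P 0 x t * Q 1 x t)).
Proof.
have -> : (fun y => lw x y) = (fun y => P 0 x y ^+ 2 + Q 0 x y ^+ 2 + eps).
  by apply/funext => y; rewrite lwE.
apply: rder_eq.
  by apply: rderD; [apply: rderD; apply: rderX; [exact: Pt|exact: Qt]|exact: rder_cst].
by rewrite /= !expr1; ring.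
Qed.

Lemma rder_lhx x t : 0 < lw x t -> rder (fun y => lh y t) x (lhx x t).
Proof.
move=> w0; have wn0 := lt0r_neq0 w0; rewrite /lh.
apply: rder_eq.
  apply: rderM; first exact: rder_cst.
  by apply: rder_ln => //; exact: rder_lwx.
by rewrite /lhx /=; field.
Qed.

Lemma rder_lht x t : 0 < lw x t -> rder (fun y => lh x y) t (lht x t).
Proof.
move=> w0; have wn0 := lt0r_neq0 w0; rewrite /lh.
apply: rder_eq.
  apply: rderM; first exact: rder_cst.
  by apply: rder_ln => //; exact: rder_lwt.
by rewrite /lht /=; field.
Qed.

Let rder_lhxx x t : 0 < lw x t -> rder (fun y => lhx y t) x (lhxx x t).
Proof.
move=> w0; have wn0 := lt0r_neq0 w0; rewrite /lhx.
apply: rder_eq.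
  apply: rderM; first by apply: rderD; apply: rderM; [exact: Px|exact: Px|exact: Qx|exact: Qx].
  by apply: rderV => //; exact: rder_lwx.
by rewrite /lhxx /=; field.
Qed.

Let rder_lhtt x t : 0 < lw x t -> rder (fun y => lht x y) t (lhtt x t).
Proof.
move=> w0; have wn0 := lt0r_neq0 w0; rewrite /lht.
apply: rder_eq.
  apply: rderM; first by apply: rderB; apply: rderM; [exact: Qt|exact: Pt|exact: Pt|exact: Qt].
  by apply: rderV => //; exact: rder_lwt.
by rewrite /lhtt /=; field.
Qed.

Let cE k z : ccont (fun z : R * R => F k (z.1 +i* z.2)) z.
Proof. by apply: hol_ccont => //; apply: ccont_mk; [exact: cvg_fst|exact: cvg_snd]. Qed.
Let cP k z : rcont (fun z : R * R => P k z.1 z.2) z.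
Proof. by have [] := cE k z. Qed.
Let cQ k z : rcont (fun z : R * R => Q k z.1 z.2) z.
Proof. by have [] := cE k z. Qed.

Lemma rcont_lw z : rcont (fun z : R * R => lw z.1 z.2) z.
Proof. by apply: rcontD; [apply: rcontX; exact: ccont_cmod|exact: rcont_cst]. Qed.

Lemma rcont_lh z : 0 < lw z.1 z.2 -> rcont (fun z : R * R => lh z.1 z.2) z.
Proof.
by move=> h; apply: rcontM; [exact: rcont_cst|apply: rcont_ln => //; exact: rcont_lw].
Qed.

Lemma rcont_lht z : 0 < lw z.1 z.2 -> rcont (fun z : R * R => lht z.1 z.2) z.
Proof.
move=> h; apply: rcontM.
  by apply: rcontB; apply: rcontM.
by apply: rcontV; [exact: lt0r_neq0|exact: rcont_lw].
Qed.

Lemma rcont_llap z : 0 < lw z.1 z.2 -> rcont (fun z : R * R => llap z.1 z.2) z.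
Proof.
move=> h; apply: rcontM.
  apply: rcontM; first exact: rcont_cst.
  by apply: rcontX; exact: ccont_cmod.
by apply: rcontV; [rewrite expf_neq0// lt0r_neq0|apply: rcontX; exact: rcont_lw].
Qed.

Let rcont_lhxx z : 0 < lw z.1 z.2 -> rcont (fun z : R * R => lhxx z.1 z.2) z.
Proof.
move=> h; have c2 : rcont (fun z : R * R => (lw z.1 z.2)^-1) z.
  by apply: rcontV; [exact: lt0r_neq0|exact: rcont_lw].
have c3 : rcont (fun z : R * R => (lw z.1 z.2 ^+ 2)^-1) z.
  by apply: rcontV; [rewrite expf_neq0// lt0r_neq0|apply: rcontX; exact: rcont_lw].
rewrite /lhxx; apply: rcontB.
  apply: rcontM; last exact: c2.
  apply: rcontD; last by apply: rcontM; exact: cQ.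
  apply: rcontD; last by apply: rcontX; exact: cQ.
  by apply: rcontD; [apply: rcontX; exact: cP|apply: rcontM; exact: cP].
apply: rcontM; last exact: c3.
apply: rcontM; first exact: rcont_cst.
by apply: rcontX; apply: rcontD; apply: rcontM; first [exact: cP|exact: cQ].
Qed.

Let rcont_lhtt z : 0 < lw z.1 z.2 -> rcont (fun z : R * R => lhtt z.1 z.2) z.
Proof.
move=> h; have c2 : rcont (fun z : R * R => (lw z.1 z.2)^-1) z.
  by apply: rcontV; [exact: lt0r_neq0|exact: rcont_lw].
have c3 : rcont (fun z : R * R => (lw z.1 z.2 ^+ 2)^-1) z.
  by apply: rcontV; [rewrite expf_neq0// lt0r_neq0|apply: rcontX; exact: rcont_lw].
rewrite /lhtt; apply: rcontB.
  apply: rcontM; last exact: c2.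
  apply: rcontB; last by apply: rcontM; exact: cQ.
  apply: rcontD; last by apply: rcontX; exact: cP.
  by apply: rcontB; [apply: rcontX; exact: cQ|apply: rcontM; exact: cP].
apply: rcontM; last exact: c3.
apply: rcontM; first exact: rcont_cst.
by apply: rcontX; apply: rcontB; apply: rcontM; first [exact: cP|exact: cQ].
Qed.

Variables (a a1 a2 b b1 b2 : R -> R).
Hypothesis Da : forall x, rder a x (a1 x).
Hypothesis Da1 : forall x, rder a1 x (a2 x).
Hypothesis ca2 : continuous a2.
Hypothesis Db : forall x, rder b x (b1 x).
Hypothesis Db1 : forall x, rder b1 x (b2 x).
Hypothesis cb2 : continuous b2.

Let c1 (f : R -> R) z : {for z.1, continuous f} ->
  rcont (fun z : R * R => f z.1) z.
Proof. by move=> h; apply: rcont_comp => //; exact: cvg_fst. Qed.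
Let c2 (f : R -> R) z : {for z.2, continuous f} ->
  rcont (fun z : R * R => f z.2) z.
Proof. by move=> h; apply: rcont_comp => //; exact: cvg_snd. Qed.
Lemma rcont_sect1 (f : R * R -> R) x t : rcont f (x, t) ->
  {for x, continuous (fun y => f (y, t))}.
Proof.
move=> h; apply: (@cvg_comp _ _ _ (fun y : R => (y, t)) f _ (nbhs (x, t))); last exact: h.
by apply: (@cvg_pair _ _ _ _ (nbhs x) (nbhs t) _ _ _ (fun y : R => y) (fun=> t));
  [exact: cvg_id|exact: cvg_cst].
Qed.
Lemma rcont_sect2 (f : R * R -> R) x t : rcont f (x, t) ->
  {for t, continuous (fun y => f (x, y))}.
Proof.
move=> h; apply: (@cvg_comp _ _ _ (fun y : R => (x, y)) f _ (nbhs (x, t))); last exact: h.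
by apply: (@cvg_pair _ _ _ _ (nbhs x) (nbhs t) _ _ _ (fun=> x) (fun y : R => y));
  [exact: cvg_cst|exact: cvg_id].
Qed.

(** The integrand minus the Laplacian term is a divergence: [f1] is the x-derivative of
    [(lh a1 - lhx a) b] and [f2] the t-derivative of [(lh b1 - lht b) a], so Fubini reduces both to
    boundary terms. The conditions on [a] leave only the line [x = s]; those in t are kept, because
    the formula is also applied to rectangles at whose horizontal sides [b] is not zero. *)
Lemma green (s Y p q : R) : s <= Y -> p <= q ->
  (forall z, rect s Y p q z -> 0 < lw z.1 z.2) ->
  a s = 0 -> a Y = 0 -> a1 Y = 0 ->
  \int[mu2]_(z in rect s Y p q)
     (lh z.1 z.2 * (a2 z.1 * b z.2 + a z.1 * b2 z.2)) +
  a1 s * \int[mu]_(t in `[p, q]) (b t * lh s t) =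
  \int[mu2]_(z in rect s Y p q) (a z.1 * b z.2 * llap z.1 z.2) +
  \int[mu]_(x in `[s, Y]) (a x * (lh x q * b1 q - lht x q * b q)) -
  \int[mu]_(x in `[s, Y]) (a x * (lh x p * b1 p - lht x p * b p)).
Proof.
move=> sY pq w0 as0 aY a1Y.
have ca z : rcont (fun z : R * R => a z.1) z.
  by apply: c1; exact: rder_continuous (Da _).
have ca1 z : rcont (fun z : R * R => a1 z.1) z.
  by apply: c1; exact: rder_continuous (Da1 _).
have ca2' z : rcont (fun z : R * R => a2 z.1) z by apply: c1; exact: ca2.
have cb z : rcont (fun z : R * R => b z.2) z.
  by apply: c2; exact: rder_continuous (Db _).
have cb1 z : rcont (fun z : R * R => b1 z.2) z.
  by apply: c2; exact: rder_continuous (Db1 _).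
have cb2' z : rcont (fun z : R * R => b2 z.2) z by apply: c2; exact: cb2.
pose f1 (z : R * R) := (lh z.1 z.2 * a2 z.1 - lhxx z.1 z.2 * a z.1) * b z.2.
pose f2 (z : R * R) := (lh z.1 z.2 * b2 z.2 - lhtt z.1 z.2 * b z.2) * a z.1.
have cf1 z : rect s Y p q z -> rcont f1 z.
  move=> /w0 w; have := rcont_lh w; have := rcont_lhxx w => h1 h2.
  by rewrite /f1; apply: rcontM => //; apply: rcontB; apply: rcontM.
have cf2 z : rect s Y p q z -> rcont f2 z.
  move=> /w0 w; have := rcont_lh w; have := rcont_lhtt w => h1 h2.
  by rewrite /f2; apply: rcontM => //; apply: rcontB; apply: rcontM.
have cl z : rect s Y p q z -> rcont (fun z : R * R => a z.1 * b z.2 * llap z.1 z.2) z.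
  move=> /w0 w; have := rcont_llap w => h1.
  by apply: rcontM => //; apply: rcontM.
have i1 := cont2_rint cf1; have i2 := cont2_rint cf2; have il := cont2_rint cl.
have inr x t : s <= x <= Y -> p <= t <= q -> rect s Y p q (x, t).
  by move=> h1 h2; split; rewrite /= in_itv/=.
have mR : measurable (rect s Y p q) := measurable_rect s Y p q.
have -> : \int[mu2]_(z in rect s Y p q)
     (lh z.1 z.2 * (a2 z.1 * b z.2 + a z.1 * b2 z.2)) =
   \int[mu2]_(z in rect s Y p q) f1 z + \int[mu2]_(z in rect s Y p q) f2 z +
   \int[mu2]_(z in rect s Y p q) (a z.1 * b z.2 * llap z.1 z.2).
  rewrite -RintegralD// -RintegralD//; last exact: rintD.
  apply: eq_Rintegral => z; rewrite inE => /w0 w.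
  by rewrite -lap_lh// /f1 /f2; ring.
have lb x t : s <= x <= Y -> p <= t <= q -> 0 < lw x t.
  by move=> h1 h2; exact: (w0 (x, t) (inr _ _ h1 h2)).
have -> : \int[mu2]_(z in rect s Y p q) f1 z =
    - (a1 s * \int[mu]_(t in `[p, q]) (b t * lh s t)).
  rewrite Rfubini1//; last first.
    move=> t; rewrite /= in_itv/= => tpq; apply: continuous_on_integrable => x xs.
    by apply: rcont_sect1; apply: cf1; exact: inr.
  rewrite -RintegralZl//; last first.
    apply: continuous_on_integrable => t tpq.
    have ss : s <= s <= Y by rewrite lexx.
    have h1 : rcont (fun z : R * R => b z.2 * lh z.1 z.2) (s, t).
      by apply: rcontM => //; apply: rcont_lh; exact: lb.
    exact: (rcont_sect2 h1).
  rewrite -RintegralN//; last first.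
    apply: continuous_on_integrable => t tpq.
    have ss : s <= s <= Y by rewrite lexx.
    have h1 : rcont (fun z : R * R => a1 s * (b z.2 * lh z.1 z.2)) (s, t).
      apply: rcontM; first exact: rcont_cst.
      by apply: rcontM => //; apply: rcont_lh; exact: lb.
    exact: (rcont_sect2 h1).
  apply: eq_Rintegral => t; rewrite inE/= in_itv/= => tpq.
  rewrite (@FTC _ (fun x => f1 (x, t)) (fun x => (lh x t * a1 x - lhx x t * a x) * b t))//.
  - by rewrite aY a1Y as0; ring.
  - move=> x xs; apply: rder_eq.
      apply: rderM; last exact: rder_cst.
      apply: rderB; apply: rderM.
      + by apply: rder_lhx; exact: lb.
      + exact: Da1.
      + by apply: rder_lhxx; exact: lb.
      + exact: Da.
    by rewrite /f1/=; ring.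
  - by move=> x xs; apply: rcont_sect1; apply: cf1; exact: inr.
have -> : \int[mu2]_(z in rect s Y p q) f2 z =
    \int[mu]_(x in `[s, Y]) (a x * (lh x q * b1 q - lht x q * b q)) -
    \int[mu]_(x in `[s, Y]) (a x * (lh x p * b1 p - lht x p * b p)).
  rewrite Rfubini2//; last first.
    move=> x; rewrite /= in_itv/= => tpq; apply: continuous_on_integrable => t xs.
    by apply: rcont_sect2; apply: cf2; exact: inr.
  have ci r : p <= r <= q -> rint mu `[s, Y] (fun x => a x * (lh x r * b1 r - lht x r * b r)).
    move=> rpq; apply: continuous_on_integrable => x xs.
    have w := lb _ _ xs rpq.
    have h1 : rcont (fun z : R * R => a z.1 * (lh z.1 z.2 * b1 z.2 - lht z.1 z.2 * b z.2)) (x, r).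
      by apply: rcontM => //; apply: rcontB; apply: rcontM => //;
        [exact: rcont_lh|exact: rcont_lht].
    exact: (rcont_sect1 h1).
  rewrite -RintegralB//; try (apply: ci; rewrite ?lexx ?pq//).
  apply: eq_Rintegral => x; rewrite inE/= in_itv/= => xs.
  rewrite (@FTC _ (fun t => f2 (x, t)) (fun t => (lh x t * b1 t - lht x t * b t) * a x))//.
  - by ring.
  - move=> t tpq; apply: rder_eq.
      apply: rderM; last exact: rder_cst.
      apply: rderB; apply: rderM.
      + by apply: rder_lht; exact: lb.
      + exact: Db1.
      + by apply: rder_lhtt; exact: lb.
      + exact: Db.
    by rewrite /f2/=; ring.
  - by move=> t tpq; apply: rcont_sect2; apply: cf2; exact: inr.
by ring.
Qed.

End Green.

(** * Logarithmic singularities *)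

Section Convergence.
Context d (T : measurableType d) {R : realType}.
Variable mu : {measure set T -> \bar R}.
Implicit Types (D : set T) (f g : T -> R).

Lemma Rdct D (f_ : nat -> T -> R) f g : measurable D ->
  (forall n, measurable_fun D (f_ n)) ->
  (forall x, D x -> f_ n x @[n --> \oo] --> f x) ->
  (forall n x, D x -> `|f_ n x| <= g x) -> rint mu D g ->
  \int[mu]_(x in D) f_ n x @[n --> \oo] --> \int[mu]_(x in D) f x.
Proof.
move=> mD mf ff fg ig.
have mff : measurable_fun D f by exact: (@measurable_fun_cvg _ T R D f_ f mf ff).
have fg' x : D x -> `|f x| <= g x.
  move=> Dx; apply: (@cvgr_to_le nat \oo _ R (fun n => `|f_ n x|) `|f x| (g x)).
    exact: (cvg_norm (ff x Dx)).
  by apply: nearW => n; exact: fg.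
have if_ : rint mu D f by apply: rint_dom ig.
rewrite /Rintegral; apply: fine_cvg; rewrite fineK; last exact: integrable_fin_num.
apply: (dominated_cvg mD (g := EFin \o g)) => //.
- by move=> n; apply/measurable_EFinP; exact: mf.
- by move=> x Dx; apply/fine_cvgP; split; [exact: nearW|exact: (ff x Dx)].
Qed.

Lemma rint_null D N f : measurable N -> measurable D -> mu N = 0%E ->
  measurable_fun D f -> rint mu (D `\` N) f -> rint mu D f.
Proof.
move=> mN mD N0 mf h; apply/(negligible_integrable mN mD _ N0) => //.
exact/measurable_EFinP.
Qed.

Lemma Rintegral_null D N f : measurable N -> measurable D -> mu N = 0%E ->
  rint mu D f -> \int[mu]_(x in D) f x = \int[mu]_(x in D `\` N) f x.
Proof. by move=> mN mD N0 h; rewrite /Rintegral (negligible_integral mN mD h N0). Qed.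

(** Used with [v] the height above a zero: the horizontal line through the zero is cut out together
    with a strip shrinking to it. *)
Lemma Rintegral_cut D f (v : T -> R) : measurable D -> rint mu D f ->
  measurable_fun setT v -> mu (D `&` [set x | v x = 0]) = 0%E ->
  \int[mu]_(x in D `&` [set x | n.+1%:R^-1 <= `|v x|]) f x @[n --> \oo] -->
  \int[mu]_(x in D) f x.
Proof.
move=> mD hf mv N0.
have mN : measurable (D `&` [set x | v x = 0]).
  apply: measurableI => //; have -> : [set x | v x = 0] = setT `&` v @^-1` [set 0].
    by rewrite setTI.
  exact: mv.
have mE n : measurable [set x | n.+1%:R^-1 <= `|v x|].
  have -> : [set x | n.+1%:R^-1 <= `|v x|] =
     setT `&` (fun x => `|v x|) @^-1` `[n.+1%:R^-1, +oo[.
    by apply/seteqP; split=> x /=; rewrite in_itv/= andbT //; case.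
  by apply: (measurableT_comp (@normr_measurable _ setT) mv).
have mff := rint_meas hf.
pose h := f \_ [set x | v x != 0].
have mC : measurable (D `\` (D `&` [set x | v x = 0])) by exact: measurableD.
have E : \int[mu]_(x in D) f x = \int[mu]_(x in D) h x.
  rewrite (Rintegral_null mN mD N0 hf) -Rintegral_mkcondr; congr Rintegral.
  apply/seteqP; split=> x [Dx /= h1]; split => //.
    by apply/eqP => h2; apply: h1.
  by move=> [_ /= h2]; move: h1; rewrite h2 eqxx.
rewrite E; under eq_fun do rewrite Rintegral_mkcondr.
apply: (@Rdct _ _ _ (fun x => `|f x|)) => //.
- move=> n; apply/measurable_restrict => //.
  by apply: measurable_funS mff => //; exact: subIsetr.
- move=> x Dx; rewrite /h /patch; case: ifPn => [|hx].
    rewrite inE/= => vx; apply: cvg_near_cst.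
    have [k kv] : exists k : nat, k.+1%:R^-1 <= `|v x|.
      exists (Num.truncn `|v x|^-1); rewrite invf_ple ?posrE ?normr_gt0//.
      by apply/ltW; apply: truncnS_gt.
    exists k => // n /= kn; rewrite ifT// inE/=; apply: le_trans kv.
    by rewrite lef_pV2 ?posrE// ler_nat ltnS.
  apply: cvg_near_cst; apply: nearW => n; rewrite ifF//.
  move: hx; rewrite notin_setE/= => /negP; rewrite negbK => /eqP v0.
  by apply/negbTE; rewrite notin_setE/= v0 normr0; apply/negP; rewrite -ltNge invr_gt0.
- by move=> n x Dx; rewrite /patch; case: ifP => // _; rewrite normr0.
- exact: rint_norm.
Qed.

End Convergence.

Section LogIntegrable.
Context {R : realType}.
Local Notation mu := (@lebesgue_measure R).

Lemma ln_le_sub1 (x : R) : 0 < x -> ln x <= x - 1.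
Proof.
move=> x0; have := @expR_ge1Dx R (ln x); rewrite lnK ?posrE//; lra.
Qed.

Lemma ln_sqr_abs (v : R) : ln (v ^+ 2) = 2 * ln `|v|.
Proof.
have [->|v0] := eqVneq v 0; first by rewrite expr0n/= normr0 ln0// mulr0.
by rewrite -real_normK ?num_real// lnXn ?normr_gt0// mulr_natl.
Qed.

Lemma ln_prim (e v : R) : 0 < e ->
  rder (fun v => v * (2^-1 * ln (v ^+ 2 + e ^+ 2)) - v + e * atan (v / e)) v
    (2^-1 * ln (v ^+ 2 + e ^+ 2)).
Proof.
move=> e0; have ve : 0 < v ^+ 2 + e ^+ 2 by rewrite ltr_wpDl ?sqr_ge0// exprn_gt0.
have en0 := lt0r_neq0 e0; have ven0 := lt0r_neq0 ve.
apply: rder_eq; first by repeat rder_step.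
rewrite /=.
have : 1 + (v / e) ^+ 2 != 0 by rewrite gt_eqF// ltr_wpDr ?sqr_ge0.
rewrite exprMn exprVn.
have -> : 1 + v ^+ 2 / e ^+ 2 = (v ^+ 2 + e ^+ 2) / e ^+ 2 by field.
by move=> _; field; rewrite ven0 en0.
Qed.

(** The regularised logarithm has an explicit primitive ([ln_prim]), which bounds its integrals by 4
    uniformly; monotone convergence carries the bound over to |ln |t - g||. *)
Lemma rint_ln1 (g : R) : rint mu `[g - 1, g + 1] (fun t => ln `|t - g|).
Proof.
pose I : set R := `[g - 1, g + 1]%classic.
pose e n : R := n.+1%:R^-1.
have e0 n : 0 < e n by rewrite invr_gt0.
have e1 n : e n <= 1 by rewrite invf_le1// ler1n.
(* The constant 1 keeps [u n] nonnegative on the interval and pays for the factor 2 in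
   [v^2 + e^2 <= 2 v^2], valid for [v >= e]. The integral of [u n] is
   [4 - ln (1 + e^2) - 2 e atan (1/e)]. *)
pose u n (t : R) : R := 1 - 2^-1 * ln ((t - g) ^+ 2 + e n ^+ 2).
have p0 n t : 0 < (t - g) ^+ 2 + e n ^+ 2 by rewrite ltr_wpDl ?sqr_ge0// exprn_gt0.
have cu n t : rcont (u n) t.
  apply: rcontB; first exact: rcont_cst.
  apply: rcontM; first exact: rcont_cst.
  apply: rcont_ln => //; apply: rcontD; last exact: rcont_cst.
  by apply: rcontX; apply: rcontB; [exact: cvg_id|exact: rcont_cst].
have tg t : g - 1 <= t <= g + 1 -> (t - g) ^+ 2 <= 1.
  move=> /andP[h1 h2]; rewrite -real_normK ?num_real// exprn_ile1// ler_norml; lra.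
have u0 n t : g - 1 <= t <= g + 1 -> 0 <= u n t.
  move=> /tg h; have := ln_le_sub1 (p0 n t).
  have : e n ^+ 2 <= 1 by rewrite exprn_ile1// ltW.
  rewrite /u; lra.
have iu n : (\int[mu]_(t in I) (u n t)%:E <= 4%:E)%E.
  rewrite -(fineK (integrable_fin_num _ (continuous_on_integrable (fun t _ => cu n t))))//.
  rewrite lee_fin -/(Rintegral _ _ _).
  pose F v := v * (2^-1 * ln (v ^+ 2 + e n ^+ 2)) - v + e n * atan (v / e n).
  rewrite (@FTC _ (u n) (fun t => t - F (t - g))); last 3 first.
  - by rewrite lerD2l lerN10 || lra.
  - move=> x _; apply: rderB; first exact: rder_id.
    apply: rder_eq; first apply: rder_comp (ln_prim _ (e0 n)) _.
      by apply: rderB; [exact: rder_id|exact: rder_cst].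
    by rewrite subr0 mulr1.
  - by move=> x _; exact: cu.
  rewrite /F (_ : g + 1 - g = 1); last by ring.
  rewrite (_ : g - 1 - g = - 1); last by ring.
  rewrite !mulNr atanN sqrrN expr1n.
  have h1 : 0 <= ln (1 + e n ^+ 2) by rewrite ln_ge0// lerDl sqr_ge0.
  have h2 : 0 <= e n * atan (1 / e n).
    by rewrite mulr_ge0 ?(ltW (e0 n))// -atan0 le_atan// divr_ge0// ltW.
  by move: h1 h2; set A := ln _; set B := _ * atan _ => h1 h2; rewrite mulrN -/B; lra.
have ml : measurable_fun setT (fun t : R => ln `|t - g|).
  apply: measurableT_comp; first exact: measurable_ln.
  by apply: measurableT_comp => //; exact: measurable_funB.
(* Truncation near the singularity: [w n] increases with [n] and stays below [u n]. *)
pose w n (t : R) : R := if e n <= `|t - g| then `|ln `|t - g| | else 0.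
have me n : measurable_fun setT (fun t : R => e n <= `|t - g|).
  by apply: measurable_fun_ler => //; apply: measurableT_comp => //; exact: measurable_funB.
have mw n : measurable_fun setT (w n).
  apply: measurable_fun_ifT => //.
  by apply: measurableT_comp.
have wu n t : g - 1 <= t <= g + 1 -> w n t <= u n t.
  move=> tI; rewrite /w; case: ifPn => [etg|_]; last exact: u0.
  have v0 : 0 < `|t - g| by rewrite (lt_le_trans (e0 n)).
  have v1 : `|t - g| <= 1 by rewrite ler_norml; lra.
  rewrite ler0_norm ?ln_le0// /u.
  have : ln ((t - g) ^+ 2 + e n ^+ 2) <= ln (`|t - g| ^+ 2 * 2).
    rewrite ler_ln ?posrE// ?mulr_gt0 ?exprn_gt0//.
    rewrite mulr2n mulrDr mulr1 real_normK ?num_real// lerD2l.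
    by rewrite -[leRHS]real_normK ?num_real// lerXn2r// nnegrE// ltW.
  rewrite lnM ?posrE ?exprn_gt0// lnXn//.
  have := @ln_le_sub1 2 (ltr0n _ 2); lra.
have bound : (\int[mu]_(t in I) (`|ln `|t - g| |)%:E <= 4%:E)%E.
  have cw (t : R) : w n t @[n --> \oo] --> `|ln `|t - g| |.
    apply: cvg_near_cst; have [->|tg0] := eqVneq t g.
      by apply: nearW => n; rewrite /w subrr normr0 ln0// normr0 if_same.
    have tg1 : 0 < `|t - g| by rewrite normr_gt0 subr_eq0.
    exists (Num.truncn `|t - g|^-1) => // n /= kn; rewrite /w ifT// /e.
    rewrite invf_ple ?posrE//; apply/ltW/(lt_le_trans (truncnS_gt _)).
    by rewrite ler_nat ltnS.
  have nd t : {homo (fun n => (w n t)%:E) : m n / (m <= n)%N >-> (m <= n)%E}.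
    move=> m n mn; rewrite lee_fin /w; case: ifPn => [h|_].
      rewrite ifT// (le_trans _ h)// /e lef_pV2 ?posrE// ler_nat ltnS //.
    by case: ifP.
  have -> : (\int[mu]_(t in I) (`|ln `|t - g| |)%:E =
    \int[mu]_(t in I) limn (fun n => (w n t)%:E))%E.
    apply: eq_integral => t _; apply/esym/cvg_lim => //.
    by apply/fine_cvgP; split; [exact: nearW|exact: cw].
  have cv := @cvg_monotone_convergence _ _ _ mu I
    (measurable_itv _) (fun n t => (w n t)%:E) _ _ (fun t _ => nd t).
  rewrite -(cvg_lim _ (cv _ _))//; last 2 first.
  - by move=> n; apply/measurable_EFinP; exact: (measurable_funTS (mw n)).
  - by move=> n t _; rewrite lee_fin /w; case: ifP.
  apply: lime_le.
    apply/cvg_ex; eexists; apply: cv.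
    - by move=> n; apply/measurable_EFinP; exact: (measurable_funTS (mw n)).
    - by move=> n t _; rewrite lee_fin /w; case: ifP.
  apply: nearW => n; apply: le_trans (iu n). apply: ge0_le_integral;
    first [ exact: measurable_itv
          | by move=> t _; rewrite lee_fin /w; case: ifP
          | by apply/measurable_EFinP; exact: (measurable_funTS (mw n))
          | by apply/measurable_EFinP; apply: measurable_funTS;
               apply: continuous_measurable_fun => t; exact: cu
          | by move=> t; rewrite /I /= in_itv/= => h; rewrite lee_fin wu
          | by move=> t; rewrite /I /= in_itv/= => h; rewrite lee_fin u0 ].
apply/integrableP; split; first by apply/measurable_EFinP; exact: (measurable_funTS ml).
exact: le_lt_trans bound (ltry _).
Qed.

End LogIntegrable.

(** * Integrability of log |z - rho| and the limit of the Poisson kernel *)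

Section LogKernel.
Context {R : realType}.
Local Notation mu := (@lebesgue_measure R).
Implicit Types (x t : R) (rho : R[i]).

Lemma rint_cont (f : R -> R) a b : (forall x, a <= x <= b -> rcont f x) ->
  rint mu `[a, b] f.
Proof. exact: continuous_on_integrable. Qed.

Lemma cvg0_le (u v : nat -> R) : (forall n, `|u n| <= v n) ->
  v n @[n --> \oo] --> (0 : R) -> u n @[n --> \oo] --> (0 : R).
Proof.
move=> uv /cvgrPdist_le v0; apply/cvgrPdist_le => e e0.
apply: filterS (v0 e e0) => n; rewrite !sub0r !normrN => h.
by rewrite (le_trans (uv n))// (le_trans (ler_norm _)).
Qed.

Lemma rint_lnabs (A B g : R) : rint mu `[A, B] (fun t => ln `|t - g|).
Proof.
pose I : set R := `[g - 1, g + 1]%classic.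
have mI : measurable I by exact: measurable_itv.
have ml : measurable_fun setT (fun t : R => ln `|t - g|).
  apply: measurableT_comp; first exact: measurable_ln.
  by apply: measurableT_comp => //; exact: measurable_funB.
apply: (@rint_dom _ _ _ mu _ _
  (fun t => `|((fun t : R => ln `|t - g|) \_ I) t| + `|t - g|)) => //.
- exact: measurable_funTS.
- move=> t _; rewrite /patch; case: ifPn => [_|]; first by rewrite lerDl.
  rewrite notin_setE /I /= in_itv/= => /negP; rewrite negb_and -!ltNge => h.
  rewrite normr0 add0r; have h1 : 1 <= `|t - g|.
    by case/orP: h => h; [rewrite ler0_norm|rewrite ger0_norm]; lra.
  rewrite ger0_norm ?ln_ge0//; have := ln_le_sub1 (lt_le_trans ltr01 h1); lra.
- apply: rintD => //.
    have h := (rint_patch mu _ mI).1 (rint_ln1 g).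
    by apply: rint_norm; apply: rint_sub h => //.
  apply: rint_cont => t _; apply: rcont_norm.
  by apply: rcontB; [exact: cvg_id|exact: rcont_cst].
Qed.

(** The function log |z|, with the value 0 at [z = 0]. *)
Definition lnm (z : R[i]) : R := ln (cmod z).

(** The majorant depends on the height [t] alone, which reduces integrability on rectangles and on
    vertical lines to that of ln |t|. *)
Lemma lnm_bound rho x t M : t != complex.Im rho ->
  `|x - complex.Re rho| + `|t - complex.Im rho| <= M ->
  `|lnm ((x +i* t) - rho)| <= `|ln `|t - complex.Im rho| | + M.
Proof.
move=> tg hM; set v := t - _ in hM *; set z := _ - rho.
have v0 : 0 < `|v| by rewrite normr_gt0 subr_eq0.
have zv : `|v| <= cmod z.
  by have := Im_le_cmod z; rewrite /z cImB.
have zM : cmod z <= M.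
  by apply: le_trans hM; have := cmod_le z; rewrite /z cImB cReB.
have z0 : 0 < cmod z by apply: lt_le_trans zv.
have h1 : lnm z <= M by rewrite /lnm; have := ln_le_sub1 z0; lra.
have h2 : ln `|v| <= lnm z by rewrite /lnm ler_ln.
have M0 : 0 <= M by rewrite (le_trans _ zM)// cmod_ge0.
rewrite ler_norml; have := ler_norm (ln `|v|); have := ler_norm (- ln `|v|).
by rewrite normrN; lra.
Qed.

Lemma rcont_cmod_sub rho (z : R * R) :
  rcont (fun z : R * R => cmod ((z.1 +i* z.2) - rho)) z.
Proof.
apply: ccont_cmod; apply: ccontB; last exact: ccont_cst.
by apply: ccont_mk; [exact: cvg_fst|exact: cvg_snd].
Qed.

Lemma measurable_lnm rho (D : set (R * R)) : measurable D ->
  measurable_fun D (fun z : R * R => lnm ((z.1 +i* z.2) - rho)).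
Proof.
move=> mD; apply: (measurableT_comp (@measurable_ln R)).
by apply: cont2_measurable => // z _; exact: rcont_cmod_sub.
Qed.

Lemma measurable_lnm_line rho s (D : set R) : measurable D ->
  measurable_fun D (fun t => lnm ((s +i* t) - rho)).
Proof.
move=> mD; apply: (measurableT_comp (@measurable_ln R)).
apply: measurable_funTS; apply: continuous_measurable_fun => t.
exact: (rcont_sect2 (@rcont_cmod_sub rho (s, t))).
Qed.

Lemma mu2_null_snd s Y p q (g : R) :
  mu2 (rect s Y p q `&` [set z | z.2 - g = 0]) = 0%E.
Proof.
have -> : rect s Y p q `&` [set z | z.2 - g = 0] =
    `[s, Y] `*` (`[p, q] `&` [set g]).
  apply/seteqP; split=> -[x t].
    move=> [[h1 h2] /= h3]; split => //; split => //=.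
    by apply/eqP; rewrite -subr_eq0 h3.
  by move=> [h1 [h2 /= h3]]; split => //=; rewrite h3 subrr.
have m1 : measurable (`[p, q] `&` [set g]) by apply: measurableI.
rewrite mu2_setX//.
suff -> : mu (`[p, q] `&` [set g]) = 0%E by rewrite mule0.
apply/eqP; rewrite eq_le measure_ge0 andbT -(lebesgue_measure_set1 g).
apply: le_measure; [rewrite inE; exact: measurableI|rewrite inE; exact: measurable_set1|exact: subIsetr].
Qed.

Lemma mu_null_line p q (g : R) : mu (`[p, q] `&` [set t | t - g = 0]) = 0%E.
Proof.
have -> : `[p, q] `&` [set t | t - g = 0] = `[p, q] `&` [set g].
  apply/seteqP; split=> x /= [h1 h2]; split => //.
    by apply/eqP; rewrite -subr_eq0 h2.
  by rewrite h2 subrr.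
apply/eqP; rewrite eq_le measure_ge0 andbT -(lebesgue_measure_set1 g).
apply: le_measure; [rewrite inE; exact: measurableI|rewrite inE; exact: measurable_set1|exact: subIsetr].
Qed.

Lemma rint_lnm_rect rho s Y p q :
  rint mu2 (rect s Y p q) (fun z => lnm ((z.1 +i* z.2) - rho)).
Proof.
set g := complex.Im rho; set be := complex.Re rho.
have mR := measurable_rect s Y p q.
have mN : measurable (rect s Y p q `&` [set z | z.2 - g = 0]).
  apply: measurableI => //.
  have -> : [set z : R * R | z.2 - g = 0] = setT `&` (fun z : R * R => z.2 - g) @^-1` [set 0].
    by rewrite setTI.
  by apply: measurable_funB => //; exact: measurable_snd.
apply: (@rint_null _ _ _ mu2 _ _ _ mN) => //; first exact: mu2_null_snd.
  exact: measurable_lnm.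
pose M := `|s| + `|Y| + `|be| + (`|p| + `|q| + `|g|).
apply: (@rint_dom _ _ _ mu2 _ _ (fun z => `|ln `|z.2 - g| | + M)).
- exact: (measurableD mR mN).
- by apply: measurable_lnm; exact: (measurableD mR mN).
- move=> -[x t] [[/=]]; rewrite !in_itv/= => /andP[x1 x2] /andP[t1 t2] h.
  apply: lnm_bound.
    apply/eqP => tg; apply: h; split; last by rewrite /= tg subrr.
    by split; rewrite /= in_itv/= ?x1 ?t1.
  rewrite /M; apply: lerD.
    rewrite (le_trans (ler_normB _ _))// lerD2r ler_norml.
    by have := ler_norm Y; have := ler_norm (- s); rewrite normrN; have := normr_ge0 Y; have := normr_ge0 s; lra.
  rewrite (le_trans (ler_normB _ _))// lerD2r ler_norml.
  by have := ler_norm q; have := ler_norm (- p); rewrite normrN; have := normr_ge0 q; have := normr_ge0 p; lra.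
- apply: (@rint_sub _ _ _ mu2 _ (rect s Y p q)) => //.
  + exact: (measurableD mR mN).
  + apply: rintD => //.
      apply: (@rint_snd R s Y `[p, q] (fun t => `|ln `|t - g| |)) => //.
      by apply: rint_norm; exact: rint_lnabs.
    by apply: cont2_rint => z _; exact: rcont_cst.
Qed.

Lemma rint_lnm_line rho s p q : rint mu `[p, q] (fun t => lnm ((s +i* t) - rho)).
Proof.
set g := complex.Im rho; set be := complex.Re rho.
have mN : measurable (`[p, q] `&` [set t | t - g = 0]).
  apply: measurableI => //.
  have -> : [set t : R | t - g = 0] = setT `&` (fun t : R => t - g) @^-1` [set 0].
    by rewrite setTI.
  by apply: measurable_funB.
apply: (@rint_null _ _ _ mu _ _ _ mN) => //; first exact: mu_null_line.
  exact: measurable_lnm_line.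
pose M := `|s - be| + (`|p| + `|q| + `|g|).
have mD : measurable (`[p, q] `\` (`[p, q] `&` [set t | t - g = 0])) by exact: measurableD.
apply: (@rint_dom _ _ _ mu _ _ (fun t => `|ln `|t - g| | + M)) => //.
- exact: measurable_lnm_line.
- move=> t [/=]; rewrite !in_itv/= => /andP[t1 t2] h.
  apply: lnm_bound.
    apply/eqP => tg; apply: h; split; last by rewrite /= tg subrr.
    by rewrite t1.
  rewrite /M lerD2l (le_trans (ler_normB _ _))// lerD2r ler_norml.
  by have := ler_norm q; have := ler_norm (- p); rewrite normrN; have := normr_ge0 q; have := normr_ge0 p; lra.
- apply: (@rint_sub _ _ _ mu _ `[p, q]) => //.
  apply: rintD => //; first by apply: rint_norm; exact: rint_lnabs.
    by apply: rint_cont => z _; exact: rcont_cst.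
Qed.

(** The weights are given by formulas that do not vanish outside their rectangle. Evaluated at a
    clamped coordinate, they take there their boundary value 0, so a zero outside the rectangle gets
    weight 0 without a case distinction. *)
Definition clamp (a b x : R) := Num.max a (Num.min b x).

Lemma clamp_cases a b x : a <= b -> [\/ x <= a /\ clamp a b x = a,
  [/\ a <= x, x <= b & clamp a b x = x] | b <= x /\ clamp a b x = b].
Proof.
move=> ab; rewrite /clamp; have [bx|/ltW xb] := leP b x.
  by constructor 3; split => //; apply/max_idPr.
have [ax|/ltW xa] := leP a x; first by constructor 2.
by constructor 1.
Qed.

Lemma clampL a b x : x <= a -> clamp a b x = a.
Proof. by move=> h; apply/max_idPl; rewrite ge_min h orbT. Qed.
Lemma clampR a b x : a <= b -> b <= x -> clamp a b x = b.
Proof. by move=> ab h; rewrite /clamp (min_idPl h); apply/max_idPr. Qed.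
Lemma clampM a b x : a <= x -> x <= b -> clamp a b x = x.
Proof. by move=> ax h; rewrite /clamp (min_idPr h); apply/max_idPr. Qed.

Lemma clamp_itv a b x : a <= b -> a <= clamp a b x <= b.
Proof.
by move=> ab; case: (clamp_cases x ab) => [[h ->]|[h1 h2 ->]|[h ->]];
  rewrite ?lexx ?ab ?h1.
Qed.

Lemma clamp_lip a b x y : a <= b -> `|clamp a b x - clamp a b y| <= `|x - y|.
Proof.
move=> ab; rewrite ler_norml.
have := ler_norm (x - y); have := ler_norm (- (x - y)); rewrite normrN => h1 h2.
have h3 := normr_ge0 (x - y).
by case: (clamp_cases x ab) => [[? ->]|[? ? ->]|[? ->]];
  case: (clamp_cases y ab) => [[? ->]|[? ? ->]|[? ->]]; apply/andP; split; lra.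
Qed.

Lemma lip_clamp (f f1 : R -> R) p q : p <= q -> (forall x, rder f x (f1 x)) ->
  continuous f1 ->
  exists2 M, 0 <= M & forall u v, `|f (clamp p q u) - f (clamp p q v)| <= M * `|u - v|.
Proof.
move=> pq Df cf1.
have [K fK] : exists K, forall z, rect p q 0 0 z -> `|f1 z.1| <= K.
  apply: (@rect_bounded R p q 0 0 (fun z => f1 z.1)) => z _.
  by apply: rcont_comp; [exact: cf1|exact: cvg_fst].
have fK' x : p <= x <= q -> `|f1 x| <= K.
  by move=> h; apply: (fK (x, 0)); split; rewrite /= in_itv/= ?lexx.
have K0 : 0 <= K by apply: le_trans (normr_ge0 (f1 p)) _; apply: fK'; rewrite lexx.
exists K => // u v.
have W x y : p <= x -> x <= y -> y <= q -> `|f y - f x| <= K * `|y - x|.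
  move=> px xy yq; rewrite [`|y - x|]ger0_norm ?subr_ge0//.
  apply: (MVT_bound xy) => z /andP[h1 h2]; first exact: Df.
  by apply: fK'; rewrite (le_trans px h1) (le_trans h2 yq).
apply: (@le_trans _ _ (K * `|clamp p q u - clamp p q v|)).
  have /andP[u1 u2] := clamp_itv u pq; have /andP[v1 v2] := clamp_itv v pq.
  have [h|/ltW h] := leP (clamp p q v) (clamp p q u); first exact: W.
  by rewrite distrC [`|clamp p q u - _|]distrC; exact: W.
by rewrite ler_wpM2l// clamp_lip.
Qed.

Lemma cvg_atan_scale (w : R) :
  atan (w * n.+1%:R) @[n --> \oo] --> Num.sg w * (pi / 2).
Proof.
have P (y : R) : 0 < y -> atan (y * n.+1%:R) @[n --> \oo] --> pi / 2.
  move=> y0; have cy : y * n.+1%:R @[n --> \oo] --> +oo.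
    apply/cvgryPge => A; exists (Num.truncn (A / y)) => // n /= An.
    rewrite mulrC -ler_pdivrMr//; apply/ltW/(lt_le_trans (truncnS_gt _)).
    by rewrite ler_nat ltnS.
  exact: (cvg_comp _ _ cy (@cvgy_atan R)).
have [w0|w0|->] := ltrgt0P w.
- by rewrite gtr0_sg// mul1r; exact: P.
- rewrite ltr0_sg// mulN1r.
  have E n : atan (w * n.+1%:R) = - atan (- w * n.+1%:R).
    by rewrite mulNr atanN opprK.
  under eq_fun do rewrite E.
  by apply: cvgN; apply: P; rewrite oppr_gt0.
- under eq_fun do rewrite mul0r atan0.
  by rewrite sgr0 mul0r; exact: cvg_cst.
Qed.

Lemma mitv (i : interval R) : measurable ([set` i] : set (measurableTypeR R)).
Proof. exact: measurable_itv. Qed.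

Lemma rint_oc (f : R -> R) c d : rint mu `[c, d] f -> rint mu `]c, d] f.
Proof.
move=> h; apply: (@rint_sub _ _ _ mu _ `[c, d]%classic) => //.
exact: subset_itv_oc_cc.
Qed.

Lemma rint_co (f : R -> R) c d : rint mu `[c, d] f -> rint mu `[c, d[ f.
Proof.
move=> h; apply: (@rint_sub _ _ _ mu _ `[c, d]%classic) => //.
exact: subset_itv_co_cc.
Qed.

Section Poisson.
Variables (a a1 : R -> R) (s Y be : R).
Hypothesis sY : s <= Y.
Hypothesis Da : forall x, rder a x (a1 x).
Hypothesis ca1 : continuous a1.
Hypothesis as0 : a s = 0.
Hypothesis aY : a Y = 0.

Let ia1 c d : rint mu `[c, d] a1.
Proof. by apply: rint_cont => x _; exact: ca1. Qed.

Let msg : measurable_fun setT (fun x => Num.sg (x - be)).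
Proof.
have -> : (fun x => Num.sg (x - be)) =
    (fun x => if be < x then 1 else if x < be then -1 else 0).
  apply/funext => x; have [h|h|->] := ltgtP be x.
  - by rewrite gtr0_sg// subr_gt0.
  - by rewrite ltr0_sg// subr_lt0.
  - by rewrite subrr sgr0.
apply: measurable_fun_ifT => //; first exact: measurable_fun_ltr.
by apply: measurable_fun_ifT => //; exact: measurable_fun_ltr.
Qed.

Let isg c d : rint mu `[c, d] (fun x => a1 x * Num.sg (x - be)).
Proof.
apply: (@rint_dom _ _ _ mu _ _ (fun x => `|a1 x|)) => //.
- apply: measurable_funM; first by have := rint_meas (ia1 c d).
  exact: measurable_funTS.
- move=> x _; rewrite normrM ler_piMr//.
  by rewrite normr_sg; case: (_ != _).
- by apply: rint_norm; exact: ia1.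
Qed.

Let FTCa c d : c <= d -> \int[mu]_(x in `[c, d]) a1 x = a d - a c.
Proof. by move=> cd; apply: FTC => // x _; exact: ca1. Qed.

Let sgR c d : c <= d -> be <= c ->
  \int[mu]_(x in `[c, d]) (a1 x * Num.sg (x - be)) = a d - a c.
Proof.
move=> cd bc; rewrite -FTCa// -(Rintegral_itv_obnd_cbnd (rint_oc (isg c d))).
rewrite -(Rintegral_itv_obnd_cbnd (rint_oc (ia1 c d))).
apply: eq_Rintegral => x; rewrite inE/= in_itv/= => /andP[cx _].
by rewrite gtr0_sg ?mulr1// subr_gt0 (le_lt_trans bc).
Qed.

Let sgL c d : c <= d -> d <= be ->
  \int[mu]_(x in `[c, d]) (a1 x * Num.sg (x - be)) = - (a d - a c).
Proof.
move=> cd bc; rewrite -FTCa// -(RintegralN (mitv _) (ia1 c d)).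
rewrite -(Rintegral_itv_bndo_bndc (rint_co (isg c d))).
rewrite -(Rintegral_itv_bndo_bndc (rint_co (rintN (mitv _) (ia1 c d)))).
apply: eq_Rintegral => x; rewrite inE/= in_itv/= => /andP[_ xd].
by rewrite ltr0_sg ?mulrN1// subr_lt0 (lt_le_trans xd).
Qed.

Let sg_clamp : \int[mu]_(x in `[s, Y]) (a1 x * Num.sg (x - be)) =
  - 2 * a (clamp s Y be).
Proof.
have [h|h] := leP be s.
  by rewrite (clampL _ h) sgR// as0 aY subrr mulr0.
have [h'|h'] := leP Y be.
  by rewrite (clampR sY h') sgL// as0 aY subrr oppr0 mulr0.
rewrite (clampM (ltW h) (ltW h')).
have := @Rintegral_itvB R (fun x => a1 x * Num.sg (x - be)) (BLeft s) (BRight Y) be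
  (isg s Y).
rewrite !bnd_simp (ltW h) (ltW h') => /(_ isT isT).
rewrite (Rintegral_itv_obnd_cbnd (rint_oc (isg be Y))).
rewrite (sgR (ltW h') (lexx _)) (sgL (ltW h) (lexx _)) as0 aY => E.
by move: E => /eqP; rewrite subr_eq => /eqP ->; ring.
Qed.

(** The kernel [e / ((x - be)^2 + e^2)] tends to pi times the Dirac mass at [be]. Integration by
    parts replaces it by [atan ((x - be) / e)], which is bounded and tends to [pi / 2] times the
    sign of [x - be]; dominated convergence then applies. *)
Lemma poisson_limit :
  \int[mu]_(x in `[s, Y]) (a x * (n.+1%:R^-1 / ((x - be) ^+ 2 + n.+1%:R^-1 ^+ 2)))
    @[n --> \oo] --> pi * a (clamp s Y be).
Proof.
pose e n : R := n.+1%:R^-1.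
have e0 n : 0 < e n by rewrite invr_gt0.
have w0 n x : 0 < (x - be) ^+ 2 + e n ^+ 2 by rewrite ltr_wpDl ?sqr_ge0// exprn_gt0.
have cat n x : rcont (fun x => atan ((x - be) * n.+1%:R)) x.
  apply: rcont_atan; apply: rcontM; last exact: rcont_cst.
  by apply: rcontB; [exact: cvg_id|exact: rcont_cst].
have cA x : rcont a x by exact: rder_continuous (Da x).
have ck n x : rcont (fun x => a x * (e n / ((x - be) ^+ 2 + e n ^+ 2))) x.
  apply: rcontM => //; apply: rcontM; first exact: rcont_cst.
  apply: rcontV; first exact: lt0r_neq0.
  apply: rcontD; last exact: rcont_cst.
  by apply: rcontX; apply: rcontB; [exact: cvg_id|exact: rcont_cst].
have i1 n : rint mu `[s, Y] (fun x => a1 x * atan ((x - be) * n.+1%:R)).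
  by apply: rint_cont => x _; apply: rcontM; [exact: ca1|exact: cat].
have i2 n : rint mu `[s, Y] (fun x => a x * (e n / ((x - be) ^+ 2 + e n ^+ 2))).
  by apply: rint_cont => x _; exact: ck.
have E n : \int[mu]_(x in `[s, Y]) (a x * (e n / ((x - be) ^+ 2 + e n ^+ 2))) =
    - \int[mu]_(x in `[s, Y]) (a1 x * atan ((x - be) * n.+1%:R)).
  apply/eqP; rewrite -addr_eq0 addrC -(RintegralD (mitv _) (i1 n) (i2 n)); apply/eqP.
  rewrite (@FTC _ _ (fun x => a x * atan ((x - be) * n.+1%:R)))//.
  - by rewrite as0 aY !mul0r subrr.
  - move=> x _; apply: rder_eq.
      apply: rderM; first exact: Da.
      apply: rder_atan; apply: rderM; last exact: rder_cst.
      by apply: rderB; [exact: rder_id|exact: rder_cst].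
    congr (_ + _ * _) => /=; rewrite subr0 mulr0 addr0 mul1r.
    have h := lt0r_neq0 (w0 n x); have m0 := lt0r_neq0 (e0 n).
    have -> : n.+1%:R = (e n)^-1 by rewrite invrK.
    have h' : 1 + ((x - be) / e n) ^+ 2 != 0 by rewrite gt_eqF// ltr_wpDr ?sqr_ge0.
    move: h m0 h'; generalize (e n) => m h m0 h'.
    have -> : 1 + ((x - be) / m) ^+ 2 = ((x - be) ^+ 2 + m ^+ 2) / m ^+ 2 by field.
    by field; rewrite h m0.
  - move=> x _; have h : rcont (fun x => a1 x * atan ((x - be) * n.+1%:R) +
        a x * (e n / ((x - be) ^+ 2 + e n ^+ 2))) x.
      by apply: rcontD; [apply: rcontM; [exact: ca1|exact: cat]|exact: ck].
    exact: h.
under eq_fun do rewrite E.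
have -> : pi * a (clamp s Y be) = - \int[mu]_(x in `[s, Y])
    (a1 x * (Num.sg (x - be) * (pi / 2))).
  under eq_Rintegral do rewrite mulrA.
  by rewrite (RintegralZr _ (mitv _) (isg s Y)) sg_clamp; field.
apply: cvgN; apply: (@Rdct _ _ _ mu _ _ _ (fun x => `|a1 x| * 2)) => //.
- by move=> n; have := rint_meas (i1 n).
- by move=> x _; apply: cvgM; [exact: cvg_cst|exact: cvg_atan_scale].
- move=> n x _; rewrite normrM ler_wpM2l// ler_norml.
  have := atan_gtNpi2 ((x - be) * n.+1%:R); have := atan_ltpi2 ((x - be) * n.+1%:R).
  by have := @pihalf_lt2 R; lra.
- have := rintZ 2 (mitv `[s, Y]) (rint_norm (ia1 s Y)).
  by congr rint; apply/funext => x; rewrite mulrC.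
Qed.

End Poisson.
End LogKernel.

(** * Green's formula for log |z - rho| *)

Section LogFactor.
Context {R : realType}.
Local Notation mu := (@lebesgue_measure R).

Lemma mrect (s Y u v : R) :
  measurable (rect s Y u v : set (measurableTypeR R * measurableTypeR R)).
Proof. exact: measurable_rect. Qed.

Implicit Types (x t : R) (rho : R[i]).

Definition idF rho : nat -> R[i] -> R[i] := mulXsub rho (fun k _ => (k == 0%N)%:R).

Lemma hol_one : hol (fun k (_ : R[i]) => (k == 0%N)%:R : R[i]).
Proof.
move=> k M; exists 1; split => //.
- by move=> s _; case: (k == 0%N); rewrite ?cmod1 ?cmod0.
- move=> s h _ _; rewrite subrr mulr0 subr0 cmod0 mul1r; exact: sqr_ge0.
Qed.

Lemma hol_idF rho : hol (idF rho).
Proof. exact: hol_mulXsub hol_one. Qed.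

Lemma idF0 rho z : idF rho 0%N z = z - rho.
Proof. by rewrite /idF /mulXsub/= mulr1 mul0r addr0. Qed.

Lemma idF1 rho z : idF rho 1%N z = 1.
Proof. by rewrite /idF /mulXsub/= mulr0 add0r mulr1. Qed.

Lemma lw_idF rho x t :
  lw (idF rho) 0 x t = (x - complex.Re rho) ^+ 2 + (t - complex.Im rho) ^+ 2.
Proof. by rewrite /lw idF0 sqr_cmod addr0 cReB cImB. Qed.

Lemma lh_idF rho x t : lh (idF rho) 0 x t = lnm ((x +i* t) - rho).
Proof.
by rewrite /lh /lw idF0 addr0 ln_sqr_abs ger0_norm ?cmod_ge0// mulrA mulVf// mul1r.
Qed.

Lemma lnm_sqr rho x t : lnm ((x +i* t) - rho) =
  2^-1 * ln ((x - complex.Re rho) ^+ 2 + (t - complex.Im rho) ^+ 2).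
Proof. by rewrite -lh_idF /lh lw_idF. Qed.

Lemma lht_idF rho x t : lht (idF rho) 0 x t =
  (t - complex.Im rho) / ((x - complex.Re rho) ^+ 2 + (t - complex.Im rho) ^+ 2).
Proof.
rewrite /lht lw_idF !idF0 !idF1 /=; congr (_ / _).
by rewrite cImB/= mulr1 mulr0 subr0.
Qed.

Variables (a a1 a2 b b1 b2 : R -> R).
Hypothesis Da : forall x, rder a x (a1 x).
Hypothesis Da1 : forall x, rder a1 x (a2 x).
Hypothesis ca2 : continuous a2.
Hypothesis Db : forall x, rder b x (b1 x).
Hypothesis Db1 : forall x, rder b1 x (b2 x).
Hypothesis cb2 : continuous b2.
Variables (s Y p q : R) (rho : R[i]).
Hypothesis sY : s <= Y.
Hypothesis pq : p <= q.
Hypothesis as0 : a s = 0.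
Hypothesis aY : a Y = 0.
Hypothesis a1Y : a1 Y = 0.
Hypothesis bp : b p = 0.
Hypothesis bq : b q = 0.
Hypothesis b1p : b1 p = 0.
Hypothesis b1q : b1 q = 0.

Let be := complex.Re rho.
Let g := complex.Im rho.
Let f (z : R * R) := lnm ((z.1 +i* z.2) - rho) * (a2 z.1 * b z.2 + a z.1 * b2 z.2).
Let l t := b t * lnm ((s +i* t) - rho).
Let H e := \int[mu]_(x in `[s, Y]) (a x * (2^-1 * ln ((x - be) ^+ 2 + e ^+ 2))).
Let K e := \int[mu]_(x in `[s, Y]) (a x * (e / ((x - be) ^+ 2 + e ^+ 2))).

Let cA x : rcont a x. Proof. exact: rder_continuous (Da x). Qed.
Let w0 e x : 0 < e -> 0 < (x - be) ^+ 2 + e ^+ 2.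
Proof. by move=> e0; rewrite ltr_wpDl ?sqr_ge0// exprn_gt0. Qed.
Let cw e x : rcont (fun x => (x - be) ^+ 2 + e ^+ 2) x.
Proof.
apply: rcontD; last exact: rcont_cst.
by apply: rcontX; apply: rcontB; [exact: cvg_id|exact: rcont_cst].
Qed.
Let iH e : 0 < e -> rint mu `[s, Y] (fun x => a x * (2^-1 * ln ((x - be) ^+ 2 + e ^+ 2))).
Proof.
move=> e0; apply: rint_cont => x _; apply: rcontM => //.
by apply: rcontM; [exact: rcont_cst|apply: rcont_ln; [exact: w0|exact: cw]].
Qed.
Let iK e : 0 < e -> rint mu `[s, Y] (fun x => a x * (e / ((x - be) ^+ 2 + e ^+ 2))).
Proof.
move=> e0; apply: rint_cont => x _; apply: rcontM => //.
apply: rcontM; first exact: rcont_cst.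
by apply: rcontV; [apply: lt0r_neq0; exact: w0|exact: cw].
Qed.

Let empty_rect u v : v < u -> rect s Y u v = set0.
Proof. by move=> uv; rewrite /rect (@set_itv_ge _ _ (BLeft u)) ?setX0// bnd_simp -ltNge. Qed.

Let green0 u v : p <= u -> u <= v -> v <= q -> (forall t, u <= t <= v -> t != g) ->
  \int[mu2]_(z in rect s Y u v) f z + a1 s * \int[mu]_(t in `[u, v]) l t =
  \int[mu]_(x in `[s, Y]) (a x * (2^-1 * ln ((x - be) ^+ 2 + (v - g) ^+ 2) * b1 v -
    (v - g) / ((x - be) ^+ 2 + (v - g) ^+ 2) * b v)) -
  \int[mu]_(x in `[s, Y]) (a x * (2^-1 * ln ((x - be) ^+ 2 + (u - g) ^+ 2) * b1 u -
    (u - g) / ((x - be) ^+ 2 + (u - g) ^+ 2) * b u)).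
Proof.
move=> pu uv vq ug.
have w1 z : rect s Y u v z -> 0 < lw (idF rho) 0 z.1 z.2.
  move=> [_ /=]; rewrite in_itv/= => /ug tg; rewrite lw_idF.
  by rewrite ltr_wpDl ?sqr_ge0// exprn_even_gt0//= subr_eq0.
have := green (hol_idF rho) Da Da1 ca2 Db Db1 cb2 sY uv w1 as0 aY a1Y.
have -> : \int[mu2]_(z in rect s Y u v) (a z.1 * b z.2 * llap (idF rho) 0 z.1 z.2) = 0.
  under eq_Rintegral do rewrite /llap !(mulr0, mul0r).
  by rewrite Rintegral_cst ?mul0r//; exact: measurable_rect.
rewrite add0r => E; transitivity (\int[mu2]_(z in rect s Y u v)
  (lh (idF rho) 0 z.1 z.2 * (a2 z.1 * b z.2 + a z.1 * b2 z.2)) +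
  a1 s * \int[mu]_(t in `[u, v]) (b t * lh (idF rho) 0 s t)).
  by congr (_ + _ * _); apply: eq_Rintegral => z _; rewrite lh_idF.
by rewrite E; congr (_ - _); apply: eq_Rintegral => x _; rewrite lh_idF lht_idF lnm_sqr.
Qed.

Let zero_end c d u : b u = 0 -> b1 u = 0 ->
  \int[mu]_(x in `[s, Y]) (a x * (c x * b1 u - d x * b u)) = 0.
Proof.
move=> -> ->; under eq_Rintegral do rewrite !mulr0 subrr mulr0.
by rewrite Rintegral_cst ?mul0r//; exact: measurable_itv.
Qed.

(** Below the cut, [b] and [b1] survive only on the side at height [g - e]; clamping covers the
    cases in which this height lies outside the window. *)
Let low e : 0 < e ->
  \int[mu2]_(z in rect s Y p (Num.min q (g - e))) f z +
  a1 s * \int[mu]_(t in `[p, Num.min q (g - e)]) l t =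
  b1 (clamp p q (g - e)) * H e + b (clamp p q (g - e)) * K e.
Proof.
move=> e0; have [h|h] := ltP (g - e) p.
  rewrite (clampL _ (ltW h)) bp b1p !mul0r addr0.
  have h' : Num.min q (g - e) < p by rewrite gt_min h orbT.
  rewrite empty_rect// Rintegral_set0 set_itv_ge ?Rintegral_set0 ?mulr0 ?addr0//.
  by rewrite bnd_simp -ltNge.
have pm : p <= Num.min q (g - e) by rewrite le_min pq h.
rewrite green0//; last 2 first.
- by rewrite ge_min lexx.
- by move=> t /andP[_]; rewrite le_min => /andP[_ h1]; rewrite lt_eqF//; lra.
rewrite [X in _ - X]zero_end// subr0.
have [h1|/ltW h1] := leP q (g - e).
  rewrite zero_end// clampR// bq b1q; ring.
rewrite (clampM h h1).
rewrite -(RintegralZl _ (mitv _) (iH e0)) -(RintegralZl _ (mitv _) (iK e0)).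
rewrite -(RintegralD (mitv _) (rintZ _ (mitv _) (iH e0)) (rintZ _ (mitv _) (iK e0))).
apply: eq_Rintegral => x _.
have -> : g - e - g = - e by ring.
by rewrite sqrrN; ring.
Qed.

Let up e : 0 < e ->
  \int[mu2]_(z in rect s Y (Num.max p (g + e)) q) f z +
  a1 s * \int[mu]_(t in `[Num.max p (g + e), q]) l t =
  - (b1 (clamp p q (g + e)) * H e) + b (clamp p q (g + e)) * K e.
Proof.
move=> e0; have [h|h] := ltP q (g + e).
  rewrite (clampR pq (ltW h)) bq b1q !mul0r oppr0 addr0.
  have h' : q < Num.max p (g + e) by rewrite lt_max h orbT.
  rewrite empty_rect// Rintegral_set0 set_itv_ge ?Rintegral_set0 ?mulr0 ?addr0//.
  by rewrite bnd_simp -ltNge.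
have pm : Num.max p (g + e) <= q by rewrite ge_max pq h.
rewrite green0//; last 2 first.
- by rewrite le_max lexx.
- by move=> t /andP[+ _]; rewrite ge_max => /andP[_ h1]; rewrite gt_eqF//; lra.
rewrite [X in X - _]zero_end// sub0r.
have [h1|/ltW h1] := leP (g + e) p.
  rewrite zero_end// clampL// bp b1p; ring.
rewrite (clampM h1 h).
rewrite -(RintegralZl _ (mitv _) (iH e0)) -(RintegralZl _ (mitv _) (iK e0)).
rewrite -(RintegralN (mitv _) (rintZ _ (mitv _) (iH e0))).
rewrite -(RintegralD (mitv _) (rintN (mitv _) (rintZ _ (mitv _) (iH e0))) (rintZ _ (mitv _) (iK e0))).
have iD : rint mu `[s, Y] (fun x => a x *
  (2^-1 * ln ((x - be) ^+ 2 + (g + e - g) ^+ 2) * b1 (g + e) -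
   (g + e - g) / ((x - be) ^+ 2 + (g + e - g) ^+ 2) * b (g + e))).
  have -> : g + e - g = e by ring.
  have := rintB (mitv _) (rintZ (b1 (g + e)) (mitv _) (iH e0)) (rintZ (b (g + e)) (mitv _) (iK e0)).
  by congr rint; apply/funext => x; ring.
rewrite -(RintegralN (mitv _) iD); apply: eq_Rintegral => x _.
have -> : g + e - g = e by ring.
by ring.
Qed.

Let cf z : rcont (fun z : R * R => a2 z.1 * b z.2 + a z.1 * b2 z.2) z.
Proof.
apply: rcontD; apply: rcontM.
- by apply: rcont_comp; [exact: ca2|exact: cvg_fst].
- by apply: rcont_comp; [exact: rder_continuous (Db _)|exact: cvg_snd].
- by apply: rcont_comp; [exact: rder_continuous (Da _)|exact: cvg_fst].
- by apply: rcont_comp; [exact: cb2|exact: cvg_snd].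
Qed.

Lemma rint_lnm_mul c d (phi : R * R -> R) : (forall z, rcont phi z) ->
  rint mu2 (rect s Y c d) (fun z => lnm ((z.1 +i* z.2) - rho) * phi z).
Proof.
move=> cphi.
have [M fM] := @rect_bounded R s Y c d phi (fun z _ => cphi z).
have mR := measurable_rect s Y c d.
apply: (@rint_dom _ _ _ mu2 _ _ (fun z => `|M| * `|lnm ((z.1 +i* z.2) - rho)|)) => //.
- apply: measurable_funM; first exact: measurable_lnm.
  by apply: cont2_measurable => // z _; exact: cphi.
- move=> z rz; rewrite normrM mulrC; apply: ler_wpM2r => //.
  exact: le_trans (fM _ rz) (ler_norm _).
- exact: (@rintZ _ _ _ mu2 _ _ _ mR (rint_norm (rint_lnm_rect rho s Y c d))).
Qed.

Lemma rint_lnm_line_mul c d (phi : R -> R) : (forall t, rcont phi t) ->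
  rint mu `[c, d] (fun t => phi t * lnm ((s +i* t) - rho)).
Proof.
move=> cphi.
have [M fM] := @rect_bounded R c d 0 0 (fun z => phi z.1)
  (fun z _ => rcont_comp (cphi z.1) (@cvg_fst _ _ _ _ _)).
apply: (@rint_dom _ _ _ mu _ _ (fun t => `|M| * `|lnm ((s +i* t) - rho)|)) => //.
- apply: measurable_funM; last exact: measurable_lnm_line.
  by apply: measurable_funTS; apply: continuous_measurable_fun => t; exact: cphi.
- move=> t rz; rewrite normrM; apply: ler_wpM2r => //.
  apply: le_trans (fM (t, 0) _) (ler_norm _).
  by split => //; rewrite /= in_itv/= lexx.
- exact: (@rintZ _ _ _ mu _ _ _ (mitv _) (rint_norm (rint_lnm_line rho s c d))).
Qed.

Let cutE e : 0 < e ->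
  \int[mu2]_(z in rect s Y p q `&` [set z | e <= `|z.2 - g|]) f z +
  a1 s * \int[mu]_(t in `[p, q] `&` [set t | e <= `|t - g|]) l t =
  (b1 (clamp p q (g - e)) - b1 (clamp p q (g + e))) * H e +
  (b (clamp p q (g - e)) + b (clamp p q (g + e))) * K e.
Proof.
move=> e0.
have E1 : `[p, q] `&` [set t | e <= `|t - g|] =
    `[p, Num.min q (g - e)] `|` `[Num.max p (g + e), q].
  apply/seteqP; split=> t /=; rewrite !in_itv/= le_min ge_max.
    move=> [/andP[t1 t2]]; rewrite ler_normr => /orP[h|h].
      by right; rewrite t1 t2 andbT; lra.
    by left; rewrite t1 t2 /=; lra.
  case=> [/andP[t1 /andP[t2 t3]]|/andP[/andP[t1 t2] t3]].
    split; first by rewrite t1 t2.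
    by rewrite ler_normr; apply/orP; right; lra.
  split; first by rewrite t1 t3.
  by rewrite ler_normr; apply/orP; left; lra.
have E2 : rect s Y p q `&` [set z | e <= `|z.2 - g|] =
    rect s Y p (Num.min q (g - e)) `|` rect s Y (Num.max p (g + e)) q.
  have E t : (`[p, q]%classic t /\ e <= `|t - g|) <->
      (`[p, Num.min q (g - e)]%classic t \/ `[Num.max p (g + e), q]%classic t).
    have := E1; rewrite predeqE => /(_ t); exact.
  apply/seteqP; split=> -[x t].
    by move=> [[h1 h2] h3]; case: ((E t).1 (conj h2 h3)) => h4; [left|right].
  move=> [[h1 h2]|[h1 h2]].
    by have [h3 h4] := (E t).2 (or_introl h2); split.
  by have [h3 h4] := (E t).2 (or_intror h2); split.
have if_ : rint mu2 (rect s Y p q) f by exact: rint_lnm_mul.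
have il : rint mu `[p, q] l.
  by apply: rint_lnm_line_mul => t; exact: rder_continuous (Db t).
have mR u v := mrect s Y u v.
have D1 : [disjoint `[p, Num.min q (g - e)]%classic & `[Num.max p (g + e), q]%classic].
  apply/disj_setPS => t [/=]; rewrite !in_itv/= le_min ge_max.
  by move=> /andP[_ /andP[_ h1]] /andP[/andP[_ h2] _]; lra.
have D2 : [disjoint rect s Y p (Num.min q (g - e)) & rect s Y (Num.max p (g + e)) q].
  apply/disj_setPS => -[x t] [[_ h1] [_ h2]].
  by move/disj_setPS : D1 => /(_ t (conj h1 h2)).
rewrite E2 (Rintegral_setU (mR _ _) (mR _ _) _ D2); last first.
  apply: (rint_sub (mR p q) _ _ if_); first exact: measurableU.
  by rewrite -E2; exact: subIsetl.
rewrite E1 (Rintegral_setU (mitv _) (mitv _) _ D1); last first.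
  apply: (rint_sub (mitv _) _ _ il); first exact: measurableU.
  by rewrite -E1; exact: subIsetl.
have := low e0; have := up e0.
by rewrite mulrDr => h1 h2; rewrite addrACA h1 h2; ring.
Qed.

Let H_bound : exists2 C, 0 <= C & forall e, 0 < e -> e <= 1 -> `|H e| <= C * (1 - ln e).
Proof.
pose M := (`|s - be| + `|Y - be|) ^+ 2 + 1.
have M1 : 1 <= M by rewrite lerDr sqr_ge0.
have iA : rint mu `[s, Y] (fun x => `|a x|).
  by apply: rint_cont => x _; apply: rcont_norm.
exists (M * \int[mu]_(x in `[s, Y]) `|a x|).
  by rewrite mulr_ge0 ?Rintegral_ge0//; lra.
move=> e e0 e1; have le0 : ln e <= 0 by exact: ln_le0.
rewrite mulrAC -(RintegralZl _ (mitv _) iA).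
apply: (Rintegral_bound (mitv _) (iH e0)); first exact: rintZ.
move=> x; rewrite /= in_itv/= => /andP[x1 x2]; rewrite normrM mulrC ler_wpM2r//.
have W := w0 x e0.
have h1 : ln ((x - be) ^+ 2 + e ^+ 2) <= M.
  apply: (le_trans (ln_le_sub1 W)); rewrite /M lerBlDr -addrA.
  have : (x - be) ^+ 2 <= (`|s - be| + `|Y - be|) ^+ 2.
    rewrite -[leLHS]real_normK ?num_real// lerXn2r// ?nnegrE ?addr_ge0// ler_norml.
    have := ler_norm (Y - be); have := ler_norm (- (s - be)); rewrite normrN.
    have := normr_ge0 (Y - be); have := normr_ge0 (s - be) => *; apply/andP; split; lra.
  have : e ^+ 2 <= 1 by rewrite exprn_ile1// ltW.
  lra.
have h2 : 2 * ln e <= ln ((x - be) ^+ 2 + e ^+ 2).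
  have -> : 2 * ln e = ln (e ^+ 2) by rewrite ln_sqr_abs gtr0_norm.
  by rewrite ler_ln ?posrE// ?exprn_gt0// lerDr sqr_ge0.
have h3 : - (M * ln e) >= - ln e by rewrite lerN2 -[leRHS]mul1r ler_wnM2r.
rewrite ler_norml mulrBr mulr1; apply/andP; split; last lra.
by nra.
Qed.

(** A strip of half-height [e] about the height of [rho] is cut out; on the two remaining parts the
    logarithm is harmonic. On the sides of the cut, the terms with [b1] form a difference O(e) times
    [H e], which is O(1 - ln e), and vanish in the limit. Those with [b] add up: both sides carry
    the Poisson integral [K e], which tends to pi times the value of [a], and this gives the factor
    2 pi. *)
Theorem log_factor :
  \int[mu2]_(z in rect s Y p q) f z + a1 s * \int[mu]_(t in `[p, q]) l t =
  2 * pi * (a (clamp s Y be) * b (clamp p q g)).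
Proof.
pose e n : R := n.+1%:R^-1.
have e0 n : 0 < e n by rewrite invr_gt0.
have e1 n : e n <= 1 by rewrite invf_le1// ler1n.
have if_ : rint mu2 (rect s Y p q) f by exact: rint_lnm_mul.
have il : rint mu `[p, q] l.
  by apply: rint_lnm_line_mul => t; exact: rder_continuous (Db t).
have mv1 : measurable_fun setT (fun z : measurableTypeR R * measurableTypeR R => z.2 - g : R).
  by apply: measurable_funB => //; exact: measurable_snd.
have mv2 : measurable_fun setT (fun t : measurableTypeR R => t - g : R).
  exact: measurable_funB.
have cv1 := Rintegral_cut (mrect s Y p q) if_ mv1 (mu2_null_snd _ _ _ _ _).
have cv2 := Rintegral_cut (mitv _) il mv2 (mu_null_line _ _ _).
have L : (\int[mu2]_(z in rect s Y p q `&` [set z | e n <= `|z.2 - g|]) f z +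
  a1 s * \int[mu]_(t in `[p, q] `&` [set t | e n <= `|t - g|]) l t) @[n --> \oo] -->
  \int[mu2]_(z in rect s Y p q) f z + a1 s * \int[mu]_(t in `[p, q]) l t.
  by apply: cvgD; [exact: cv1|apply: cvgM; [exact: cvg_cst|exact: cv2]].
have ca1 : continuous a1 by move=> x; exact: rder_continuous (Da1 x).
have cb1 : continuous b1 by move=> x; exact: rder_continuous (Db1 x).
have ce : e n @[n --> \oo] --> (0 : R) by exact: cvg_harmonic.
have [M M0 Mb] := lip_clamp pq Db cb1.
have [M' M'0 Mb1] := lip_clamp pq Db1 cb2.
have [C C0 HC] := H_bound.
have kK : K (e n) @[n --> \oo] --> pi * a (clamp s Y be).
  exact: (@poisson_limit _ a a1 s Y be sY Da ca1 as0 aY).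
have lim_b (sg : bool) : b (clamp p q (if sg then g - e n else g + e n)) @[n --> \oo] -->
    b (clamp p q g).
  have -> : b (clamp p q g) = 0 + b (clamp p q g) by rewrite add0r.
  have E n : b (clamp p q (if sg then g - e n else g + e n)) =
     (b (clamp p q (if sg then g - e n else g + e n)) - b (clamp p q g)) + b (clamp p q g).
    by rewrite subrK.
  under eq_fun do rewrite E.
  apply: cvgD; last exact: cvg_cst.
  apply: (@cvg0_le _ _ (fun n => M * e n)).
    move=> n; apply: (le_trans (Mb _ _)); rewrite ler_wpM2l//.
    by case: sg {E}; [have -> : g - e n - g = - e n by ring|have -> : g + e n - g = e n by ring]; rewrite ?normrN gtr0_norm.
  by rewrite -(mulr0 M); apply: cvgM => //; exact: cvg_cst.
have T2 : (b1 (clamp p q (g - e n)) - b1 (clamp p q (g + e n))) * H (e n) @[n --> \oo]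
    --> (0 : R).
  (* The majorant rests on [e (1 - ln e) <= 3 sqrt e], obtained from [ln x <= x - 1] at
     [x = 1 / sqrt e]. *)
  apply: (@cvg0_le _ _ (fun n => M' * 2 * C * 3 * Num.sqrt (e n))).
    move=> n; rewrite normrM.
    have h1 : `|b1 (clamp p q (g - e n)) - b1 (clamp p q (g + e n))| <= M' * (2 * e n).
      apply: (le_trans (Mb1 _ _)); rewrite ler_wpM2l//.
      have -> : g - e n - (g + e n) = - (2 * e n) by ring.
      by rewrite normrN ger0_norm// mulr_ge0// ltW.
    have h2 := HC _ (e0 n) (e1 n).
    apply: (@le_trans _ _ ((M' * (2 * e n)) * (C * (1 - ln (e n))))).
      by apply: ler_pM.
    have s0 : 0 < Num.sqrt (e n) by rewrite sqrtr_gt0.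
    have sE : e n = Num.sqrt (e n) ^+ 2 by rewrite sqr_sqrtr// ltW.
    have s1 : Num.sqrt (e n) <= 1.
      by rewrite -sqrtr1 ler_sqrt// ?ltr01.
    have h3 : e n * (1 - ln (e n)) <= 3 * Num.sqrt (e n).
      have := @ln_le_sub1 R (Num.sqrt (e n))^-1.
      rewrite invr_gt0 => /(_ s0); rewrite lnV ?posrE// => h4.
      have -> : ln (e n) = 2 * ln (Num.sqrt (e n)).
        by rewrite {1}sE ln_sqr_abs gtr0_norm.
      rewrite {1}sE; move: s0 s1 h4; generalize (Num.sqrt (e n)) => r r0 r1 h4.
      have h5 : r * - ln r <= 1.
        apply: (@le_trans _ _ (r * (r^-1 - 1))); first by rewrite ler_wpM2l// ltW.
        by rewrite mulrBr mulfV ?lt0r_neq0// mulr1; lra.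
      by rewrite expr2; nra.
    have -> : M' * (2 * e n) * (C * (1 - ln (e n))) = (M' * 2 * C) * (e n * (1 - ln (e n))).
      by ring.
    rewrite -[leRHS]mulrA ler_wpM2l// !mulr_ge0//.
  rewrite -(mulr0 (M' * 2 * C * 3)); apply: cvgM; first exact: cvg_cst.
  rewrite -(@sqrtr0 R); apply: (@continuous_cvg _ _ _ _ _ e (@Num.sqrt R)) => //.
  exact: sqrt_continuous.
have RR : ((b1 (clamp p q (g - e n)) - b1 (clamp p q (g + e n))) * H (e n) +
  (b (clamp p q (g - e n)) + b (clamp p q (g + e n))) * K (e n)) @[n --> \oo] -->
  0 + (b (clamp p q g) + b (clamp p q g)) * (pi * a (clamp s Y be)).
  apply: cvgD => //; apply: cvgM => //.
  by apply: cvgD; [exact: (lim_b true)|exact: (lim_b false)].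
have -> : 2 * pi * (a (clamp s Y be) * b (clamp p q g)) =
  0 + (b (clamp p q g) + b (clamp p q g)) * (pi * a (clamp s Y be)) by ring.
have EE n := cutE (e0 n).
move: L; under eq_fun do rewrite EE.
move=> L; exact: (cvg_unique _ L RR).
Qed.

End LogFactor.

(** * Green formula for log|F| *)

Section NullLines.
Context {R : realType}.
Local Notation mu := (@lebesgue_measure R).

(** Horizontal lines through the points of a list. They form a null set off which no factor [z - w]
    vanishes, so that the logarithm of the product is the sum of the logarithms there; at a zero the
    convention ln 0 = 0 breaks this identity. *)
Definition onlines (zs : seq R[i]) (t : R) := has (fun w => t == complex.Im w) zs.

Lemma measurable_lines1 (zs : seq R[i]) (D : set (measurableTypeR R)) : measurable D ->
  measurable (D `&` [set t | onlines zs t] : set (measurableTypeR R)).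
Proof.
move=> mD; apply: measurableI => //; elim: zs => [|z zs ih].
  have -> : [set t | onlines [::] t] = set0 by apply/seteqP; split.
  exact: measurable0.
have -> : [set t | onlines (z :: zs) t] = [set complex.Im z] `|` [set t | onlines zs t].
  apply/seteqP; split=> t /=; rewrite /onlines/=.
    by case/orP => [/eqP|]; [left|right].
  by case=> [->|->]; rewrite ?eqxx ?orbT.
by apply: measurableU => //; exact: measurable_set1.
Qed.

Lemma mu_lines1 (zs : seq R[i]) (D : set (measurableTypeR R)) : measurable D ->
  mu (D `&` [set t | onlines zs t]) = 0%E.
Proof.
move=> mD; elim: zs => [|z zs ih].
  have -> : D `&` [set t | onlines [::] t] = set0 by apply/seteqP; split => // x [].
  exact: measure0.
have E : D `&` [set t | onlines (z :: zs) t] `<=`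
    [set complex.Im z] `|` (D `&` [set t | onlines zs t]).
  by move=> t /= [Dt]; rewrite /onlines/=; case/orP => [/eqP|]; [left|right].
apply/eqP; rewrite eq_le measure_ge0 andbT.
apply: (le_trans (le_measure mu _ _ E)).
- by rewrite inE; exact: measurable_lines1.
- by rewrite inE; apply: measurableU; [exact: measurable_set1|exact: measurable_lines1].
- have h : (mu ([set complex.Im z] `|` (D `&` [set t | onlines zs t])) <=
      mu [set complex.Im z] + mu (D `&` [set t | onlines zs t]))%E.
    by apply: measureU2; [exact: measurable_set1|exact: measurable_lines1].
  have E0 : mu [set complex.Im z] = 0%E by exact: lebesgue_measure_set1.
  by rewrite E0 ih adde0 in h.
Qed.

Definition null2 zs (s Y p q : R) : set (measurableTypeR R * measurableTypeR R) :=
  `[s, Y]%classic `*` (`[p, q] `&` [set t | onlines zs t]).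

Lemma measurable_null2 zs s Y p q : measurable (null2 zs s Y p q).
Proof. by apply: measurableX; [exact: mitv|apply: measurable_lines1; exact: mitv]. Qed.

Lemma mu2_null2 zs s Y p q : mu2 (null2 zs s Y p q) = 0%E.
Proof.
rewrite /null2 mu2_setX; [|exact: mitv|by apply: measurable_lines1; exact: mitv].
by rewrite mu_lines1 ?mule0//; exact: mitv.
Qed.

Lemma Rint_off2 zs s Y p q (f : R * R -> R) : rint mu2 (rect s Y p q) f ->
  \int[mu2]_(z in rect s Y p q) f z =
  \int[mu2]_(z in rect s Y p q `\` null2 zs s Y p q) f z.
Proof.
exact: (Rintegral_null (measurable_null2 zs s Y p q) (mrect s Y p q) (mu2_null2 _ _ _ _ _)).
Qed.

Lemma off2P zs s Y p q z : (rect s Y p q `\` null2 zs s Y p q) z ->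
  rect s Y p q z /\ ~~ onlines zs z.2.
Proof.
move=> [[h1 h2] h3]; split => //; apply/negP => h; apply: h3.
by split => //; split.
Qed.

Lemma moff2 zs s Y p q : measurable (rect s Y p q `\` null2 zs s Y p q :
  set (measurableTypeR R * measurableTypeR R)).
Proof. by apply: measurableD; [exact: mrect|exact: measurable_null2]. Qed.

Lemma rint_off2 zs s Y p q (f : R * R -> R) : rint mu2 (rect s Y p q) f ->
  rint mu2 (rect s Y p q `\` null2 zs s Y p q) f.
Proof.
move=> h; apply: (rint_sub (mrect s Y p q) (moff2 _ _ _ _ _) _ h).
exact: subDsetl.
Qed.

Lemma rint_from_off2 zs s Y p q (f h : R * R -> R) :
  measurable_fun (rect s Y p q : set (measurableTypeR R * measurableTypeR R)) f ->
  rint mu2 (rect s Y p q) h ->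
  (forall z, rect s Y p q z -> ~~ onlines zs z.2 -> f z = h z) ->
  rint mu2 (rect s Y p q) f.
Proof.
move=> mf ih E.
apply: (@rint_null _ _ _ mu2 _ _ _ (measurable_null2 zs s Y p q)) => //.
- exact: mrect.
- exact: mu2_null2.
- apply: (@rint_dom _ _ _ mu2 _ _ (fun z => `|h z|)).
  + exact: moff2.
  + apply: measurable_funS mf; [exact: mrect|exact: subDsetl].
  + by move=> z /off2P[h1 h2]; rewrite E.
  + by apply: rint_norm; exact: rint_off2.
Qed.

Lemma Rint_eq_off2 zs s Y p q (f h : R * R -> R) :
  rint mu2 (rect s Y p q) f -> rint mu2 (rect s Y p q) h ->
  (forall z, rect s Y p q z -> ~~ onlines zs z.2 -> f z = h z) ->
  \int[mu2]_(z in rect s Y p q) f z = \int[mu2]_(z in rect s Y p q) h z.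
Proof.
move=> i1 i2 E; rewrite (Rint_off2 zs i1) (Rint_off2 zs i2).
by apply: eq_Rintegral => z; rewrite inE => /off2P[h1 h2]; exact: E.
Qed.

Lemma Rint_le_off2 zs s Y p q (f h : R * R -> R) :
  rint mu2 (rect s Y p q) f -> rint mu2 (rect s Y p q) h ->
  (forall z, rect s Y p q z -> ~~ onlines zs z.2 -> f z <= h z) ->
  \int[mu2]_(z in rect s Y p q) f z <= \int[mu2]_(z in rect s Y p q) h z.
Proof.
move=> i1 i2 E; rewrite (Rint_off2 zs i1) (Rint_off2 zs i2).
apply: le_Rintegral; [exact: moff2|exact: rint_off2|exact: rint_off2|].
by move=> z /off2P[h1 h2]; exact: E.
Qed.

Lemma rint_from_off1 zs p q (f h : R -> R) :
  measurable_fun (`[p, q]%classic : set (measurableTypeR R)) f ->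
  rint mu `[p, q] h ->
  (forall t, p <= t <= q -> ~~ onlines zs t -> f t = h t) ->
  rint mu `[p, q] f.
Proof.
move=> mf ih E.
have mN := measurable_lines1 zs (mitv `[p, q]).
have mD := measurableD (mitv `[p, q]) mN.
apply: (@rint_null _ _ _ mu _ _ _ mN) => //; first exact: (mu_lines1 _ (mitv _)).
apply: (@rint_dom _ _ _ mu _ _ (fun z => `|h z|)) => //.
- apply: measurable_funS mf => //; exact: subDsetl.
- move=> t [/=]; rewrite in_itv/= => h1 h2; rewrite E//.
  by apply/negP => h3; apply: h2.
- by apply: rint_norm; apply: (rint_sub (mitv `[p, q]) mD _ ih); exact: subDsetl.
Qed.

Lemma Rint_eq_off1 zs p q (f h : R -> R) :
  rint mu `[p, q] f -> rint mu `[p, q] h ->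
  (forall t, p <= t <= q -> ~~ onlines zs t -> f t = h t) ->
  \int[mu]_(t in `[p, q]) f t = \int[mu]_(t in `[p, q]) h t.
Proof.
move=> i1 i2 E.
have mN := measurable_lines1 zs (mitv `[p, q]).
have N0 := mu_lines1 zs (mitv `[p, q]).
rewrite (Rintegral_null mN (mitv _) N0 i1) (Rintegral_null mN (mitv _) N0 i2).
apply: eq_Rintegral => t; rewrite inE => -[/=]; rewrite in_itv/= => h1 h2; rewrite E//.
by apply/negP => h3; apply: h2.
Qed.

End NullLines.

Section SumGreen.
Context {R : realType}.
Local Notation mu := (@lebesgue_measure R).
Variables (a a1 a2 b b1 b2 : R -> R).
Hypothesis Da : forall x, rder a x (a1 x).
Hypothesis Da1 : forall x, rder a1 x (a2 x).
Hypothesis ca2 : continuous a2.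
Hypothesis Db : forall x, rder b x (b1 x).
Hypothesis Db1 : forall x, rder b1 x (b2 x).
Hypothesis cb2 : continuous b2.
Variables (s Y p q : R).
Hypothesis sY : s <= Y.
Hypothesis pq : p <= q.
Hypothesis as0 : a s = 0.
Hypothesis aY : a Y = 0.
Hypothesis a1Y : a1 Y = 0.
Hypothesis bp : b p = 0.
Hypothesis bq : b q = 0.
Hypothesis b1p : b1 p = 0.
Hypothesis b1q : b1 q = 0.

Definition lap2 (z : R * R) := a2 z.1 * b z.2 + a z.1 * b2 z.2.

Lemma rcont_lap2 z : rcont lap2 z.
Proof.
apply: rcontD; apply: rcontM.
- by apply: rcont_comp; [exact: ca2|exact: cvg_fst].
- by apply: rcont_comp; [exact: rder_continuous (Db _)|exact: cvg_snd].
- by apply: rcont_comp; [exact: rder_continuous (Da _)|exact: cvg_fst].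
- by apply: rcont_comp; [exact: cb2|exact: cvg_snd].
Qed.

Variables (G : nat -> R[i] -> R[i]) (zs : seq R[i]) (eps : R).
Hypothesis hG : hol G.
Hypothesis w0 : forall z, rect s Y p q z -> 0 < lw G eps z.1 z.2.

(** Only the cofactor is regularised: for [eps = 0] this is log |F| off the null lines, and for
    [eps > 0] it remains usable when [G] has zeros. *)
Definition hsum (x t : R) := \sum_(w <- zs) lnm ((x +i* t) - w) + lh G eps x t.

Let i1 : rint mu2 (rect s Y p q) (fun z => lh G eps z.1 z.2 * lap2 z).
Proof.
apply: cont2_rint => z /w0 wz; apply: rcontM; [exact: rcont_lh|exact: rcont_lap2].
Qed.

Let i2 w : rint mu2 (rect s Y p q) (fun z => lnm ((z.1 +i* z.2) - w) * lap2 z).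
Proof. by apply: rint_lnm_mul => z; exact: rcont_lap2. Qed.

Lemma rint_hsum : rint mu2 (rect s Y p q) (fun z => hsum z.1 z.2 * lap2 z).
Proof.
have := rintD (mrect s Y p q) (rint_sum zs (mrect s Y p q) i2) i1.
by congr rint; apply/funext => z; rewrite /hsum mulrDl mulr_suml.
Qed.

Let ss : s <= s <= Y. Proof. by rewrite lexx sY. Qed.

Let j1 : rint mu `[p, q] (fun t => b t * lh G eps s t).
Proof.
apply: rint_cont => t tpq.
have wz : 0 < lw G eps s t by apply: (w0 (z := (s, t))); split; rewrite /= in_itv.
apply: rcontM; first exact: rder_continuous (Db t).
exact: (rcont_sect2 (@rcont_lh _ G eps hG (s, t) wz)).
Qed.

Let j2 w : rint mu `[p, q] (fun t => b t * lnm ((s +i* t) - w)).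
Proof. by apply: rint_lnm_line_mul => t; exact: rder_continuous (Db t). Qed.

Lemma rint_hsum_line : rint mu `[p, q] (fun t => b t * hsum s t).
Proof.
have := rintD (mitv _) (rint_sum zs (mitv _) j2) j1.
by congr rint; apply/funext => z; rewrite /hsum mulrDr mulr_sumr.
Qed.

(** Sum of [log_factor] over the list and of [green] for the cofactor, whose horizontal boundary
    terms vanish with [b] and [b1]. *)
Lemma sum_green :
  \int[mu2]_(z in rect s Y p q) (hsum z.1 z.2 * lap2 z) +
  a1 s * \int[mu]_(t in `[p, q]) (b t * hsum s t) =
  2 * pi * (\sum_(w <- zs) a (clamp s Y (complex.Re w)) * b (clamp p q (complex.Im w))) +
  \int[mu2]_(z in rect s Y p q) (a z.1 * b z.2 * llap G eps z.1 z.2).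
Proof.
have E1 : \int[mu2]_(z in rect s Y p q) (hsum z.1 z.2 * lap2 z) =
  \sum_(w <- zs) \int[mu2]_(z in rect s Y p q) (lnm ((z.1 +i* z.2) - w) * lap2 z) +
  \int[mu2]_(z in rect s Y p q) (lh G eps z.1 z.2 * lap2 z).
  rewrite -(Rintegral_sum zs (mrect s Y p q) i2).
  rewrite -(RintegralD (mrect s Y p q) (rint_sum zs (mrect s Y p q) i2) i1).
  by apply: eq_Rintegral => z _; rewrite /hsum mulrDl mulr_suml.
have E2 : \int[mu]_(t in `[p, q]) (b t * hsum s t) =
  \sum_(w <- zs) \int[mu]_(t in `[p, q]) (b t * lnm ((s +i* t) - w)) +
  \int[mu]_(t in `[p, q]) (b t * lh G eps s t).
  rewrite -(Rintegral_sum zs (mitv _) j2).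
  rewrite -(RintegralD (mitv _) (rint_sum zs (mitv _) j2) j1).
  by apply: eq_Rintegral => z _; rewrite /hsum mulrDr mulr_sumr.
rewrite E1 E2 mulrDr addrACA; congr (_ + _).
  rewrite [a1 s * _]mulr_sumr -big_split/= mulr_sumr; apply: eq_bigr => w _.
  exact: (log_factor Da Da1 ca2 Db Db1 cb2 w sY pq as0 aY a1Y bp bq b1p b1q).
rewrite (green hG Da Da1 ca2 Db Db1 cb2 sY pq w0 as0 aY a1Y).
have Z u : b u = 0 -> b1 u = 0 ->
  \int[mu]_(x in `[s, Y]) (a x * (lh G eps x u * b1 u - lht G eps x u * b u)) = 0.
  move=> -> ->; under eq_Rintegral do rewrite !mulr0 subrr mulr0.
  by rewrite Rintegral_cst ?mul0r//; exact: measurable_itv.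
by rewrite !Z// subrr addr0 || rewrite !Z// addr0 subr0.
Qed.

End SumGreen.

Section LogGreen.
Context {R : realType}.
Local Notation mu := (@lebesgue_measure R).
Variables (F G : nat -> R[i] -> R[i]) (zs : seq R[i]).
Hypothesis hF : hol F.
Hypothesis hG : hol G.
Hypothesis FE : forall z, F 0%N z = (\prod_(w <- zs) (z - w)) * G 0%N z.

Definition lF (x t : R) := lnm (F 0%N (x +i* t)).

Lemma cmod_prod (z : R[i]) (ws : seq R[i]) :
  cmod (\prod_(w <- ws) (z - w)) = \prod_(w <- ws) cmod (z - w).
Proof. by elim: ws => [|w ws ih]; rewrite ?big_nil ?cmod1// !big_cons cmodM ih. Qed.

Lemma ln_prod (ws : seq R[i]) (z : R[i]) : (forall w, w \in ws -> z != w) ->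
  0 < \prod_(w <- ws) cmod (z - w) /\
  ln (\prod_(w <- ws) cmod (z - w)) = \sum_(w <- ws) lnm (z - w).
Proof.
elim: ws => [|w ws ih] H; first by rewrite !big_nil ln1.
have [p0 E] := ih (fun v h => H v (mem_behead (s := w :: ws) h)).
have w0 : 0 < cmod (z - w) by rewrite cmod_gt0 subr_eq0 H// mem_head.
by rewrite !big_cons mulr_gt0// lnM ?posrE// E.
Qed.

Lemma offlines_neq (x t : R) w : ~~ onlines zs t -> w \in zs -> (x +i* t) != w.
Proof.
move=> /hasPn h /h; apply: contra => /eqP <-; by rewrite eqxx.
Qed.

Lemma measurable_lF s Y p q :
  measurable_fun (rect s Y p q : set (measurableTypeR R * measurableTypeR R))
    (fun z => lF z.1 z.2).
Proof.
apply: (measurableT_comp (@measurable_ln R)).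
apply: cont2_measurable; first exact: measurable_rect.
move=> z _; apply: ccont_cmod; apply: hol_ccont => //.
by apply: ccont_mk; [exact: cvg_fst|exact: cvg_snd].
Qed.

Lemma measurable_lF_line (s : R) (D : set (measurableTypeR R)) : measurable D ->
  measurable_fun D (fun t => lF s t).
Proof.
move=> mD; apply: (measurableT_comp (@measurable_ln R)).
apply: measurable_funTS; apply: continuous_measurable_fun => t.
have h : rcont (fun t : R => cmod (F 0%N (s +i* t))) t.
  apply: ccont_cmod; apply: hol_ccont => //.
  by apply: ccont_mk; [exact: rcont_cst|exact: cvg_id].
exact: h.
Qed.

Lemma lF_hsum x t : G 0%N (x +i* t) != 0 -> ~~ onlines zs t ->
  lF x t = hsum G zs 0 x t.
Proof.
move=> G0 tz; have [p0 E] := ln_prod (fun w h => offlines_neq x tz h).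
rewrite /lF /lnm FE cmodM cmod_prod lnM ?posrE ?cmod_gt0// E /hsum; congr (_ + _).
by rewrite /lh /lw addr0 ln_sqr_abs ger0_norm ?cmod_ge0// mulrA mulVf// mul1r.
Qed.

Lemma cont_rint_lF s Y p q : (forall z, rect s Y p q z -> G 0%N (z.1 +i* z.2) != 0) ->
  rint mu2 (rect s Y p q) (fun z => lF z.1 z.2).
Proof.
move=> G0.
apply: (@rint_from_off2 _ zs s Y p q _ (fun z => hsum G zs 0 z.1 z.2)).
- exact: measurable_lF.
- apply: rintD; first exact: mrect.
    apply: rint_sum; first exact: mrect.
    by move=> w; exact: rint_lnm_rect.
  apply: cont2_rint => z /G0 gz; apply: rcont_lh => //.
  by rewrite /lw addr0 exprn_gt0// cmod_gt0.
- by move=> z rz tz; apply: lF_hsum => //; exact: G0.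
Qed.

Lemma cont_rint_lF_line s p q : (forall t, p <= t <= q -> G 0%N (s +i* t) != 0) ->
  rint mu `[p, q] (fun t => lF s t).
Proof.
move=> G0.
apply: (@rint_from_off1 _ zs p q _ (fun t => hsum G zs 0 s t)).
- by apply: measurable_lF_line; exact: mitv.
- apply: rintD; first exact: mitv.
    apply: rint_sum; first exact: mitv.
    by move=> w; exact: rint_lnm_line.
  apply: rint_cont => t /G0 gz.
  have wz : 0 < lw G 0 s t by rewrite /lw addr0 exprn_gt0// cmod_gt0.
  exact: (rcont_sect2 (@rcont_lh _ G 0 hG (s, t) wz)).
- by move=> t rz tz; apply: lF_hsum => //; exact: G0.
Qed.

Variables (a a1 a2 b b1 b2 : R -> R).
Hypothesis Da : forall x, rder a x (a1 x).
Hypothesis Da1 : forall x, rder a1 x (a2 x).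
Hypothesis ca2 : continuous a2.
Hypothesis Db : forall x, rder b x (b1 x).
Hypothesis Db1 : forall x, rder b1 x (b2 x).
Hypothesis cb2 : continuous b2.
Variables (s Y p q : R).
Hypothesis sY : s <= Y.
Hypothesis pq : p <= q.
Hypothesis as0 : a s = 0.
Hypothesis aY : a Y = 0.
Hypothesis a1Y : a1 Y = 0.
Hypothesis bp : b p = 0.
Hypothesis bq : b q = 0.
Hypothesis b1p : b1 p = 0.
Hypothesis b1q : b1 q = 0.

Lemma rint_lF_mul (phi : R * R -> R) :
  (forall z, rect s Y p q z -> G 0%N (z.1 +i* z.2) != 0) ->
  (forall z, rcont phi z) ->
  rint mu2 (rect s Y p q) (fun z => lF z.1 z.2 * phi z).
Proof.
move=> G0 cphi; have il := cont_rint_lF G0.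
have [M fM] := @rect_bounded R s Y p q phi (fun z _ => cphi z).
have mR := mrect s Y p q.
apply: (@rint_dom _ _ _ mu2 _ _ (fun z => `|M| * `|lF z.1 z.2|)) => //.
- apply: measurable_funM; first exact: measurable_lF.
  by apply: cont2_measurable => // z _; exact: cphi.
- move=> z rz; rewrite normrM mulrC; apply: ler_wpM2r => //.
  exact: le_trans (fM _ rz) (ler_norm _).
- exact: (@rintZ _ _ _ mu2 _ _ _ mR (rint_norm il)).
Qed.

Lemma rint_lF_line_mul (phi : R -> R) :
  (forall t, p <= t <= q -> G 0%N (s +i* t) != 0) ->
  (forall t, rcont phi t) ->
  rint mu `[p, q] (fun t => phi t * lF s t).
Proof.
move=> G0 cphi; have il := cont_rint_lF_line G0.
have [M fM] := @rect_bounded R p q 0 0 (fun z => phi z.1)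
  (fun z _ => rcont_comp (cphi z.1) (@cvg_fst _ _ _ _ _)).
apply: (@rint_dom _ _ _ mu _ _ (fun t => `|M| * `|lF s t|)) => //.
- apply: measurable_funM; last by apply: measurable_lF_line; exact: mitv.
  by apply: measurable_funTS; apply: continuous_measurable_fun => t; exact: cphi.
- move=> t rz; rewrite normrM; apply: ler_wpM2r => //.
  apply: le_trans (fM (t, 0) _) (ler_norm _).
  by split => //; rewrite /= in_itv/= lexx.
- exact: (@rintZ _ _ _ mu _ _ _ (mitv _) (rint_norm il)).
Qed.

Lemma log_green : (forall z, rect s Y p q z -> G 0%N (z.1 +i* z.2) != 0) ->
  \int[mu2]_(z in rect s Y p q) (lF z.1 z.2 * lap2 a a2 b b2 z) +
  a1 s * \int[mu]_(t in `[p, q]) (b t * lF s t) =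
  2 * pi * (\sum_(w <- zs) a (clamp s Y (complex.Re w)) * b (clamp p q (complex.Im w))).
Proof.
move=> G0.
have w0 z : rect s Y p q z -> 0 < lw G 0 z.1 z.2.
  by move=> /G0 gz; rewrite /lw addr0 exprn_gt0// cmod_gt0.
have G0s t : p <= t <= q -> G 0%N (s +i* t) != 0.
  move=> h; apply: (G0 (s, t)); split; rewrite /= in_itv//=.
  by rewrite lexx sY.
have cl z : rcont (lap2 a a2 b b2) z by exact: (rcont_lap2 Da ca2 Db cb2).
have := sum_green Da Da1 ca2 Db Db1 cb2 sY pq as0 aY a1Y bp bq b1p b1q zs hG w0.
have -> : \int[mu2]_(z in rect s Y p q) (a z.1 * b z.2 * llap G 0 z.1 z.2) = 0.
  under eq_Rintegral do rewrite /llap !(mulr0, mul0r).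
  by rewrite Rintegral_cst ?mul0r//; exact: mrect.
rewrite addr0 => <-; congr (_ + _ * _).
  apply: (@Rint_eq_off2 _ zs).
  - exact: rint_lF_mul.
  - exact: (rint_hsum Da ca2 Db cb2 zs hG w0).
  - by move=> z rz tz; rewrite lF_hsum//; exact: G0.
apply: (@Rint_eq_off1 _ zs).
- by apply: rint_lF_line_mul => // t; exact: rder_continuous (Db t).
- exact: (rint_hsum_line Db sY zs hG w0).
- by move=> t rz tz; rewrite lF_hsum//; exact: G0s.
Qed.

End LogGreen.

(** * Weights *)

Section TestFunctions.
Context {R : realType}.
Local Notation mu := (@lebesgue_measure R).
Implicit Types (x t tau s L : R).

Definition bumpf tau t : R := cos (pi / 2 * (t - tau)) ^+ 2.
Definition bump1 tau t : R :=
  - (pi * (cos (pi / 2 * (t - tau)) * sin (pi / 2 * (t - tau)))).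
(** Written through the window itself, so that one reads off both [b'' >= - pi^2 b] and the change
    of sign under a shift by 1. *)
Definition bump2 tau t : R := pi ^+ 2 / 2 - pi ^+ 2 * bumpf tau t.

Lemma rder_bump tau t : rder (bumpf tau) t (bump1 tau t).
Proof. by rewrite /bumpf; rder_tac; rewrite /bump1 /=; field. Qed.

Lemma rder_bump1 tau t : rder (bump1 tau) t (bump2 tau t).
Proof.
rewrite /bump1; rder_tac; rewrite /bump2 /bumpf /=.
have := cos2Dsin2 (pi / 2 * (t - tau)).
move: (cos _) (sin _) => c d E.
have -> : pi ^+ 2 / 2 = pi ^+ 2 / 2 * (c ^+ 2 + d ^+ 2) by rewrite E mulr1.
by field.
Qed.

Lemma cont_bump2 tau : continuous (bump2 tau).
Proof.
move=> t; have h : rcont (bump2 tau) t.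
  apply: rcontB; first exact: rcont_cst.
  by apply: rcontM; [exact: rcont_cst|exact: rder_continuous (rder_bump tau t)].
exact: h.
Qed.

Lemma bump_end tau : [/\ bumpf tau (tau - 1) = 0, bumpf tau (tau + 1) = 0,
  bump1 tau (tau - 1) = 0 & bump1 tau (tau + 1) = 0].
Proof.
have E1 : pi / 2 * (tau - 1 - tau) = - (pi / 2) :> R by ring.
have E2 : pi / 2 * (tau + 1 - tau) = pi / 2 :> R by ring.
rewrite /bumpf /bump1 E1 E2 cosN cos_pihalf.
by rewrite expr0n/= !mul0r mulr0 oppr0.
Qed.

Lemma bump_ge0 tau t : 0 <= bumpf tau t.
Proof. exact: sqr_ge0. Qed.

Lemma bump_le1 tau t : bumpf tau t <= 1.
Proof.
rewrite /bumpf; have := cos2Dsin2 (pi / 2 * (t - tau)).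
by have := sqr_ge0 (sin (pi / 2 * (t - tau))); lra.
Qed.

Lemma bump_ge2 tau t : `|t - tau| <= 2^-1 -> 2^-1 <= bumpf tau t.
Proof.
move=> h; rewrite /bumpf; have p0 := @pi_gt0 R.
have E : cos (pi / 2 * (t - tau) *+ 2) = cos (pi / 2 * (t - tau)) ^+ 2 *+ 2 - 1.
  exact: cos_mulr2n.
have : 0 <= cos (pi / 2 * (t - tau) *+ 2).
  have -> : pi / 2 * (t - tau) *+ 2 = pi * (t - tau) by rewrite mulr2n; field.
  move: h; rewrite ler_norml => /andP[h1 h2].
  by apply: cos_ge0_pihalf; apply/andP; split; nra.
by rewrite E mulr2n; lra.
Qed.

Lemma pi_sqr_le : pi ^+ 2 <= 16 :> R.
Proof. have := @pihalf_lt2 R; have := @pi_gt0 R => h1 h2; nra. Qed.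

Lemma pi_sqr_ge : 4 <= pi ^+ 2 :> R.
Proof. have := @pi_ge2 R => h1; nra. Qed.

Lemma bump2_le tau t : `|bump2 tau t| <= 8.
Proof.
rewrite /bump2; have := bump_ge0 tau t; have := bump_le1 tau t.
have := pi_sqr_le; have := pi_sqr_ge => h1 h2 h3 h4.
by rewrite ler_norml; apply/andP; split; nra.
Qed.

Lemma bumpfS tau t : bumpf tau t + bumpf (tau + 1) t = 1.
Proof.
have E : pi / 2 * (t - (tau + 1)) = pi / 2 * (t - tau) - pi / 2 :> R by field.
by rewrite /bumpf E cosBpihalf cos2Dsin2.
Qed.

Lemma bump2S tau t : bump2 (tau + 1) t = - bump2 tau t.
Proof.
by rewrite /bump2 -[bumpf (tau + 1) t](addKr (bumpf tau t)) bumpfS; field.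
Qed.

(* The weight y^m (1 - y/L)^2, y = x - s, and its first two derivatives. *)
Definition jf (m : nat) s L x : R := (x - s) ^+ m * (1 - (x - s) / L) ^+ 2.
Definition jf1 (m : nat) s L x : R :=
  m%:R * (x - s) ^+ m.-1 * (1 - (x - s) / L) ^+ 2
  - 2 / L * ((x - s) ^+ m * (1 - (x - s) / L)).
Definition jf2 (m : nat) s L x : R :=
  m%:R * m.-1%:R * (x - s) ^+ m.-2 * (1 - (x - s) / L) ^+ 2
  - 4 / L * (m%:R * (x - s) ^+ m.-1 * (1 - (x - s) / L))
  + 2 / L ^+ 2 * (x - s) ^+ m.

Lemma rder_sub_pow m s x : rder (fun x => (x - s) ^+ m) x (m%:R * (x - s) ^+ m.-1).
Proof.
by apply: (rder_eq (rderX m (rderB (rder_id x) (rder_cst x s)))); rewrite subr0 mul1r mulr_natl.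
Qed.

Lemma rder_cut s L x : rder (fun x => 1 - (x - s) / L) x (- L^-1).
Proof. by rder_tac; rewrite /=; ring. Qed.

Lemma rder_jf m s L x : rder (jf m s L) x (jf1 m s L x).
Proof.
apply: rder_eq; first apply: rderM (rder_sub_pow m s x) (rderX _ (rder_cut s L x)).
by rewrite /jf1 /=; ring.
Qed.

Lemma rder_jf1 m s L x : rder (jf1 m s L) x (jf2 m s L x).
Proof.
apply: rder_eq.
  apply: rderB.
    apply: rderM (rderX _ (rder_cut s L x)).
    by apply: rderM; [exact: rder_cst|exact: rder_sub_pow].
  apply: rderM; first exact: rder_cst.
  by apply: rderM; [exact: rder_sub_pow|exact: rder_cut].
by rewrite /jf2 /= exprVn || rewrite /jf2 /= -exprVn; ring.
Qed.

Lemma cont_jf2 m s L : continuous (jf2 m s L).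
Proof.
move=> x; have h1 : rcont (fun x => x - s) x.
  by apply: rcontB; [exact: cvg_id|exact: rcont_cst].
have h2 : rcont (fun x => 1 - (x - s) / L) x by exact: rder_continuous (rder_cut s L x).
have h : rcont (jf2 m s L) x.
  apply: rcontD; last by apply: rcontM; [exact: rcont_cst|exact: rcontX].
  apply: rcontB.
    apply: rcontM; last exact: rcontX.
    by apply: rcontM; [exact: rcont_cst|exact: rcontX].
  apply: rcontM; first exact: rcont_cst.
  by apply: rcontM => //; apply: rcontM; [exact: rcont_cst|exact: rcontX].
exact: h.
Qed.

Lemma jf_start m s L : jf m.+1 s L s = 0.
Proof. by rewrite /jf subrr expr0n mul0r. Qed.

Lemma jf_end m s L : 0 < L -> jf m s L (s + L) = 0 /\ jf1 m s L (s + L) = 0.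
Proof.
move=> L0; have E : 1 - (s + L - s) / L = 0.
  by rewrite (_ : s + L - s = L) ?divff ?subrr ?lt0r_neq0//; ring.
by rewrite /jf /jf1 E expr0n/= !mulr0 subrr.
Qed.

Lemma jf1_start s L : jf1 1 s L s = 1.
Proof. by rewrite /jf1 /= subrr expr0 expr1 !mul0r subr0 expr1n mulr0 subr0 !mulr1. Qed.

Lemma jf1_start2 m s L : jf1 m.+2 s L s = 0.
Proof. by rewrite /jf1 /= subrr !expr0n/= !mulr0 !mul0r mulr0 subrr. Qed.

Lemma jf_ge0 m s L x : s <= x -> 0 <= jf m s L x.
Proof. by move=> h; rewrite /jf mulr_ge0 ?sqr_ge0// exprn_ge0// subr_ge0. Qed.

(** Up to the distance D = L/5 the cut-off factor is at least (4/5)^2 = 16/25, and from distance 1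
    on the power is at least 1. *)
Lemma jf_ge m s L x D : 0 < L -> 5 * D <= L -> s + 1 <= x -> x <= s + D ->
  2^-1 <= jf m s L x.
Proof.
move=> L0 LD x1 x2; rewrite /jf.
have q5 : (x - s) / L <= 5^-1.
  by rewrite ler_pdivrMr//; lra.
have h1 : 1 <= (x - s) ^+ m by apply: exprn_ege1; lra.
have h2 : 2^-1 <= (1 - (x - s) / L) ^+ 2.
  move: q5; set q := _ / L => q5.
  apply: (@le_trans _ _ ((4 / 5) ^+ 2)); first by lra.
  by rewrite lerXn2r// ?nnegrE; lra.
by rewrite -[leLHS]mul1r; apply: ler_pM.
Qed.

(* Makes the Laplacian of the weight times a window nonnegative, because the
   second derivative of a window is at least - pi^2 times the window. *)
Lemma jf2_ge n s x D : 0 < D -> 4 * D <= n%:R -> s <= x -> x <= s + D ->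
  pi ^+ 2 * jf n.+2 s (5 * D) x <= jf2 n.+2 s (5 * D) x.
Proof.
move=> D0 nD x1 x2; have L0 : 0 < 5 * D by rewrite mulr_gt0.
set L := 5 * D in L0 *; set y := x - s.
have y0 : 0 <= y by rewrite subr_ge0.
have yD : y <= D by rewrite /y; lra.
pose q := y / L; have q0 : 0 <= q by rewrite divr_ge0// ltW.
have q5 : q <= 5^-1 by rewrite /q ler_pdivrMr// /L; lra.
pose r := 1 - q; have r0 : 0 < r by rewrite /r; lra.
have qr : 4 * q <= r by rewrite /r; lra.
apply: (@le_trans _ _ (16 * jf n.+2 s L x)).
  by rewrite ler_wpM2r ?jf_ge0// pi_sqr_le.
have Ln0 := lt0r_neq0 L0.
rewrite -subr_ge0.
(* With [pi ^+ 2] replaced by 16, the difference is a sum of three nonnegative terms: [r >= 4 q]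
   because L = 5 D, and [n (n + 2) >= 16 y^2] because [4 D <= n]. *)
have -> : jf2 n.+2 s L x - 16 * jf n.+2 s L x = y ^+ n *
   ((n%:R + 2) * r * (r - 4 * q) + r ^+ 2 * ((n%:R + 2) * n%:R - 16 * y ^+ 2) + 2 * q ^+ 2).
  rewrite /jf2 /jf /= -/y !exprS -[n.+2]addn2 -[n.+1]addn1 !natrD.
  by move: (y ^+ n) => z; rewrite /r /q; field.
have n0 : 0 <= n%:R :> R by [].
apply: mulr_ge0; first exact: exprn_ge0.
apply: addr_ge0; last by rewrite mulr_ge0// sqr_ge0.
apply: addr_ge0.
  apply: mulr_ge0; last by rewrite subr_ge0.
  by apply: mulr_ge0; [rewrite addr_ge0|exact: ltW].
apply: mulr_ge0; first exact: sqr_ge0.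
have yn : 4 * y <= n%:R by lra.
rewrite subr_ge0 (_ : 16 * y ^+ 2 = (4 * y) ^+ 2); last by ring.
apply: (@le_trans _ _ (n%:R ^+ 2)); first by rewrite lerXn2r// nnegrE// mulr_ge0.
by rewrite expr2 ler_wpM2r// lerDl.
Qed.

End TestFunctions.

(** * Zeros and area bounds in a window *)

Section Estimates.
Context {R : realType}.
Local Notation mu := (@lebesgue_measure R).
Implicit Types (x t tau s L : R).

Lemma Rint_cst_rect (s Y p q c : R) : s <= Y -> p <= q ->
  \int[mu2]_(z in rect s Y p q) c = c * ((Y - s) * (q - p)).
Proof.
move=> sY pq; rewrite Rintegral_cst; last exact: mrect.
have E (a b : R) : a <= b -> mu `[a, b] = (b - a)%:E.
  move=> ab; rewrite lebesgue_measure_itv/= lte_fin.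
  by move: ab; rewrite le_eqVlt => /predU1P[->|->]; rewrite ?ltxx ?subrr// EFinB.
have -> : mu2 (rect s Y p q) = (mu `[s, Y] * mu `[p, q])%E.
  by apply: mu2_setX; exact: mitv.
by rewrite !E.
Qed.

Lemma ln_near1 (u : R) : `|u - 1| <= 2^-1 -> `|ln u| <= 2 * `|u - 1|.
Proof.
move=> h; have /andP[h1 h2] : - 2^-1 <= u - 1 <= 2^-1 by rewrite -ler_norml.
have u0 : 0 < u by lra.
have l1 := ln_le_sub1 u0.
have := @ln_le_sub1 R u^-1; rewrite invr_gt0 => /(_ u0); rewrite lnV ?posrE// => l2.
have l3 : u^-1 - 1 <= 2 * `|u - 1|.
  have -> : u^-1 - 1 = (1 - u) * u^-1 by rewrite mulrBl mul1r mulfV ?lt0r_neq0.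
  apply: (@le_trans _ _ (`|u - 1| * u^-1)).
    by rewrite ler_wpM2r ?invr_ge0 ?(ltW u0)// -normrN opprB ler_norm.
  rewrite mulrC ler_wpM2r// invf_ple ?posrE//; lra.
have := ler_norm (u - 1); have := normr_ge0 (u - 1) => h3 h4.
by rewrite ler_norml; apply/andP; split; lra.
Qed.

Variables (F : nat -> R[i] -> R[i]) (sg A0 C k : R) (N : nat).
Hypothesis hF : hol F.
Hypothesis A00 : 0 <= A0.
Hypothesis HA : forall x t, sg - 2 <= x -> -2 <= t ->
  cmod (F 0%N (x +i* t)) <= A0 * (t + 3) ^+ N.
Hypothesis C0 : 0 <= C.
Hypothesis k0 : 0 < k.
Hypothesis HB : forall x t, 2 <= x -> -2 <= t ->
  cmod (F 0%N (x +i* t) - 1) <= C * expR (- (k * x)).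

(* An abscissa beyond which |F - 1| <= 1/2. *)
Definition s1 : R := Num.max 2 (Num.max (sg + 1) (2 * C / k)).

Lemma s1_ge2 : 2 <= s1. Proof. by rewrite /s1 le_max lexx. Qed.
Lemma s1_gesg : sg + 1 <= s1. Proof. by rewrite /s1 !le_max lexx orbT. Qed.
Lemma s1_geC : 2 * C / k <= s1. Proof. by rewrite /s1 !le_max lexx !orbT. Qed.

Lemma right_small x : s1 <= x -> C * expR (- (k * x)) <= 2^-1.
Proof.
move=> xs; have := s1_geC; have := s1_ge2 => h1 h2.
have x0 : 0 < 1 + k * x by rewrite addr_gt0// mulr_gt0//; lra.
have h3 : 2 * C <= k * x.
  by have := le_trans h2 xs; rewrite ler_pdivrMr// [_ * k]mulrC.
have h4 : expR (- (k * x)) <= (1 + k * x)^-1.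
  by rewrite expRN lef_pV2 ?posrE ?expR_gt0// expR_ge1Dx.
apply: (le_trans (ler_wpM2l C0 h4)).
rewrite ler_pdivrMr//; lra.
Qed.

Lemma right_near1 x t : s1 <= x -> -2 <= t -> `|cmod (F 0%N (x +i* t)) - 1| <= C * expR (- (k * x)).
Proof.
move=> xs t2; have x2 : 2 <= x by have := s1_ge2; lra.
apply: le_trans (HB x2 t2).
have h1 := cmod_triB (F 0%N (x +i* t)) 1.
have h2 := cmod_triB 1 (F 0%N (x +i* t)).
rewrite cmodC cmod1 in h2; rewrite cmod1 in h1.
by rewrite ler_norml; apply/andP; split; lra.
Qed.

Lemma right_half x t : s1 <= x -> -2 <= t ->
  2^-1 <= cmod (F 0%N (x +i* t)) <= 3 / 2.
Proof.
move=> xs t2; have := le_trans (right_near1 xs t2) (right_small xs).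
by rewrite ler_norml => /andP[h1 h2]; apply/andP; split; lra.
Qed.

Lemma right_lF x t : s1 <= x -> -2 <= t -> `|lF F x t| <= 2 * (C * expR (- (k * x))).
Proof.
move=> xs t2; have h := right_near1 xs t2.
apply: (le_trans (ln_near1 (le_trans h (right_small xs)))).
by rewrite ler_wpM2l.
Qed.

Lemma right_lF1 x t : s1 <= x -> -2 <= t -> `|lF F x t| <= 1.
Proof.
move=> xs t2; apply: (le_trans (right_lF xs t2)).
by have := right_small xs; lra.
Qed.

(** The scale of all error terms. Windows have centre [tau >= -1], so they stay in [t >= -2], where
    F is bounded; on a window [t + 3 <= tau + 4], whence the shift 4, which also makes [Lam] at
    least 1. *)
Definition Lam tau : R := 1 + ln (tau + 4).
Definition K0 : R := ln (A0 + 1) + N%:R + 2.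

Lemma Lam_ge1 tau : -1 <= tau -> 1 <= Lam tau.
Proof. by move=> h; rewrite /Lam lerDl ln_ge0//; lra. Qed.

Lemma Lam_le tau tau' : -1 <= tau -> tau <= tau' -> Lam tau <= Lam tau'.
Proof. by move=> h1 h2; rewrite /Lam lerD2l ler_ln ?posrE//; lra. Qed.

Lemma K0_ge2 : 2 <= K0.
Proof. by rewrite /K0 -lerBlDr subrr addr_ge0// ln_ge0// lerDr. Qed.

Lemma left_ln x t tau (e : R) : -1 <= tau -> sg - 2 <= x -> tau - 1 <= t <= tau + 1 ->
  0 <= e <= 1 -> 0 < cmod (F 0%N (x +i* t)) ^+ 2 + e ->
  2^-1 * ln (cmod (F 0%N (x +i* t)) ^+ 2 + e) <= K0 * Lam tau.
Proof.
move=> ht xs /andP[t1 t2] /andP[e0 e1] w0.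
have T1 : 1 <= tau + 4 by lra.
have P1 : 1 <= (tau + 4) ^+ N by exact: exprn_ege1.
have FM : cmod (F 0%N (x +i* t)) <= A0 * (tau + 4) ^+ N.
  apply: (le_trans (HA xs _)); first by lra.
  by rewrite ler_wpM2l// lerXn2r// ?nnegrE; [lra|lra|lra].
set c := cmod _ in FM w0 *; have c0 : 0 <= c by exact: cmod_ge0.
pose M := (A0 + 1) * (tau + 4) ^+ N.
have M1 : c + 1 <= M by rewrite /M mulrDl mul1r lerD.
have M0 : 0 < M by lra.
apply: (@le_trans _ _ (ln M)).
  have h : ln (c ^+ 2 + e) <= ln (M ^+ 2).
    rewrite ler_ln ?posrE ?exprn_gt0//.
    by apply: (@le_trans _ _ ((c + 1) ^+ 2)); [nra|rewrite lerXn2r// ?nnegrE; lra].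
  by move: h; rewrite ln_sqr_abs gtr0_norm//; lra.
have T0 : 0 < tau + 4 by lra.
have A1 : 0 < A0 + 1 by rewrite ltr_wpDl.
rewrite /M lnM ?posrE ?exprn_gt0// lnXn//.
have l0 : 0 <= ln (tau + 4) by rewrite ln_ge0.
have l1 : 0 <= ln (A0 + 1) by rewrite ln_ge0// lerDr.
rewrite /K0 /Lam -[ln _ *+ N]mulr_natl; have N0 : 0 <= N%:R :> R by [].
move: N0 l0 l1 (mulr_ge0 l0 l1); generalize (N%:R : R) (ln (tau + 4)) (ln (A0 + 1)).
move=> r u v r0 u0 v0 uv; have := mulr_ge0 r0 u0; lra.
Qed.

Lemma left_lF x t tau : -1 <= tau -> sg - 2 <= x -> tau - 1 <= t <= tau + 1 ->
  lF F x t <= K0 * Lam tau.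
Proof.
move=> ht xs tt; rewrite /lF /lnm.
have [->|c0] := eqVneq (cmod (F 0%N (x +i* t))) 0.
  rewrite ln0// mulr_ge0//; first by have := K0_ge2; lra.
  by have := Lam_ge1 ht; lra.
have c1 : 0 < cmod (F 0%N (x +i* t)) by rewrite lt_neqAle eq_sym c0 cmod_ge0.
have := @left_ln x t tau 0 ht xs tt; rewrite lexx ler01 addr0 => /(_ isT).
rewrite exprn_gt0// => /(_ isT).
by rewrite ln_sqr_abs gtr0_norm// mulrA mulVf// mul1r.
Qed.

(** * Jensen-type bounds in one window *)

Section Jensen.
Variable s0 : R.
Hypothesis s0sg : sg - 2 <= s0.
Hypothesis s0s1 : s0 < s1.

Let D := s1 - s0.
Let L := 5 * D.
Let n := (Num.truncn (4 * D)).+1.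
Let Y := s0 + L.
Let a := jf n.+2 s0 L.
Let a1 := jf1 n.+2 s0 L.
Let a2 := jf2 n.+2 s0 L.
Let D0 : 0 < D. Proof. by rewrite subr_gt0. Qed.
Let L0 : 0 < L. Proof. by rewrite mulr_gt0. Qed.
Let nD : 4 * D <= n%:R. Proof. by apply/ltW; exact: truncnS_gt. Qed.
Let sY : s0 <= Y. Proof. by rewrite lerDl ltW. Qed.
Let a_ge0 x : s0 <= x -> 0 <= a x. Proof. exact: jf_ge0. Qed.
Let lap tau := lap2 a a2 (bumpf tau) (bump2 tau).

Let lap_bound : exists2 M, 0 <= M & forall tau z, s0 <= z.1 <= Y -> `|lap tau z| <= M.
Proof.
have [M1 H1] := @rect_bounded R s0 Y 0 0 (fun z => a2 z.1)
  (fun z _ => rcont_comp (@cont_jf2 R n.+2 s0 L z.1) (@cvg_fst _ _ _ _ _)).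
have [M2 H2] := @rect_bounded R s0 Y 0 0 (fun z => a z.1)
  (fun z _ => rcont_comp (rder_continuous (rder_jf n.+2 s0 L z.1)) (@cvg_fst _ _ _ _ _)).
exists (`|M1| + `|M2| * 8); first by rewrite addr_ge0// mulr_ge0.
move=> tau z zs; have h : rect s0 Y 0 0 (z.1, 0) by split; rewrite /= in_itv/= ?lexx.
rewrite /lap /lap2 (le_trans (ler_normD _ _))// (normrM (a2 z.1)) (normrM (a z.1)); apply: lerD.
  rewrite (@le_trans _ _ `|a2 z.1|)//; last exact: le_trans (H1 _ h) (ler_norm _).
  by apply: ler_piMr => //; rewrite ger0_norm; [exact: bump_le1|exact: bump_ge0].
apply: ler_pM => //; first exact: le_trans (H2 _ h) (ler_norm _).
exact: bump2_le.
Qed.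

(** The part [- pi^2 a b] of [a b''] is absorbed by [a'' b] ([jf2_ge]); what is left is [pi^2 / 2]
    times [a], at least [2 a]. *)
Let lap_ge tau z : s0 <= z.1 <= s1 -> 2 * a z.1 <= lap tau z.
Proof.
move=> /andP[h1 h2]; rewrite /lap /lap2 /bump2.
have h3 : z.1 <= s0 + D by rewrite /D; lra.
have h4 := jf2_ge D0 nD h1 h3.
rewrite -/L -/(a z.1) -/(a2 z.1) in h4.
have h5 := bump_ge0 tau z.2; have h6 := a_ge0 h1; have h7 := @pi_sqr_ge R.
have h8 : 0 <= (a2 z.1 - pi ^+ 2 * a z.1) * bumpf tau z.2 by rewrite mulr_ge0// subr_ge0.
nra.
Qed.

(** The bound is uniform over all lists [zs] that divide F, and [G] may still vanish. The exponent
    of the weight being at least 2, there is no line term, and the regularised Laplacian contributes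
    nonnegatively; hence the weighted count is at most the area integral. Its integrand is
    O([Lam tau]): left of [s1] since [lap] is nonnegative and the logarithm bounded above, right of
    it since |F| is near 1. *)
Lemma jensen : exists2 CJ, 0 <= CJ & forall tau zs G, -1 <= tau -> hol G ->
  (forall z, F 0%N z = (\prod_(w <- zs) (z - w)) * G 0%N z) ->
  \sum_(w <- zs) a (clamp s0 Y (complex.Re w)) *
     bumpf tau (clamp (tau - 1) (tau + 1) (complex.Im w)) <= CJ * Lam tau.
Proof.
have [DM DM0 HDM] := lap_bound.
exists (2 * K0 * DM * (L * 2)).
  have h : 0 <= K0 by have := K0_ge2; lra.
  by rewrite !mulr_ge0// ltW.
move=> tau zs G ht hG FE.
set p := tau - 1; set q := tau + 1; have pq : p <= q by rewrite /p /q; lra.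
have [e1 e2 e3 e4] := bump_end tau.
have [aY a1Y] := jf_end n.+2 s0 L0.
have cP z : rcont (fun z : R * R => cmod (\prod_(w <- zs) ((z.1 +i* z.2) - w)) ^+ 2) z.
  apply: rcontX; apply: ccont_cmod; elim: zs {FE} => [|w zs ih].
    by under eq_fun do rewrite big_nil; exact: ccont_cst.
  under eq_fun do rewrite big_cons; apply: ccontM => //.
  by apply: ccontB; [apply: ccont_mk; [exact: cvg_fst|exact: cvg_snd]|exact: ccont_cst].
have [PM HP] := @rect_bounded R s0 Y p q _ (fun z _ => cP z).
(* Small enough that [eps] times the squared modulus of the product is at most 1 on the rectangle,
   as [left_ln] requires. *)
pose eps := (`|PM| + 1)^-1.
have eps0 : 0 < eps by rewrite invr_gt0 ltr_wpDl.
have w0 z : rect s0 Y p q z -> 0 < lw G eps z.1 z.2.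
  by move=> _; rewrite ltr_wpDl ?sqr_ge0.
have cb2 := @cont_bump2 R tau.
have ca2 : continuous a2 by exact: cont_jf2.
have Da x : rder a x (a1 x) by exact: rder_jf.
have Da1 x : rder a1 x (a2 x) by exact: rder_jf1.
have E := sum_green Da Da1 ca2 (rder_bump tau) (rder_bump1 tau) cb2 sY pq
  (jf_start _ _ _) aY a1Y e1 e2 e3 e4 zs hG w0.
rewrite /a1 jf1_start2 mul0r addr0 in E.
have iH := rint_hsum Da ca2 (rder_bump tau) cb2 zs hG w0.
have B : \int[mu2]_(z in rect s0 Y p q) (hsum G zs eps z.1 z.2 * lap tau z) <=
    2 * K0 * DM * (L * 2) * Lam tau.
  have -> : 2 * K0 * DM * (L * 2) * Lam tau = (2 * (K0 * Lam tau) * DM) * ((Y - s0) * (q - p)).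
    by rewrite /Y /p /q; ring.
  rewrite -Rint_cst_rect//; apply: (@Rint_le_off2 _ zs) => //.
    by apply: cont2_rint => z _; exact: rcont_cst.
  move=> z rz tz; have [] := rz; rewrite /= !in_itv/= => zs1 zp.
  have lb := HDM tau z zs1.
  have t2 : -2 <= z.2 by move: zp; rewrite /p => /andP[]; lra.
  have KL : 2 <= K0 * Lam tau.
    by have := K0_ge2; have := Lam_ge1 ht => h1 h2; nra.
  have [pr0 lE] := ln_prod (fun w h => offlines_neq z.1 tz h).
  set P := \prod_(w <- zs) cmod _ in pr0 lE.
  (* Multiplying out, the regularisation of [G] by [eps] becomes one of F by [eps * P ^+ 2]. *)
  have hE : hsum G zs eps z.1 z.2 = 2^-1 * ln (cmod (F 0%N (z.1 +i* z.2)) ^+ 2 + eps * P ^+ 2).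
    rewrite /hsum -lE /lh.
    have -> : ln P = 2^-1 * ln (P ^+ 2).
      by rewrite ln_sqr_abs gtr0_norm// mulrA mulVf// mul1r.
    rewrite -mulrDr -lnM ?posrE ?exprn_gt0//; last exact: w0.
    by congr (_ * ln _); rewrite /lw FE cmodM cmod_prod -/P; ring.
  have eP : 0 <= eps * P ^+ 2 <= 1.
    apply/andP; split; first by rewrite mulr_ge0 ?sqr_ge0// ltW.
    rewrite /eps mulrC ler_pdivrMr ?ltr_wpDl// mul1r.
    have := HP z rz; rewrite cmod_prod -/P ger0_norm ?sqr_ge0// => /le_trans; apply.
    by have := ler_norm PM; lra.
  have eP0 : 0 < cmod (F 0%N (z.1 +i* z.2)) ^+ 2 + eps * P ^+ 2.
    by rewrite ltr_wpDl ?sqr_ge0// mulr_gt0// exprn_gt0.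
  have [zx|/ltW zx] := leP z.1 s1.
    have l1 : 0 <= lap tau z.
      have h : s0 <= z.1 <= s1 by case/andP: zs1 => -> _.
      by have := lap_ge tau h; have := a_ge0 (proj1 (andP h)); lra.
    have zs2 : sg - 2 <= z.1 by case/andP: zs1 => h _; exact: le_trans s0sg h.
    have := left_ln ht zs2 zp eP eP0; rewrite -hE => h.
    move: lb; rewrite ger0_norm// => lb.
    apply: (@le_trans _ _ (K0 * Lam tau * lap tau z)); first by rewrite ler_wpM2r.
    apply: (@le_trans _ _ (K0 * Lam tau * DM)).
      by apply: ler_wpM2l => //; lra.
    by apply: ler_wpM2r => //; lra.
  have /andP[r1 r2] := right_half zx t2.
  have h2 : `|hsum G zs eps z.1 z.2| <= 2.
    rewrite hE; set u := _ + _ in eP0 *.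
    have u1 : 4^-1 <= u by rewrite /u; case/andP: eP => ? ?; nra.
    have u2 : u <= 13 / 4 by rewrite /u; case/andP: eP => ? ?; nra.
    have l1 := ln_le_sub1 eP0.
    have := @ln_le_sub1 R u^-1; rewrite invr_gt0 => /(_ eP0); rewrite lnV ?posrE// => l2.
    have u3 : u^-1 <= 4 by rewrite invf_ple ?posrE.
    by rewrite ler_norml; apply/andP; split; lra.
  apply: (le_trans (ler_norm _)); rewrite normrM.
  by apply: ler_pM => //; lra.
have I0 : 0 <= \int[mu2]_(z in rect s0 Y p q) (a z.1 * bumpf tau z.2 * llap G eps z.1 z.2).
  apply: Rintegral_ge0 => z rz; have [] := rz; rewrite /= !in_itv/= => /andP[z1 _] _.
  apply: mulr_ge0; first by apply: mulr_ge0; [exact: a_ge0|exact: bump_ge0].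
  by rewrite /llap mulr_ge0 ?invr_ge0 ?sqr_ge0// mulr_ge0 ?sqr_ge0// mulr_ge0// ltW.
set S := \sum_(w <- zs) _ in E *.
have S0 : 0 <= S.
  rewrite /S; apply: sumr_ge0 => w _; rewrite mulr_ge0 ?bump_ge0// a_ge0//.
  by have /andP[] := clamp_itv (complex.Re w) sY.
have p2 := @pi_ge2 R.
have : S <= 2 * pi * S by nra.
by move: E; rewrite -/(lap tau) => E; move: B; rewrite E; lra.
Qed.

(** The integral of [lF * lap] is nonnegative, being a weighted sum over zeros. Where [lF <= M],
    with M = [K0 * Lam tau], one has [|lF| <= 2 M - lF]; since [lap >= 2 a >= 1] on the inner
    rectangle, which starts at distance 1 from the left edge, the upper bound for [lF] becomes a
    bound for the integral of its modulus. *)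
Lemma area_L1 : exists2 C1, 0 <= C1 & forall tau zs G, -1 <= tau -> hol G ->
  (forall z, F 0%N z = (\prod_(w <- zs) (z - w)) * G 0%N z) ->
  (forall z, rect s0 Y (tau - 1) (tau + 1) z -> G 0%N (z.1 +i* z.2) != 0) ->
  \int[mu2]_(z in rect (s0 + 1) s1 (tau - 1) (tau + 1)) `|lF F z.1 z.2| <= C1 * Lam tau.
Proof.
have [DM DM0 HDM] := lap_bound.
exists (2 * K0 * DM * (L * 2)).
  have h : 0 <= K0 by have := K0_ge2; lra.
  by rewrite !mulr_ge0// ltW.
move=> tau zs G ht hG FE G0.
set p := tau - 1; set q := tau + 1; have pq : p <= q by rewrite /p /q; lra.
have [e1 e2 e3 e4] := bump_end tau.
have [aY a1Y] := jf_end n.+2 s0 L0.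
have cb2 := @cont_bump2 R tau.
have ca2 : continuous a2 by exact: cont_jf2.
have Da x : rder a x (a1 x) by exact: rder_jf.
have Da1 x : rder a1 x (a2 x) by exact: rder_jf1.
have E := log_green hF hG FE Da Da1 ca2 (rder_bump tau) (rder_bump1 tau) cb2 sY pq
  (jf_start _ _ _) aY a1Y e1 e2 e3 e4 G0.
rewrite /a1 jf1_start2 mul0r addr0 -/(lap tau) in E.
have I0 : 0 <= \int[mu2]_(z in rect s0 Y p q) (lF F z.1 z.2 * lap tau z).
  rewrite E mulr_ge0//; first by rewrite mulr_ge0// pi_ge0.
  apply: sumr_ge0 => w _; rewrite mulr_ge0 ?bump_ge0// a_ge0//.
  by have /andP[] := clamp_itv (complex.Re w) sY.
have cl z : rcont (lap tau) z by exact: (rcont_lap2 Da ca2 (rder_bump tau) cb2).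
have il : rint mu2 (rect s0 Y p q) (fun z => lF F z.1 z.2 * lap tau z).
  exact: (rint_lF_mul hF hG FE G0).
have ia : rint mu2 (rect s0 Y p q) (fun z => `|lF F z.1 z.2|).
  exact: (rint_norm (cont_rint_lF hF hG FE G0)).
have sub : rect (s0 + 1) s1 p q `<=` rect s0 Y p q.
  move=> z [/= + h2]; rewrite !in_itv/= => /andP[h1 h3]; split => //=.
  rewrite in_itv/=; apply/andP; split; first by lra.
  by rewrite /Y /L /D; have := s0s1; lra.
have -> : \int[mu2]_(z in rect (s0 + 1) s1 p q) `|lF F z.1 z.2| =
   \int[mu2]_(z in rect s0 Y p q) ((fun z => `|lF F z.1 z.2|) \_ (rect (s0 + 1) s1 p q)) z.
  by rewrite -Rintegral_mkcondr setIidr.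
have -> : 2 * K0 * DM * (L * 2) * Lam tau = (2 * (K0 * Lam tau) * DM) * ((Y - s0) * (q - p)).
  by rewrite /Y /p /q; ring.
have ic : rint mu2 (rect s0 Y p q) (fun=> 2 * (K0 * Lam tau) * DM).
  by apply: cont2_rint => z _; exact: rcont_cst.
rewrite -Rint_cst_rect//.
apply: (@le_trans _ _ (\int[mu2]_(z in rect s0 Y p q)
  (2 * (K0 * Lam tau) * DM - lF F z.1 z.2 * lap tau z))); last first.
  by rewrite (RintegralB (mrect _ _ _ _) ic il); lra.
have iP : rint mu2 (rect s0 Y p q)
    ((fun z => `|lF F z.1 z.2|) \_ (rect (s0 + 1) s1 p q)).
  apply: (@rint_dom _ _ _ mu2 _ _ (fun z => `|lF F z.1 z.2|)) => //.
  - exact: mrect.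
  - apply/(measurable_restrict _ (mrect _ _ _ _) (mrect _ _ _ _)).
    by apply: measurable_funS (rint_meas ia); [exact: mrect|exact: subIsetl].
  - by move=> z _; rewrite /patch; case: ifP => //; rewrite ?normr0 ?normr_id.
apply: le_Rintegral => //; first exact: mrect.
  by apply: rintB => //; exact: mrect.
move=> z rz; have [] := rz; rewrite /= !in_itv/= => zs1 zp.
have lb := HDM tau z zs1.
have t2 : -2 <= z.2 by move: zp; rewrite /p => /andP[]; lra.
have KL : 2 <= K0 * Lam tau.
  by have := K0_ge2; have := Lam_ge1 ht => h1 h2; nra.
have [zx|zx] := leP z.1 s1; last first.
  rewrite /patch ifF; last first.
    apply/negbTE; rewrite notin_setE => -[/=]; rewrite in_itv/= => /andP[_ h] _.
    by move: h; rewrite leNgt zx.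
  have := right_lF1 (ltW zx) t2 => h.
  have := ler_norm (lF F z.1 z.2 * lap tau z); rewrite normrM => h2.
  have : `|lF F z.1 z.2| * `|lap tau z| <= 1 * DM by apply: ler_pM.
  have : 2 * DM <= K0 * Lam tau * DM by apply: ler_wpM2r.
  have -> : point = 0 :> R by [].
  lra.
have h : s0 <= z.1 <= s1 by case/andP: zs1 => -> _.
have lg := lap_ge tau h; have ag := a_ge0 (proj1 (andP h)).
have l0 : 0 <= lap tau z by lra.
move: lb; rewrite ger0_norm// => lb.
have zs2 : sg - 2 <= z.1 by case/andP: zs1 => h' _; exact: le_trans s0sg h'.
have lu := left_lF ht zs2 zp.
have la : `|lF F z.1 z.2| <= 2 * (K0 * Lam tau) - lF F z.1 z.2.
  by rewrite ler_norml; apply/andP; split; lra.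
have M1 : `|lF F z.1 z.2| * lap tau z <= 2 * (K0 * Lam tau) * DM - lF F z.1 z.2 * lap tau z.
  apply: (@le_trans _ _ ((2 * (K0 * Lam tau) - lF F z.1 z.2) * lap tau z)).
    by rewrite ler_wpM2r.
  by rewrite mulrBl lerD2r ler_wpM2l//; lra.
apply: le_trans M1; rewrite /patch; case: ifPn => [|_]; last by rewrite mulr_ge0.
rewrite inE => -[/=]; rewrite in_itv/= => /andP[h1 h2] _.
have : 2^-1 <= a z.1.
  by apply: (@jf_ge _ _ _ _ _ D) => //; rewrite /D; lra.
by move=> h3; rewrite ler_peMr//; lra.
Qed.

End Jensen.

End Estimates.

(** * Counting the zeros and dividing them out *)

Section Assembly.
Context {R : realType}.
Local Notation mu := (@lebesgue_measure R).
Implicit Types (x t tau s L : R).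

Variables (F : nat -> R[i] -> R[i]) (sg A0 C k : R) (N : nat).
Hypothesis hF : hol F.
Hypothesis A00 : 0 <= A0.
Hypothesis HA : forall x t, sg - 2 <= x -> -2 <= t ->
  cmod (F 0%N (x +i* t)) <= A0 * (t + 3) ^+ N.
Hypothesis C0 : 0 <= C.
Hypothesis k0 : 0 < k.
Hypothesis HB : forall x t, 2 <= x -> -2 <= t ->
  cmod (F 0%N (x +i* t) - 1) <= C * expR (- (k * x)).

Let S1 := s1 sg C k.
Let S1sg : sg + 1 <= S1. Proof. exact: s1_gesg. Qed.

Definition factors (zs : seq R[i]) (G : nat -> R[i] -> R[i]) :=
  hol G /\ forall z, F 0%N z = (\prod_(w <- zs) (z - w)) * G 0%N z.

Definition in_cell tau (w : R[i]) :=
  (sg - 1 <= complex.Re w <= S1) && (tau - 2^-1 <= complex.Im w <= tau + 2^-1).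

(** Jensen's bound with left edge [sg - 2], so that the weight is at least 1/2 from [sg - 1] on; the
    window is at least 1/2 at distance 1/2 from its centre, which gives the factor 4. *)
Lemma count_cell : exists2 CC, 0 <= CC & forall tau zs G, -1 <= tau -> factors zs G ->
  (count (in_cell tau) zs)%:R <= CC * Lam tau.
Proof.
have e1 : sg - 2 <= sg - 2 by [].
have e2 : sg - 2 < s1 sg C k by have := S1sg; rewrite /S1; lra.
have [CJ CJ0 HJ] := jensen A00 HA C0 k0 HB e1 e2.
exists (4 * CJ); first by rewrite mulr_ge0.
move=> tau zs G ht [hG FE]; have := HJ tau zs G ht hG FE.
set D := s1 sg C k - (sg - 2); set n := _.+3; set L := 5 * D.
have D0 : 0 < D by rewrite subr_gt0.
have L0 : 0 < L by rewrite mulr_gt0.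
have sL : sg - 2 <= sg - 2 + L by rewrite lerDl ltW.
move=> H; rewrite -mulrA -ler_pdivrMl//; apply: le_trans H.
rewrite -sum1_count natr_sum mulr_sumr big_mkcond/=; apply: ler_sum => w _.
have j0 : 0 <= jf n (sg - 2) L (clamp (sg - 2) (sg - 2 + L) (complex.Re w)).
  by apply: jf_ge0; have /andP[] := clamp_itv (complex.Re w) sL.
case: ifPn => [|_]; last by rewrite mulr_ge0// bump_ge0.
rewrite /in_cell => /andP[/andP[w1 w2] /andP[w3 w4]].
rewrite mulr1 (_ : 4^-1 = 2^-1 * 2^-1); last by field.
rewrite clampM; [|lra|by rewrite /L /D; move: w2; rewrite /S1; have := e2; lra].
rewrite clampM; [|lra|lra].
apply: ler_pM => //.
  by apply: (@jf_ge _ _ _ _ _ D) => //; [lra|rewrite /D; move: w2; rewrite /S1; lra].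
by apply: bump_ge2; rewrite ler_norml; apply/andP; split; lra.
Qed.

Lemma factors_nil : factors [::] F.
Proof. by split=> // z; rewrite big_nil mul1r. Qed.

Lemma factors_right zs G x t : factors zs G -> S1 <= x -> -2 <= t -> G 0%N (x +i* t) != 0.
Proof.
move=> [_ FE] xs t2; have /andP[h _] := right_half C0 k0 HB xs t2.
apply: contraTneq h => e.
by rewrite FE e mulr0 cmod0 -ltNge invr_gt0.
Qed.

(** Zeros of the cofactor are divided out one at a time. Each new one lies in the box, as F has no
    zeros beyond [S1], and [count_cell] bounds the number of entries in the box for all partial
    factorisations at once; so the process stops. *)
Lemma exists_factors (m : nat) : exists zs G, factors zs G /\
  forall x t, sg - 1 <= x -> -1 <= t <= m%:R -> G 0%N (x +i* t) != 0.
Proof.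
have [CC CC0 HC] := count_cell.
pose box (w : R[i]) := (sg - 1 <= complex.Re w <= S1) && (-1 <= complex.Im w <= m%:R).
(* Centres -1, 0, ..., m of unit cells, which cover the heights from -1 to m. *)
pose tj (j : nat) : R := j%:R - 1.
have cov zs : (count box zs <= \sum_(j < m.+2) count (in_cell (tj j)) zs)%N.
  elim: zs => [|w zs ih]; first by [].
  rewrite /= big_split/= leq_add//.
  case bw : (box w) => //; move: bw => /andP[b1 /andP[b2 b3]].
  have h0 : 0 <= complex.Im w + 3 / 2 by lra.
  pose j := Num.truncn (complex.Im w + 3 / 2).
  have /andP[j1 j2] := truncn_itv h0; rewrite -/j in j1 j2.
  have jm : (j < m.+2)%N.
    rewrite -(ltr_nat R) (le_lt_trans j1)// -[m.+2]addn2 natrD; lra.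
  rewrite (bigD1 (Ordinal jm))//= /in_cell b1/= /tj.
  rewrite -addn1 natrD in j2.
  by have -> : j%:R - 1 - 2^-1 <= complex.Im w <= j%:R - 1 + 2^-1
    by apply/andP; split; lra.
have [B HBd] : exists B : nat, forall zs G, factors zs G -> (count box zs <= B)%N.
  exists (Num.truncn (\sum_(j < m.+2) CC * Lam (tj j))) => zs G fz.
  rewrite truncn_ge_nat.
    apply: le_trans (_ : (\sum_(j < m.+2) count (in_cell (tj j)) zs)%N%:R <= _).
      by rewrite ler_nat.
    rewrite natr_sum; apply: ler_sum => j _; apply: HC fz.
    by rewrite /tj lerBrDr addrC subrr.
  apply: sumr_ge0 => j _; rewrite mulr_ge0//.
  have : -1 <= tj j by rewrite /tj lerBrDr addrC subrr.
  by move/Lam_ge1; lra.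
(* [d] bounds the number of zeros of the box that may still be divided out; at [d = 0] a further
   zero would exceed [B]. *)
suff: forall d zs G, factors zs G -> (B <= count box zs + d)%N -> exists zs G, factors zs G /\
    forall x t, sg - 1 <= x -> -1 <= t <= m%:R -> G 0%N (x +i* t) != 0.
  by move=> H; exact: (H B _ _ factors_nil (leq_addl _ _)).
elim=> [|d ih] zs G fz Bd.
all: have [H|] := pselect (forall x t, sg - 1 <= x -> -1 <= t <= m%:R -> G 0%N (x +i* t) != 0); first by exists zs, G.
all: move=> /existsNP[x /existsNP[t /not_implyP[x1 /not_implyP[t1 /negP]]]].
all: rewrite negbK => /eqP G0; have [hG FE] := fz; have [Q hQ QE] := hol_factor hG G0.
all: have fz' : factors ((x +i* t) :: zs) Q
  by split=> // z; rewrite big_cons FE QE; ring.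
all: have bx : box (x +i* t).
1,3: rewrite /box /= x1 t1 /= andbT leNgt; apply/negP => /ltW xs;
     (have t2 : -2 <= t by have /andP[t2 _] := t1; lra);
     by have := factors_right fz xs t2; rewrite G0 eqxx.
  by have := HBd _ _ fz'; rewrite /= bx add1n ltnNge -(addn0 (count box zs)) Bd.
by apply: (ih _ _ fz'); rewrite /= bx add1n addSnnS.
Qed.

End Assembly.

(** * The window identity and its telescoping *)

Section Splitting.
Context {R : realType}.
Local Notation mu := (@lebesgue_measure R).

Lemma rint_patchS d (T : measurableType d) (nu : {measure set T -> \bar R})
    (D E : set T) (f : T -> R) :
  measurable D -> measurable E -> E `<=` D -> rint nu E f -> rint nu D (f \_ E).
Proof.
move=> mD mE ED h; have h2 := (rint_patch nu f mE).1 h.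
exact: (@rint_sub _ _ _ nu D setT _ measurableT mD _ h2).
Qed.

Lemma Rint_patchS d (T : measurableType d) (nu : {measure set T -> \bar R})
    (D E : set T) (f : T -> R) : E `<=` D ->
  \int[nu]_(x in D) (f \_ E) x = \int[nu]_(x in E) f x.
Proof. by move=> ED; rewrite -Rintegral_mkcondr setIidr. Qed.

Lemma Rint_split_rect s Y p m q (f : R * R -> R) : p <= m -> m <= q ->
  rint mu2 (rect s Y p q) f ->
  \int[mu2]_(z in rect s Y p q) f z =
  \int[mu2]_(z in rect s Y p m) f z + \int[mu2]_(z in rect s Y m q) f z.
Proof.
move=> pm mq hf.
have s1 : rect s Y p m `<=` rect s Y p q.
  by move=> z [h1 /=]; rewrite in_itv/= => /andP[h2 h3]; split=> //=; rewrite in_itv/= h2 (le_trans h3).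
have s2 : rect s Y m q `<=` rect s Y p q.
  by move=> z [h1 /=]; rewrite in_itv/= => /andP[h2 h3]; split=> //=; rewrite in_itv/= h3 (le_trans pm).
have i1 : rint mu2 (rect s Y p m) f.
  by apply: (@rint_sub _ _ _ mu2 _ (rect s Y p q)) => //; exact: mrect.
have i2 : rint mu2 (rect s Y m q) f.
  by apply: (@rint_sub _ _ _ mu2 _ (rect s Y p q)) => //; exact: mrect.
have j1 := rint_patchS (mrect _ _ _ _) (mrect _ _ _ _) s1 i1.
have j2 := rint_patchS (mrect _ _ _ _) (mrect _ _ _ _) s2 i2.
rewrite -(Rint_patchS mu2 f s1) -(Rint_patchS mu2 f s2).
rewrite -(RintegralD (mrect _ _ _ _) j1 j2).
(* The common side at height [m] is a null line, encoded by a one-point list. *)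
apply: (@Rint_eq_off2 _ [:: 0 +i* m]) => //.
  by apply: rintD => //; exact: mrect.
move=> z [z1 z2]; rewrite /onlines /= orbF => zm.
have E1 : (z \in rect s Y p m) = (z.2 < m).
  apply/idP/idP; first by rewrite inE => -[_]; rewrite /= in_itv/= lt_neqAle zm => /andP[].
  move=> h; rewrite inE; split=> //=; move: z2; rewrite /= !in_itv/= => /andP[-> _].
  exact: ltW.
have E2 : (z \in rect s Y m q) = (m < z.2).
  apply/idP/idP; first by rewrite inE => -[_]; rewrite /= in_itv/= lt_neqAle eq_sym zm => /andP[].
  move=> h; rewrite inE; split=> //=; move: z2; rewrite /= !in_itv/= => /andP[_ ->].
  by rewrite ltW.
rewrite /patch E1 E2.
have Z : point = 0 :> R by [].
case: (ltgtP z.2 m) zm => // _ _; rewrite Z ?addr0 ?add0r//.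
Qed.

Lemma Rint_split p m q (f : R -> R) : p <= m -> m <= q ->
  rint mu `[p, q] f ->
  \int[mu]_(t in `[p, q]) f t = \int[mu]_(t in `[p, m]) f t + \int[mu]_(t in `[m, q]) f t.
Proof.
move=> pm mq hf.
have s1 : `[p, m]%classic `<=` `[p, q]%classic.
  by move=> z /=; rewrite !in_itv/= => /andP[-> h3]; rewrite (le_trans h3).
have s2 : `[m, q]%classic `<=` `[p, q]%classic.
  by move=> z /=; rewrite !in_itv/= => /andP[h2 ->]; rewrite (le_trans pm).
have i1 : rint mu `[p, m] f by exact: (rint_sub (mitv `[p, q]) (mitv _) s1).
have i2 : rint mu `[m, q] f by exact: (rint_sub (mitv `[p, q]) (mitv _) s2).
have j1 := rint_patchS (mitv _) (mitv _) s1 i1.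
have j2 := rint_patchS (mitv _) (mitv _) s2 i2.
rewrite -(Rint_patchS mu f s1) -(Rint_patchS mu f s2).
rewrite -(RintegralD (mitv _) j1 j2).
apply: (@Rint_eq_off1 _ [:: 0 +i* m]) => //.
  by apply: rintD => //; exact: mitv.
move=> z /andP[z1 z2]; rewrite /onlines /= orbF => zm.
have E1 : (z \in (`[p, m]%classic : set R)) = (z < m).
  by rewrite mem_setE in_itv/= z1 /= lt_neqAle zm.
have E2 : (z \in (`[m, q]%classic : set R)) = (m < z).
  by rewrite mem_setE in_itv/= z2 andbT lt_neqAle eq_sym zm.
rewrite /patch E1 E2.
have Z : point = 0 :> R by [].
case: (ltgtP z m) zm => // _ _; rewrite Z ?addr0 ?add0r//.
Qed.

Lemma Rint_cst_itv p q (c : R) : p <= q -> \int[mu]_(t in `[p, q]) c = c * (q - p).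
Proof.
move=> pq; rewrite (@FTC _ _ (fun t => c * t))//; first by rewrite mulrBr.
  by move=> t _; rder_tac; rewrite /= ?mulr1; ring.
by move=> t _; exact: (@rcont_cst _ _ c t).
Qed.

End Splitting.

(** * Green's identity in one window *)

Section BumpIdentity.
Context {R : realType}.
Local Notation mu := (@lebesgue_measure R).
Implicit Types (x t tau s L : R).

Variables (F : nat -> R[i] -> R[i]) (sg A0 C k : R) (N : nat).
Hypothesis hF : hol F.
Hypothesis A00 : 0 <= A0.
Hypothesis HA : forall x t, sg - 2 <= x -> -2 <= t ->
  cmod (F 0%N (x +i* t)) <= A0 * (t + 3) ^+ N.
Hypothesis C0 : 0 <= C.
Hypothesis k0 : 0 < k.
Hypothesis HB : forall x t, 2 <= x -> -2 <= t ->
  cmod (F 0%N (x +i* t) - 1) <= C * expR (- (k * x)).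

Let S1 := s1 sg C k.
Let S1sg : sg + 1 <= S1. Proof. exact: s1_gesg. Qed.
Let L0 : R := S1 - sg + 1.

Definition nonvan (G : nat -> R[i] -> R[i]) (p q : R) :=
  forall x t, sg - 1 <= x -> p <= t <= q -> G 0%N (x +i* t) != 0.

(** Majorant of [(1 + (x - sg)) * |lF|] to the right of [S1]; thanks to the exponential decay its
    integral is bounded independently of L. *)
Let tail x := (1 + (x - sg)) * (2 * (C * expR (- (k * x)))).

Let tail_ge0 x : sg <= x -> 0 <= tail x.
Proof.
move=> h; rewrite /tail mulr_ge0//; first by rewrite addr_ge0// subr_ge0.
by rewrite !mulr_ge0// expR_ge0.
Qed.

Let rcont_tail x : rcont tail x.
Proof.
have h : rder tail x ((2 * (C * expR (- (k * x)))) - k * tail x).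
  by rewrite /tail; rder_tac; rewrite /tail /=; ring.
exact: rder_continuous h.
Qed.

Let tail_int L : 0 <= L ->
  \int[mu]_(x in `[sg, sg + L]) tail x <= 2 * C / k * (1 + k^-1) * expR (- (k * sg)).
Proof.
move=> L_ge0; pose P x := - (2 * C / k * ((1 + (x - sg) + k^-1) * expR (- (k * x)))).
have kk : k != 0 by rewrite lt0r_neq0.
rewrite (@FTC _ _ P) ?lerDl//; last by move=> x _; exact: rcont_tail.
  have Ck : 0 <= 2 * C / k by rewrite divr_ge0 ?mulr_ge0// ltW.
  have E1 := expR_ge0 (- (k * (sg + L))).
  have k1 : 0 <= k^-1 by rewrite invr_ge0 ltW.
  have : 0 <= 2 * C / k * ((1 + (sg + L - sg) + k^-1) * expR (- (k * (sg + L)))).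
    by rewrite !mulr_ge0// addr_ge0// addr_ge0//; lra.
  by rewrite /P subrr addr0; lra.
move=> x _; rewrite /P; rder_tac; rewrite /tail /=; field.
by rewrite kk.
Qed.

(** The factor [1 + (x - sg)] dominates the weight [jf 1] as well as constants, hence both area
    terms; the bound does not depend on L. *)
Lemma area_bound : exists2 CV, 0 <= CV & forall tau zs G L, 0 <= tau ->
  factors F zs G -> nonvan G (tau - 1) (tau + 1) -> L0 <= L ->
  \int[mu2]_(z in rect sg (sg + L) (tau - 1) (tau + 1))
    ((1 + (z.1 - sg)) * `|lF F z.1 z.2|) <= CV * Lam tau.
Proof.
(* [area_L1] is used with left edge [sg - 1], so that its inner rectangle starts exactly at [sg]. *)
have e1 : sg - 2 <= sg - 1 by lra.
have e2 : sg - 1 < s1 sg C k by have := S1sg; rewrite /S1; lra.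
have [C1 C10 H1] := area_L1 hF A00 HA C0 k0 HB e1 e2.
pose Kt := 2 * C / k * (1 + k^-1) * expR (- (k * sg)).
have Kt0 : 0 <= Kt.
  rewrite /Kt mulr_ge0 ?expR_ge0// mulr_ge0//; first by rewrite divr_ge0 ?mulr_ge0// ltW.
  by rewrite addr_ge0// invr_ge0 ltW.
pose W := 1 + (S1 - sg).
have W0 : 0 <= W by have := S1sg; rewrite /W; lra.
exists (W * C1 + Kt * 2); first by rewrite addr_ge0// mulr_ge0.
move=> tau zs G L ht [hG FE] G0 LL.
have L_ge0 : 0 <= L by move: LL; rewrite /L0; have := S1sg; lra.
set p := tau - 1; set q := tau + 1.
have pq : p <= q by rewrite /p /q; lra.
have t1 : -1 <= tau by lra.
have G0' s Y : sg - 1 <= s -> forall z, rect s Y p q z -> G 0%N (z.1 +i* z.2) != 0.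
  move=> sx z [/=]; rewrite !in_itv/= => /andP[h1 _] h2; apply: G0 => //.
  exact: le_trans h1.
have A1 := H1 tau zs G t1 hG FE (G0' _ _ (lexx _)).
rewrite subrK -/S1 -/p -/q in A1.
have il : rint mu2 (rect sg (sg + L) p q) (fun z => lF F z.1 z.2).
  by apply: (cont_rint_lF hF hG FE); apply: G0'; lra.
have i1 : rint mu2 (rect sg (sg + L) p q) (fun z => `|lF F z.1 z.2|) by exact: rint_norm il.
have i2 : rint mu2 (rect sg (sg + L) p q) (fun z => (1 + (z.1 - sg)) * `|lF F z.1 z.2|).
  have c : forall z : R * R, rcont (fun z : R * R => 1 + (z.1 - sg)) z.
    move=> z; apply: rcontD; first exact: rcont_cst.
    by apply: rcontB; [exact: cvg_fst|exact: rcont_cst].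
  have G0s := G0' sg (sg + L) _; have sgsg : sg - 1 <= sg by lra.
  have h := rint_norm (rint_lF_mul hF hG FE (G0s sgsg) c).
  apply: (@rint_dom _ _ _ mu2 _ _ _ _ _ _ h); first exact: mrect.
    apply: measurable_funM; last exact: (rint_meas i1).
    by apply: cont2_measurable; [exact: mrect|move=> z _; exact: c].
  by move=> z _; rewrite !normrM normr_id mulrC.
have sub : rect sg S1 p q `<=` rect sg (sg + L) p q.
  move=> z [/= + h2]; rewrite !in_itv/= => /andP[h1 h3]; split => //=.
  by rewrite in_itv/= h1 (le_trans h3)//; move: LL; rewrite /L0; lra.
have i3 : rint mu2 (rect sg S1 p q) (fun z => `|lF F z.1 z.2|).
  by apply: (@rint_sub _ _ _ mu2 _ _ _ _ _ sub i1); exact: mrect.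
have i4 := rint_patchS (mrect _ _ _ _) (mrect _ _ _ _) sub i3.
have i5 : rint mu2 (rect sg (sg + L) p q) (fun z => tail z.1).
  by apply: cont2_rint => z _; apply: (rcont_comp (h := tail)); [exact: rcont_tail|exact: cvg_fst].
have i6 := @rintZ _ _ _ mu2 _ _ W (mrect _ _ _ _) i4.
apply: (@le_trans _ _ (\int[mu2]_(z in rect sg (sg + L) p q)
  (W * ((fun z => `|lF F z.1 z.2|) \_ (rect sg S1 p q)) z + tail z.1))).
  apply: le_Rintegral => //; first exact: mrect.
    by apply: rintD => //; exact: mrect.
  move=> z rz; have [] := rz; rewrite /= !in_itv/= => /andP[z1 z2] zp.
  have [zx|zx] := leP z.1 S1.
    rewrite /patch ifT; last by rewrite inE; split => //=; rewrite in_itv/= z1.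
    have := tail_ge0 z1; have := normr_ge0 (lF F z.1 z.2) => h1 h2.
    have : (1 + (z.1 - sg)) * `|lF F z.1 z.2| <= W * `|lF F z.1 z.2|.
      by rewrite ler_wpM2r// /W; lra.
    lra.
  rewrite /patch ifF; last first.
    apply/negbTE; rewrite notin_setE => -[/=]; rewrite in_itv/= => /andP[_ h] _.
    by move: h; rewrite leNgt zx.
  have -> : point = 0 :> R by [].
  rewrite mulr0 add0r /tail; apply: ler_wpM2l; first by lra.
  have zt : -2 <= z.2 by move: zp; rewrite /p => /andP[]; lra.
  exact: (right_lF C0 k0 HB (ltW zx) zt).
rewrite (RintegralD (mrect _ _ _ _) i6 i5) (RintegralZl _ (mrect _ _ _ _) i4).
rewrite (Rint_patchS mu2 _ sub).
have -> : \int[mu2]_(z in rect sg (sg + L) p q) tail z.1 =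
    \int[mu]_(x in `[sg, sg + L]) tail x * 2.
  rewrite (Rfubini1 (mitv _) (mitv _) i5); last first.
    by move=> t _; apply: rint_cont => x _; exact: rcont_tail.
  by rewrite /= Rint_cst_itv// /p /q; congr (_ * _); ring.
rewrite [leRHS]mulrDl; apply: lerD.
  by rewrite -mulrA ler_wpM2l.
have := tail_int L_ge0; rewrite -/Kt => h; have := Lam_ge1 t1 => h2.
have : Kt * 2 <= Kt * 2 * Lam tau by rewrite ler_peMr// mulr_ge0.
lra.
Qed.

Definition zsum L tau (zs : seq R[i]) := \sum_(w <- zs)
  jf 1 sg L (clamp sg (sg + L) (complex.Re w)) *
  bumpf tau (clamp (tau - 1) (tau + 1) (complex.Im w)).

(** The area term with [a b''], over a variable range of heights: each half of a window shares its
    strip with a neighbouring window, against which it cancels ([sideintS]). *)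
Definition sideint L tau (p q : R) := \int[mu2]_(z in rect sg (sg + L) p q)
  (lF F z.1 z.2 * (jf 1 sg L z.1 * bump2 tau z.2)).

Lemma rcont_side L tau (z : R * R) : rcont (fun z : R * R => jf 1 sg L z.1 * bump2 tau z.2) z.
Proof.
have cJ x : rcont (jf 1 sg L) x by exact: rder_continuous (rder_jf 1 sg L x).
apply: rcontM; first by apply: rcont_comp; [exact: (cJ z.1)|exact: cvg_fst].
by apply: rcont_comp; [exact: (@cont_bump2 R tau z.2)|exact: cvg_snd].
Qed.

Lemma sideintS zs G L tau p q : factors F zs G -> nonvan G p q ->
  sideint L (tau + 1) p q = - sideint L tau p q.
Proof.
move=> [hG FE] G0; rewrite /sideint -RintegralN; [|exact: mrect|].
  by apply: eq_Rintegral => z _; rewrite bump2S !mulrN.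
have G0' z : rect sg (sg + L) p q z -> G 0%N (z.1 +i* z.2) != 0.
  move=> [/=]; rewrite !in_itv/= => /andP[h1 _] h2; apply: G0 => //.
  by apply: le_trans h1; lra.
exact: (rint_lF_mul hF hG FE G0' (@rcont_side L tau)).
Qed.

Lemma jf_1_le L x : 0 < L -> sg <= x <= sg + L -> `|jf 1 sg L x| <= 1 + (x - sg).
Proof.
move=> L_gt0 /andP[x1 x2]; rewrite ger0_norm; last exact: jf_ge0.
rewrite /jf expr1; set u := (x - sg) / L.
have u0 : 0 <= u by rewrite divr_ge0 ?subr_ge0// ltW.
have u1 : u <= 1 by rewrite ler_pdivrMr// mul1r; lra.
have : (x - sg) * (1 - u) ^+ 2 <= (x - sg) * 1.
  by rewrite ler_wpM2l ?subr_ge0// expr_le1//; lra.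
lra.
Qed.

Lemma jf2_1_le L x : 0 < L -> sg <= x <= sg + L -> `|jf2 1 sg L x| <= 4 / L.
Proof.
move=> L_gt0 /andP[x1 x2].
(* In [u = (x - sg) / L], which runs over the unit interval, the second derivative is
   [(6 u - 4) / L]; this makes the term [a'' b] disappear as L grows. *)
have -> : jf2 1 sg L x = (6 * ((x - sg) / L) - 4) / L.
  by rewrite /jf2 /=; field; rewrite lt0r_neq0.
have Li : 0 <= L^-1 by rewrite invr_ge0 ltW.
rewrite normrM (ger0_norm Li) ler_pM2r ?invr_gt0//.
set u := (x - sg) / L.
have u0 : 0 <= u by rewrite divr_ge0 ?subr_ge0// ltW.
have u1 : u <= 1 by rewrite ler_pdivrMr// mul1r; lra.
by rewrite ler_norml; apply/andP; split; lra.
Qed.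

(** [log_green] with the weight [jf 1], whose slope at [sg] is 1, so that the line integral appears
    with coefficient 1. The right-hand side of the third estimate is the term [a'' b]. *)
Lemma bump_identity : exists2 CV, 0 <= CV & forall tau zs G L, 0 <= tau ->
  factors F zs G -> nonvan G (tau - 1) (tau + 1) -> L0 <= L ->
  [/\ `|sideint L tau (tau - 1) tau| <= CV * Lam tau,
      `|sideint L tau tau (tau + 1)| <= CV * Lam tau &
   `|\int[mu]_(t in `[tau - 1, tau + 1]) (bumpf tau t * lF F sg t) +
     sideint L tau (tau - 1) tau + sideint L tau tau (tau + 1)
     - 2 * pi * zsum L tau zs| <= CV / L * Lam tau].
Proof.
have [CV CV0 HV] := area_bound.
exists (8 * CV); first by rewrite mulr_ge0.
move=> tau zs G L ht fz G0 LL; have [hG FE] := fz.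
have L_gt0 : 0 < L by move: LL; rewrite /L0; have := S1sg; lra.
have A := HV tau zs G L ht fz G0 LL.
set p := tau - 1 in A G0 *; set q := tau + 1 in A G0 *.
have pq : p <= q by rewrite /p /q; lra.
have pt : p <= tau by rewrite /p; lra.
have tq : tau <= q by rewrite /q; lra.
have sY : sg <= sg + L by rewrite lerDl ltW.
have G0' z : rect sg (sg + L) p q z -> G 0%N (z.1 +i* z.2) != 0.
  move=> [/=]; rewrite !in_itv/= => /andP[h1 _] h2; apply: G0 => //.
  by apply: le_trans h1; lra.
have iM phi : (forall z, rcont phi z) -> rint mu2 (rect sg (sg + L) p q)
    (fun z => lF F z.1 z.2 * phi z) by exact: (rint_lF_mul hF hG FE G0').
have cB : continuous (bumpf tau) by move=> t; exact: rder_continuous (rder_bump tau t).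
have c1 z : rcont (fun z : R * R => jf2 1 sg L z.1 * bumpf tau z.2) z.
  apply: rcontM; first by apply: rcont_comp; [exact: (@cont_jf2 R 1 sg L z.1)|exact: cvg_fst].
  by apply: rcont_comp; [exact: (cB z.2)|exact: cvg_snd].
have i1 := iM _ c1; have i2 := iM _ (@rcont_side L tau).
have iA : rint mu2 (rect sg (sg + L) p q) (fun z => (1 + (z.1 - sg)) * `|lF F z.1 z.2|).
  have c : forall z : R * R, rcont (fun z : R * R => 1 + (z.1 - sg)) z.
    move=> z; apply: rcontD; first exact: rcont_cst.
    by apply: rcontB; [exact: cvg_fst|exact: rcont_cst].
  have h := rint_norm (iM _ c).
  apply: (@rint_dom _ _ _ mu2 _ _ _ _ _ _ h); first exact: mrect.
    apply: measurable_funM.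
      by apply: cont2_measurable; [exact: mrect|move=> z _; exact: c].
    by have := rint_meas (rint_norm (cont_rint_lF hF hG FE G0')).
  by move=> z _; rewrite !normrM normr_id mulrC.
have bnd p' q' : p <= p' -> q' <= q -> `|sideint L tau p' q'| <= 8 * CV * Lam tau.
  move=> pp qq; have sub : rect sg (sg + L) p' q' `<=` rect sg (sg + L) p q.
    move=> z [h1 /=]; rewrite !in_itv/= => /andP[h2 h3]; split => //=.
    by rewrite in_itv/= (le_trans pp)// (le_trans h3).
  have j2 : rint mu2 (rect sg (sg + L) p' q')
      (fun z => lF F z.1 z.2 * (jf 1 sg L z.1 * bump2 tau z.2)).
    by apply: (@rint_sub _ _ _ mu2 _ _ _ _ _ sub i2); exact: mrect.
  have jA := @rintZ _ _ _ mu2 _ _ 8 (mrect _ _ _ _) iA.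
  have jN := rint_norm i2.
  apply: (@le_trans _ _ (\int[mu2]_(z in rect sg (sg + L) p' q')
    `|lF F z.1 z.2 * (jf 1 sg L z.1 * bump2 tau z.2)|)).
    by apply: (Rintegral_bound (mrect _ _ _ _) j2 (rint_norm j2)) => z _.
  have jN' := rint_norm j2.
  rewrite -(Rint_patchS mu2 _ sub).
  have jP := rint_patchS (mrect _ _ _ _) (mrect _ _ _ _) sub jN'.
  apply: (@le_trans _ _ (\int[mu2]_(z in rect sg (sg + L) p q)
      (8 * ((1 + (z.1 - sg)) * `|lF F z.1 z.2|)))); last first.
    by rewrite (RintegralZl _ (mrect _ _ _ _) iA) -mulrA ler_wpM2l.
  apply: le_Rintegral => //; first exact: mrect.
  move=> z [/=]; rewrite !in_itv/= => z1 z2.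
  have J := jf_1_le L_gt0 z1; have B := bump2_le tau z.2.
  have z0 : 0 <= 1 + (z.1 - sg) by have /andP[] := z1; lra.
  have B2 : `|lF F z.1 z.2 * (jf 1 sg L z.1 * bump2 tau z.2)| <=
      8 * ((1 + (z.1 - sg)) * `|lF F z.1 z.2|).
    rewrite normrM (normrM (jf _ _ _ _)).
    have -> : 8 * ((1 + (z.1 - sg)) * `|lF F z.1 z.2|) =
      `|lF F z.1 z.2| * ((1 + (z.1 - sg)) * 8) by ring.
    by apply: ler_wpM2l => //; apply: ler_pM.
  rewrite /patch; case: ifP => [_|_]; first exact: B2.
  have -> : point = 0 :> R by [].
  by apply: le_trans B2.
split; [exact: bnd|exact: bnd|].
have [e1 e2 e3 e4] := bump_end tau.
have [aY a1Y] := jf_end 1 sg L_gt0.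
have E := log_green hF hG FE (rder_jf 1 sg L) (rder_jf1 1 sg L) (@cont_jf2 R 1 sg L)
  (rder_bump tau) (rder_bump1 tau) (@cont_bump2 R tau) sY pq
  (jf_start _ _ _) aY a1Y e1 e2 e3 e4 G0'.
rewrite jf1_start mul1r -/(zsum L tau zs) in E; rewrite -E.
set I1 := \int[mu]_(t in _) _.
have -> : \int[mu2]_(z in rect sg (sg + L) p q)
     (lF F z.1 z.2 * lap2 (jf 1 sg L) (jf2 1 sg L) (bumpf tau) (bump2 tau) z) =
   \int[mu2]_(z in rect sg (sg + L) p q) (lF F z.1 z.2 * (jf2 1 sg L z.1 * bumpf tau z.2)) +
   (sideint L tau p tau + sideint L tau tau q).
  rewrite -(Rint_split_rect pt tq i2) -(RintegralD (mrect _ _ _ _) i1 i2).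
  by apply: eq_Rintegral => z _; rewrite /lap2 mulrDr.
set I2 := \int[mu2]_(z in _) _.
have -> : I1 + sideint L tau p tau + sideint L tau tau q -
    (I2 + (sideint L tau p tau + sideint L tau tau q) + I1) = - I2 by ring.
rewrite normrN.
have jA := @rintZ _ _ _ mu2 _ _ (4 / L) (mrect _ _ _ _) iA.
apply: (@le_trans _ _ (\int[mu2]_(z in rect sg (sg + L) p q)
      (4 / L * ((1 + (z.1 - sg)) * `|lF F z.1 z.2|)))).
  apply: (Rintegral_bound (mrect _ _ _ _) i1 jA).
  move=> z [/=]; rewrite !in_itv/= => z1 z2.
  have J := jf2_1_le L_gt0 z1.
  have z0 : 1 <= 1 + (z.1 - sg) by have /andP[] := z1; lra.
  rewrite normrM (normrM (jf2 _ _ _ _)) (ger0_norm (bump_ge0 _ _)).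
  have B := bump_le1 tau z.2; have b0 := bump_ge0 tau z.2.
  have h1 : `|jf2 1 sg L z.1| * bumpf tau z.2 <= 4 / L * 1 by apply: ler_pM.
  have L4 : 0 <= 4 / L by rewrite divr_ge0// ltW.
  have h2 : `|lF F z.1 z.2| * (`|jf2 1 sg L z.1| * bumpf tau z.2) <= `|lF F z.1 z.2| * (4 / L).
    by rewrite ler_wpM2l//; lra.
  apply: (le_trans h2); rewrite mulrC ler_wpM2l// ler_peMl//.
rewrite (RintegralZl _ (mrect _ _ _ _) iA).
have L4 : 0 <= 4 / L by rewrite divr_ge0// ltW.
apply: (le_trans (ler_wpM2l L4 A)).
have l1 : 1 <= Lam tau by apply: Lam_ge1; lra.
have : 0 <= 4 / L * (CV * Lam tau) by rewrite !mulr_ge0//; lra.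
have -> : 8 * CV / L * Lam tau = 2 * (4 / L * (CV * Lam tau)) by ring.
lra.
Qed.

End BumpIdentity.

(** * Adding up the windows *)

Section Telescope.
Context {R : realType}.
Local Notation mu := (@lebesgue_measure R).
Implicit Types (x t tau s L : R).

Definition cbump tau t : R := bumpf tau (clamp (tau - 1) (tau + 1) t).

Lemma cbump_ge0 tau t : 0 <= cbump tau t. Proof. exact: bump_ge0. Qed.
Lemma cbump_le1 tau t : cbump tau t <= 1. Proof. exact: bump_le1. Qed.

Lemma cbump_left tau t : t <= tau - 1 -> cbump tau t = 0.
Proof. by move=> h; rewrite /cbump clampL//; have [] := bump_end tau. Qed.

Lemma cbump_right tau t : tau + 1 <= t -> cbump tau t = 0.
Proof.
move=> h; rewrite /cbump clampR//; last lra.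
by have [] := bump_end tau.
Qed.

Lemma cbumpS tau t : tau <= t <= tau + 1 -> cbump tau t + cbump (tau + 1) t = 1.
Proof. by move=> /andP[h1 h2]; rewrite /cbump !clampM; [exact: bumpfS|lra|lra|lra|lra]. Qed.

Variable t0 : R.
Let tk (j : nat) : R := t0 + j%:R.

Let tkS j : tk j.+1 = tk j + 1.
Proof. by rewrite /tk -addn1 natrD addrA. Qed.

Let tk_ge j : t0 <= tk j. Proof. by rewrite /tk lerDl. Qed.

Definition bumpsum (n : nat) t : R := \sum_(j < n.+1) cbump (t0 + j%:R) t.

(** Consecutive windows overlap by half and add up to 1 on the overlap; outside the range from [t0]
    to [t0 + n] only the outer half of an end window is left. *)
Lemma bumpsumP n t :
  [/\ t <= t0 -> bumpsum n t = cbump t0 t, t0 <= t <= t0 + n%:R -> bumpsum n t = 1 &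
      t0 + n%:R <= t -> bumpsum n t = cbump (t0 + n%:R) t].
Proof.
elim: n => [|n [ih1 ih2 ih3]].
  rewrite /bumpsum big_ord_recl big_ord0 !addr0; split => // h.
  have -> : t = t0 by apply/eqP; rewrite eq_le andbC.
  by rewrite /cbump clampM; [rewrite /bumpf subrr mulr0 cos0 expr1n|lra|lra].
have E : bumpsum n.+1 t = bumpsum n t + cbump (tk n + 1) t.
  by rewrite {1}/bumpsum big_ord_recr /= -tkS.
rewrite E -/(tk n.+1) tkS; move: (tk_ge n) ih2 ih3; rewrite -/(tk n).
move: (tk n) => u tn ih2 ih3.
split=> [h|/andP[h1 h2]|h].
- by rewrite ih1// (@cbump_left (u + 1)) ?addr0//; lra.
- have [h3|h3] := leP t u.
    by rewrite ih2 ?h1// (@cbump_left (u + 1)) ?addr0//; lra.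
  by rewrite ih3 ?ltW// cbumpS// h2 ltW.
- by rewrite ih3 ?(@cbump_right u) ?add0r//; lra.
Qed.

Lemma bumpsum_itv n t : 0 <= bumpsum n t <= 1.
Proof.
have [h1 h2 h3] := bumpsumP n t.
have [h|/ltW h] := leP t t0; first by rewrite h1// cbump_ge0 cbump_le1.
have [h'|/ltW h'] := leP (t0 + n%:R) t; first by rewrite h3// cbump_ge0 cbump_le1.
by rewrite h2 ?h// ler01 lexx.
Qed.

Variables (F : nat -> R[i] -> R[i]) (sg : R).
Hypothesis hF : hol F.

Lemma rint_bump_line zs G s p q tau : factors F zs G -> (forall t, p <= t <= q -> G 0%N (s +i* t) != 0) ->
  rint mu `[p, q] (fun t => bumpf tau t * lF F s t).
Proof.
move=> [hG FE] G0; apply: (rint_lF_line_mul hF hG FE G0) => t.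
exact: rder_continuous (rder_bump tau t).
Qed.

Lemma line_telescope zs G n : factors F zs G -> nonvan sg G (t0 - 1) (t0 + n%:R + 1) ->
  \sum_(j < n.+1) \int[mu]_(t in `[t0 + j%:R - 1, t0 + j%:R + 1])
     (bumpf (t0 + j%:R) t * lF F sg t) =
  \int[mu]_(t in `[t0 - 1, t0]) (bumpf t0 t * lF F sg t) +
  \int[mu]_(t in `[t0, t0 + n%:R]) lF F sg t +
  \int[mu]_(t in `[t0 + n%:R, t0 + n%:R + 1]) (bumpf (t0 + n%:R) t * lF F sg t).
Proof.
move=> fz; have [hG FE] := fz.
have sg1 : sg - 1 <= sg by lra.
elim: n => [|n ih] G0.
  rewrite big_ord_recl big_ord0 !addr0 set_itv1 Rintegral_set1 addr0.
  apply: Rint_split; [lra|lra|].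
  by apply: rint_bump_line fz _ => t h; apply: G0 => //; rewrite addr0.
rewrite big_ord_recr /= ih; last first.
  move=> x t x1 /andP[x2 x3]; apply: G0 => //; rewrite x2 (le_trans x3)//.
  by rewrite -/(tk n.+1) -/(tk n) tkS; lra.
move: G0; rewrite -!/(tk n.+1) -!/(tk n) !tkS => G0; have tn := tk_ge n.
have i1 tau p q : t0 - 1 <= p -> q <= tk n + 1 + 1 ->
    rint mu `[p, q] (fun t => bumpf tau t * lF F sg t).
  move=> h1 h2; apply: rint_bump_line fz _ => t /andP[h3 h4].
  by apply: G0 => //; apply/andP; split; lra.
have i2 p q : t0 - 1 <= p -> q <= tk n + 1 + 1 -> rint mu `[p, q] (fun t => lF F sg t).
  move=> h1 h2; apply: (cont_rint_lF_line hF hG FE) => t /andP[h3 h4].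
  by apply: G0 => //; apply/andP; split; lra.
rewrite (_ : tk n + 1 - 1 = tk n); last by ring.
rewrite (@Rint_split _ (tk n) (tk n + 1) (tk n + 1 + 1)); [|lra|lra|apply: i1; lra].
rewrite (@Rint_split _ t0 (tk n) (tk n + 1)); [|lra|lra|apply: i2; lra].
have -> : \int[mu]_(t in `[tk n, tk n + 1]) lF F sg t =
    \int[mu]_(t in `[tk n, tk n + 1]) (bumpf (tk n) t * lF F sg t) +
    \int[mu]_(t in `[tk n, tk n + 1]) (bumpf (tk n + 1) t * lF F sg t).
  rewrite -(RintegralD (mitv _) (i1 _ _ _ _ _) (i1 _ _ _ _ _)); try lra.
  by apply: eq_Rintegral => t _; rewrite -mulrDl bumpfS mul1r.
by ring.
Qed.

(** On the strip between two consecutive centres, the upper half of one window meets the lower half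
    of the next, with opposite [b'']; what survives is the lower half of the first and the upper
    half of the last. *)
Lemma side_telescope zs G n L : factors F zs G -> nonvan sg G (t0 - 1) (t0 + n%:R + 1) ->
  \sum_(j < n.+1) (sideint F sg L (t0 + j%:R) (t0 + j%:R - 1) (t0 + j%:R) +
     sideint F sg L (t0 + j%:R) (t0 + j%:R) (t0 + j%:R + 1)) =
  sideint F sg L t0 (t0 - 1) t0 +
  sideint F sg L (t0 + n%:R) (t0 + n%:R) (t0 + n%:R + 1).
Proof.
move=> fz; elim: n => [|n ih] G0; first by rewrite big_ord_recl big_ord0 !addr0.
rewrite big_ord_recr /= ih; last first.
  move=> x t x1 /andP[x2 x3]; apply: G0 => //; rewrite x2 (le_trans x3)//.
  by rewrite -/(tk n.+1) -/(tk n) tkS; lra.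
move: G0; rewrite -!/(tk n.+1) -!/(tk n) !tkS => G0; have tn := tk_ge n.
rewrite (_ : tk n + 1 - 1 = tk n); last by ring.
rewrite (sideintS hF L (tk n) fz); first by ring.
move=> x t x1 /andP[x2 x3]; apply: G0 => //; apply/andP; split; lra.
Qed.

Definition ypos (w : R[i]) := if sg < complex.Re w then complex.Re w - sg else 0.

Lemma ypos_ge0 w : 0 <= ypos w.
Proof. by rewrite /ypos; case: ifP => // h; rewrite subr_ge0 ltW. Qed.

(** With [u = y / L] the difference is [- y (2 u - u^2)]; it vanishes as L grows, though not
    uniformly in the zeros. *)
Lemma jf_ypos L w : 0 < L -> ypos w <= L ->
  `|jf 1 sg L (clamp sg (sg + L) (complex.Re w)) - ypos w| <= 2 * ypos w ^+ 2 / L.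
Proof.
move=> L0; rewrite /ypos; case: ifPn => [h1 h2|].
  rewrite clampM; [|exact: ltW|lra].
  rewrite /jf expr1; set y := complex.Re w - sg in h2 *; set u := y / L.
  have y0 : 0 < y by rewrite subr_gt0.
  have u0 : 0 <= u by rewrite divr_ge0 ?ltW.
  have u1 : u <= 1 by rewrite ler_pdivrMr// mul1r.
  have -> : 2 * y ^+ 2 / L = y * (2 * u) by rewrite /u; ring.
  have -> : y * (1 - u) ^+ 2 - y = - (y * (2 * u - u ^+ 2)) by ring.
  rewrite normrN ger0_norm; last by apply: mulr_ge0; [exact: ltW|nra].
  by rewrite ler_pM2l//; have := sqr_ge0 u; lra.
rewrite -leNgt => h _; rewrite clampL// jf_start subr0 normr0 expr0n/= mulr0 mul0r//.
Qed.

Lemma zsum_bumps n L zs : 0 < L -> (forall w, w \in zs -> ypos w <= L) ->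
  `|\sum_(j < n.+1) zsum sg L (t0 + j%:R) zs -
    \sum_(w <- zs) ypos w * bumpsum n (complex.Im w)| <=
  (\sum_(w <- zs) 2 * ypos w ^+ 2) / L.
Proof.
move=> L0 HL; rewrite /zsum exchange_big/= -sumrB.
apply: (le_trans (ler_norm_sum _ _ _)); rewrite mulr_suml !big_seq.
apply: ler_sum => w wz; rewrite -mulr_sumr -mulrBl normrM.
have /andP[b0 b1] := bumpsum_itv n (complex.Im w).
rewrite [`|bumpsum _ _|]ger0_norm//.
by apply: (le_trans (ler_piMr _ b1)) => //; apply: jf_ypos => //; exact: HL.
Qed.

(** The passage to the limit in L, for an error constant [E] that does not depend on L. *)
Lemma le_of_inv (X B E L1 : R) : (forall L, L1 <= L -> 0 < L -> X <= B + E / L) -> X <= B.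
Proof.
move=> H; apply/ler_addgt0Pr => e e0.
pose L := Num.max L1 ((`|E| + 1) / e).
have l0 : 0 < (`|E| + 1) / e by rewrite divr_gt0// ltr_wpDl.
have L0 : 0 < L by rewrite lt_max l0 orbT.
apply: (le_trans (H L _ L0)); first by rewrite le_max lexx.
rewrite lerD2l ler_pdivrMr//.
have : (`|E| + 1) / e <= L by rewrite le_max lexx orbT.
rewrite ler_pdivrMr// [L * e]mulrC => h; apply: le_trans h.
by have := ler_norm E; lra.
Qed.

End Telescope.

(** * The integral of log |F| over the line *)

Section LogIntegral.
Context {R : realType}.
Local Notation mu := (@lebesgue_measure R).
Implicit Types (x t tau s L : R).

Variables (F : nat -> R[i] -> R[i]) (sg A0 C k : R) (N : nat).
Hypothesis hF : hol F.
Hypothesis A00 : 0 <= A0.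
Hypothesis HA : forall x t, sg - 2 <= x -> -2 <= t ->
  cmod (F 0%N (x +i* t)) <= A0 * (t + 3) ^+ N.
Hypothesis C0 : 0 <= C.
Hypothesis k0 : 0 < k.
Hypothesis HB : forall x t, 2 <= x -> -2 <= t ->
  cmod (F 0%N (x +i* t) - 1) <= C * expR (- (k * x)).

Let S1 := s1 sg C k.
Let S1sg : sg + 1 <= S1. Proof. exact: s1_gesg. Qed.

Lemma zsum_ge0 L tau zs : 0 <= L -> 0 <= zsum sg L tau zs.
Proof.
move=> L0; apply: sumr_ge0 => w _; rewrite mulr_ge0 ?bump_ge0// jf_ge0//.
have h : sg <= sg + L by rewrite lerDl.
by have /andP[] := clamp_itv (complex.Re w) h.
Qed.

Lemma rint_bump_norm zs G p q tau : factors F zs G -> nonvan sg G p q ->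
  rint mu `[p, q] (fun t => bumpf tau t * `|lF F sg t|).
Proof.
move=> fz G0; have [hG FE] := fz.
have sg1 : sg - 1 <= sg by lra.
have G0' t : p <= t <= q -> G 0%N (sg +i* t) != 0 by exact: G0.
have i1 := rint_bump_line hF tau fz G0'.
have il := cont_rint_lF_line hF hG FE G0'.
apply: (@rint_dom _ _ _ mu _ _ _ _ _ _ (rint_norm i1)); first exact: mitv.
  apply: measurable_funM; last exact: (rint_meas (rint_norm il)).
  apply: measurable_funTS; apply: continuous_measurable_fun => t.
  exact: rder_continuous (rder_bump tau t).
by move=> t _; rewrite !normrM normr_id.
Qed.

(** As in [area_L1]: [lF] is bounded above on the line, and [bump_identity], at one fixed admissible
    L, bounds its weighted integral below because the sum over zeros is nonnegative. *)
Lemma line_bound : exists2 CL, 0 <= CL & forall tau zs G, 0 <= tau ->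
  factors F zs G -> nonvan sg G (tau - 1) (tau + 1) ->
  \int[mu]_(t in `[tau - 1, tau + 1]) (bumpf tau t * `|lF F sg t|) <= CL * Lam tau.
Proof.
have [CV CV0 HV] := bump_identity hF A00 HA C0 k0 HB.
pose L := s1 sg C k - sg + 1.
have L0 : 0 < L by have := S1sg; rewrite /L -/S1; lra.
have K1 : 0 <= K0 A0 N by have := K0_ge2 N A00; lra.
exists (4 * K0 A0 N + 2 * CV + CV / L).
  by rewrite !addr_ge0 ?mulr_ge0// invr_ge0 ltW.
move=> tau zs G ht fz G0; have [V1 V2 V3] := HV tau zs G L ht fz G0 (lexx _).
have sg1 : sg - 1 <= sg by lra.
set p := tau - 1 in V1 V3 G0 *; set q := tau + 1 in V2 V3 G0 *.
have pq : p <= q by rewrite /p /q; lra.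
have i1 : rint mu `[p, q] (fun t => bumpf tau t * lF F sg t).
  by apply: (rint_bump_line hF tau fz) => t h; exact: G0.
have i2 : rint mu `[p, q] (fun t => bumpf tau t * `|lF F sg t|).
  exact: rint_bump_norm fz G0.
have l1 : 1 <= Lam tau by apply: Lam_ge1; lra.
have ic : rint mu `[p, q] (fun=> 2 * (K0 A0 N * Lam tau)).
  by apply: rint_cont => t _; exact: rcont_cst.
have B : \int[mu]_(t in `[p, q]) (bumpf tau t * `|lF F sg t|) <=
    \int[mu]_(t in `[p, q]) (2 * (K0 A0 N * Lam tau) - bumpf tau t * lF F sg t).
  apply: le_Rintegral; [exact: mitv|exact: i2|exact: (rintB (mitv _) ic i1)|].
  move=> t /=; rewrite in_itv/= => tt.
  have t1 : -1 <= tau by lra.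
  have sg2 : sg - 2 <= sg by lra.
  have u := left_lF A00 HA t1 sg2 tt.
  have KL : 0 <= K0 A0 N * Lam tau by rewrite mulr_ge0//; lra.
  have h : `|lF F sg t| + lF F sg t <= 2 * (K0 A0 N * Lam tau).
    have : `|lF F sg t| <= 2 * (K0 A0 N * Lam tau) - lF F sg t.
      by rewrite ler_norml; apply/andP; split; lra.
    lra.
  have h0 : 0 <= `|lF F sg t| + lF F sg t by have := ler_norm (- lF F sg t); rewrite normrN; lra.
  have b0 := bump_ge0 tau t; have b1 := bump_le1 tau t.
  have : bumpf tau t * (`|lF F sg t| + lF F sg t) <= 1 * (2 * (K0 A0 N * Lam tau)) by apply: ler_pM.
  lra.
apply: (le_trans B); rewrite (RintegralB (mitv _) ic i1) Rint_cst_itv//.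
move: V3; set I1 := \int[mu]_(t in _) _; set U1 := sideint _ _ _ _ _ _ in V1 *.
set U2 := sideint _ _ _ _ _ _ in V2 *.
move=> V3; have Z0 := zsum_ge0 tau zs (ltW L0).
have P0 := @pi_ge0 R; have Z1 : 0 <= 2 * pi * zsum sg L tau zs by rewrite !mulr_ge0.
move: V3 V1 V2; rewrite !ler_norml => /andP[a1 a2] /andP[a3 a4] /andP[a5 a6].
have -> : q - p = 2 by rewrite /q /p; ring.
lra.
Qed.

(** Two consecutive windows add up to 1 on the interval between their centres. *)
Lemma line_bound1 : exists2 CL, 0 <= CL & forall tau zs G, 0 <= tau ->
  factors F zs G -> nonvan sg G (tau - 1) (tau + 2) ->
  \int[mu]_(t in `[tau, tau + 1]) `|lF F sg t| <= CL * Lam (tau + 1).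
Proof.
have [CL CL0 HL] := line_bound.
exists (2 * CL); first by rewrite mulr_ge0.
move=> tau zs G ht fz G0; have [hG FE] := fz.
have sg1 : sg - 1 <= sg by lra.
have n1 : nonvan sg G (tau - 1) (tau + 1).
  by move=> x t x1 /andP[t1 t2]; apply: G0 => //; apply/andP; split; lra.
have n2 : nonvan sg G (tau + 1 - 1) (tau + 1 + 1).
  by move=> x t x1 /andP[t1 t2]; apply: G0 => //; apply/andP; split; lra.
have ht1 : 0 <= tau + 1 by lra.
have H1 := HL _ _ _ ht fz n1; have H2 := HL _ _ _ ht1 fz n2.
have e1 : tau + 1 - 1 = tau by ring.
move: H2; rewrite e1 => H2.
have il p q : tau - 1 <= p -> q <= tau + 2 -> rint mu `[p, q] (fun t => lF F sg t).
  move=> h1 h2; apply: (cont_rint_lF_line hF hG FE) => t /andP[h3 h4].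
  by apply: G0 => //; apply/andP; split; lra.
have ib s p q : tau - 1 <= p -> q <= tau + 2 -> rint mu `[p, q] (fun t => bumpf s t * `|lF F sg t|).
  move=> h1 h2; apply: rint_bump_norm fz _ => x t x1 /andP[h3 h4].
  by apply: G0 => //; apply/andP; split; lra.
have g0 s p q : 0 <= \int[mu]_(t in `[p, q]) (bumpf s t * `|lF F sg t|).
  by apply: Rintegral_ge0 => t _; rewrite mulr_ge0// bump_ge0.
have HLm : CL * Lam tau <= CL * Lam (tau + 1) by rewrite ler_wpM2l//; apply: Lam_le; lra.
have u1 : tau - 1 <= tau by lra.
have u2 : tau <= tau + 1 by lra.
have u3 : tau + 1 <= tau + 2 by lra.
have u4 : tau + 1 + 1 <= tau + 2 by lra.
have u5 : tau + 1 <= tau + 1 + 1 by lra.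
have E : \int[mu]_(t in `[tau, tau + 1]) `|lF F sg t| =
    \int[mu]_(t in `[tau, tau + 1]) (bumpf tau t * `|lF F sg t|) +
    \int[mu]_(t in `[tau, tau + 1]) (bumpf (tau + 1) t * `|lF F sg t|).
  rewrite -(RintegralD (mitv _) (ib tau _ _ u1 u3) (ib (tau + 1) _ _ u1 u3)).
  by apply: eq_Rintegral => t _; rewrite -mulrDl bumpfS mul1r.
rewrite E.
have X1 := Rint_split u1 u2 (ib tau _ _ (lexx _) u3).
have X2 := Rint_split u2 u5 (ib (tau + 1) _ _ u1 u4).
have G1 := g0 tau (tau - 1) tau; have G2 := g0 (tau + 1) (tau + 1) (tau + 1 + 1).
rewrite X1 in H1; rewrite X2 in H2; apply: le_trans (_ : CL * Lam tau + CL * Lam (tau + 1) <= _); last by rewrite mulrDl mul1r mulrDl lerD2r.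
apply: lerD; first by apply: le_trans H1; rewrite lerDr.
by apply: le_trans H2; rewrite lerDl.
Qed.

Lemma bump_line_le tau zs G p q : factors F zs G -> nonvan sg G (tau - 1) (tau + 1) ->
  tau - 1 <= p -> q <= tau + 1 ->
  `|\int[mu]_(t in `[p, q]) (bumpf tau t * lF F sg t)| <=
  \int[mu]_(t in `[tau - 1, tau + 1]) (bumpf tau t * `|lF F sg t|).
Proof.
move=> fz nvt h2 h4; have sg1 : sg - 1 <= sg by lra.
have i1 p' q' : tau - 1 <= p' -> q' <= tau + 1 -> rint mu `[p', q'] (fun t => bumpf tau t * lF F sg t).
  move=> k1 k2; apply: (rint_bump_line hF tau fz) => t /andP[k3 k4].
  by apply: nvt => //; rewrite (le_trans k1 k3) (le_trans k4 k2).
have e t : bumpf tau t * `|lF F sg t| = `|bumpf tau t * lF F sg t|.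
  by rewrite normrM (ger0_norm (bump_ge0 _ _)).
under [X in _ <= X]eq_Rintegral do rewrite e.
have sub : `[p, q]%classic `<=` `[tau - 1, tau + 1]%classic.
  by move=> t /=; rewrite !in_itv/= => /andP[k1 k2]; rewrite (le_trans h2 k1) (le_trans k2 h4).
have ip := rint_norm (i1 p q h2 h4).
apply: (@le_trans _ _ (\int[mu]_(t in `[p, q]) `|bumpf tau t * lF F sg t|)).
  by apply: (Rintegral_bound (mitv _) (i1 _ _ h2 h4) ip).
rewrite -(Rint_patchS mu _ sub); apply: le_Rintegral.
- exact: mitv.
- exact: rint_patchS (mitv _) (mitv _) sub ip.
- exact: rint_norm (i1 _ _ (lexx _) (lexx _)).
- by move=> t _; rewrite /patch; case: ifP => // _; exact: normr_ge0.
Qed.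

Lemma window_facts (a b T : R) : 1 <= a -> a <= b -> b <= T -> T < b + 1 ->
  [/\ 0 <= a, 0 <= b, -1 <= a - 1, a + 1 <= T + 2 & a - 1 <= a] /\
  [/\ a <= a + 1, -1 <= b - 1, b - 1 <= b, b <= b + 1 & b + 2 <= T + 2] /\
  [/\ -1 <= b, T <= T + 2, -1 <= a & b + 1 <= T + 2] /\
  [/\ Lam a <= Lam (b + 1), Lam b <= Lam (b + 1) & Lam (b + 1) <= 1 + ln (T + 5)].
Proof.
move=> h1 h2 h3 h4; split; first by split; lra.
split; first by split; lra.
split; first by split; lra.
split; [by apply: Lam_le; lra|by apply: Lam_le; lra|].
rewrite /Lam lerD2l ler_ln ?posrE; lra.
Qed.

Lemma zero_re_lt zs G w : factors F zs G -> w \in zs -> -2 <= complex.Im w -> complex.Re w < S1.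
Proof.
move=> fz wz iw; rewrite ltNge; apply/negP => h.
have /andP[] := right_half C0 k0 HB h iw.
have -> : (complex.Re w +i* complex.Im w) = w by case: w {wz iw h}.
have [_ FE] := fz.
rewrite FE (big_rem w)//= subrr !mul0r cmod0.
by rewrite leNgt invr_gt0 ltr0n.
Qed.

Lemma norm_combine1 (A u v y z c e f : R) : `|A + (u + v) - y| <= e -> `|u| <= c -> `|v| <= c ->
  `|y - z| <= f -> `|A - z| <= 2 * c + (e + f).
Proof.
rewrite !ler_norml => /andP[a1 a2] /andP[a3 a4] /andP[a5 a6] /andP[a7 a8].
by apply/andP; split; lra.
Qed.

Lemma norm_combine2 (a b c d u v w r y z : R) : `|u| <= a -> `|v| <= a -> `|r| <= b ->
  `|u + w + v - y| <= c -> `|y - z| <= d -> `|w + r - z| <= 2 * a + b + c + d.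
Proof.
rewrite !ler_norml => /andP[a1 a2] /andP[a3 a4] /andP[a5 a6] /andP[a7 a8] /andP[a9 a10].
by apply/andP; split; lra.
Qed.

Variable t0 : R.
Hypothesis t01 : 1 <= t0.

Let good T (w : R[i]) := [&& sg < complex.Re w, 0 < complex.Im w & complex.Im w <= T].

(** The sum of the windows differs from the indicator of the heights in ]0, T] only between 0 and
    [t0], covered by a fixed number of cells, and between [tn] and [tn + 1], covered by two cells.
    Each cell holds a number of zeros bounded by [count_cell], and each zero counts for at most
    [S1 - sg]. *)
Lemma zeros_vs_bumps : exists2 CZ, 0 <= CZ & forall n T zs G, factors F zs G ->
  t0 + n%:R <= T -> T < t0 + n%:R + 1 ->
  `|\sum_(w <- zs) ypos sg w * bumpsum t0 n (complex.Im w) -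
    \sum_(w <- zs | good T w) (complex.Re w - sg)| <= CZ * Lam (t0 + n%:R + 1).
Proof.
have [CC CC0 HC] := count_cell A00 HA C0 k0 HB.
pose J := (Num.truncn (t0 + 1)).
pose SJ := \sum_(j < J.+1) Lam (j%:R : R).
have SJ0 : 0 <= SJ.
  apply: sumr_ge0 => j _; apply: (@le_trans _ _ 1) => //; apply: Lam_ge1.
  by apply: (@le_trans _ _ 0) => //; rewrite lerN10.
have D0 : 0 <= S1 - sg by have := S1sg; lra.
exists ((S1 - sg) * (CC * (SJ + 2))); first by rewrite !mulr_ge0// addr_ge0.
have t1 : 1 <= t0 by exact: t01.
move=> n T zs G fz Tn Tn1; set tn := t0 + n%:R in Tn Tn1 *.
have tn0 : t0 <= tn by rewrite /tn lerDl.
pose cell := in_cell sg C k.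
have pw w : w \in zs ->
  `|ypos sg w * bumpsum t0 n (complex.Im w) - (if good T w then complex.Re w - sg else 0)| <=
  (S1 - sg) * (\sum_(j < J.+1) (cell j%:R w : nat)%:R + (cell tn w : nat)%:R + (cell (tn + 1) w : nat)%:R).
  move=> wz; have s0 : 0 <= \sum_(j < J.+1) (cell j%:R w : nat)%:R :> R by exact: sumr_ge0.
  have RHS0 : 0 <= (S1 - sg) * (\sum_(j < J.+1) (cell j%:R w : nat)%:R + (cell tn w : nat)%:R + (cell (tn + 1) w : nat)%:R).
    by rewrite mulr_ge0// !addr_ge0.
  rewrite /ypos /good; case: (ltP sg (complex.Re w)) => [hs|_] /=; last by rewrite mul0r subr0 normr0.
  have -> : (if (0 < complex.Im w) && (complex.Im w <= T) then complex.Re w - sg else 0) =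
     (complex.Re w - sg) * ((0 < complex.Im w) && (complex.Im w <= T) : nat)%:R.
    by case: ifP; rewrite ?mulr1 ?mulr0.
  rewrite -mulrBr.
  have [b1 b2 b3] := bumpsumP t0 n (complex.Im w); have /andP[b4 b5] := bumpsum_itv t0 n (complex.Im w).
  (* Here [1 <= t0] matters: the first window starts at [t0 - 1], so it gives no weight to zeros at
     height 0 or below. *)
  have [iw|iw] := leP (complex.Im w) 0.
    by rewrite b1 ?cbump_left ?subr0 ?mulr0 ?normr0//; lra.
  have fin : 1 <= \sum_(j < J.+1) (cell j%:R w : nat)%:R + (cell tn w : nat)%:R + (cell (tn + 1) w : nat)%:R :> R ->
    `|(complex.Re w - sg) * (bumpsum t0 n (complex.Im w) - (true && (complex.Im w <= T) : nat)%:R)| <=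
    (S1 - sg) * (\sum_(j < J.+1) (cell j%:R w : nat)%:R + (cell tn w : nat)%:R + (cell (tn + 1) w : nat)%:R).
    move=> h1; rewrite normrM; apply: ler_pM => //.
      have i2 : -2 <= complex.Im w by lra.
      by have := zero_re_lt fz wz i2; rewrite ger0_norm; lra.
    apply: le_trans h1; rewrite ler_norml; case: (true && _) => /=; apply/andP; split; lra.
  have wS : complex.Re w < S1 by apply: (zero_re_lt fz wz); lra.
  have cellP tau : tau - 2^-1 <= complex.Im w -> complex.Im w <= tau + 2^-1 -> cell tau w.
    by move=> h1 h2; rewrite /cell /in_cell -/S1 h1 h2 (ltW wS) !andbT; lra.
  have [it|it] := ltP (complex.Im w) t0.
    apply: fin; rewrite -addrA; apply: ler_wpDr; first by rewrite addr_ge0.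
    have h0 : 0 <= complex.Im w + 2^-1 by lra.
    pose j := Num.truncn (complex.Im w + 2^-1).
    have /andP[j1 j2] := truncn_itv h0; rewrite -/j in j1 j2.
    have jJ : (j < J.+1)%N by rewrite ltnS; apply: le_truncn; lra.
    rewrite (bigD1 (Ordinal jJ))//= cellP; first by rewrite lerDl sumr_ge0.
      by lra.
    by rewrite -[j.+1%:R]natr1 in j2; lra.
  have [in1|in1] := leP (complex.Im w) tn.
    by rewrite b2 ?it// (le_trans in1)//= subrr mulr0 normr0.
  have [in2|in2] := leP (complex.Im w) (tn + 1).
    apply: fin; rewrite -addrA; apply: ler_wpDl => //.
    have [in3|in3] := leP (complex.Im w) (tn + 2^-1).
      by rewrite cellP//; [rewrite lerDl|lra].
    by rewrite (cellP (tn + 1)); [rewrite lerDr|lra|lra].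
  rewrite b3 ?(ltW in1)// cbump_right ?(ltW in2)//.
  by rewrite (leNgt (complex.Im w)) (lt_trans Tn1 in2)//= subr0 mulr0 normr0.
rewrite [X in _ - X]big_mkcond/= -sumrB.
apply: (le_trans (ler_norm_sum _ _ _)); rewrite big_seq.
apply: (le_trans (ler_sum _ pw)); rewrite -big_seq -mulr_sumr -mulrA ler_wpM2l//.
rewrite !big_split/= exchange_big/=.
have cs tau : \sum_(w <- zs) (cell tau w : nat)%:R = (count (cell tau) zs)%:R :> R.
  by rewrite -natr_sum -sum1_count [in RHS]big_mkcond; congr (_%:R); apply: eq_bigr => w _; case: (cell _ _).
rewrite !cs; under eq_bigr do rewrite cs.
have m1 : -1 <= tn by lra.
have l0 := Lam_ge1 m1; have l1 : Lam tn <= Lam (tn + 1) by apply: Lam_le; lra.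
have c1 : (count (cell tn) zs)%:R <= CC * Lam (tn + 1).
  by apply: (le_trans (HC _ _ _ m1 fz)); rewrite ler_wpM2l.
have c2 : (count (cell (tn + 1)) zs)%:R <= CC * Lam (tn + 1).
  by apply: (HC _ _ _ _ fz); lra.
have c3 : \sum_(j < J.+1) (count (cell j%:R) zs)%:R <= CC * SJ * Lam (tn + 1).
  apply: (@le_trans _ _ (CC * SJ)).
    rewrite mulr_sumr; apply: ler_sum => j _; apply: (HC _ _ _ _ fz).
    by apply: (@le_trans _ _ 0) => //; rewrite lerN10.
  by rewrite ler_peMr ?mulr_ge0//; lra.
have -> : CC * (SJ + 2) * Lam (tn + 1) =
  CC * SJ * Lam (tn + 1) + CC * Lam (tn + 1) + CC * Lam (tn + 1) by ring.
by rewrite !lerD.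
Qed.

(** The list and the cofactor are chosen for the given T and are returned, because the sum over
    zeros and the integrability on the line are both read off from them. *)
Theorem log_integral : exists2 K, 0 <= K & forall T, t0 <= T -> exists zs G,
  [/\ factors F zs G, nonvan sg G (-1) T, rint mu `[t0, T] (fun t => lF F sg t) &
  `|\int[mu]_(t in `[t0, T]) lF F sg t -
    2 * pi * \sum_(w <- zs | good T w) (complex.Re w - sg)| <= K * (1 + ln (T + 5))].
Proof.
have [CV CV0 HV] := bump_identity hF A00 HA C0 k0 HB.
have [CL CL0 HL] := line_bound.
have [CM CM0 HM] := line_bound1.
have [CZ CZ0 HZ] := zeros_vs_bumps.
have P0 := @pi_ge0 R.
exists (2 * CL + CM + 2 * CV + 2 * pi * CZ).
  by rewrite !addr_ge0// !mulr_ge0.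
move=> T tT; have t0_1 : 1 <= t0 by exact: t01.
have T0 : 0 <= T - t0 by rewrite subr_ge0.
pose n := Num.truncn (T - t0).
have /andP[n1 n2] := truncn_itv T0; rewrite -/n in n1 n2.
rewrite -addn1 natrD in n2.
pose tn := t0 + n%:R.
have tn1 : tn <= T by rewrite /tn; lra.
have tn2 : T < tn + 1 by rewrite /tn; lra.
have t0n : t0 <= tn by rewrite /tn lerDl.
have [[t0_0 tn_0 h1 h2 h3] [[h4 h5 h6 h7 h8] [[h9 nT m1 tl] [lt0 ltn' lT]]]] :=
  window_facts t0_1 t0n tn1 tn2.
pose m := (Num.truncn (T + 2)).+1.
have mT : T + 2 <= m%:R by apply/ltW; exact: truncnS_gt.
have [zs [G [fz G0]]] := exists_factors hF A00 HA C0 k0 HB m.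
have [hG FE] := fz.
have nv p q : -1 <= p -> q <= T + 2 -> nonvan sg G p q.
  by move=> k1 k2 x t x1 /andP[t1 t2]; apply: G0 => //; rewrite (le_trans k1 t1) (le_trans t2 (le_trans k2 mT)).
have sg1 : sg - 1 <= sg by lra.
have il p q : -1 <= p -> q <= T + 2 -> rint mu `[p, q] (fun t => lF F sg t).
  by move=> k1 k2; apply: (cont_rint_lF_line hF hG FE) => t k3; apply: (nv _ _ k1 k2).
exists zs, G; split => //; [exact: nv|exact: il|].
have nvb : nonvan sg G (t0 - 1) (tn + 1) := nv _ _ h1 tl.
have nv0 : nonvan sg G (t0 - 1) (t0 + 1) := nv _ _ h1 h2.
have nvn : nonvan sg G (tn - 1) (tn + 1) := nv _ _ h5 tl.
have nvt : nonvan sg G (tn - 1) (tn + 2) := nv _ _ h5 h8.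
have iT := il _ _ h9 nT.
have iT1 := il _ _ h9 tl.
have i0 := il _ _ m1 nT.
have nrm tau p q : 0 <= tau -> nonvan sg G (tau - 1) (tau + 1) -> tau - 1 <= p -> p <= q ->
   q <= tau + 1 -> `|\int[mu]_(t in `[p, q]) (bumpf tau t * lF F sg t)| <= CL * Lam tau.
  move=> g0 g1 g2 g3 g4.
  exact: le_trans (bump_line_le fz g1 g2 g4) (HL tau zs G g0 fz g1).
pose Lm := Lam (tn + 1).
have tj_ge (j : nat) : 0 <= t0 + j%:R by rewrite addr_ge0.
have nvj (j : 'I_n.+1) : nonvan sg G (t0 + j%:R - 1) (t0 + j%:R + 1).
  have jn : t0 + j%:R <= tn by rewrite lerD2l ler_nat -ltnS.
  apply: nv; last by apply: le_trans tl; rewrite lerD2r.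
  by apply: (le_trans h1); rewrite lerD2r lerDl.
have LT := line_telescope hF fz nvb.
have LZ := HZ n T zs G fz tn1 tn2.
rewrite -/tn in LT LZ.
set Z := \sum_(w <- zs | good T w) _ in LZ *.
set YW := \sum_(w <- zs) _ * _ in LZ.
set A := \sum_(j < n.+1) _ in LT.
set I0 := \int[mu]_(t in `[t0 - 1, t0]) _ in LT.
set I1 := \int[mu]_(t in `[t0, tn]) _ in LT.
set I2 := \int[mu]_(t in `[tn, tn + 1]) _ in LT.
have B0 : `|I0| <= CL * Lm.
  apply: (@le_trans _ _ (CL * Lam t0)); [exact: nrm|by rewrite ler_wpM2l].
have B2 : `|I2| <= CL * Lm.
  apply: (@le_trans _ _ (CL * Lam tn)); [exact: nrm|by rewrite ler_wpM2l].
have B3 : `|\int[mu]_(t in `[tn, T]) lF F sg t| <= CM * Lm.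
  apply: le_trans (HM tn zs G tn_0 fz nvt).
  have sub : `[tn, T]%classic `<=` `[tn, tn + 1]%classic.
    by move=> t /=; rewrite !in_itv/= => /andP[-> k2]; rewrite (le_trans k2)// ltW.
  apply: (@le_trans _ _ (\int[mu]_(t in `[tn, T]) `|lF F sg t|)).
    by apply: (Rintegral_bound (mitv _) iT (rint_norm iT)).
  rewrite -(Rint_patchS mu _ sub); apply: le_Rintegral.
  - exact: mitv.
  - exact: rint_patchS (mitv _) (mitv _) sub (rint_norm iT).
  - exact: rint_norm iT1.
  - by move=> t _; rewrite /patch; case: ifP => // _; exact: normr_ge0.
have B4 : `|A - 2 * pi * YW| <= 2 * CV * Lm.
  (* The sum of all [ypos] exceeds each of them, so that every zero lies within distance L. Both
     [L1] and [E] depend on T and on the zeros, which is harmless since L tends to infinity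
     first. *)
  pose L1 := Num.max (s1 sg C k - sg + 1) (\sum_(w <- zs) ypos sg w).
  pose E := \sum_(j < n.+1) CV * Lam (t0 + j%:R) + 2 * pi * (\sum_(w <- zs) 2 * ypos sg w ^+ 2).
  apply: (@le_of_inv _ _ _ E L1) => L LL L_gt0.
  have LL0 : s1 sg C k - sg + 1 <= L by apply: le_trans LL; rewrite le_max lexx.
  have LLy w : w \in zs -> ypos sg w <= L.
    move=> wz; apply: le_trans LL; rewrite le_max; apply/orP; right.
    rewrite (big_rem w)//= lerDl; apply: sumr_ge0 => v _; exact: ypos_ge0.
  have ZB := zsum_bumps t0 n L_gt0 LLy; rewrite -/YW in ZB.
  have ST := side_telescope hF L fz nvb; rewrite -/tn in ST.
  set SZ := \sum_(j < n.+1) zsum _ _ _ _ in ZB.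
  have [V0 _ _] := HV t0 zs G L t0_0 fz nv0 LL0.
  have [_ Vn _] := HV tn zs G L tn_0 fz nvn LL0.
  have Bs : `|A + \sum_(j < n.+1) (sideint F sg L (t0 + j%:R) (t0 + j%:R - 1) (t0 + j%:R) +
     sideint F sg L (t0 + j%:R) (t0 + j%:R) (t0 + j%:R + 1)) - 2 * pi * SZ| <=
     (\sum_(j < n.+1) CV * Lam (t0 + j%:R)) / L.
    rewrite /A /SZ mulr_sumr -big_split/= -sumrB.
    apply: (le_trans (ler_norm_sum _ _ _)); rewrite mulr_suml; apply: ler_sum => j _.
    have [_ _ V] := HV _ zs G L (tj_ge j) fz (nvj j) LL0.
    by rewrite addrA [leRHS]mulrAC.
  rewrite ST in Bs.
  have V0' : `|sideint F sg L t0 (t0 - 1) t0| <= CV * Lm.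
    apply: (@le_trans _ _ (CV * Lam t0)); [exact: V0|by rewrite ler_wpM2l].
  have Vn' : `|sideint F sg L tn tn (tn + 1)| <= CV * Lm.
    apply: (@le_trans _ _ (CV * Lam tn)); [exact: Vn|by rewrite ler_wpM2l].
  have ZB' : `|2 * pi * SZ - 2 * pi * YW| <= 2 * pi * (\sum_(w <- zs) 2 * ypos sg w ^+ 2) / L.
    rewrite -mulrBr normrM ger0_norm ?mulr_ge0// -mulrA; apply: ler_wpM2l => //.
    by rewrite mulr_ge0.
  rewrite [E / L]mulrDl -(mulrA 2 CV Lm).
  exact: norm_combine1 Bs V0' Vn' ZB'.
(* The last piece, from [tn] to T, is shorter than 1 and is covered by [line_bound1]. *)
rewrite (@Rint_split _ t0 tn T)// -/I1.
have ZB : `|2 * pi * YW - 2 * pi * Z| <= 2 * pi * (CZ * Lm).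
  by rewrite -mulrBr normrM ger0_norm ?mulr_ge0// ler_wpM2l// mulr_ge0.
set I3 := \int[mu]_(t in `[tn, T]) _ in B3 *.
apply: (@le_trans _ _ ((2 * CL + CM + 2 * CV + 2 * pi * CZ) * Lm)); last first.
  by apply: ler_wpM2l => //; rewrite !addr_ge0// !mulr_ge0.

rewrite LT in B4; apply: le_trans (norm_combine2 B0 B2 B3 B4 ZB) _.
have -> : 2 * (CL * Lm) + CM * Lm + 2 * CV * Lm + 2 * pi * (CZ * Lm) =
  (2 * CL + CM + 2 * CV + 2 * pi * CZ) * Lm by ring.
by [].
Qed.

End LogIntegral.

(** * The line of integration *)

Section Line.
Context {R : realType}.
Local Notation mu := (@lebesgue_measure R).
Implicit Types (c u v t x : R) (s : R[i]).

Lemma sin_atan v : sin (atan v) = v * cos (atan v).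
Proof.
have c0 : cos (atan v) != 0 by rewrite gt_eqF// cos_gt0_pihalf// atan_gtNpi2 atan_ltpi2.
by apply: (mulIf (invr_neq0 c0)); rewrite -mulrA mulfV// mulr1; exact: atanK.
Qed.

Lemma tan_atan_inj v (y : R) : - (pi / 2) < y < pi / 2 -> tan y = v -> atan v = y.
Proof. by move=> h <-; rewrite tanK// in_itv. Qed.

(** These angles occur when a parallelogram with a side along 1 + i is seen from its centre, in the
    residue computation. With [y = atan (1/3)] they are [pi/4 + y] and [pi/2 - y]. *)
Lemma atan2D3 : atan 2 + atan 3 = 3 * (pi / 4) :> R.
Proof.
have P := @pi_gt0 R; set y := atan (3^-1 : R).
have y1 : y < pi / 4 by rewrite -atan1 lt_atan// invf_lt1// ltr1n.
have y0 : 0 < y by rewrite -(@atan0 R) lt_atan// invr_gt0.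
have cy : cos y != 0 by rewrite gt_eqF// cos_gt0_pihalf//; apply/andP; split; lra.
have c4 : cos (pi / 4) != 0 :> R by rewrite gt_eqF// cos_gt0_pihalf//; apply/andP; split; lra.
have -> : atan 2 = pi / 4 + y :> R.
  apply: tan_atan_inj; first by apply/andP; split; lra.
  by rewrite tanD// tan_piquarter atanK; field.
have -> : atan 3 = pi / 2 - y :> R.
  apply: tan_atan_inj; first by apply/andP; split; lra.
  rewrite /tan sinB cosB sin_pihalf cos_pihalf !mul1r !mul0r subr0 add0r.
  by rewrite sin_atan -/y invfM invrK mulrCA mulfV// mulr1.
by field.
Qed.

Definition lX c u : R[i] := (c + u) +i* u.
Definition lsq c u : R := (c + u) ^+ 2 + u ^+ 2.
(** The argument of the point [c + u (1 + i)] in closed form: a rotation by [pi / 4] makes the line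
    vertical, where the argument is an arctangent, smooth along the whole line. *)
Definition lth c u : R := atan (1 + 2 * u / c) - pi / 4.
Definition lL c u : R[i] := (2^-1 * ln (lsq c u)) +i* lth c u.

Lemma aux_lineE c u : aux_line c u = lX c u.
Proof. by apply: complex_ext; rewrite /aux_line /aux_direction /lX ?cReD ?cImD ?cReM ?cImM /=; ring. Qed.

Lemma lsq_ge c u : 0 < c -> c ^+ 2 / 2 <= lsq c u.
Proof. by move=> c0; rewrite /lsq; have := sqr_ge0 (c + 2 * u); nra. Qed.

Lemma lsq_gt0 c u : 0 < c -> 0 < lsq c u.
Proof. by move=> c0; apply: lt_le_trans (lsq_ge u c0); rewrite divr_gt0// exprn_gt0. Qed.

Lemma cmod_lX c u : cmod (lX c u) = Num.sqrt (lsq c u).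
Proof. by rewrite cmod_def. Qed.

Lemma lX_neq0 c u : 0 < c -> lX c u != 0.
Proof. by move=> c0; rewrite -cmod_gt0 cmod_lX sqrtr_gt0 lsq_gt0. Qed.

Lemma ln_cmod_lX c u : 0 < c -> ln (cmod (lX c u)) = 2^-1 * ln (lsq c u).
Proof.
move=> c0; have h : 0 < cmod (lX c u) by rewrite cmod_gt0 lX_neq0.
rewrite -[lsq c u](sqr_sqrtr (ltW (lsq_gt0 u c0))) -cmod_lX ln_sqr_abs gtr0_norm//.
by rewrite mulrA mulVf// mul1r.
Qed.

Lemma lth_itv c u : - (3 * (pi / 4)) < lth c u < pi / 4.
Proof.
rewrite /lth; have := atan_gtNpi2 (1 + 2 * u / c); have := atan_ltpi2 (1 + 2 * u / c).
by move=> h1 h2; apply/andP; split; lra.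
Qed.

Lemma cos_lth c u : 0 < c -> cos (lth c u) = (c + u) / cmod (lX c u).
Proof.
move=> c0; have P := @pi_gt0 R; rewrite /lth; set w := 1 + 2 * u / c.
have s4 : sin (pi / 4) = cos (pi / 4) :> R.
  by have := sin_atan 1; rewrite atan1 mul1r.
have c4 : 0 < cos (pi / 4) :> R by rewrite cos_gt0_pihalf//; apply/andP; split; lra.
have c42 : cos (pi / 4) ^+ 2 = 2^-1 :> R.
  by have := cos2Dsin2 (pi / 4 : R); rewrite s4; lra.
have cw : 0 < cos (atan w) by rewrite cos_gt0_pihalf// atan_gtNpi2 atan_ltpi2.
have cw2 : cos (atan w) ^+ 2 * (1 + w ^+ 2) = 1.
  by have h := cos2Dsin2 (atan w); rewrite sin_atan in h; rewrite -[RHS]h; ring.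
have X0 : 0 < cmod (lX c u) by rewrite cmod_gt0 lX_neq0.
rewrite cosB sin_atan s4.
apply: (mulIf (lt0r_neq0 X0)); rewrite mulfVK ?lt0r_neq0//.
have -> : (cos (atan w) * cos (pi / 4) + w * cos (atan w) * cos (pi / 4)) * cmod (lX c u) =
  (1 + w) * (cos (atan w) * cos (pi / 4) * cmod (lX c u)) by ring.
have -> : cos (atan w) * cos (pi / 4) * cmod (lX c u) = c / 2.
  apply/eqP; rewrite -(@eqrXn2 _ 2)//; last 2 first.
    by rewrite !mulr_ge0// ltW.
    by rewrite divr_ge0// ltW.
  rewrite !exprMn c42 cmod_lX sqr_sqrtr ?ltW ?lsq_gt0//.
  have -> : lsq c u = (1 + w ^+ 2) * (c ^+ 2 / 2) by rewrite /w /lsq; field; rewrite lt0r_neq0.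
  by apply/eqP; rewrite mulrACA mulrA [_ * 2^-1 * _]mulrAC cw2 mul1r; field.
by rewrite /w; field; rewrite lt0r_neq0.
Qed.

Lemma lth_ge0 c u : 0 < c -> (0 <= lth c u) = (0 <= u).
Proof.
move=> c0; rewrite /lth subr_ge0 -atan1; apply/idP/idP => h.
  rewrite leNgt; apply/negP => u0; move: h; rewrite leNgt => /negP; apply.
  by apply: lt_atan; rewrite gtrDl pmulr_llt0 ?invr_gt0// pmulr_rlt0.
by apply: le_atan; rewrite lerDl divr_ge0 ?mulr_ge0// ltW.
Qed.

Lemma clog_line c u : 0 < c -> clog (lX c u) = lL c u.
Proof.
move=> c0; have P := @pi_gt0 R; have /andP[h1 h2] := lth_itv c u.
apply: complex_ext => /=; first exact: ln_cmod_lX.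
rewrite /carg /= -cos_lth// -(lth_ge0 u c0); case: ifPn => [h|]; last rewrite -ltNge => h.
  by rewrite cosK// in_itv/= h/=; lra.
by rewrite -cosN cosK ?opprK// in_itv/=; apply/andP; split; lra.
Qed.

Lemma cder_lX_u c u : cder (lX c) u (1 +i* 1).
Proof. by split; rewrite /lX /=; rder_tac; rewrite /=; ring. Qed.

Lemma cder_lX_c c u : cder (lX ^~ u) c 1.
Proof. by split; rewrite /lX /=; rder_tac; rewrite /=; ring. Qed.

Lemma cder_lL_u c u : 0 < c -> cder (lL c) u ((1 +i* 1) / lX c u).
Proof.
move=> c0; have l0 := lsq_gt0 u c0; have c1 : c != 0 by rewrite lt0r_neq0.
have l1 : (c + u) ^+ 2 + u ^+ 2 != 0 by rewrite lt0r_neq0.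
have l2 : 1 + (1 + 2 * u / c) ^+ 2 != 0 by rewrite lt0r_neq0// ltr_pwDl// sqr_ge0.
have d1 : rder (lsq c) u (2 * (c + u) + 2 * u) by rewrite /lsq; rder_tac; rewrite /=; ring.
have d2 : rder (fun u => 1 + 2 * u / c) u (2 / c) by rder_tac; rewrite /=; ring.
split.
  change (rder (fun u => 2^-1 * ln (lsq c u)) u (complex.Re ((1 +i* 1) / lX c u))).
  apply: rder_eq; first exact: (rderM (rder_cst _ _) (rder_ln (f := lsq c) l0 d1)).
  by rewrite !(cReM, cReV, cImV) /= /lsq; field.
apply: rder_eq; first by exact: (rderB (rder_atan d2) (rder_cst _ _)).
have -> : (1 + (1 + 2 * u / c) ^+ 2)^-1 = c ^+ 2 / (2 * ((c + u) ^+ 2 + u ^+ 2)).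
  apply: (mulfI l2); rewrite mulfV//.
  by field; rewrite l1 c1.
by rewrite !(cImM, cReV, cImV) /=; field; rewrite l1 c1.
Qed.

Lemma cder_lL_c c u : 0 < c -> cder (lL ^~ u) c (1 / lX c u).
Proof.
move=> c0; have l0 := lsq_gt0 u c0; have c1 : c != 0 by rewrite lt0r_neq0.
have l1 : (c + u) ^+ 2 + u ^+ 2 != 0 by rewrite lt0r_neq0.
have l2 : 1 + (1 + 2 * u / c) ^+ 2 != 0 by rewrite lt0r_neq0// ltr_pwDl// sqr_ge0.
have d1 : rder (lsq ^~ u) c (2 * (c + u)) by rewrite /lsq; rder_tac; rewrite /=; ring.
have d2 : rder (fun c => 1 + 2 * u / c) c (- (2 * u / c ^+ 2)).
  by rder_tac; rewrite /=; field.
split.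
  change (rder (fun c => 2^-1 * ln (lsq c u)) c (complex.Re (1 / lX c u))).
  apply: rder_eq; first exact: (rderM (rder_cst _ _) (rder_ln (f := lsq ^~ u) l0 d1)).
  by rewrite !(cReM, cReV, cImV) /= /lsq; field.
apply: rder_eq; first by exact: (rderB (rder_atan d2) (rder_cst _ _)).
have -> : (1 + (1 + 2 * u / c) ^+ 2)^-1 = c ^+ 2 / (2 * ((c + u) ^+ 2 + u ^+ 2)).
  apply: (mulfI l2); rewrite mulfV//.
  by field; rewrite l1 c1.
by rewrite !(cImM, cReV, cImV) /=; field; rewrite l1 c1.
Qed.

Lemma rcont_lsq (z : R * R) : rcont (fun z : R * R => lsq z.1 z.2) z.
Proof.
apply: rcontD; apply: rcontX; last exact: cvg_snd.
by apply: rcontD; [exact: cvg_fst|exact: cvg_snd].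
Qed.

Lemma ccont_lX (z : R * R) : ccont (fun z : R * R => lX z.1 z.2) z.
Proof.
by apply: ccont_mk; [apply: rcontD; [exact: cvg_fst|exact: cvg_snd]|exact: cvg_snd].
Qed.

Lemma ccont_lL (z : R * R) : 0 < z.1 -> ccont (fun z : R * R => lL z.1 z.2) z.
Proof.
move=> c0; apply: ccont_mk.
  apply: rcontM; first exact: rcont_cst.
  by apply: rcont_ln; [exact: lsq_gt0|exact: rcont_lsq].
apply: rcontB; last exact: rcont_cst.
apply: rcont_atan; apply: rcontD; first exact: rcont_cst.
apply: rcontM; first by apply: rcontM; [exact: rcont_cst|exact: cvg_snd].
by apply: rcontV; [rewrite lt0r_neq0|exact: cvg_fst].
Qed.

(** The common Gaussian majorant of all integrals over the line; up to a constant it is the normal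
    density with standard deviation 2. *)
Definition gs u : R := expR (- (u ^+ 2 / 8)).

Lemma rint_gs : rint mu setT gs.
Proof.
have s0 : (2 : R) != 0 by [].
have h := @integrable_normal_pdf R 0 2.
have p0 : normal_peak (2 : R) != 0 by rewrite gt_eqF// normal_peak_gt0.
have -> : gs = fun u => (normal_peak (2 : R))^-1 * normal_pdf 0 2 u.
  apply/funext => u; rewrite normal_pdfE//= /normal_fun mulrA mulVf// mul1r /gs.
  by congr expR; rewrite subr0; field.
by apply: rintZ.
Qed.

Lemma gs_bound (a b u : R) : 0 <= b -> a + b * `|u| - u ^+ 2 / 4 <= a + 2 * b ^+ 2 - u ^+ 2 / 8.
Proof.
move=> b0; rewrite -[u ^+ 2]real_normK ?num_real//; have := normr_ge0 u.
move: `|u| => w w0; have := sqr_ge0 (w - 4 * b); nra.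
Qed.

(** In [y = u / c], the derivative of the difference of the two sides has the sign of [y]. The
    coefficient 1/2 is small enough for the Gaussian factor to win in [exponent_bound]. *)
Lemma lth_le c u : 0 < c -> lth c u <= u / c + (u / c) ^+ 2 / 2.
Proof.
move=> c0; rewrite /lth -(mulrA 2); set v := u / c.
pose h (y : R) := y + y ^+ 2 / 2 - atan (1 + 2 * y) + pi / 4.
pose dh (y : R) := 1 + y - (1 + 2 * y + 2 * y ^+ 2)^-1.
have q0 (y : R) : 0 < 1 + 2 * y + 2 * y ^+ 2 by have := sqr_ge0 (1 + 2 * y); nra.
have q1 (y : R) : 1 + 2 * y + 2 * y ^+ 2 != 0 by rewrite lt0r_neq0.
have dE (y : R) : rder h y (dh y).
  have l2 : 1 + (1 + 2 * y) ^+ 2 != 0 by rewrite lt0r_neq0// ltr_pwDl// sqr_ge0.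
  rewrite /h; rder_tac; rewrite /dh /=.
  have -> : (1 + (1 + 2 * y) ^+ 2)^-1 = (1 + 2 * y + 2 * y ^+ 2)^-1 / 2.
    by rewrite -invfM; congr (_^-1); ring.
  by field.
have dhE (y : R) : dh y = y * (3 + 4 * y + 2 * y ^+ 2) / (1 + 2 * y + 2 * y ^+ 2).
  by rewrite /dh; field.
have r0 (y : R) : 0 <= 3 + 4 * y + 2 * y ^+ 2 by have := sqr_ge0 (1 + y); nra.
have cdh (y : R) : {for y, continuous dh}.
  have hh : rcont dh y.
    rewrite /dh; apply: rcontB; first by apply: rcontD; [exact: rcont_cst|exact: cvg_id].
    apply: rcontV => //; apply: rcontD.
      apply: rcontD; first exact: rcont_cst.
      by apply: rcontM; [exact: rcont_cst|exact: cvg_id].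
    by apply: rcontM; [exact: rcont_cst|apply: rcontX; exact: cvg_id].
  exact: hh.
have h0 : h 0 = 0 by rewrite /h mulr0 addr0 atan1 expr0n/= mul0r addr0; lra.
suff: 0 <= h v by rewrite /h; lra.
have [v0|v0] := leP 0 v.
  have := @FTC R dh h 0 v v0 (fun x _ => dE x) (fun x _ => cdh x); rewrite h0 subr0 => <-.
  apply: Rintegral_ge0 => y; rewrite /= in_itv/= => /andP[y0 _].
  by rewrite dhE !mulr_ge0// ?invr_ge0 ltW.
have := @FTC R (fun y => - dh y) (fun y => - h y) v 0 (ltW v0)
  (fun x _ => rderN (dE x)) (fun x _ => @rcontN _ _ _ _ (cdh x)); rewrite h0 oppr0 sub0r opprK => <-.
apply: Rintegral_ge0 => y; rewrite /= in_itv/= => /andP[_ y0].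
rewrite dhE -mulNr -mulNr !mulr_ge0// ?oppr_ge0 ?invr_ge0//.
exact: ltW.
Qed.

End Line.

(** * Cauchy theorem on parallelograms *)

Section ComplexFTC.
Context {R : realType}.
Local Notation mu := (@lebesgue_measure R).
Implicit Types (c u v t x d : R) (s z w : R[i]).

Lemma ccont_rint (p : R -> R[i]) (a b : R) : (forall x, a <= x <= b -> ccont p x) ->
  crint mu `[a, b] p.
Proof. by move=> h; split; apply: rint_cont => x hx; have [] := h x hx. Qed.

Lemma cFTC (p P : R -> R[i]) (a b : R) : a <= b ->
  (forall x, a <= x <= b -> cder P x (p x)) -> (forall x, a <= x <= b -> ccont p x) ->
  cint mu `[a, b] p = P b - P a.
Proof.
move=> ab hP hp; apply: complex_ext; rewrite ?cReB ?cImB /=.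
  apply: (FTC (F := fun x => complex.Re (P x)) ab) => x hx; first exact: (hP x hx).1.
  exact: (hp x hx).1.
apply: (FTC (F := fun x => complex.Im (P x)) ab) => x hx; first exact: (hP x hx).2.
exact: (hp x hx).2.
Qed.

Lemma cint_split p m q (f : R -> R[i]) : p <= m -> m <= q -> crint mu `[p, q] f ->
  cint mu `[p, q] f = cint mu `[p, m] f + cint mu `[m, q] f.
Proof.
move=> pm mq [f1 f2]; apply: complex_ext; rewrite ?cReD ?cImD /=.
  exact: (Rint_split pm mq f1).
exact: (Rint_split pm mq f2).
Qed.

Lemma fubini_ftc (P Q H : R -> R -> R) c1 c2 p q : c1 <= c2 -> p <= q ->
  (forall c u, c1 <= c <= c2 -> p <= u <= q ->
    [/\ rder (P ^~ u) c (H c u), rder (Q c) u (H c u) & rcont (fun z : R * R => H z.1 z.2) (c, u)]) ->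
  \int[mu]_(u in `[p, q]) (P c2 u - P c1 u) = \int[mu]_(c in `[c1, c2]) (Q c q - Q c p).
Proof.
move=> c12 pq hyp.
have cH1 c u : c1 <= c <= c2 -> p <= u <= q -> rcont (H ^~ u) c.
  move=> hc hu; have [_ _ h] := hyp c u hc hu.
  exact: (@rcont_sect1 _ (fun z : R * R => H z.1 z.2) c u h).
have cH2 c u : c1 <= c <= c2 -> p <= u <= q -> rcont (H c) u.
  move=> hc hu; have [_ _ h] := hyp c u hc hu.
  exact: (@rcont_sect2 _ (fun z : R * R => H z.1 z.2) c u h).
have iH : rint mu2 (rect c1 c2 p q) (fun z : R * R => H z.1 z.2).
  apply: cont2_rint => -[c u] [/=]; rewrite !in_itv/= => hc hu.
  by have [] := hyp c u hc hu.
have E1 := Rfubini1 (mitv _) (mitv _) iH.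
have E2 := Rfubini2 (mitv _) (mitv _) iH.
transitivity (\int[mu2]_(z in rect c1 c2 p q) H z.1 z.2).
  rewrite E1; last first.
    by move=> u; rewrite /= in_itv/= => hu; apply: rint_cont => c hc; exact: cH1.
  apply: eq_Rintegral => u; rewrite inE/= in_itv/= => hu.
  rewrite (FTC (F := P ^~ u) c12)// => c hc; last exact: cH1.
  by have [] := hyp c u hc hu.
rewrite E2; last first.
  by move=> c; rewrite /= in_itv/= => hc; apply: rint_cont => u hu; exact: cH2.
apply: eq_Rintegral => c; rewrite inE/= in_itv/= => hc.
rewrite (FTC (F := Q c) pq)// => u hu; last exact: cH2.
by have [] := hyp c u hc hu.
Qed.

(** Cauchy's theorem in the oblique coordinates (c, u) of the point [c + u w]: for a holomorphic
    function the u-derivative is [w] times the c-derivative, and Fubini equates the two pairs of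
    sides. *)
Lemma cauchy_rect (g D : R -> R -> R[i]) w c1 c2 p q : c1 <= c2 -> p <= q ->
  (forall c u, c1 <= c <= c2 -> p <= u <= q ->
    [/\ cder (g ^~ u) c (D c u), cder (g c) u (w * D c u) & ccont (fun z : R * R => D z.1 z.2) (c, u)]) ->
  cint mu `[p, q] (fun u => w * (g c2 u - g c1 u)) = cint mu `[c1, c2] (fun c => g c q - g c p).
Proof.
move=> c12 pq hyp.
have cw c u : c1 <= c <= c2 -> p <= u <= q ->
    ccont (fun z : R * R => w * D z.1 z.2) (c, u).
  by move=> hc hu; have [_ _ h] := hyp c u hc hu; apply: ccontM => //; exact: ccont_cst.
have dw c u : c1 <= c <= c2 -> p <= u <= q -> cder (fun c => w * g c u) c (w * D c u).
  move=> hc hu; have [h _ _] := hyp c u hc hu.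
  by apply: cder_eq; first exact: (cderM (cder_cst c w) h); rewrite mul0r add0r.
apply: complex_ext => /=.
  transitivity (\int[mu]_(u in `[p, q]) (complex.Re (w * g c2 u) - complex.Re (w * g c1 u))).
    by apply: eq_Rintegral => u _; rewrite mulrBr cReB.
  transitivity (\int[mu]_(c in `[c1, c2]) (complex.Re (g c q) - complex.Re (g c p))); last first.
    by apply: eq_Rintegral => u _; rewrite cReB.
  apply: (@fubini_ftc (fun c u => complex.Re (w * g c u)) (fun c u => complex.Re (g c u))
    (fun c u => complex.Re (w * D c u))) => // c u hc hu.
  by have [_ [h1 _] _] := hyp c u hc hu; split => //; [exact: (dw c u hc hu).1|exact: (cw c u hc hu).1].
transitivity (\int[mu]_(u in `[p, q]) (complex.Im (w * g c2 u) - complex.Im (w * g c1 u))).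
  by apply: eq_Rintegral => u _; rewrite mulrBr cImB.
transitivity (\int[mu]_(c in `[c1, c2]) (complex.Im (g c q) - complex.Im (g c p))); last first.
  by apply: eq_Rintegral => u _; rewrite cImB.
apply: (@fubini_ftc (fun c u => complex.Im (w * g c u)) (fun c u => complex.Im (g c u))
  (fun c u => complex.Im (w * D c u))) => // c u hc hu.
by have [_ [_ h1] _] := hyp c u hc hu; split => //; [exact: (dw c u hc hu).2|exact: (cw c u hc hu).2].
Qed.

Lemma Rint_line_cvg (f : R -> R) : rint mu setT f ->
  (\int[mu]_(x in `[- (n%:R : R), n%:R]) f x) @[n --> \oo] --> \int[mu]_(x in setT) f x.
Proof.
move=> hf.
have E n : \int[mu]_(x in `[- (n%:R : R), n%:R]) f x =
    \int[mu]_(x in setT) (f \_ `[- (n%:R : R), n%:R]) x by rewrite Rint_patchS.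
under eq_fun do rewrite E.
apply: (@Rdct _ _ _ mu setT (fun n => f \_ `[- (n%:R : R), n%:R]) f (fun x => `|f x|)) => //.
- move=> n; apply/(measurable_restrictT _ (mitv _)).
  exact: measurable_funTS (rint_meas hf).
- move=> x _; apply: cvg_near_cst; near=> n.
  rewrite /patch ifT// mem_setE in_itv/= -ler_norml.
  by near: n; exact: nbhs_infty_ger.
- by move=> n x _; rewrite /patch; case: ifP => _ //; rewrite normr0.
- exact: rint_norm.
Unshelve. all: by end_near. Qed.

Lemma cint_line_cvg (f : R -> R[i]) : crint mu setT f ->
  cmod (cint mu `[- (n%:R : R), n%:R] f - cint mu setT f) @[n --> \oo] --> (0 : R).
Proof.
move=> [f1 f2]; have h1 := Rint_line_cvg f1; have h2 := Rint_line_cvg f2.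
have h : (`|\int[mu]_(x in `[- (n%:R : R), n%:R]) complex.Re (f x) - \int[mu]_(x in setT) complex.Re (f x)|
   + `|\int[mu]_(x in `[- (n%:R : R), n%:R]) complex.Im (f x) - \int[mu]_(x in setT) complex.Im (f x)|)
   @[n --> \oo] --> (0 : R).
  rewrite -[X in _ --> X]addr0; apply: cvgD.
    by rewrite -(normr0 R); apply: cvg_norm; rewrite -(subrr (\int[mu]_(x in setT) complex.Re (f x))); apply: cvgB => //; exact: cvg_cst.
  by rewrite -(normr0 R); apply: cvg_norm; rewrite -(subrr (\int[mu]_(x in setT) complex.Im (f x))); apply: cvgB => //; exact: cvg_cst.
apply: (@cvg0_le _ _ _ _ h) => n; rewrite (ger0_norm (cmod_ge0 _)).
by rewrite (le_trans (cmod_le _))// cReB cImB.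
Qed.

Lemma gs_ge0 u : 0 <= gs u. Proof. exact: expR_ge0. Qed.

Lemma gs_nat_cvg : gs (n%:R : R) @[n --> \oo] --> (0 : R).
Proof.
have h : (8 * (n.+1%:R : R)^-1) @[n --> \oo] --> (0 : R).
  rewrite -(mulr0 (8 : R)); apply: cvgM; first exact: cvg_cst.
  exact: cvg_harmonic.
apply: (@cvg0_le _ _ _ _ h) => n; rewrite ger0_norm ?gs_ge0// /gs expRN.
have n0 : 0 <= n%:R :> R by [].
have y0 : 0 < 1 + n%:R ^+ 2 / 8 :> R by rewrite ltr_pwDl// divr_ge0// sqr_ge0.
apply: (@le_trans _ _ (1 + n%:R ^+ 2 / 8)^-1).
  by rewrite lef_pV2 ?posrE ?expR_gt0// expR_ge1Dx.
rewrite ler_pdivlMr// mulrC ler_pdivrMr//.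
have : n%:R <= n%:R ^+ 2 :> R by rewrite -natrX ler_nat; case: (n) => // m; rewrite expnS expn1; exact: leq_pmulr.
by rewrite -[n.+1%:R]natr1; move: (n%:R : R) => y; lra.
Qed.

Lemma le0_of_cvg0 (a : R) (v : nat -> R) : (forall n, (0 < n)%N -> a <= v n) ->
  v n @[n --> \oo] --> (0 : R) -> a <= 0.
Proof.
move=> h hv; rewrite -(cvg_lim (@Rhausdorff R) hv).
apply: limr_ge; first by apply/cvg_ex; exists 0.
by near=> n; apply: h; near: n; exact: nbhs_infty_gt.
Unshelve. all: by end_near. Qed.

End ComplexFTC.

(** * The integrand and the displacement of the line *)

Section Kernel.
Context {R : realType}.
Local Notation mu := (@lebesgue_measure R).
Implicit Types (c u v t x d : R) (s z w l : R[i]).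

Local Notation ipi := ('i * (pi : R)%:C).
(** Equal to 2i sin(pi z), whose zeros are the integers. *)
Definition den z : R[i] := cexp (ipi * z) - cexp (- (ipi * z)).
Definition kerX s z l : R[i] := cexp (- s * l) * cexp (ipi * z ^+ 2) / den z.
(* dkerX s z l is the derivative of kerX s in the direction z, when l = log z. *)
Definition dkerX s z l : R[i] :=
  kerX s z l * (- s / z + 2 * ipi * z - ipi * (cexp (ipi * z) + cexp (- (ipi * z))) / den z).
Definition ker s c u := kerX s (lX c u) (lL c u).
Definition lw1 : R[i] := 1 +i* 1.

Lemma cmod_lw1 : cmod lw1 <= 2.
Proof. by apply: (le_trans (cmod_le _)); rewrite /= normr1. Qed.

Lemma lw1_neq0 : lw1 != 0.
Proof. by rewrite eq_complex /= oner_eq0. Qed.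

Lemma aux_integrandE s c u : 0 < c -> aux_integrand s (aux_line c u) = ker s c u.
Proof. by move=> c0; rewrite aux_lineE /aux_integrand /cpow clog_line. Qed.

Lemma Re_ipi z : complex.Re (ipi * z) = - (pi * complex.Im z).
Proof. by rewrite !cReM !cImM /=; ring. Qed.

Lemma Im_ipi z : complex.Im (ipi * z) = pi * complex.Re z.
Proof. by rewrite !cImM !cReM /=; ring. Qed.

Lemma sqr_cmod_den c u : cmod (den (lX c u)) ^+ 2 =
  (expR (pi * u) - expR (- (pi * u))) ^+ 2 + 4 * sin (pi * (c + u)) ^+ 2.
Proof.
rewrite sqr_cmod /den cReB cImB.
have -> : cexp (ipi * lX c u) = expR (- (pi * u)) * cos (pi * (c + u)) +i*
    (expR (- (pi * u)) * sin (pi * (c + u))) by rewrite /cexp Re_ipi Im_ipi.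
have -> : cexp (- (ipi * lX c u)) = expR (pi * u) * cos (pi * (c + u)) +i*
    (- (expR (pi * u) * sin (pi * (c + u)))).
  by rewrite /cexp cReN cImN Re_ipi Im_ipi opprK cosN sinN mulrN.
rewrite /=; have := cos2Dsin2 (pi * (c + u)); have := expRxMexpNx_1 (pi * u).
move: (expR (pi * u)) (expR (- (pi * u))) (cos _) (sin _) => e f C S ef cs.
have -> : (f * C - e * C) ^+ 2 + (f * S - - (e * S)) ^+ 2 =
  (e - f) ^+ 2 * (C ^+ 2 + S ^+ 2) + 4 * (e * f) * S ^+ 2 by ring.
by rewrite cs ef !mulr1.
Qed.

Lemma sinh_ge (y : R) : `|y| <= `|expR y - expR (- y)|.
Proof.
wlog y0 : y / 0 <= y.
  move=> h; have [/h//|/ltW y0] := leP 0 y.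
  by have := h (- y); rewrite oppr_ge0 opprK normrN distrC; apply.
have h1 := expR_ge1Dx y; have h2 : expR (- y) <= 1 by rewrite -expR0 ler_expR oppr_le0.
by rewrite !ger0_norm//; lra.
Qed.

Lemma den_ge c u : `|pi * u| <= cmod (den (lX c u)).
Proof.
apply: (le_trans (sinh_ge _)); rewrite -(@ler_pXn2r _ 2)// ?nnegrE ?cmod_ge0//.
by rewrite sqr_cmod_den real_normK ?num_real// lerDl mulr_ge0// sqr_ge0.
Qed.

Lemma den_ge1 c u : 1 <= `|u| -> 1 <= cmod (den (lX c u)).
Proof.
move=> h; apply: le_trans (den_ge c u); rewrite normrM (ger0_norm (@pi_ge0 R)).
by have := @pi_ge2 R; nra.
Qed.

Lemma den_neq0_im c u : u != 0 -> den (lX c u) != 0.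
Proof.
move=> u0; rewrite -cmod_gt0; apply: lt_le_trans (den_ge c u).
by rewrite normr_gt0 mulf_neq0// gt_eqF// pi_gt0.
Qed.

Lemma sqr_sinDn (y : R) (n : nat) : sin (y + n%:R * pi) ^+ 2 = sin y ^+ 2.
Proof.
elim: n => [|n ih]; first by rewrite mul0r addr0.
by rewrite -natr1 mulrDl mul1r addrA sinDpi sqrrN.
Qed.

Lemma den_neq0 (n : nat) c u : n%:R < c -> c < n%:R + 1 -> den (lX c u) != 0.
Proof.
move=> nc cn; have [->|] := eqVneq u 0; last exact: den_neq0_im.
rewrite -cmod_gt0 lt_neqAle cmod_ge0 andbT eq_sym.
suff : cmod (den (lX c 0)) ^+ 2 != 0 by rewrite expf_eq0.
rewrite sqr_cmod_den mulr0 oppr0 subrr expr0n/= add0r addr0 mulf_neq0//.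
have -> : pi * c = pi * (c - n%:R) + n%:R * pi by ring.
rewrite sqr_sinDn expf_neq0// gt_eqF// sin_gt0_pi//.
rewrite mulr_gt0 ?pi_gt0 ?subr_gt0//=.
rewrite -[ltRHS]mulr1 ltr_pM2l ?pi_gt0//; lra.
Qed.

(** At half-integer [c] the sine becomes a cosine of [pi u], and the hyperbolic term is at least
    [(pi u)^2], hence at least the squared sine; so cos^2 + sin^2 = 1 is a lower bound. This is why
    the lines are moved to [N + 1/2]. *)
Lemma den_half (n : nat) u : 1 <= cmod (den (lX (n%:R + 2^-1) u)).
Proof.
have [h|h] := leP 1 `|pi * u|; first exact: le_trans h (den_ge _ _).
rewrite -(@ler_pXn2r _ 2)// ?nnegrE ?cmod_ge0// expr1n sqr_cmod_den.
have -> : pi * (n%:R + 2^-1 + u) = (pi * u + pi / 2) + n%:R * pi by ring.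
rewrite sqr_sinDn sinDpihalf.
have hs : sin (pi * u) ^+ 2 <= (pi * u) ^+ 2.
  rewrite -[leLHS]real_normK ?num_real// -[leRHS]real_normK ?num_real//.
  rewrite lerXn2r ?nnegrE//.
  wlog y0 : u {h} / 0 <= pi * u.
    move=> hw; have [/hw//|/ltW y0] := leP 0 (pi * u).
    by have := hw (- u); rewrite mulrN oppr_ge0 sinN !normrN; apply.
  have := @MVT_bound R sin cos 0 (pi * u) 1 y0.
  rewrite sin0 subr0 mul1r subr0 (ger0_norm y0); apply.
    by move=> x _; exact: is_derive_sin.
  by move=> x _; rewrite ler_norml cos_geN1 cos_le1.
have he : (pi * u) ^+ 2 <= (expR (pi * u) - expR (- (pi * u))) ^+ 2.
  rewrite -[leLHS]real_normK ?num_real// -[leRHS]real_normK ?num_real//.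
  by rewrite lerXn2r ?nnegrE// sinh_ge.
have hp : (pi * u) ^+ 2 <= 1.
  by rewrite -[leLHS]real_normK ?num_real// expr_le1// ltW.
by have := cos2Dsin2 (pi * u); lra.
Qed.

Lemma cder_kerX s (X l : R -> R[i]) y w : cder X y w -> cder l y (w / X y) -> den (X y) != 0 ->
  cder (fun y => kerX s (X y) (l y)) y (w * dkerX s (X y) (l y)).
Proof.
move=> dX dl d0; rewrite /kerX.
have d1 : cder (fun y => cexp (- s * l y)) y (- s * (w / X y) * cexp (- s * l y)).
  apply: cder_cexp; apply: cder_eq; first exact: (cderM (cder_cst _ _) dl).
  by rewrite mul0r add0r.
have d2 : cder (fun y => ipi * X y) y (ipi * w).
  by apply: cder_eq; first exact: (cderM (cder_cst _ _) dX); rewrite mul0r add0r.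
have d3 : cder (fun y => cexp (ipi * X y ^+ 2)) y (2 * ipi * X y * w * cexp (ipi * X y ^+ 2)).
  apply: cder_cexp; apply: cder_eq.
    by apply: (cderM (cder_cst _ _)); exact: (cderM dX dX).
  by rewrite mul0r add0r; ring.
have d4 : cder (fun y => den (X y)) y (ipi * w * (cexp (ipi * X y) + cexp (- (ipi * X y)))).
  rewrite /den; apply: cder_eq.
    by apply: cderB; apply: cder_cexp; [exact: d2|exact: (cderN d2)].
  by ring.
apply: cder_eq; first exact: (cderM (cderM d1 d3) (cderV d0 d4)).
rewrite /dkerX /kerX; move: d0; move: (den _) (cexp (ipi * X y)) (cexp (- (ipi * X y))) => D e f D0.
move: (X y)^-1 => Xi.
by field.
Qed.

Lemma ccont_X2 (T : topologicalType) (p : T -> R[i]) (z0 : T) : ccont p z0 -> ccont (fun z : T => p z ^+ 2) z0.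
Proof. by move=> h; have := ccontM h h. Qed.

Lemma ccont_den (T : topologicalType) (p : T -> R[i]) (z0 : T) : ccont p z0 -> ccont (fun z : T => den (p z)) z0.
Proof.
move=> h; have h1 : ccont (fun z : T => ipi * p z) z0 by apply: ccontM => //; exact: ccont_cst.
by apply: ccontB; apply: ccont_cexp => //; exact: ccontN.
Qed.

Lemma ccont_ker2 s (z : R * R) : 0 < z.1 -> den (lX z.1 z.2) != 0 ->
  ccont (fun z : R * R => ker s z.1 z.2) z.
Proof.
move=> c0 d0; apply: ccontM; last by apply: ccontV => //; apply: ccont_den; exact: ccont_lX.
apply: ccontM; apply: ccont_cexp.
  by apply: ccontM; [exact: ccont_cst|exact: ccont_lL].
by apply: ccontM; [exact: ccont_cst|apply: ccont_X2; exact: ccont_lX].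
Qed.

Lemma ccont_dker2 s (z : R * R) : 0 < z.1 -> den (lX z.1 z.2) != 0 ->
  ccont (fun z : R * R => dkerX s (lX z.1 z.2) (lL z.1 z.2)) z.
Proof.
move=> c0 d0; have cX := ccont_lX z.
have h1 : ccont (fun z : R * R => ipi * lX z.1 z.2) z by apply: ccontM => //; exact: ccont_cst.
apply: ccontM; first exact: ccont_ker2.
apply: ccontB.
  apply: ccontD; last by apply: ccontM => //; exact: ccont_cst.
  by apply: ccontM; [exact: ccont_cst|apply: ccontV => //; exact: lX_neq0].
apply: ccontM; last by apply: ccontV => //; exact: ccont_den.
apply: ccontM; first exact: ccont_cst.
by apply: ccontD; apply: ccont_cexp => //; exact: ccontN.
Qed.

Lemma cder_ker_c s c u : 0 < c -> den (lX c u) != 0 ->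
  cder (ker s ^~ u) c (dkerX s (lX c u) (lL c u)).
Proof.
move=> c0 d0; apply: cder_eq; first exact: (cder_kerX s (cder_lX_c c u) (cder_lL_c u c0) d0).
by rewrite mul1r.
Qed.

Lemma cder_ker_u s c u : 0 < c -> den (lX c u) != 0 ->
  cder (ker s c) u (lw1 * dkerX s (lX c u) (lL c u)).
Proof. by move=> c0 d0; exact: (cder_kerX s (cder_lX_u c u) (cder_lL_u u c0) d0). Qed.

Lemma cmod_lL_le c1 c2 c u : 0 < c1 -> c1 <= c -> c <= c2 ->
  cmod (lL c u) <= c2 + c1 ^- 2 + 3 + 2 * `|u|.
Proof.
move=> c10 h1 h2; have c0 : 0 < c by lra.
apply: (le_trans (cmod_le _)); rewrite /lL /= -ln_cmod_lX//.
have X0 : 0 < cmod (lX c u) by rewrite cmod_gt0 lX_neq0.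
have l1 := ln_le_sub1 X0.
have Xle : cmod (lX c u) <= c + 2 * `|u|.
  apply: (le_trans (cmod_le _)); rewrite /=.
  by have := ler_normD c u; rewrite (gtr0_norm c0); lra.
have l2 : - ln (cmod (lX c u)) <= c1 ^- 2.
  rewrite ln_cmod_lX//; have L0 := lsq_gt0 u c0.
  have := @ln_le_sub1 R (lsq c u)^-1; rewrite invr_gt0 => /(_ L0); rewrite lnV ?posrE// => l3.
  have : (lsq c u)^-1 <= (c1 ^+ 2 / 2)^-1.
    rewrite lef_pV2 ?posrE// ?divr_gt0 ?exprn_gt0//.
    apply: le_trans (lsq_ge u c0); rewrite ler_pM2r// lerXn2r// ?nnegrE; lra.
  rewrite invfM invrK; lra.
have p4 : pi <= 4 :> R.
  by rewrite -(@ler_pXn2r _ 2)// ?nnegrE ?pi_ge0// (le_trans (@pi_sqr_le R))//; lra.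
have /andP[t1 t2] := lth_itv c u.
have h3 : `|lth c u| <= 3 by rewrite ler_norml; apply/andP; split; lra.
have h4 : `|ln (cmod (lX c u))| <= c2 + c1 ^- 2 + 2 * `|u|.
  have ci : 0 <= c1 ^- 2 by rewrite invr_ge0 sqr_ge0.
  have u0 := normr_ge0 u.
  by rewrite ler_norml; apply/andP; split; lra.
lra.
Qed.

Lemma cmod_sq_exp c u : 0 < c -> cmod (cexp (ipi * lX c u ^+ 2)) <= expR (8 * c * `|u| - u ^+ 2 / 2).
Proof.
move=> c0; rewrite cmod_cexp ler_expR Re_ipi.
have -> : complex.Im (lX c u ^+ 2) = 2 * ((c + u) * u) by rewrite expr2 cImM /=; ring.
have p2 := @pi_ge2 R.
have p4 : pi <= 4 :> R.
  by rewrite -(@ler_pXn2r _ 2)// ?nnegrE ?pi_ge0// (le_trans (@pi_sqr_le R))//; lra.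
have h1 : - (c * u) <= c * `|u| by rewrite -mulrN ler_pM2l// -normrN ler_norm.
have h2 : 0 <= c * `|u| by rewrite mulr_ge0// ltW.
have h3 := sqr_ge0 u.
have a1 : - (2 * pi * (c * u)) <= 8 * (c * `|u|).
  have [h|h] := leP 0 (- (c * u)); nra.
have a2 : 2 * pi * u ^+ 2 >= u ^+ 2 / 2 by nra.
have -> : - (pi * (2 * ((c + u) * u))) = - (2 * pi * (c * u)) - 2 * pi * u ^+ 2 by ring.
lra.
Qed.

(** Uniform in [c]: along the line the logarithm grows at most linearly, while exp(i pi z^2) has
    Gaussian decay. *)
Lemma num_bound (M c1 c2 c u : R) : 0 <= M -> 0 < c1 -> c1 <= c -> c <= c2 ->
  expR (M * cmod (lL c u)) * cmod (cexp (ipi * lX c u ^+ 2)) <=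
  expR (M * (c2 + c1 ^- 2 + 3) + 2 * (2 * M + 8 * c2) ^+ 2) * gs u.
Proof.
move=> M0 c10 h1 h2; have c0 : 0 < c by lra.
apply: (@le_trans _ _ (expR (M * (c2 + c1 ^- 2 + 3 + 2 * `|u|)) * expR (8 * c * `|u| - u ^+ 2 / 2))).
  apply: ler_pM; rewrite ?expR_ge0 ?cmod_ge0//; last exact: cmod_sq_exp.
  by rewrite ler_expR ler_wpM2l// cmod_lL_le.
rewrite /gs -!expRD ler_expR.
have b0 : 0 <= 2 * M + 8 * c2 by lra.
have := gs_bound (M * (c2 + c1 ^- 2 + 3)) u b0.
have u0 := normr_ge0 u; have : c * `|u| <= c2 * `|u| by rewrite ler_wpM2r.
have := sqr_ge0 u; lra.
Qed.

Lemma cmod_cexp_le s l : cmod (cexp (- s * l)) <= expR (cmod s * cmod l).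
Proof.
rewrite cmod_cexp ler_expR (le_trans (ler_norm _))// (le_trans (Re_le_cmod _))//.
by rewrite cmodM cmodN.
Qed.

Lemma ker_tail s c1 c2 : 0 < c1 -> exists2 K, 0 <= K &
  forall c u, c1 <= c -> c <= c2 -> 1 <= cmod (den (lX c u)) -> cmod (ker s c u) <= K * gs u.
Proof.
move=> c10; exists (expR (cmod s * (c2 + c1 ^- 2 + 3) + 2 * (2 * cmod s + 8 * c2) ^+ 2)).
  exact: expR_ge0.
move=> c u h1 h2 d1; rewrite /ker /kerX cmodM cmodV.
apply: le_trans (num_bound u (cmod_ge0 s) c10 h1 h2).
rewrite cmodM ler_pdivrMr; last lra.
apply: (@le_trans _ _ (expR (cmod s * cmod (lL c u)) * cmod (cexp (ipi * lX c u ^+ 2)))).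
  by rewrite ler_wpM2r ?cmod_ge0// cmod_cexp_le.
by rewrite ler_peMr// mulr_ge0 ?expR_ge0// cmod_ge0.
Qed.

Lemma ccont_ker s c u : 0 < c -> den (lX c u) != 0 -> ccont (ker s c) u.
Proof. by move=> c0 d0; exact: cder_ccont (cder_ker_u s c0 d0). Qed.

Lemma cmeas_cont (p : R -> R[i]) : (forall u, ccont p u) -> cmeas (setT : set (measurableTypeR R)) p.
Proof.
move=> h; split; apply: measurable_funTS; apply: continuous_measurable_fun => u.
  exact: (h u).1.
exact: (h u).2.
Qed.

Lemma crint_ker s c : 0 < c -> (forall u, den (lX c u) != 0) -> crint mu setT (ker s c).
Proof.
move=> c0 d0; have [K K0 HK] := ker_tail s c c0.
have [B HB] := @rect_bounded R (-1) 1 0 0 (fun z : R * R => cmod (ker s c z.1))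
  (fun (z : R * R) _ => rcont_comp (ccont_cmod (ccont_ker s c0 (d0 z.1))) (@cvg_fst _ _ _ _ _)).
apply: (@crint_dom _ _ _ mu _ _ (fun u => (K + `|B| * expR 1) * gs u)).
- exact: measurableT.
- by apply: cmeas_cont => u; exact: ccont_ker.
- move=> u _; have [h|/ltW h] := leP 1 `|u|.
    apply: (le_trans (HK c u (lexx _) (lexx _) (den_ge1 c h))).
    by rewrite ler_wpM2r ?gs_ge0// lerDl mulr_ge0// expR_ge0.
  have hu : cmod (ker s c u) <= `|B|.
    have := HB (u, 0); rewrite ger0_norm ?cmod_ge0// => /(_ _)/le_trans; apply; last exact: ler_norm.
    by split; rewrite /= in_itv/= ?lexx// -ler_norml.
  apply: (le_trans hu); rewrite mulrDl; apply: ler_wpDl; first by rewrite mulr_ge0// gs_ge0.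
  rewrite -mulrA ler_peMr// /gs -expRD; apply: le_trans (expR_ge1Dx _).
  have : u ^+ 2 <= 1 by rewrite -[u ^+ 2]real_normK ?num_real// expr_le1.
  by lra.
- by apply: rintZ; [exact: measurableT|exact: rint_gs].
Qed.

Definition J s c : R[i] := cint mu setT (ker s c).

Lemma riemann_auxE s c : 0 < c -> (forall u, den (lX c u) != 0) -> riemann_aux c s = - (lw1 * J s c).
Proof.
move=> c0 d0; rewrite /riemann_aux; congr (- _).
rewrite /J -(@cintZ _ _ _ mu); [|exact: measurableT|exact: crint_ker].
have -> : (fun u => aux_integrand s (aux_line c u) * aux_direction R) = (fun u => lw1 * ker s c u).
  by apply/funext => u; rewrite aux_integrandE// mulrC.
by [].
Qed.

(** Cauchy's theorem on the two strips where [|u|] runs from [d] to [m], away from the poles; the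
    sides at [u = m] and [u = - m] vanish as [m] grows. What remains is the integral around the
    parallelogram [|u| <= d], which may contain a pole. The case [d = 0] gives [J_indep]. *)
Lemma J_diff s c1 c2 d : 0 < c1 -> c1 <= c2 -> 0 <= d -> d <= 1 ->
  (forall u, den (lX c1 u) != 0) -> (forall u, den (lX c2 u) != 0) ->
  (forall c u, c1 <= c <= c2 -> d <= `|u| -> den (lX c u) != 0) ->
  lw1 * (J s c2 - J s c1) =
  cint mu `[- d, d] (fun u => lw1 * (ker s c2 u - ker s c1 u)) +
  cint mu `[c1, c2] (fun c => ker s c (- d) - ker s c d).
Proof.
move=> c10 c12 d0 d1 n1 n2 nd.
have c20 : 0 < c2 by lra.
have [K K0 HK] := ker_tail s c2 c10.
set P := cint mu `[- d, d] _; set Q := cint mu `[c1, c2] _.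
have cI p q c : (forall u, den (lX c u) != 0) -> 0 < c -> crint mu `[p, q] (ker s c).
  by move=> hn hc; apply: ccont_rint => u _; exact: ccont_ker.
pose Z (m : nat) := lw1 * (cint mu `[- (m%:R : R), m%:R] (ker s c2) - cint mu `[- (m%:R : R), m%:R] (ker s c1)).
pose W (m : nat) := cint mu `[c1, c2] (fun c => ker s c m%:R - ker s c (- m%:R)).
have cc c u : c1 <= c <= c2 -> d <= `|u| -> u != 0 -> ccont (ker s ^~ u) c.
  move=> hc hu u0; have c0 : 0 < c by lra.
  exact: cder_ccont (cder_ker_c s c0 (nd c u hc hu)).
(* [Z m] is the truncated left-hand side, [P + Q] the integral around the inner parallelogram, and
   [W m] the contribution of the far sides. *)
have key m : (0 < m)%N -> Z m = P + Q + W m.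
  move=> m0; have m1 : 1 <= m%:R :> R by rewrite ler1n.
  have ZE : Z m = cint mu `[- (m%:R : R), m%:R] (fun u => lw1 * (ker s c2 u - ker s c1 u)).
    rewrite /Z -(@cintB _ _ _ mu) -?(@cintZ _ _ _ mu)//; try exact: mitv; try exact: cI.
    by apply: ccont_rint => u _; apply: ccontB; exact: ccont_ker.
  have ci p q : crint mu `[p, q] (fun u => lw1 * (ker s c2 u - ker s c1 u)).
    by apply: ccont_rint => u _; apply: ccontM; [exact: ccont_cst|apply: ccontB; exact: ccont_ker].
  rewrite ZE (@cint_split _ (- m%:R) (- d) m%:R)//; [|lra|lra].
  rewrite (@cint_split _ (- d) d m%:R)//; [|lra|lra].
  have rc p q : p <= q -> (forall u, p <= u <= q -> d <= `|u|) ->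
      cint mu `[p, q] (fun u => lw1 * (ker s c2 u - ker s c1 u)) =
      cint mu `[c1, c2] (fun c => ker s c q - ker s c p).
    move=> pq hu; apply: (@cauchy_rect _ (ker s) (fun c u => dkerX s (lX c u) (lL c u))) => //.
    move=> c u hc h; have c0 : 0 < c by lra.
    have dn := nd c u hc (hu u h).
    by split; [exact: cder_ker_c|exact: cder_ker_u|exact: (@ccont_dker2 s (c, u))].
  rewrite (rc (- m%:R) (- d)); [|lra|by move=> u /andP[_ h]; rewrite -normrN (le_trans _ (ler_norm _))//; lra].
  rewrite (rc d m%:R); [|lra|by move=> u /andP[h _]; rewrite (le_trans _ (ler_norm _))//; lra].
  have ic u : d <= `|u| -> crint mu `[c1, c2] (ker s ^~ u).
    move=> hu; apply: ccont_rint => c hc; have c0 : 0 < c by lra.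
    exact: cder_ccont (cder_ker_c s c0 (nd c u hc hu)).
  have dm : d <= `|m%:R : R| by rewrite ger0_norm//; lra.
  have dm' : d <= `|- (m%:R : R)| by rewrite normrN.
  have dd : d <= `|d| by exact: ler_norm.
  have dd' : d <= `|- d| by rewrite normrN.
  have i1 := ic _ dm; have i2 := ic _ dm'; have i3 := ic _ dd; have i4 := ic _ dd'.
  rewrite /Q /W !(@cintB _ _ _ mu)//; try exact: mitv.
  by rewrite -/P; ring.
have Wb m : (0 < m)%N -> cmod (W m) <= 2 * (2 * K * (c2 - c1) * gs m%:R).
  move=> m0; have m1 : 1 <= m%:R :> R by rewrite ler1n.
  have dm : d <= `|m%:R : R| by rewrite ger0_norm//; lra.
  have dm' : d <= `|- (m%:R : R)| by rewrite normrN.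
  have mn0 : m%:R != 0 :> R by rewrite pnatr_eq0 -lt0n.
  have -> : 2 * K * (c2 - c1) * gs m%:R = \int[mu]_(c in `[c1, c2]) (2 * K * gs m%:R).
    by rewrite Rint_cst_itv//; ring.
  apply: (@cint_bound _ _ _ mu); first exact: mitv.
  - by apply: ccont_rint => c hc; apply: ccontB; apply: cc; rewrite ?oppr_eq0.
  - by apply: rint_cont => c _; exact: rcont_cst.
  - move=> c hc; have /andP[h1 h2] : c1 <= c <= c2 by move: hc; rewrite /= in_itv.
    apply: (le_trans (cmodB _ _)).
    have b1 : 1 <= `|m%:R : R| by rewrite ger0_norm.
    have b2 : 1 <= `|- (m%:R : R)| by rewrite normrN.
    have k1 := HK c _ h1 h2 (den_ge1 c b1); have k2 := HK c _ h1 h2 (den_ge1 c b2).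
    have gE : gs (- m%:R : R) = gs m%:R by rewrite /gs sqrrN.
    by rewrite gE in k2; lra.
have J1 := cint_line_cvg (crint_ker s c10 n1).
have J2 := cint_line_cvg (crint_ker s c20 n2).
apply/eqP; rewrite -subr_eq0 -cmod_eq0 eq_le cmod_ge0 andbT.
apply: (@le0_of_cvg0 _ _ (fun m => 2 * (cmod (cint mu `[- (m%:R : R), m%:R] (ker s c2) - J s c2) +
   cmod (cint mu `[- (m%:R : R), m%:R] (ker s c1) - J s c1)) + 2 * (2 * K * (c2 - c1)) * gs m%:R)).
  move=> m m0; have := Wb m m0; have := key m m0.
  set a := cint mu _ (ker s c2); set b := cint mu _ (ker s c1).
  rewrite /Z -/a -/b => E1 E2.
  have -> : lw1 * (J s c2 - J s c1) - (P + Q) = W m - lw1 * ((a - J s c2) - (b - J s c1)).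
    have -> : W m = lw1 * (a - b) - (P + Q) by rewrite E1; ring.
    by ring.
  apply: (le_trans (cmodB _ _)); rewrite addrC; apply: lerD; last by apply: (le_trans E2); lra.
  rewrite cmodM; apply: ler_pM; rewrite ?cmod_ge0 ?cmod_lw1//.
  exact: cmodB.
rewrite -[X in _ --> X]addr0; apply: cvgD.
  rewrite -[X in _ --> X](mulr0 (2 : R)); apply: cvgM; first exact: cvg_cst.
  by rewrite -[X in _ --> X]addr0; exact: cvgD.
rewrite -[X in _ --> X](mulr0 (2 * (2 * K * (c2 - c1)) : R)); apply: cvgM; first exact: cvg_cst.
exact: gs_nat_cvg.
Qed.

Lemma J_indep s (n : nat) c1 c2 : n%:R < c1 -> c1 <= c2 -> c2 < n%:R + 1 -> J s c1 = J s c2.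
Proof.
move=> h1 h2 h3; have n0 : 0 <= n%:R :> R by [].
have hd c u : c1 <= c <= c2 -> den (lX c u) != 0.
  by move=> /andP[a b]; apply: (@den_neq0 n); lra.
have := @J_diff s c1 c2 0; rewrite h2 lexx ler01 oppr0 => /(_ _ isT isT isT) H.
have {}H : lw1 * (J s c2 - J s c1) = 0.
  rewrite H; last by move=> c u hc _; exact: hd.
  - have -> : cint mu `[c1, c2] (fun c => ker s c 0 - ker s c 0) = 0.
      rewrite (@eq_cint _ _ _ mu _ _ (fun=> 0)); last by move=> x _; rewrite subrr.
      rewrite (@cFTC _ _ (fun=> 0)) ?subrr// => x _; first exact: cder_cst.
      exact: ccont_cst.
    rewrite addr0; apply: complex_ext => /=; by rewrite set_itv1 Rintegral_set1.
  - lra.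
  - by move=> u; apply: hd; rewrite lexx h2.
  - by move=> u; apply: hd; rewrite lexx h2.
move/eqP: H; rewrite mulf_eq0 (negbTE lw1_neq0)/= subr_eq0 => /eqP->//.
Qed.

End Kernel.

(** * Residues *)

Section Jump.
Context {R : realType}.
Local Notation mu := (@lebesgue_measure R).
Implicit Types (c u v t x d : R) (s z w l : R[i]).
Local Notation ipi := ('i * (pi : R)%:C).

Lemma lL_real c : 0 < c -> lL c 0 = (ln c)%:C.
Proof.
move=> c0; apply: complex_ext => /=.
  by rewrite /lsq addr0 expr0n/= addr0 ln_sqr_abs gtr0_norm// mulrA mulVf// mul1r.
by rewrite /lth mulr0 mul0r addr0 atan1 subrr.
Qed.

Definition npow s (n : nat) : R[i] := cexp (- s * (ln (n%:R : R))%:C).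

Lemma pi_le4 : pi <= 4 :> R.
Proof.
by rewrite -(@ler_pXn2r _ 2)// ?nnegrE ?pi_ge0// (le_trans (@pi_sqr_le R))//; lra.
Qed.

Lemma cmod_ipi z : cmod (ipi * z) = pi * cmod z.
Proof. by rewrite !cmodM cmod_i mul1r cmod_real ger0_norm ?pi_ge0. Qed.

Lemma cMVT_abs (p dp : R -> R[i]) a b K :
  (forall x, `|x - a| <= `|b - a| -> cder p x (dp x) /\ cmod (dp x) <= K) ->
  cmod (p b - p a) <= 2 * K * `|b - a|.
Proof.
move=> h; have [ab|/ltW ba] := leP a b.
  rewrite ger0_norm ?subr_ge0//; apply: (@cMVT_bound _ p dp) => // x /andP[x1 x2].
    by apply: (h x _).1; rewrite !ger0_norm ?subr_ge0// lerD2r.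
  by apply: (h x _).2; rewrite !ger0_norm ?subr_ge0// lerD2r.
rewrite distrC ger0_norm ?subr_ge0// cmodC; apply: (@cMVT_bound _ p dp) => // x /andP[x1 x2].
  by apply: (h x _).1; rewrite !ler0_norm ?subr_le0// lerN2 lerD2r.
by apply: (h x _).2; rewrite !ler0_norm ?subr_le0// lerN2 lerD2r.
Qed.

Lemma lX_ge c u : 2^-1 <= c -> `|u| <= 4^-1 -> 4^-1 <= cmod (lX c u).
Proof.
move=> h1; rewrite ler_norml => /andP[h2 h3]; apply: le_trans (Re_le_cmod _).
by rewrite /=; apply: le_trans (ler_norm _); lra.
Qed.

Lemma lL_lip (n : nat) c u : (0 < n)%N -> `|c - n%:R| <= 2^-1 -> `|u| <= 4^-1 ->
  cmod (lL c u - lL n%:R 0) <= 16 * `|u| + 8 * `|c - n%:R|.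
Proof.
move=> n0 hc hu; have n1 : 1 <= n%:R :> R by rewrite ler1n.
have c1 : 2^-1 <= c by move: hc; rewrite ler_norml => /andP[]; lra.
have c0 : 0 < c by lra.
have -> : lL c u - lL n%:R 0 = (lL c u - lL c 0) + (lL c 0 - lL n%:R 0) by ring.
apply: (le_trans (cmodD _ _)); apply: lerD.
  have := @cMVT_abs (lL c) (fun v => lw1 / lX c v) 0 u 8; rewrite subr0.
  have -> : 2 * 8 = 16 :> R by ring.
  apply => v; rewrite subr0 => hv; split; first exact: cder_lL_u.
  have X4 := lX_ge c1 (le_trans hv hu).
  rewrite cmodM cmodV ler_pdivrMr; last lra.
  by apply: (le_trans (@cmod_lw1 R)); lra.
have := @cMVT_abs (lL ^~ 0) (fun v => 1 / lX v 0) n%:R c 4.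
have -> : 2 * 4 = 8 :> R by ring.
apply => v hv; have v1 : 2^-1 <= v by move: (le_trans hv hc); rewrite ler_norml => /andP[]; lra.
split; first by apply: cder_lL_c; lra.
have X4 := @lX_ge v 0 v1; rewrite normr0 in X4.
have {}X4 : 4^-1 <= cmod (lX v 0) by apply: X4.
by rewrite cmodM cmodV cmod1 ler_pdivrMr; lra.
Qed.

Lemma cexp_ipin (n : nat) : cexp (ipi * n%:R) = (-1) ^+ n.
Proof.
elim: n => [|n ih]; first by rewrite mulr0 cexp0.
rewrite -natr1 mulrDr mulr1 cexpD ih exprSr; congr (_ * _).
rewrite -[ipi]mulr1 /cexp Re_ipi Im_ipi /= mulr0 oppr0 expR0 !mul1r mulr1 cospi sinpi.
by apply: complex_ext; rewrite ?cReN ?cImN /= ?oppr0.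
Qed.

(** The numbers n and n^2 have the same parity, so the sign (-1)^n of exp(i pi n^2) cancels that of
    [den (n + z)]; therefore the residues carry no alternating sign. *)
Lemma kerX_shift s (n : nat) z l : kerX s (n%:R + z) l =
  cexp (- s * l + (2 * ipi * n%:R * z + ipi * z ^+ 2)) / den z.
Proof.
have e1 : cexp (- (ipi * n%:R)) = (-1) ^+ n :> R[i].
  by rewrite cexpN cexp_ipin -exprVn invrN1.
have dE : den (n%:R + z) = (-1) ^+ n * den z.
  by rewrite /den mulrDr opprD !cexpD e1 cexp_ipin mulrBr.
have qE : cexp (ipi * (n%:R + z) ^+ 2) = (-1) ^+ n * cexp (2 * ipi * n%:R * z + ipi * z ^+ 2).
  have -> : ipi * (n%:R + z) ^+ 2 = ipi * (n * n)%:R + (2 * ipi * n%:R * z + ipi * z ^+ 2).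
    by rewrite natrM; ring.
  by rewrite cexpD cexp_ipin -signr_odd oddM andbb signr_odd.
have sg0 : (-1) ^+ n != 0 :> R[i] by rewrite signr_eq0.
rewrite /kerX dE qE [cexp (- s * l + _)]cexpD.
set a := cexp (- s * l); set b := cexp (2 * ipi * n%:R * z + ipi * z ^+ 2); set e := (-1) ^+ n in sg0 *.
have -> : a * (e * b) = e * (a * b) by ring.
by rewrite -mulf_div divff// mul1r.
Qed.

Lemma cexp_expR_small (y : R) : 0 <= y -> y <= 2^-1 -> expR y <= 2.
Proof.
move=> y0 y1; have := expR_ge1Dx (- y); have := expRxMexpNx_1 y; have := expR_gt0 y.
by move: (expR y) (expR (- y)) => e f e0 ef h; nra.
Qed.

Lemma den_near0 z : cmod z <= 100^-1 ->
  cmod (den z - 2 * (ipi * z)) <= 16 * cmod (ipi * z) ^+ 2 /\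
  cmod (ipi * z) <= cmod (den z).
Proof.
move=> hz; have P2 := @pi_ge2 R; have P4 := pi_le4; have z0 := cmod_ge0 z.
set y := ipi * z; have yE : cmod y = pi * cmod z by exact: cmod_ipi.
have y0 := cmod_ge0 y; have y25 : cmod y <= 25^-1 by rewrite yE; nra.
have e2 : expR (cmod y) <= 2 by apply: cexp_expR_small; lra.
have h1 := cexp_sub1D y; have := cexp_sub1D (- y); rewrite cmodN => h2.
have b : 4 * cmod y ^+ 2 * expR (cmod y) <= 8 * cmod y ^+ 2.
  have := sqr_ge0 (cmod y); have := expR_gt0 (cmod y); nra.
have D : cmod (den z - 2 * y) <= 16 * cmod y ^+ 2.
  have -> : den z - 2 * y = (cexp y - 1 - y) - (cexp (- y) - 1 - - y) by rewrite /den -/y; ring.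
  by apply: (le_trans (cmodB _ _)); lra.
split => //.
have h3 := cmod_triB (2 * y) (den z); rewrite (cmodC (2 * y)) in h3.
have c2 : cmod (2 * y) = 2 * cmod y.
  by rewrite cmodM; congr (_ * _); have := cmod_real (2 : R); rewrite ger0_norm// => <-; rewrite rmorph_nat.
rewrite c2 in h3; nra.
Qed.

(** By [kerX_shift] the integrand is [npow s n] times exp(E) / [den z] with E = O(z), while [den z]
    is [2 i pi z] up to O(z^2); removing the polar part leaves a bounded function. *)
Lemma near_pole s (n : nat) : (0 < n)%N -> exists2 M, 0 <= M & forall c u,
  lX c u - n%:R != 0 -> cmod (lX c u - n%:R) <= 100^-1 ->
  cmod (ker s c u - npow s n / (2 * ipi) / (lX c u - n%:R)) <= M.
Proof.
move=> n0; have n1 : 1 <= n%:R :> R by rewrite ler1n.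
(* Lipschitz constant of the exponent [E] below: [32 |s|] from the logarithm ([lL_lip]), [8 n] and 4
   from the terms [2 i pi n z] and [i pi z^2], with [pi <= 4]. *)
pose CE := 32 * cmod s + 8 * n%:R + 4.
have CE0 : 0 <= CE by rewrite !addr_ge0// mulr_ge0// cmod_ge0.
exists (cmod (npow s n) * (2 * CE * expR CE + 8)).
  by rewrite mulr_ge0 ?cmod_ge0// addr_ge0// !mulr_ge0 ?expR_ge0.
move=> c u; set z := lX c u - n%:R => zn hz.
have P2 := @pi_ge2 R; have P4 := pi_le4; have z0 := cmod_ge0 z.
have reN : complex.Re (n%:R : R[i]) = n%:R by rewrite -(rmorph_nat (@real_complex R)).
have imN : complex.Im (n%:R : R[i]) = 0 by rewrite -(rmorph_nat (@real_complex R)).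
have rz : complex.Re z = c + u - n%:R by rewrite /z cReB reN.
have iz : complex.Im z = u by rewrite /z cImB imN subr0.
have uz : `|u| <= cmod z by rewrite -iz Im_le_cmod.
have cz : `|c - n%:R| <= 2 * cmod z.
  have -> : c - n%:R = complex.Re z - complex.Im z by rewrite rz iz; ring.
  apply: (le_trans (ler_normB _ _)); have := Re_le_cmod z; have := Im_le_cmod z; lra.
have LL : cmod (lL c u - lL n%:R 0) <= 32 * cmod z.
  by apply: (le_trans (lL_lip n0 _ _)); lra.
rewrite lL_real in LL; last lra.
have XE : lX c u = n%:R + z by rewrite /z; ring.
rewrite /ker XE kerX_shift; set l := lL c u in LL *; set l0 := (ln _)%:C in LL.
pose E := - s * (l - l0) + (2 * ipi * n%:R * z + ipi * z ^+ 2).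
have -> : cexp (- s * l + (2 * ipi * n%:R * z + ipi * z ^+ 2)) = npow s n * cexp E.
  by rewrite /npow -cexpD /E; congr cexp; rewrite -/l0; ring.
have [d1 d2] := den_near0 hz; set y := ipi * z in d1 d2.
have yE : cmod y = pi * cmod z by exact: cmod_ipi.
have zpos : 0 < cmod z by rewrite cmod_gt0.
have ypos : 0 < cmod y by rewrite yE mulr_gt0//; lra.
have yn : y != 0 by rewrite -cmod_gt0.
have dpos : 0 < cmod (den z) by exact: lt_le_trans d2.
have dn : den z != 0 by rewrite -cmod_gt0.
have cN : cmod (n%:R : R[i]) = n%:R.
  by rewrite -(rmorph_nat (@real_complex R)) cmod_real ger0_norm.
have c2 : cmod (2 : R[i]) = 2.
  by rewrite -(rmorph_nat (@real_complex R)) cmod_real ger0_norm.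
have EE : cmod E <= CE * cmod z.
  have -> : CE * cmod z = 32 * cmod s * cmod z + (8 * n%:R * cmod z + 4 * cmod z).
    by rewrite /CE; ring.
  rewrite /E; apply: (le_trans (cmodD _ _)); apply: lerD.
    by rewrite cmodM cmodN; have := ler_wpM2l (cmod_ge0 s) LL; lra.
  apply: (le_trans (cmodD _ _)); apply: lerD.
    have -> : 2 * ipi * n%:R * z = 2 * n%:R * (ipi * z) by ring.
    rewrite cmodM cmod_ipi cmodM c2 cN.
    have := ler_wpM2r (mulr_ge0 (ler0n R n) z0) P4; lra.
  rewrite expr2 mulrA cmodM cmod_ipi.
  have zz : cmod z * cmod z <= 1 * cmod z by rewrite ler_wpM2r//; lra.
  have := ler_wpM2r (mulr_ge0 z0 z0) P4; lra.
have z1 : cmod z <= 1 by lra.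
have EC : expR (cmod E) <= expR CE.
  by rewrite ler_expR (le_trans EE)// ler_piMr.
have E1 : cmod (cexp E - 1) <= 2 * (CE * cmod y) * expR CE.
  apply: (le_trans (cexp_sub1 E)); apply: ler_pM; rewrite ?expR_ge0//.
    by rewrite mulr_ge0// cmod_ge0.
  rewrite ler_pM2l//; apply: (le_trans EE); rewrite ler_wpM2l// yE; nra.
have -> : npow s n * cexp E / den z - npow s n / (2 * ipi) / z =
    npow s n * ((2 * y * (cexp E - 1) - (den z - 2 * y)) / (2 * y * den z)).
  have ip : ipi != 0 by apply: contraNneq yn; rewrite /y => ->; rewrite mul0r.
  by rewrite /y; move: ip dn zn; move: ipi (den z) => p D p0 D0 zn; field; rewrite p0 D0 zn.
clearbody y.
rewrite cmodM ler_wpM2l ?cmod_ge0// cmodM cmodV ler_pdivrMr; last first.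
  by rewrite cmod_gt0 mulf_neq0// mulf_neq0// pnatr_eq0.
apply: (le_trans (cmodB _ _)); rewrite !cmodM c2.
have e0 := expR_ge0 CE; have b1 := cmod_ge0 (cexp E - 1).
apply: (@le_trans _ _ ((2 * CE * expR CE + 8) * (2 * cmod y * cmod y))); last first.
  apply: ler_wpM2l; first by rewrite addr_ge0// !mulr_ge0.
  by apply: ler_wpM2l => //; rewrite mulr_ge0// ltW.
have -> : (2 * CE * expR CE + 8) * (2 * cmod y * cmod y) =
  2 * cmod y * (2 * (CE * cmod y) * expR CE) + 16 * cmod y ^+ 2 by ring.
by apply: lerD => //; rewrite ler_wpM2l// mulr_ge0// ltW.
Qed.

Lemma cder_opp (p : R -> R[i]) x dp : cder p (- x) dp -> cder (fun y => p (- y)) x (- dp).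
Proof.
move=> [h1 h2]; split.
  apply: rder_eq; first exact: (rder_comp (f := fun y => complex.Re (p y)) h1 (rderN (rder_id x))).
  by rewrite cReN mulrN mulr1.
apply: rder_eq; first exact: (rder_comp (f := fun y => complex.Im (p y)) h2 (rderN (rder_id x))).
by rewrite cImN mulrN mulr1.
Qed.

(** A branch of log((c - a) - i d), up to an imaginary constant, that is smooth along the whole
    horizontal line. *)
Definition logshift a d c : R[i] := (2^-1 * ln ((c - a) ^+ 2 + d ^+ 2)) +i* atan ((c - a) / d).

Lemma cder_logshift a d c : d != 0 -> cder (logshift a d) c ((c - a) +i* (- d))^-1.
Proof.
move=> d0; have dd : 0 < d ^+ 2 by rewrite exprn_even_gt0.
have q0 : 0 < (c - a) ^+ 2 + d ^+ 2 by rewrite ltr_wpDl// sqr_ge0.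
have q1 : (c - a) ^+ 2 + d ^+ 2 != 0 by rewrite lt0r_neq0.
have d1 : rder (fun c => (c - a) ^+ 2 + d ^+ 2) c (2 * (c - a)) by rder_tac; rewrite /=; ring.
have d2 : rder (fun c => (c - a) / d) c d^-1 by rder_tac; rewrite /=; ring.
have q2 : 1 + ((c - a) / d) ^+ 2 != 0 by rewrite lt0r_neq0// ltr_pwDl// sqr_ge0.
split.
  change (rder (fun c => 2^-1 * ln ((c - a) ^+ 2 + d ^+ 2)) c (complex.Re ((c - a) +i* (- d))^-1)).
  apply: rder_eq; first exact: (rderM (rder_cst _ _) (rder_ln (f := fun c => (c - a) ^+ 2 + d ^+ 2) q0 d1)).
  by rewrite cReV /= sqrrN; field.
change (rder (fun c => atan ((c - a) / d)) c (complex.Im ((c - a) +i* (- d))^-1)).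
apply: rder_eq; first exact: (rder_atan d2).
have -> : (1 + ((c - a) / d) ^+ 2)^-1 = d ^+ 2 / ((c - a) ^+ 2 + d ^+ 2).
  by apply: (mulfI q2); rewrite mulfV//; field; rewrite q1 d0.
by rewrite cImV /= sqrrN; field; rewrite q1 d0.
Qed.

Lemma cnatE (n : nat) : (n%:R : R[i]) = (n%:R : R)%:C.
Proof. by rewrite -(rmorph_nat (@real_complex R)). Qed.

(** The integral of 1/(z - n) around a parallelogram centred at n, from explicit logarithms on the
    four sides: the moduli cancel, and the angles add up to 2 pi by [atan2D3]. *)
Lemma polar (n : nat) d : 0 < d ->
  cint mu `[- d, d] (fun u => lw1 * ((lX (n%:R + d) u - n%:R)^-1 - (lX (n%:R - d) u - n%:R)^-1)) +
  cint mu `[n%:R - d, n%:R + d] (fun c => (lX c (- d) - n%:R)^-1 - (lX c d - n%:R)^-1) = 2 * ipi.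
Proof.
move=> d0; have dn : d != 0 by rewrite lt0r_neq0.
have e1 u : lX (n%:R + d) u - n%:R = lX d u.
  by rewrite cnatE; apply: complex_ext; rewrite ?cReB ?cImB /=; ring.
have e2 u : lX (n%:R - d) u - n%:R = - lX d (- u).
  by rewrite cnatE; apply: complex_ext; rewrite ?cReB ?cImB ?cReN ?cImN /=; ring.
have e3 c : lX c (- d) - n%:R = (c - (n%:R + d)) +i* (- d).
  by rewrite cnatE; apply: complex_ext; rewrite ?cReB ?cImB /=; ring.
have e4 c : lX c d - n%:R = (c - (n%:R - d)) +i* (- - d).
  by rewrite cnatE; apply: complex_ext; rewrite ?cReB ?cImB /=; ring.
have n1 v : lX d v != 0 by exact: lX_neq0.
have dd : - d <= d by lra.
have A1 := @cFTC R (fun u => lw1 * ((lX (n%:R + d) u - n%:R)^-1 - (lX (n%:R - d) u - n%:R)^-1))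
  (fun u => lL d u - lL d (- u)) (- d) d dd.
rewrite {}A1; first last.
  move=> u _; have h (v : R) : ccont (lX d) v by exact: cder_ccont (cder_lX_u d v).
  have {}h1 : ccont (fun u => (lX d u)^-1 - (- lX d (- u))^-1) u.
    apply: ccontB; apply: ccontV => //; rewrite ?oppr_eq0//.
    by apply: ccontN; exact: cder_ccont (cder_opp (cder_lX_u d (- u))).
  have := ccontM (ccont_cst lw1 u) h1.
  by congr ccont; apply/funext => v; rewrite e1 e2.
  move=> u _; rewrite e1 e2; apply: cder_eq.
    exact: (cderB (cder_lL_u u d0) (cder_opp (cder_lL_u (- u) d0))).
  by rewrite invrN !opprK mulrDr.
have nd : n%:R - d <= n%:R + d :> R by lra.
have A2 := @cFTC R (fun c => (lX c (- d) - n%:R)^-1 - (lX c d - n%:R)^-1)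
  (fun c => logshift (n%:R + d) d c - logshift (n%:R - d) (- d) c) _ _ nd.
rewrite {}A2; first last.
  move=> c _.
  have nz a (b : R) : b != 0 -> a +i* b != 0 by move=> b0; rewrite eq_complex /= negb_and b0 orbT.
  have h1 : ccont (fun c => ((c - (n%:R + d)) +i* (- d))^-1 - ((c - (n%:R - d)) +i* (- - d))^-1) c.
    apply: ccontB; apply: ccontV; rewrite ?nz ?opprK ?oppr_eq0//; apply: ccont_mk.
    - by apply: rcontB; [exact: cvg_id|exact: rcont_cst].
    - exact: rcont_cst.
    - by apply: rcontB; [exact: cvg_id|exact: rcont_cst].
    - exact: rcont_cst.
  by move: h1; congr ccont; apply/funext => v; rewrite e3 e4.
  move=> c _; rewrite e3 e4; apply: cderB; first exact: cder_logshift.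
  by apply: cder_logshift; rewrite oppr_eq0.
clear dd.
have q5 : ln (lsq d d) = ln (5 * d ^+ 2) by congr ln; rewrite /lsq; ring.
have q1 : ln (lsq d (- d)) = ln (d ^+ 2) by congr ln; rewrite /lsq; ring.
have P := @atan2D3 R.
have dd : (d / d) = 1 by rewrite divff.
have a1 : lth d d = atan 3 - pi / 4 by rewrite /lth -mulrA dd mulr1; congr (atan _ - _); ring.
have a2 : lth d (- d) = - (pi / 4) - pi / 4.
  rewrite /lth mulrN mulNr -mulrA dd mulr1 (_ : 1 - 2 = - 1); last by ring.
  by rewrite atanN atan1.
apply: complex_ext.
  rewrite [RHS](_ : _ = 0); last by rewrite (cnatE 2) !cReM !cImM /=; ring.
  rewrite !(cReD, cReN) /lL /logshift /= ?opprK q5 q1.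
  rewrite (_ : n%:R + d - (n%:R + d) = 0); last by ring.
  rewrite (_ : n%:R + d - (n%:R - d) = 2 * d); last by ring.
  rewrite (_ : n%:R - d - (n%:R + d) = - (2 * d)); last by ring.
  rewrite (_ : n%:R - d - (n%:R - d) = 0); last by ring.
  rewrite !sqrrN expr0n/= !add0r (_ : (2 * d) ^+ 2 + d ^+ 2 = 5 * d ^+ 2); last by ring.
  by ring.
rewrite [RHS](_ : _ = 2 * pi); last by rewrite (cnatE 2) !cImM !cReM /=; ring.
rewrite !(cImD, cImN) /lL /logshift /= a1 a2 ?opprK.
rewrite (_ : n%:R + d - (n%:R + d) = 0); last by ring.
rewrite (_ : n%:R + d - (n%:R - d) = 2 * d); last by ring.
rewrite (_ : n%:R - d - (n%:R + d) = - (2 * d)); last by ring.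
rewrite (_ : n%:R - d - (n%:R - d) = 0); last by ring.
rewrite !invrN !mulrN !mulNr -!mulrA !dd !mulr1 !mul0r oppr0 !atanN !atan0.
lra.
Qed.

(* The residue at n: cut out a parallelogram of size d around n, on which the
   polar part contributes exactly npow s n and the rest O(d), and let d tend to 0. *)
Lemma jump s (n : nat) : (0 < n)%N ->
  lw1 * (J s (n%:R + 2^-1) - J s (n%:R - 2^-1)) = npow s n.
Proof.
move=> n0; have n1 : 1 <= n%:R :> R by rewrite ler1n.
have [M M0 HM] := near_pole s n0.
set V := lw1 * _; set rho := npow s n / (2 * ipi).
have ip : 2 * ipi != 0.
  rewrite -cmod_gt0 2!cmodM cmod_i mul1r cmod_real mulr_gt0//.
    by rewrite cmod_gt0 pnatr_eq0.
  by rewrite normr_gt0 lt0r_neq0// pi_gt0.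
apply/eqP; rewrite -subr_eq0 -cmod_eq0 eq_le cmod_ge0 andbT.
(* The two pairs of sides contribute at most [16 M d] and [8 M d]; the size [300^-1] keeps the
   parallelogram in the disc of [near_pole]. *)
suff H d : 0 < d -> d <= 300^-1 -> cmod (V - npow s n) <= 24 * M * d.
  apply/ler_addgt0Pr => e e0; rewrite add0r.
  pose d := Num.min 300^-1 (e / (24 * M + 1)).
  have M1 : 0 < 24 * M + 1 by rewrite ltr_wpDl// mulr_ge0.
  have d0 : 0 < d by rewrite lt_min invr_gt0 ltr0n/= divr_gt0.
  have d1 : d <= 300^-1 by rewrite ge_min lexx.
  apply: (le_trans (H d d0 d1)).
  have : d <= e / (24 * M + 1) by rewrite ge_min lexx orbT.
  rewrite ler_pdivlMr// => h; apply: le_trans h; rewrite [leRHS]mulrC ler_wpM2r//; lra.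
move=> d0 d3.
have -> : V = lw1 * (J s (n%:R + d) - J s (n%:R - d)).
  have m1 : n.-1%:R = n%:R - 1 :> R by rewrite -subn1 natrB.
  rewrite /V; congr (_ * (_ - _)); first by symmetry; apply: (@J_indep _ s n); lra.
  by apply: (@J_indep _ s n.-1); rewrite ?m1; lra.
have ndc c u : u != 0 \/ (n%:R < c /\ c < n%:R + 1) \/ (n%:R - 1 < c /\ c < n%:R) -> den (lX c u) != 0.
  move=> [h|[[h1 h2]|[h1 h2]]]; first exact: den_neq0_im.
    exact: (@den_neq0 _ n).
  by apply: (@den_neq0 _ n.-1); rewrite -subn1 natrB//; lra.
have np u : den (lX (n%:R + d) u) != 0 by apply: ndc; right; left; split; lra.
have nm u : den (lX (n%:R - d) u) != 0 by apply: ndc; right; right; split; lra.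
have un u : d <= `|u| -> u != 0.
  by move=> h; rewrite -normr_gt0; lra.
have g1 : 0 < n%:R - d by lra.
have g2 : n%:R - d <= n%:R + d by lra.
have g3 : d <= 1 by lra.
rewrite (J_diff s g1 g2 (ltW d0) g3 nm np (fun c u _ h => ndc c u (or_introl (un u h)))).
have PP := polar n d0; move/(congr1 ( *%R rho)): PP; rewrite [rho * (2 * _)]mulfVK// => PP.
rewrite -{}PP mulrDr.
have cX0 c u : lX c u - n%:R = (c - n%:R + u) +i* u.
  by rewrite cnatE; apply: complex_ext; rewrite ?cReB ?cImB /=; ring.
have zb c u : `|c - n%:R| <= d -> `|u| <= d -> cmod (lX c u - n%:R) <= 100^-1.
  move=> h1 h2; rewrite cX0; apply: (le_trans (cmod_le _)); rewrite /=.
  by have := ler_normD (c - n%:R) u; lra.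
have zn c u : u != 0 \/ c != n%:R -> lX c u - n%:R != 0.
  move=> [h|h]; rewrite cX0; apply/eqP => -[e1 e2]; first by rewrite e2 eqxx in h.
  by move: h; rewrite e2 addr0 in e1; rewrite -subr_eq0 e1 eqxx.
have cp : n%:R + d != n%:R by rewrite -subr_eq0 addrAC subrr add0r lt0r_neq0.
have cm : n%:R - d != n%:R by rewrite -subr_eq0 addrAC subrr add0r oppr_eq0 lt0r_neq0.
have dp : `|n%:R + d - n%:R| <= d by rewrite addrAC subrr add0r gtr0_norm.
have dm : `|n%:R - d - n%:R| <= d by rewrite addrAC subrr add0r normrN gtr0_norm.
have cXu c u : ccont (lX c) u by exact: cder_ccont (cder_lX_u c u).
have cXc c u : ccont (lX ^~ u) c by exact: cder_ccont (cder_lX_c c u).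
have cI1 u : ccont (fun u => lw1 * (ker s (n%:R + d) u - ker s (n%:R - d) u)) u.
  by apply: ccontM; [exact: ccont_cst|apply: ccontB; apply: ccont_ker => //; lra].
have cI2 u : ccont (fun u => lw1 * ((lX (n%:R + d) u - n%:R)^-1 - (lX (n%:R - d) u - n%:R)^-1)) u.
  apply: ccontM; first exact: ccont_cst.
  by apply: ccontB; apply: ccontV; [apply: zn; right|apply: ccontB => //; exact: ccont_cst|
    apply: zn; right|apply: ccontB => //; exact: ccont_cst].
have dn : d != 0 by rewrite lt0r_neq0.
have dn' : - d != 0 by rewrite oppr_eq0.
have cI3 c : n%:R - d <= c <= n%:R + d -> ccont (fun c => ker s c (- d) - ker s c d) c.
  move=> hc; have c0 : 0 < c by lra.
  by apply: ccontB; apply: cder_ccont; apply: cder_ker_c => //; apply: ndc; left.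
have cI4 c : ccont (fun c => (lX c (- d) - n%:R)^-1 - (lX c d - n%:R)^-1) c.
  by apply: ccontB; apply: ccontV; [apply: zn; left|apply: ccontB => //; exact: ccont_cst|
    apply: zn; left|apply: ccontB => //; exact: ccont_cst].
set P1 := cint mu _ _; set Q1 := cint mu _ _; set P2 := cint mu _ _; set Q2 := cint mu _ _.
have -> : P1 + Q1 - (rho * P2 + rho * Q2) = (P1 - rho * P2) + (Q1 - rho * Q2) by ring.
have dd : - d <= d by lra.
have r1 : crint mu `[- d, d] (fun u => lw1 * (ker s (n%:R + d) u - ker s (n%:R - d) u)).
  by apply: ccont_rint => u _; exact: cI1.
have r2 : crint mu `[- d, d] (fun u => lw1 * ((lX (n%:R + d) u - n%:R)^-1 - (lX (n%:R - d) u - n%:R)^-1)).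
  by apply: ccont_rint => u _; exact: cI2.
have r3 : crint mu `[n%:R - d, n%:R + d] (fun c => ker s c (- d) - ker s c d).
  by apply: ccont_rint => u h; exact: cI3.
have r4 : crint mu `[n%:R - d, n%:R + d] (fun c => (lX c (- d) - n%:R)^-1 - (lX c d - n%:R)^-1).
  by apply: ccont_rint => u _; exact: cI4.
have r2' := @crintZ _ _ _ mu _ _ rho (mitv _) r2.
have r4' := @crintZ _ _ _ mu _ _ rho (mitv _) r4.
have bI a b (p : R -> R[i]) K : a <= b -> crint mu `[a, b] p -> 0 <= K ->
    (forall x, a <= x <= b -> cmod (p x) <= K) -> cmod (cint mu `[a, b] p) <= 2 * (K * (b - a)).
  move=> ab hp K0 hK; rewrite -(Rint_cst_itv K ab).
  apply: (@cint_bound _ _ _ mu _ _ _ (mitv _) hp).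
    by apply: rint_cont => x _; exact: rcont_cst.
  by move=> x hx; apply: hK; move: hx; rewrite /= in_itv.
have B1 : cmod (P1 - rho * P2) <= 2 * (4 * M * (d - - d)).
  rewrite /P2 -(@cintZ _ _ _ mu _ _ _ (mitv _) r2) /P1 -(@cintB _ _ _ mu _ _ _ (mitv _) r1 r2').
  apply: bI => //; [|by rewrite mulr_ge0|].
    have := @crintD _ _ _ mu _ _ _ (mitv _) r1 (@crintZ _ _ _ mu _ _ (-1) (mitv _) r2').
    by congr (crint _ _ _); apply/funext => u; rewrite mulN1r.
  move=> u hu; have hu' : `|u| <= d by rewrite ler_norml.
  have b1 := HM _ u (zn _ u (or_intror cp)) (zb _ _ dp hu').
  have b2 := HM _ u (zn _ u (or_intror cm)) (zb _ _ dm hu').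
  rewrite -/rho in b1 b2; move: b1 b2.
  set k1 := ker _ _ _; set k2 := ker _ _ _; set z1 := (lX (n%:R + d) u - n%:R)^-1; set z2 := (lX (n%:R - d) u - n%:R)^-1.
  move=> b1 b2.
  have -> : lw1 * (k1 - k2) - rho * (lw1 * (z1 - z2)) = lw1 * ((k1 - rho * z1) - (k2 - rho * z2)) by ring.
  rewrite cmodM; have -> : 4 * M = 2 * (2 * M) by ring.
  apply: ler_pM; rewrite ?cmod_ge0 ?cmod_lw1//.
  by apply: (le_trans (cmodB _ _)); lra.
have B2 : cmod (Q1 - rho * Q2) <= 2 * (2 * M * (n%:R + d - (n%:R - d))).
  rewrite /Q2 -(@cintZ _ _ _ mu _ _ _ (mitv _) r4) /Q1 -(@cintB _ _ _ mu _ _ _ (mitv _) r3 r4').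
  apply: bI; [exact: g2| |by rewrite mulr_ge0|].
    have := @crintD _ _ _ mu _ _ _ (mitv _) r3 (@crintZ _ _ _ mu _ _ (-1) (mitv _) r4').
    by congr (crint _ _ _); apply/funext => u; rewrite mulN1r.
  move=> c hc; have hc' : `|c - n%:R| <= d by rewrite ler_norml; apply/andP; split; lra.
  have hd : `|d| <= d by rewrite gtr0_norm.
  have hd' : `|- d| <= d by rewrite normrN gtr0_norm.
  have b1 := HM c _ (zn c _ (or_introl dn)) (zb _ _ hc' hd).
  have b2 := HM c _ (zn c _ (or_introl dn')) (zb _ _ hc' hd').
  rewrite -/rho in b1 b2; move: b1 b2.
  set k1 := ker _ _ _; set k2 := ker _ _ _; set z1 := (lX c d - n%:R)^-1; set z2 := (lX c (- d) - n%:R)^-1.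
  move=> b1 b2.
  have -> : k2 - k1 - rho * (z2 - z1) = (k2 - rho * z2) - (k1 - rho * z1) by ring.
  by apply: (le_trans (cmodB _ _)); lra.
apply: (le_trans (cmodD _ _)); lra.
Qed.

Lemma riemann_aux_sum s (n : nat) :
  riemann_aux 2^-1 s = \sum_(j < n) npow s j.+1 - lw1 * J s (n%:R + 2^-1).
Proof.
rewrite riemann_auxE; [|lra|by move=> u; apply: (@den_neq0 _ 0); lra].
elim: n => [|n ih]; first by rewrite big_ord0 !add0r.
rewrite ih big_ord_recr /= -(@jump s n.+1)//.
have -> : n.+1%:R - 2^-1 = n%:R + 2^-1 :> R by rewrite -[n.+1%:R]natr1; field.
by ring.
Qed.

Lemma riemann_aux_indep c : 0 < c < 1 -> riemann_aux c = riemann_aux (2^-1 : R).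
Proof.
move=> /andP[c0 c1]; apply/funext => s.
have h d : 0 < d -> d < 1 -> riemann_aux d s = - (lw1 * J s d).
  by move=> d0 d1; apply: riemann_auxE => // u; apply: (@den_neq0 _ 0); lra.
rewrite h// h; [|lra|lra]; congr (- (_ * _)).
have [h1|/ltW h1] := leP c 2^-1; first by apply: (@J_indep _ s 0); lra.
by symmetry; apply: (@J_indep _ s 0); lra.
Qed.

End Jump.

(** * Growth of the auxiliary function *)

Section Bounds.
Context {R : realType}.
Local Notation mu := (@lebesgue_measure R).
Implicit Types (c u v t x d : R) (s z w l : R[i]).
Local Notation ipi := ('i * (pi : R)%:C).

(** Here [r] stands for t / (2 pi). Divided by 2 pi, and with c = N + 1/2, the exponent is at most
    [(r/c - c) u + (r/(2 c^2) - 1) u^2] by [lth_le]. As sqrt r is close to c, the linear coefficient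
    is at most 3/2 in modulus, independently of [r]; and [r <= 16/9 c^2] leaves at most [- u^2 / 9].
    With [N = 1] this also holds for small [r]. *)
Lemma exponent_bound (N : nat) (r u : R) : (0 < N)%N -> 0 <= r -> r < (N%:R + 1) ^+ 2 ->
  N%:R ^+ 2 <= r \/ N = 1%N ->
  2 * pi * r * lth (N%:R + 2^-1) u - 2 * pi * ((N%:R + 2^-1) * u) - 2 * pi * u ^+ 2 <=
  10 + 12 * `|u| - u ^+ 2 / 4.
Proof.
move=> N0 r0 r1 r2; have n1 : 1 <= N%:R :> R by rewrite ler1n.
set c := N%:R + 2^-1; have c32 : 3 / 2 <= c by rewrite /c; lra.
have c0 : 0 < c by lra.
have P2 := @pi_ge2 R; have P4 := @pi_le4 R.
have th := lth_le u c0.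
have cn : c != 0 by rewrite lt0r_neq0.
have rle : r <= 16 / 9 * c ^+ 2.
  apply/ltW/(lt_le_trans r1); have -> : 16 / 9 * c ^+ 2 = (4 / 3 * c) ^+ 2 by field.
  rewrite lerXn2r ?nnegrE//; rewrite /c; lra.
have lin1 : r - c ^+ 2 <= 3 / 2 * c by move: r1; rewrite /c; nra.
have lin2 : c ^+ 2 - r <= 3 / 2 * c.
  case: r2 => [h|h]; first by move: h; rewrite /c; nra.
  have -> : c = 3 / 2 by rewrite /c h; field.
  lra.
have h1 : r * lth c u <= r * (u / c + (u / c) ^+ 2 / 2) by rewrite ler_wpM2l.
have a1 : r / c - c <= 3 / 2.
  by rewrite lerBlDr ler_pdivrMr//; move: lin1; rewrite expr2; lra.
have a2 : - (3 / 2) <= r / c - c.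
  by rewrite lerBrDr ler_pdivlMr//; move: lin2; rewrite expr2; lra.
have a3 : (r / c - c) * u <= 3 / 2 * `|u|.
  apply: (le_trans (ler_norm _)); rewrite normrM ler_wpM2r// ler_norml.
  by apply/andP; split; lra.
have a4 : (r / (2 * c ^+ 2) - 1) * u ^+ 2 <= - (1 / 9) * u ^+ 2.
  rewrite ler_wpM2r ?sqr_ge0// lerBlDr ler_pdivrMr; last by rewrite mulr_gt0// exprn_gt0.
  by lra.
have E : r * (u / c + (u / c) ^+ 2 / 2) - c * u - u ^+ 2 =
    (r / c - c) * u + (r / (2 * c ^+ 2) - 1) * u ^+ 2 by field.
have b1 : r * lth c u - c * u - u ^+ 2 <= 3 / 2 * `|u| - 1 / 9 * u ^+ 2 by lra.
have -> : 2 * pi * r * lth c u - 2 * pi * (c * u) - 2 * pi * u ^+ 2 =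
  2 * pi * (r * lth c u - c * u - u ^+ 2) by ring.
have p0 : 0 <= 2 * pi :> R by lra.
apply: (le_trans (ler_wpM2l p0 b1)).
have u0 := normr_ge0 u; have u2 := sqr_ge0 u.
have k1 := ler_wpM2r u0 P4; have k2 := ler_wpM2r u2 P2.
lra.
Qed.

(** N is the integer part of sqrt (t / (2 pi)), or 1 if that is 0 or t is negative. For negative t
    the constant 10 absorbs the term with the argument, which is at most 2 * 3. *)
Lemma choose_N t : -2 <= t -> exists N : nat, [/\ (0 < N)%N, N%:R <= t + 3 &
  forall u, t * lth (N%:R + 2^-1) u - 2 * pi * ((N%:R + 2^-1) * u) - 2 * pi * u ^+ 2 <=
  10 + 12 * `|u| - u ^+ 2 / 4].
Proof.
move=> t2; have P2 := @pi_ge2 R; have P4 := @pi_le4 R.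
have [t0|t0] := leP 0 t; last first.
  exists 1%N; split => //; first by lra.
  move=> u; have /andP[h1 h2] := lth_itv (1%:R + 2^-1) u.
  have u0 := normr_ge0 u; have u2 := sqr_ge0 u.
  have a1 : t * lth (1%:R + 2^-1) u <= 6.
    have : - t * - lth (1%:R + 2^-1) u <= 2 * 3.
      have [h|h] := leP 0 (- lth (1%:R + 2^-1) u); first by apply: ler_pM => //; lra.
      apply: (@le_trans _ _ 0); last by lra.
      by rewrite mulr_ge0_le0//; lra.
    by rewrite mulrNN; lra.
  have a2 : - u <= `|u| by rewrite -normrN ler_norm.
  have a3 : pi * (- u) <= pi * `|u| by rewrite ler_wpM2l//; lra.
  have k1 := ler_wpM2r u0 P4; have k2 := ler_wpM2r u2 P2.
  lra.
pose r := t / (2 * pi); have pp : 0 < 2 * pi :> R by lra.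
have r0 : 0 <= r by rewrite divr_ge0// ltW.
have tE : t = 2 * pi * r by rewrite /r mulrC mulfVK// lt0r_neq0.
have s0 : 0 <= Num.sqrt r by exact: sqrtr_ge0.
have /andP[s1 s2] := truncn_itv s0; set M := Num.truncn _ in s1 s2.
have sq : Num.sqrt r ^+ 2 = r by exact: sqr_sqrtr.
have rt : r <= t by rewrite tE; nra.
have [M0|M0] := posnP M.
  have r1 : r < 1.
    by rewrite -sq exprn_ilt1//; move: s2; rewrite M0.
  exists 1%N; split => //; first by lra.
  by move=> u; rewrite tE; apply: exponent_bound => //; [lra|right].
have Mr : M%:R ^+ 2 <= r by rewrite -sq lerXn2r ?nnegrE.
have n1 : 1 <= M%:R :> R by rewrite ler1n.
exists M; split => //; first by nra.
move=> u; rewrite tE; apply: exponent_bound => //; last by left.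
by rewrite -sq ltrXn2r ?nnegrE// natr1.
Qed.

Lemma cmod_sq_expE c u : cmod (cexp (ipi * lX c u ^+ 2)) = expR (- (2 * pi * (c * u) + 2 * pi * u ^+ 2)).
Proof. by rewrite cmod_cexp Re_ipi; congr expR; rewrite expr2 cImM /=; ring. Qed.

Lemma ker_half_le (N : nat) x t u : (0 < N)%N ->
  (t * lth (N%:R + 2^-1) u - 2 * pi * ((N%:R + 2^-1) * u) - 2 * pi * u ^+ 2 <=
  10 + 12 * `|u| - u ^+ 2 / 4) ->
  cmod (ker (x +i* t) (N%:R + 2^-1) u) <=
  expR (- (x * ln (cmod (lX (N%:R + 2^-1) u)))) * expR (10 + 12 * `|u| - u ^+ 2 / 4).
Proof.
move=> N0; set c := N%:R + 2^-1 => H; have c0 : 0 < c by rewrite addr_gt0 ?ltr0n ?invr_gt0.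
have d1 : 1 <= cmod (den (lX c u)) by exact: den_half.
rewrite /ker /kerX cmodM cmodV ler_pdivrMr; last lra.
apply: (@le_trans _ _ (expR (- (x * ln (cmod (lX c u)))) * expR (10 + 12 * `|u| - u ^+ 2 / 4))); last first.
  by rewrite ler_peMr// mulr_ge0 ?expR_ge0.
rewrite cmodM cmod_sq_expE cmod_cexp -!expRD ler_expR cReM cReN cImN /= -ln_cmod_lX//.
lra.
Qed.

(** The distance from 0 to the line is c / sqrt 2 with c >= 3/2, so |z|^2 >= 9/8, whose logarithm is
    at least 1/9. That |z| exceeds 1 on the line gives exponential decay in the real part of [s];
    the value 1/20 becomes the rate k. *)
Lemma ln_lX_ge (N : nat) u : (0 < N)%N -> 20^-1 <= ln (cmod (lX (N%:R + 2^-1) u)).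
Proof.
move=> N0; have n1 : 1 <= N%:R :> R by rewrite ler1n.
set c := N%:R + 2^-1; have c32 : 3 / 2 <= c by rewrite /c; lra.
have c0 : 0 < c by lra.
rewrite ln_cmod_lX//; have l0 := lsq_gt0 u c0.
have l1 : 9 / 8 <= lsq c u by apply: le_trans (lsq_ge u c0); nra.
have := @ln_le_sub1 R (lsq c u)^-1; rewrite invr_gt0 => /(_ l0); rewrite lnV ?posrE// => h.
have : (lsq c u)^-1 <= 8 / 9 by rewrite (_ : 8 / 9 = (9 / 8)^-1); [rewrite lef_pV2 ?posrE//|field].
lra.
Qed.

Definition IG : R := \int[mu]_(u in setT) gs u.

Lemma IG_ge0 : 0 <= IG.
Proof. by apply: Rintegral_ge0 => u _; exact: gs_ge0. Qed.

Lemma J_half_le s (N : nat) B b : (0 < N)%N -> 0 <= B -> 0 <= b ->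
  (forall u, cmod (ker s (N%:R + 2^-1) u) <= B * expR (10 + b * `|u| - u ^+ 2 / 4)) ->
  cmod (J s (N%:R + 2^-1)) <= 2 * (B * expR (10 + 2 * b ^+ 2) * IG).
Proof.
move=> N0 B0 b0 H; have c0 : 0 < N%:R + 2^-1 :> R by rewrite addr_gt0 ?ltr0n ?invr_gt0.
have dn u : den (lX (N%:R + 2^-1 : R) u) != 0 by apply: (@den_neq0 _ N); lra.
rewrite /IG -(RintegralZl _ measurableT rint_gs).
apply: (@cint_bound _ _ _ mu _ _ _ measurableT (crint_ker s c0 dn)).
  exact: (@rintZ _ _ _ mu _ _ _ measurableT rint_gs).
move=> u _; apply: (le_trans (H u)).
apply: (@le_trans _ _ (B * (expR (10 + 2 * b ^+ 2) * gs u))); last by rewrite mulrA.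
by apply: ler_wpM2l => //; rewrite /gs -expRD ler_expR; exact: gs_bound.
Qed.

Lemma cmod_npow x t (n : nat) : cmod (npow (x +i* t) n) = expR (- (x * ln n%:R)).
Proof. by rewrite /npow cmod_cexp cReM cReN /= mulr0 subr0 mulNr. Qed.

(** With m >= - x0 each of the N <= t + 3 terms of the sum is at most (t + 3)^m, which accounts for
    one further power. On the line |z| <= 4 (t + 3) exp(2 |u|), and its m-th power is absorbed by
    the Gaussian factor. *)
Lemma aux_growth (x0 : R) : exists A (m : nat), 0 <= A /\ forall x t, x0 <= x -> -2 <= t ->
  cmod (riemann_aux 2^-1 (x +i* t)) <= A * (t + 3) ^+ m.
Proof.
pose m := (Num.truncn `|x0|).+1.
have m0 : - x0 <= m%:R.
  by apply: le_trans (ltW (truncnS_gt `|x0|)); rewrite -normrN ler_norm.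
pose b : R := 12 + 2 * m%:R.
have b0 : 0 <= b by rewrite addr_ge0// mulr_ge0.
exists (1 + 2 * (2 * (4 ^+ m * expR (10 + 2 * b ^+ 2) * IG))), m.+1; split.
  by rewrite addr_ge0// !mulr_ge0// ?exprn_ge0 ?expR_ge0 ?IG_ge0.
move=> x t hx ht; have [N [N0 Nt HN]] := choose_N ht.
have n1 : 1 <= N%:R :> R by rewrite ler1n.
have t1 : 1 <= t + 3 by lra.
have mx : - x <= m%:R by lra.
rewrite (riemann_aux_sum _ N); apply: (le_trans (cmodB _ _)); rewrite mulrDl mul1r; apply: lerD.
  apply: (le_trans (cmod_sum _ _)).
  apply: (@le_trans _ _ (\sum_(j < N) (t + 3) ^+ m)); last first.
    rewrite sumr_const card_ord -[_ *+ N]mulr_natr exprSr; apply: ler_wpM2l => //.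
    by rewrite exprn_ge0//; lra.
  apply: ler_sum => j _; rewrite cmod_npow.
  have j1 : 1 <= j.+1%:R :> R by rewrite ler1n.
  have l0 : 0 <= ln (j.+1%:R : R) by rewrite ln_ge0.
  apply: (@le_trans _ _ (j.+1%:R ^+ m)).
    have -> : j.+1%:R ^+ m = expR (m%:R * ln j.+1%:R) :> R by rewrite expRM_natl lnK ?posrE.
    by rewrite ler_expR -mulNr ler_wpM2r.
  rewrite lerXn2r ?nnegrE//; first lra.
  by apply: le_trans Nt; rewrite ler_nat.
rewrite cmodM -[leRHS]mulrA; apply: ler_pM; rewrite ?cmod_ge0 ?cmod_lw1//.
have B0 : 0 <= (4 * (t + 3)) ^+ m by rewrite exprn_ge0//; lra.
apply: (@le_trans _ _ (2 * ((4 * (t + 3)) ^+ m * expR (10 + 2 * b ^+ 2) * IG))).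
  apply: J_half_le => // u; apply: (le_trans (ker_half_le x N0 (HN u))).
  have l0 : 0 <= ln (cmod (lX (N%:R + 2^-1) u)) by apply: le_trans (ln_lX_ge u N0).
  set X := cmod (lX _ u) in l0 *.
  have c0 : 0 < N%:R + 2^-1 :> R by lra.
  have X0 : 0 < X by rewrite cmod_gt0 lX_neq0.
  have u0 := normr_ge0 u.
  have Xle : X <= 4 * (t + 3) * expR (2 * `|u|).
    apply: (le_trans (cmod_le _)); rewrite /=.
    have h1 := ler_normD (N%:R + 2^-1) u; rewrite (gtr0_norm c0) in h1.
    have h2 := expR_ge1Dx (2 * `|u|).
    have h3 : 4 * (t + 3) * (1 + 2 * `|u|) <= 4 * (t + 3) * expR (2 * `|u|).
      by rewrite ler_wpM2l//; lra.
    have h4 : `|u| <= (t + 3) * `|u| by rewrite ler_peMl.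
    lra.
  have e1 : expR (- (x * ln X)) <= (4 * (t + 3)) ^+ m * expR (2 * m%:R * `|u|).
    apply: (@le_trans _ _ (X ^+ m)).
      have -> : X ^+ m = expR (m%:R * ln X) by rewrite expRM_natl lnK ?posrE.
      by rewrite ler_expR -mulNr ler_wpM2r.
    have -> : expR (2 * m%:R * `|u|) = expR (2 * `|u|) ^+ m.
      by rewrite -expRM_natl; congr expR; ring.
    by rewrite -exprMn lerXn2r ?nnegrE//; rewrite ?mulr_ge0 ?expR_ge0 ?ltW//; lra.
  apply: (le_trans (ler_wpM2r (expR_ge0 _) e1)).
  rewrite -[leLHS]mulrA; apply: ler_wpM2l => //; rewrite -expRD ler_expR /b; lra.
have -> : 2 * ((4 * (t + 3)) ^+ m * expR (10 + 2 * b ^+ 2) * IG) =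
  2 * (4 ^+ m * expR (10 + 2 * b ^+ 2) * IG) * (t + 3) ^+ m by rewrite exprMn; ring.
apply: ler_wpM2l; first by rewrite !mulr_ge0 ?exprn_ge0 ?expR_ge0 ?IG_ge0.
by rewrite exprSr ler_peMr// exprn_ge0//; lra.
Qed.

Lemma sum_inv_sqr (N : nat) : \sum_(j < N) ((j.+2%:R : R) ^- 2) <= 1 - N.+1%:R^-1.
Proof.
elim: N => [|N ih]; first by rewrite big_ord0 invr1 subrr.
rewrite big_ord_recr /=; apply: (le_trans (lerD ih (lexx _))).
have n0 : 0 < N.+1%:R :> R by rewrite ltr0n.
have -> : N.+2%:R = N.+1%:R + 1 :> R by rewrite natr1.
move: (N.+1%:R : R) n0 => y y0; have y1 : 0 < y + 1 by lra.
have : 0 <= (y * (y + 1) ^+ 2)^-1 by rewrite invr_ge0 mulr_ge0 ?sqr_ge0// ltW.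
have -> : (y * (y + 1) ^+ 2)^-1 = y^-1 - (y + 1)^-1 - (y + 1) ^- 2.
  by field; rewrite !lt0r_neq0.
lra.
Qed.

(** The 1 is the first term of the sum. The terms with n >= 2 are majorised by n^(-2) times the
    exponential, the integral by means of [ln_lX_ge]. *)
Lemma aux_near1 : exists2 C : R, 0 <= C & forall x t, 2 <= x -> -2 <= t ->
  cmod (riemann_aux 2^-1 (x +i* t) - 1) <= C * expR (- (20^-1 * x)).
Proof.
exists (expR (1 / 10) + 2 * (2 * (expR (10 + 2 * 12 ^+ 2) * IG))).
  by rewrite addr_ge0 ?expR_ge0// !mulr_ge0 ?expR_ge0 ?IG_ge0.
move=> x t hx ht; have [N [N0 Nt HN]] := choose_N ht.
rewrite (riemann_aux_sum _ N); case: N N0 Nt HN => // N N0 Nt HN.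
rewrite big_ord_recl.
have -> : npow (x +i* t) (@ord0 N).+1 = 1 by rewrite /npow ln1 mulr0 cexp0.
set S := \sum_(i < N) _; set Jw := lw1 * _.
have -> : 1 + S - Jw - 1 = S - Jw by ring.
apply: (le_trans (cmodB _ _)); rewrite mulrDl; apply: lerD.
  apply: (le_trans (cmod_sum _ _)).
  apply: (@le_trans _ _ (\sum_(j < N) (j.+2%:R ^- 2 * (expR (1 / 10) * expR (- (20^-1 * x)))))).
    apply: ler_sum => j _; rewrite lift0 cmod_npow.
    have j2 : 2 <= j.+2%:R :> R by rewrite (ler_nat _ 2).
    have j0 : 0 < j.+2%:R :> R by rewrite ltr0n.
    have l2 : 2^-1 <= ln (j.+2%:R : R).
      have := @ln_le_sub1 R (j.+2%:R)^-1; rewrite invr_gt0 => /(_ j0); rewrite lnV ?posrE// => h.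
      have key (a b : R) : - b <= a - 1 -> a <= 2^-1 -> 2^-1 <= b by lra.
      by apply: key h _; rewrite lef_pV2 ?posrE.
    have -> : (j.+2%:R : R) ^- 2 = expR (- (2 * ln j.+2%:R)).
      by rewrite expRN expRM_natl lnK ?posrE.
    rewrite -!expRD ler_expR; move: (ln (j.+2%:R : R)) l2 => y l2.
    (* Expanded, this reads [x y >= 2 y + x/20 - 1/10], whence the factor [expR (1 / 10)]. *)
    have : 0 <= (x - 2) * (y - 20^-1) by apply: mulr_ge0; lra.
    by rewrite mulrBl !mulrBr; lra.
  rewrite -mulr_suml ler_piMl// ?mulr_ge0 ?expR_ge0//.
  apply: (le_trans (sum_inv_sqr N)).
  by rewrite lerBlDr lerDl invr_ge0.
rewrite /Jw cmodM -[leRHS]mulrA; apply: ler_pM; rewrite ?cmod_ge0 ?cmod_lw1//.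
have -> : 2 * (expR (10 + 2 * 12 ^+ 2) * IG) * expR (- (20^-1 * x)) =
  2 * (expR (- (20^-1 * x)) * expR (10 + 2 * 12 ^+ 2) * IG) by ring.
apply: (J_half_le N0 (expR_ge0 _)) => //.
move=> u; apply: (le_trans (ker_half_le x N0 (HN u))).
rewrite ler_wpM2r ?expR_ge0// ler_expR lerN2.
have := ln_lX_ge u N0 => h; rewrite [20^-1 * _]mulrC ler_wpM2l//; lra.
Qed.

(* The k-th derivative of riemann_aux 2^-1. *)
Definition Faux (k : nat) s : R[i] :=
  cint mu setT (fun u => - lw1 * (- lL 2^-1 u) ^+ k * ker s 2^-1 u).

Lemma Faux0 s : Faux 0 s = riemann_aux 2^-1 s.
Proof.
have c0 : 0 < 2^-1 :> R by rewrite invr_gt0.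
have dn u : den (lX (2^-1 : R) u) != 0 by apply: (@den_neq0 _ 0); lra.
rewrite riemann_auxE// /J /Faux -mulNr -(@cintZ _ _ _ mu _ _ _ measurableT (crint_ker s c0 dn)).
by congr cint; apply/funext => u; rewrite expr0 mulr1.
Qed.

(** Each derivative in [s] brings out a factor [- log z]. Powers and exponentials of the logarithm
    are dominated by the Gaussian decay of the kernel ([num_bound]), as [hol_param] requires. *)
Lemma hol_Faux : hol Faux.
Proof.
have c0 : 0 < 2^-1 :> R by rewrite invr_gt0.
have dn u : den (lX (2^-1 : R) u) != 0 by apply: (@den_neq0 _ 0); lra.
apply: (@hol_param _ _ _ mu setT (fun k u s => - lw1 * (- lL 2^-1 u) ^+ k * ker s 2^-1 u)).
- exact: measurableT.
- move=> k s; apply: cmeas_cont => u; apply: ccontM; last exact: ccont_ker.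
  apply: ccontM; first exact: ccont_cst.
  have h : ccont (fun u => - lL 2^-1 u) u by apply: ccontN; exact: cder_ccont (cder_lL_u u c0).
  by elim: k => [|k ih]; [exact: ccont_cst|have := ccontM h ih; congr ccont; apply/funext => v; rewrite exprS].
(* In units of |log z|, [|M|] accounts for exp(- s log z), [k] for the k-th power of the logarithm,
   and 3 for the Taylor remainder, a square times an exponential. *)
move=> k M; pose M' := `|M| + k%:R + 3.
have M'0 : 0 <= M' by rewrite !addr_ge0.
pose B := expR (M' * (2^-1 + 2^-1 ^- 2 + 3) + 2 * (2 * M' + 8 * 2^-1) ^+ 2).
exists (fun u => 8 * B * gs u).
  exact: (@rintZ _ _ _ mu _ _ _ measurableT rint_gs).
move=> u _; set l := lL 2^-1 u.
have l0 := cmod_ge0 l.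
have lpow j : cmod l ^+ j <= expR (j%:R * cmod l).
  rewrite expRM_natl lerXn2r ?nnegrE ?expR_ge0//.
  by have := expR_ge1Dx (cmod l); lra.
have Q : expR (M' * cmod l) * cmod (cexp (ipi * lX 2^-1 u ^+ 2)) <= B * gs u.
  exact: num_bound.
set q := cmod (cexp _) in Q; have q0 : 0 <= q by exact: cmod_ge0.
have d1 : 1 <= cmod (den (lX (2^-1 : R) u)).
  by have := @den_half R 0 u; rewrite add0r.
pose A := cexp (ipi * lX 2^-1 u ^+ 2) / den (lX 2^-1 u).
have Aq : cmod A <= q.
  by rewrite /A cmodM cmodV ler_pdivrMr ?ler_peMr//; lra.
have kE s : ker s 2^-1 u = cexp (- s * l) * A by rewrite /ker /kerX /A mulrA.
have cl j : cmod (- lw1 * (- l) ^+ j) <= 2 * expR (j%:R * cmod l).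
  by rewrite cmodM cmodN cmodX cmodN; apply: ler_pM; rewrite ?cmod_ge0 ?cmod_lw1 ?exprn_ge0.
have cs s : cmod s <= M -> cmod (cexp (- s * l)) <= expR (`|M| * cmod l).
  move=> hs; apply: (le_trans (cmod_cexp_le s l)); rewrite ler_expR ler_wpM2r//.
  exact: le_trans hs (ler_norm M).
split.
  move=> s hs; rewrite kE cmodM [cmod (_ * A)]cmodM.
  apply: (@le_trans _ _ (2 * expR (k%:R * cmod l) * (expR (`|M| * cmod l) * q))).
    by apply: ler_pM; rewrite ?mulr_ge0 ?cmod_ge0//; apply: ler_pM; rewrite ?cmod_ge0 ?cs.
  have -> : 2 * expR (k%:R * cmod l) * (expR (`|M| * cmod l) * q) =
    2 * (expR (k%:R * cmod l + `|M| * cmod l) * q) by rewrite expRD; ring.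
  have h : expR (k%:R * cmod l + `|M| * cmod l) * q <= expR (M' * cmod l) * q.
    by rewrite ler_wpM2r// ler_expR /M'; lra.
  have g0 : 0 <= expR (M' * cmod l) * q by rewrite mulr_ge0 ?expR_ge0.
  lra.
move=> s h hs h1; rewrite !kE.
have -> : - lw1 * (- l) ^+ k * (cexp (- (s + h) * l) * A) - - lw1 * (- l) ^+ k * (cexp (- s * l) * A)
   - h * (- lw1 * (- l) ^+ k.+1 * (cexp (- s * l) * A)) =
   - lw1 * (- l) ^+ k * (cexp (- s * l) * A) * (cexp (- h * l) - 1 - (- h * l)).
  rewrite (_ : - (s + h) * l = - s * l + (- h * l)); last by ring.
  by rewrite cexpD exprS; ring.
rewrite cmodM cmodM [cmod (_ * A)]cmodM.
have r1 : cmod (cexp (- h * l) - 1 - (- h * l)) <= 4 * cmod h ^+ 2 * expR (3 * cmod l).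
  apply: (le_trans (cexp_sub1D _)); rewrite cmodM cmodN.
  have hl : cmod h * cmod l <= cmod l by rewrite ler_piMl.
  have -> : 3 * cmod l = 2%:R * cmod l + cmod l by ring.
  rewrite expRD exprMn !mulrA; apply: ler_pM; rewrite ?expR_ge0 ?ler_expR//.
    by rewrite !mulr_ge0 ?cmod_ge0.
  by rewrite -[leLHS]mulrA; apply: ler_wpM2l; [rewrite !mulr_ge0 ?cmod_ge0|exact: (lpow 2%N)].
apply: (@le_trans _ _ (2 * expR (k%:R * cmod l) * (expR (`|M| * cmod l) * q) * (4 * cmod h ^+ 2 * expR (3 * cmod l)))).
  apply: ler_pM; rewrite ?mulr_ge0 ?cmod_ge0//.
  by apply: ler_pM; rewrite ?mulr_ge0 ?cmod_ge0//; apply: ler_pM; rewrite ?cmod_ge0 ?cs.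
have -> : 2 * expR (k%:R * cmod l) * (expR (`|M| * cmod l) * q) * (4 * cmod h ^+ 2 * expR (3 * cmod l)) =
  8 * (expR (M' * cmod l) * q) * cmod h ^+ 2.
  have -> : M' * cmod l = k%:R * cmod l + `|M| * cmod l + 3 * cmod l by rewrite /M'; ring.
  by rewrite !expRD; ring.
by rewrite ler_wpM2r ?sqr_ge0// -mulrA ler_wpM2l.
Qed.

End Bounds.

(** * The theorem *)

(** As [G] has no zeros in the region, the zeros of F there are the entries of the list, and the
    multiplicity of each is the number of its occurrences; so the extended sum is finite. *)
Lemma esum_zeros (R : realType) (F : nat -> R[i] -> R[i]) (sg T : R) zs G :
  hol F -> factors F zs G -> nonvan sg G (-1) T ->
  (\esum_(rho in zeros_right_of (F 0%N) sg T)
     (multiplicity (F 0%N) rho * (complex.Re rho - sg)%:E) =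
   (\sum_(w <- zs | [&& sg < complex.Re w, (0 < complex.Im w)%R & (complex.Im w <= T)%R])
     (complex.Re w - sg))%:E)%E.
Proof.
move=> hF [hG FE] G0.
pose good (w : R[i]) := [&& sg < complex.Re w, (0 < complex.Im w)%R & (complex.Im w <= T)%R].
have G1 w : good w -> G 0%N w != 0.
  move=> /and3P[h1 h2 h3]; have := G0 (complex.Re w) (complex.Im w).
  case: w h1 h2 h3 => [a b] /= h1 h2 h3; apply; first by lra.
  by apply/andP; split; lra.
pose r := [seq w <- undup zs | good w].
have ur : uniq r by rewrite filter_uniq// undup_uniq.
have ZE : zeros_right_of (F 0%N) sg T = [set` r].
  apply/seteqP; split => [w [f0 h1 h2 h3]|w] /=; rewrite mem_filter mem_undup.
    have gw : good w by rewrite /good h1 h2 h3.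
    rewrite gw /=; apply: contraTT isT => wz; move: f0 => /eqP.
    rewrite FE mulf_eq0 (negbTE (G1 w gw)) orbF => /eqP p0.
    have : \prod_(z <- zs) (w - z) != 0.
      rewrite prodf_seq_neq0; apply/allP => z zz; rewrite /= subr_eq0.
      by apply: contraNneq wz => ->.
    by rewrite p0 eqxx.
  move=> /andP[/and3P[h1 h2 h3] wz]; split => //.
  by rewrite FE (big_rem w)//= subrr !mul0r.
have mE w : good w -> multiplicity (F 0%N) w = (count_mem w zs)%:R%:E.
  by move=> gw; exact: (multiplicity_count hF hG FE (G1 w gw)).
have nn w : w \in [set` r] -> (0 <= multiplicity (F 0%N) w * (complex.Re w - sg)%:E)%E.
  rewrite inE/= mem_filter => /andP[gw _].
  rewrite mE// -EFinM lee_fin mulr_ge0// subr_ge0.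
  by case/and3P: gw => /ltW.
rewrite ZE (esum_fset (finite_seq r) nn).
transitivity (\sum_(w <- r) (multiplicity (F 0%N) w * (complex.Re w - sg)%:E))%E.
  by symmetry; exact: fsbig_seq.
rewrite big_filter.
rewrite (eq_bigr (fun w => ((complex.Re w - sg) *+ count_mem w zs)%:E)); last first.
  by move=> w gw; rewrite mE// -EFinM mulr_natl.
rewrite sumEFin; congr (_%:E).
(* A sum over a list with repetitions is the sum over its distinct entries, each taken as often as
   it occurs. *)
rewrite -[RHS]big_undup_iterop_count; apply: eq_bigr => w _.
by rewrite Monoid.iteropE; elim: (count_mem w zs) => [|n ih] //=; rewrite mulrS ih.
Qed.

Theorem theorem1 (R : realType) (t0 sigma : R) (ht0 : 1 <= t0)
    (hsigma : sigma <= 1) :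
  exists K : R, \forall T \near +oo, forall c : R, 0 < c < 1 ->
    (`| \int[@lebesgue_measure R]_(t in `[t0, T])
          (ln (cmod (riemann_aux c (sigma +i* t)%C)))%:E
        - (2 * pi)%:E *
          \esum_(rho in zeros_right_of (riemann_aux c) sigma T)
            (multiplicity (riemann_aux c) rho
              * (complex.Re rho - sigma)%:E) |
      <= (K * ln T)%:E)%E.
Proof.
have hF := @hol_Faux R.
have fE : riemann_aux (2^-1 : R) = Faux 0 by apply/funext => s; rewrite Faux0.
have [A [m [A00 HA]]] := aux_growth (sigma - 2).
have [C C0 HB] := @aux_near1 R.
have k0 : 0 < 20^-1 :> R by rewrite invr_gt0.
rewrite fE in HA HB.
have [K K0 H] := log_integral hF A00 HA C0 k0 HB ht0.
exists (4 * K); near=> T => c c01; rewrite (riemann_aux_indep c01) fE.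
have tT : t0 <= T by near: T; apply: nbhs_pinfty_ge; rewrite num_real.
have T5 : 5 <= T by near: T; apply: nbhs_pinfty_ge; rewrite num_real.
have [zs [G [fz nv il B]]] := H T tT.
rewrite (esum_zeros hF fz nv).
(* Integrability makes the extended integral finite, hence equal to its real-valued counterpart. *)
have -> : (\int[@lebesgue_measure R]_(t in `[t0, T]) (ln (cmod (Faux 0 (sigma +i* t))))%:E)%E =
    (\int[@lebesgue_measure R]_(t in `[t0, T]) lF (@Faux R) sigma t)%:E.
  by rewrite /Rintegral fineK//; exact: integrable_fin_num il.
rewrite -EFinM -EFinB abse_EFin lee_fin; apply: (le_trans B).
have T0 : 0 < T by lra.
(* For T >= 5 one has T + 5 <= T^2 and 1 <= 2 ln T, so that [1 + ln (T + 5)] is at most 4 ln T; this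
   is the 4 in the final constant. *)
have l1 : ln (T + 5) <= 2 * ln T.
  have -> : 2 * ln T = ln (T ^+ 2) by rewrite lnXn// mulr_natl.
  by rewrite ler_ln ?posrE//; [nra|lra|rewrite exprn_gt0].
have l2 : 1 <= 2 * ln T.
  have := @ln_le_sub1 R T^-1; rewrite invr_gt0 => /(_ T0); rewrite lnV ?posrE// => h.
  have : T^-1 <= 5^-1 by rewrite lef_pV2 ?posrE.
  lra.
have -> : 4 * K * ln T = K * (4 * ln T) by ring.
by rewrite ler_wpM2l//; lra.
Unshelve. all: by end_near. Qed.
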